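(* Let $\eta$ be a stationary and ergodic point process on $\mathbb{R}^d$ with positive intensity and local second moments, whose Bartlett measure satisfies $\sigma_\eta\ll\lambda_d$, with structure factor $S_\eta$. Assume that the Fourier condition (F) (stated in the context, for the fixed test function $h$) holds. Let $0<\alpha<\beta$, $L,r_0>0$, and assume that for some $s\ge0$ and $c\in\mathbb{R}$, \[ A_r=s+c\,r^\alpha+\varepsilon_r,\qquad|\varepsilon_r|\le L r^\beta,\qquad0<r\le r_0, \] and that $\int_{B_{r_0}}S_\eta^2\,d\lambda_d<\infty$. Fix $\gamma\in(0,1)$ and $\kappa>1$. Then for every fixed $0<r\le r_0/\kappa$, \[ \liminf_{m\to\infty}\liminf_{R\to\infty}\mathbb{P}\bigl(s\in\operatorname{CI}_r(Y^{(R)};\gamma)\bigr)\ge1-\gamma . \]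
   Context: $\lambda_d$ is Lebesgue measure on $\mathbb{R}^d$; $B_R=B(0,R)$ is the ball of radius $R$ centred at the origin. Fourier transform and characters: $\hat f(\xi)=\int_{\mathbb{R}^d}f(x)e^{-2\pi i\langle x,\xi\rangle}\,d\lambda_d(x)$ and $\chi_\xi(x)=e^{2\pi i\langle x,\xi\rangle}$. **Point process.** $\eta$ is a point process (locally finite) on $\mathbb{R}^d$; stationary and ergodic refer to translations. Its intensity is $\rho_\eta$, so $\mathbb{E}\,\eta(B)=\rho_\eta\lambda_d(B)$; local second moments means $\mathbb{E}[\eta(B)^2]<\infty$ for bounded Borel $B$. Put $M(f):=\sum_{x\in\eta}f(x)-\rho_\eta\int f\,d\lambda_d$. The Bartlett measure $\sigma_\eta$ is the nonnegative measure on $\mathbb{R}^d$ defined by $\mathbb{E}[M(f)\overline{M(g)}]=\int\hat f\,\overline{\hat g}\,d\sigma_\eta$ for Schwartz $f,g$. If $\sigma_\eta\ll\lambda_d$, the structure factor $S_\eta$ is defined by $d\sigma_\eta=\rho_\eta S_\eta\,d\lambda_d$, with a fixed nonnegative Borel representative. For $r>0$, \[ A_r:=\frac{\sigma_\eta(B_r)}{\rho_\eta\lambda_d(B_r)}=\frac1{\lambda_d(B_r)}\int_{B_r}S_\eta\,d\lambda_d . \] **Fourier condition (F).** Fix $h\in C_c^\infty(B_1;\mathbb{C})$ (supported in $B_1$) with $\int|h|^2\,d\lambda_d=1$ and put $Z_R(\xi):=R^{-d/2}M(h(\cdot/R)\chi_\xi)$. Condition (F): for every $n\ge1$ there is a Borel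 set $\Omega_\eta^{(n)}\subset(\mathbb{R}^d)^n$ of full Lebesgue measure, contained in $\{(u_1,\dots,u_n):u_i\ne0,\ u_i\ne\pm u_j\text{ for }i\ne j\}$, such that for every $(u_1,\dots,u_n)\in\Omega_\eta^{(n)}$, as $R\to\infty$, $(Z_R(u_1),\dots,Z_R(u_n))$ converges in distribution to $(G_{u_1},\dots,G_{u_n})$, where the $G_{u_j}$ are independent centered circularly symmetric complex Gaussian variables (real and imaginary parts are independent centered Gaussians of equal variance) with $\mathbb{E}|G_{u_j}|^2=\rho_\eta S_\eta(u_j)$ and $\mathbb{E}G_{u_j}^2=0$. **Estimator and interval.** Put $b_r:=L\,\frac{\kappa^\alpha+\kappa^\beta}{\kappa^\alpha-1}\,r^\beta$. For real arrays $y=(y_{a,j}:a\in\{r,\kappa r\},1\le j\le m)$ with $m\ge2$, put $\bar y_a:=\frac1m\sum_j y_{a,j}$, $v_a^2(y):=\frac1{m-1}\sum_j(y_{a,j}-\bar y_a)^2$, \[ \widehat s_r(y):=\frac{\kappa^\alpha\bar y_r-\bar y_{\kappa r}}{\kappa^\alpha-1},\qquad \operatorname{se}_r(y)\ge0,\quad \operatorname{se}_r^2(y):=\frac{\kappa^{2\alpha}v_r^2(y)+v_{\kappa r}^2(y)}{m(\kappa^\alpha-1)^2}, \] \[ \operatorname{CI}_r(y;\gamma):=\bigl[\widehat s_r(y)-b_r-z_{1-\gamma/2}\operatorname{se}_r(y),\ \widehat s_r(y)+b_r+z_{1-\gamma/2}\operatorname{se}_r(y)\bigr]\cap[0,\infty),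 \] where $z_q$ is the $q$-quantile of $N(0,1)$. **Observed array.** With $\widehat\rho_R:=\eta(B_R)/\lambda_d(B_R)$, the windowed periodogram is \[ I_{R,h}(u):=\widehat\rho_R^{-1}R^{-d}\Bigl|\sum_{x\in\eta\cap B_R}h(x/R)\chi_u(x)\Bigr|^2 \] on $\{\widehat\rho_R>0\}$, and $0$ otherwise. For $a\in\{r,\kappa r\}$ and $1\le j\le m$ the frequencies $U_{a,j}$ are mutually independent, independent of $\eta$, with $U_{a,j}$ uniform on $B_a$, and $Y^{(R)}_{a,j}:=I_{R,h}(U_{a,j})$. *)

(* Defs.v *)
From HB Require Import structures.
From mathcomp Require Import all_boot all_order all_algebra.
From mathcomp Require Import all_classical all_reals all_analysis.
From mathcomp Require Import measurable_realfun.
From mathcomp.real_closed Require Import complex.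

Set Implicit Arguments.
Unset Strict Implicit.
Unset Printing Implicit Defensive.

Import Order.TTheory GRing.Theory Num.Theory.
Import numFieldNormedType.Exports.

Local Open Scope classical_set_scope.
Local Open Scope ring_scope.

(* The Borel sigma-algebra of R^n, generated by the coordinates. *)
Section rV_measurable.
Context {R : realType} {n : nat}.

Let coord (i : 'I_n) (x : 'rV[R]_n) : R := x ord0 i.

Let rV_set0 : g_sigma_preimage coord set0.
Proof. exact: sigma_algebra0. Qed.

Let rV_setC A : g_sigma_preimage coord A -> g_sigma_preimage coord (~` A).
Proof. exact: sigma_algebraC. Qed.

Let rV_bigcup (F : _^nat) : (forall i, g_sigma_preimage coord (F i)) ->
  g_sigma_preimage coord (\bigcup_i (F i)).
Proof. exact: sigma_algebra_bigcup. Qed.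

Definition rV_display : measure_display.
Proof. exact: default_measure_display. Qed.

HB.instance Definition _ := @isMeasurable.Build rV_display
  'rV[R]_n (g_sigma_preimage coord) rV_set0 rV_setC rV_bigcup.

Lemma measurable_rV_coord (i : 'I_n) :
  measurable_fun [set: 'rV[R]_n] (fun x => x ord0 i).
Proof.
move=> _ Y mY; rewrite setTI; apply: sub_sigma_algebra => /=.
rewrite -bigcup_seq/=; exists i => /=; first by rewrite mem_index_enum.
by exists Y => //; rewrite setTI.
Qed.

Lemma measurable_fun_rVP d (T : measurableType d) (f : T -> 'rV[R]_n) :
  (forall i, measurable_fun [set: T] (fun t => f t ord0 i)) ->
  measurable_fun [set: T] f.
Proof.
move=> mf _ A mA; rewrite setTI.
pose B := [set B : set 'rV[R]_n | measurable (f @^-1` B)].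
suff: B A by [].
apply: mA; split.
  split => [|C mC|F mF]; rewrite /B /=.
  - by rewrite preimage_set0; exact: measurable0.
  - by rewrite setTD -preimage_setC; exact: measurableC.
  - by rewrite preimage_bigcup; exact: bigcupT_measurable.
rewrite -bigcup_seq /= => C [i _ [Y mY <-]].
rewrite /B/= setTI -[X in measurable X]setTI; exact: mf.
Qed.

End rV_measurable.

Section mpushforward.
Context d1 d2 (T1 : measurableType d1) (T2 : measurableType d2) (R : realType).

(* [pushforward] along a bundled measurable function, so that its measure
   structure can be inferred. *)
Definition mpushforward (m : {measure set T1 -> \bar R})
  (f : {mfun T1 >-> T2}) : set T2 -> \bar R := pushforward m f.

Section measure.
Variables (m : {measure set T1 -> \bar R}) (f : {mfun T1 >-> T2}).

Let p : {measure set T2 -> \bar R} :=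
  measure_function_pushforward__canonical__measure_function_Measure m
    (measurable_funPT f).

HB.instance Definition _ := isMeasure.Build _ _ _ (mpushforward m f)
  (measure0 p) (@measure_ge0 _ _ _ p) (@measure_semi_sigma_additive _ _ _ p).
End measure.

Lemma sigma_finite_mpushforward (m : {measure set T1 -> \bar R})
    (f : {mfun T1 >-> T2}) (g : T2 -> T1) :
  sigma_finite setT m -> measurable_fun [set: T2] g -> cancel f g -> cancel g f ->
  sigma_finite setT (mpushforward m f).
Proof.
move=> [F TF Foo] mg fK gK.
exists (fun i => g @^-1` (F i)).
  by rewrite -preimage_bigcup -TF preimage_setT.
move=> i; have [mF Fi] := Foo i; split.
  by rewrite -[X in measurable X]setTI; exact: mg.
rewrite /mpushforward /pushforward -comp_preimage (_ : g \o f = id) //.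
by apply/funext => x /=; rewrite fK.
Qed.

End mpushforward.

(* The library's sigma-finite instance on [m1 \x m2] is not found by inference. *)
Lemma sigma_finite_product d1 d2 (T1 : measurableType d1)
    (T2 : measurableType d2) (R : realType)
    (m1 : {sigma_finite_measure set T1 -> \bar R})
    (m2 : {sigma_finite_measure set T2 -> \bar R}) :
  sigma_finite setT (m1 \x m2)%E.
Proof.
have /sigma_finiteP[F [TF ndF Foo]] := sigma_finiteT m1.
have /sigma_finiteP[G [TG ndG Goo]] := sigma_finiteT m2.
exists (fun n => F n `*` G n).
  rewrite -setXTT TF TG predeqE => -[x y]; split.
    move=> [/= [n _ Fnx] [k _ Gky]]; exists (maxn n k) => //; split.
    - by move: x Fnx; exact/subsetPset/ndF/leq_maxl.
    - by move: y Gky; exact/subsetPset/ndG/leq_maxr.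
  by move=> [n _ []/= ? ?]; split; exists n.
move=> k; have [? ?] := Foo k; have [? ?] := Goo k.
split; first exact: measurableX.
by rewrite product_measure1E// lte_mul_pinfty// ge0_fin_numE.
Qed.

(* The n-fold product measure, by recursion on n. *)
Section measure_pow.
Context d (T : measurableType d) (R : realType).
Variable mu : {sigma_finite_measure set T -> \bar R}.

Definition tcons n (p : T * n.-tuple T) : n.+1.-tuple T :=
  [tuple of p.1 :: p.2].

Lemma measurable_tcons n : measurable_fun setT (@tcons n).
Proof. by apply: measurable_cons; [exact: measurable_fst|exact: measurable_snd]. Qed.

HB.instance Definition _ n := isMeasurableFun.Build _ _ _ _ (@tcons n)
  (@measurable_tcons n).

Section step.
Variables (n : nat) (nu : {sigma_finite_measure set (n.-tuple T) -> \bar R}).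

Definition measure_cons := mpushforward (mu \x nu)%E (@tcons n).

HB.instance Definition _ := Measure.on measure_cons.

Let sigma_finite_measure_cons : sigma_finite setT measure_cons.
Proof.
pose uncons (t : n.+1.-tuple T) : T * n.-tuple T :=
  (thead t, [tuple of behead t]).
apply: (@sigma_finite_mpushforward _ _ _ _ _ _ _ uncons).
- exact: sigma_finite_product.
- apply/measurable_fun_pairP; split; first exact: measurable_tnth.
  exact: measurable_behead.
- by move=> [x t] /=; congr pair; rewrite ?theadE//; exact/val_inj.
- by move=> t; rewrite [RHS]tuple_eta; exact/val_inj.
Qed.

HB.instance Definition _ := Measure_isSigmaFinite.Build _ _ _ measure_cons
  sigma_finite_measure_cons.
End step.

Fixpoint measure_pow n : {sigma_finite_measure set (n.-tuple T) -> \bar R} :=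
  match n with
  | 0 => \d_[tuple]
  | n'.+1 => measure_cons (measure_pow n')
  end.

Lemma measure_powE n (A : 'I_n -> set T) : (forall i, measurable (A i)) ->
  measure_pow n [set t | forall i, A i (tnth t i)] = (\prod_(i < n) mu (A i))%E.
Proof.
elim: n A => [|n IHn] A mA.
  by rewrite big_ord0 /= diracE mem_set // => -[].
rewrite big_ord_recl /= /measure_cons /mpushforward /pushforward.
rewrite -(IHn (fun i => A (lift ord0 i)))//.
have mA' : measurable [set t | forall i, A (lift ord0 i) (@tnth n T t i)].
  rewrite (_ : [set _ | _] =
      \bigcap_(i in [set: 'I_n]) (@tnth n T)^~ i @^-1` (A (lift ord0 i))).
    apply: fin_bigcap_measurable => // i _.
    by rewrite -[X in measurable X]setTI; exact: measurable_tnth.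
  by apply/seteqP; split => t /= At i; [move=> _|]; exact: At.
rewrite -product_measure1E //; congr ((mu \x _)%E _).
apply/seteqP; split => -[x t] /=.
  move=> Axt; split; first by have := Axt ord0.
  by move=> i; have := Axt (lift ord0 i); rewrite tnthS.
move=> [Ax At] i; case: (unliftP ord0 i) => [j|] -> //=.
by rewrite tnthS; exact: At.
Qed.

End measure_pow.

Section lebesgue_rV.
Context {R : realType} {n : nat}.

Definition row_of_tuple (t : n.-tuple (measurableTypeR R)) : 'rV[R]_n := \row_i tnth t i.

Let measurable_row_of_tuple : measurable_fun setT row_of_tuple.
Proof.
apply: measurable_fun_rVP => i; rewrite (_ : (fun _ => _) = (@tnth n (measurableTypeR R))^~ i).
  exact: measurable_tnth.
by apply/funext => t; rewrite mxE.
Qed.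

HB.instance Definition _ := isMeasurableFun.Build _ _ _ _ row_of_tuple
  measurable_row_of_tuple.

Definition lebesgue_rV : set 'rV[R]_n -> \bar R :=
  mpushforward (measure_pow (@lebesgue_measure R) n) row_of_tuple.

HB.instance Definition _ := Measure.on lebesgue_rV.

Let sigma_finite_lebesgue_rV : sigma_finite setT lebesgue_rV.
Proof.
pose tuple_of_row (x : 'rV[R]_n) : n.-tuple (measurableTypeR R) := [tuple x ord0 i | i < n].
apply: (@sigma_finite_mpushforward _ _ _ _ _ _ _ tuple_of_row).
- exact: sigma_finiteT.
- apply/measurable_fun_tnthP => i.
  rewrite (_ : _ \o _ = fun x : 'rV[R]_n => x ord0 i).
    exact: measurable_rV_coord.
  by apply/funext => x /=; rewrite tnth_mktuple.
- by move=> t; apply: eq_from_tnth => i; rewrite tnth_mktuple mxE.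
- by move=> x; apply/rowP => i; rewrite mxE tnth_mktuple.
Qed.

HB.instance Definition _ := Measure_isSigmaFinite.Build _ _ _ lebesgue_rV
  sigma_finite_lebesgue_rV.

Lemma lebesgue_rV_box (a b : 'I_n -> R) : (forall i, a i <= b i) ->
  lebesgue_rV [set x | forall i, a i <= x ord0 i <= b i] =
  (\prod_(i < n) (b i - a i))%:E.
Proof.
move=> ab; pose I i : set (measurableTypeR R) := `[a i, b i]%classic.
have -> : lebesgue_rV [set x | forall i, a i <= x ord0 i <= b i] =
    measure_pow (@lebesgue_measure R) n [set t | forall i, I i (tnth t i)].
  congr (measure_pow _ n _); apply/seteqP; split => t /= abt i; have := abt i.
    by rewrite /I /= in_itv mxE.
  by rewrite /I /= in_itv mxE.
rewrite measure_powE => [|i]; last exact: measurable_itv.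
elim/big_ind2 : _ => // [x1 x2 y1 y2 -> ->|i _]; first by rewrite EFinM.
rewrite [LHS]lebesgue_measure_itv /= lte_fin.
have := ab i; rewrite le_eqVlt => /predU1P[->|->]; last by rewrite EFinB.
by rewrite ltxx subrr.
Qed.

End lebesgue_rV.

(* The unqualified [Re] and [Im] are those of numClosedFieldType, valued in R[i]. *)
Local Notation Re := complex.Re.
Local Notation Im := complex.Im.
Local Notation normc := Normc.normc.

Section complex_integral.
Local Open Scope complex_scope.
Context d (T : measurableType d) (R : realType).

Definition Cintegral (mu : {measure set T -> \bar R}) (D : set T)
    (f : T -> R[i]) : R[i] :=
  (\int[mu]_(x in D) Re (f x)) +i* (\int[mu]_(x in D) Im (f x)).

Definition Cmeasurable (f : T -> R[i]) :=
  measurable_fun setT (@Re R \o f) /\ measurable_fun setT (@Im R \o f).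

End complex_integral.

Section euclidean.
Local Open Scope complex_scope.
Context {R : realType} {d : nat}.
Local Notation E := 'rV[R]_d.

Definition dotv (x y : E) : R := \sum_(i < d) x ord0 i * y ord0 i.

(* The norm of the library on ['rV[R]_d] is the sup norm. *)
Definition enorm (x : E) : R := Num.sqrt (dotv x x).

Definition eball (r : R) : set E := [set x | enorm x < r].

Definition cis (t : R) : R[i] := cos t +i* sin t.

Definition chi (xi x : E) : R[i] := cis (2 * pi * dotv x xi).

Definition fourier (f : E -> R[i]) (xi : E) : R[i] :=
  Cintegral lebesgue_rV setT (fun x => f x * cis (- (2 * pi * dotv x xi))).

(* The partial derivative of [f] along the list of coordinates [s]. *)
Definition pderive (s : seq 'I_d) (f : E -> R) : E -> R :=
  foldr (fun i g => 'D_(delta_mx ord0 i) g) f s.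

Definition smooth (f : E -> R) := forall s : seq 'I_d,
  continuous (pderive s f) /\
  forall x i, derivable (pderive s f) x (delta_mx ord0 i).

Definition schwartz (f : E -> R) := smooth f /\
  forall (k : nat) (s : seq 'I_d), exists C : R,
    forall x, (1 + enorm x) ^+ k * `|pderive s f x| <= C.

Definition Csmooth (f : E -> R[i]) :=
  smooth (@Re R \o f) /\ smooth (@Im R \o f).

Definition Cschwartz (f : E -> R[i]) :=
  schwartz (@Re R \o f) /\ schwartz (@Im R \o f).

Definition test_function (D : set E) (f : E -> R[i]) :=
  [/\ Csmooth f, compact (closure [set x | f x != 0])
    & closure [set x | f x != 0] `<=` D].

End euclidean.

Section probability.
Context d (T : measurableType d) (R : realType) (P : probability T R).

(* Mutual independence of finitely many sigma-algebras [F i]; the events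
   [A i = setT] are allowed, hence the product rule on subfamilies. *)
Definition independent (I : finType) (F : I -> set_system T) :=
  forall A : I -> set T, (forall i, F i (A i)) ->
    P (\bigcap_(i in [set: I]) A i) = (\prod_(i in I) P (A i))%E.

Definition sigma_of d' (T' : measurableType d') (X : T -> T') : set_system T :=
  preimage_set_system setT X measurable.

(* N(0, v); for [v = 0] the library's [normal_prob] is not the Dirac mass. *)
Definition centered_normal (v : R) : set R -> \bar R :=
  if v == 0 then \d_(0 : R) else normal_prob 0 (Num.sqrt v).

Definition has_centered_normal_law (X : T -> R) (v : R) :=
  forall A, measurable A -> P (X @^-1` A) = centered_normal v A.

Definition circular_gaussian (G : T -> R[i]) := Cmeasurable G /\
  exists2 v : R, 0 <= v &
  [/\ has_centered_normal_law (@Re R \o G) v,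
      has_centered_normal_law (@Im R \o G) v
    & independent (fun b : bool =>
        sigma_of (if b then @Re R \o G else @Im R \o G))].

Definition uniform_on d' (T' : measurableType d')
    (mu : {measure set T' -> \bar R}) (D : set T') (X : T -> T') :=
  forall A, measurable A ->
    P (X @^-1` A) = (fine (mu (A `&` D)) / fine (mu D))%:E.

End probability.

Definition cvg_in_distribution (R : realType) (V : topologicalType)
    d (T : measurableType d) (P : probability T R) (X : R -> T -> V)
    d' (T' : measurableType d') (Q : probability T' R) (G : T' -> V) :=
  forall phi : V -> R, continuous phi ->
    (exists C : R, forall v, `|phi v| <= C) ->
  \int[P]_w phi (X rad w) @[rad --> +oo] --> \int[Q]_w phi (G w).

(* The identification of C^n with R^(n x 2). *)
Definition real_coords (R : realType) n (z : 'I_n -> R[i]) : 'M[R]_(n, 2) :=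
  \matrix_(j < n, k < 2) if k == ord0 then Re (z j) else Im (z j).

Section point_process.
Local Open Scope complex_scope.
Context {R : realType} {d : nat}.
Local Notation E := 'rV[R]_d.

(* Locally finite configurations of points (with multiplicities), as counting
   measures. *)
Definition configuration (mu : {measure set E -> \bar R}) :=
  forall B : set E, measurable B -> bounded_set B -> exists k : nat, mu B = k%:R%:E.

(* The sigma-algebra generated by the evaluations [phi |-> phi B]. *)
Definition config_events : set_system (set E -> \bar R) :=
  <<s [set A | exists (B : set E) (C : set \bar R), [/\ measurable B, measurable C &
                              A = (fun phi => phi B) @^-1` C]] >>.

Definition translate (t : E) (phi : set E -> \bar R) : set E -> \bar R :=
  pushforward phi (fun x => x + t).

Section defs.
Context {dO : measure_display} {Om : measurableType dO}.
Variables (P : probability Om R) (eta : R.-ker Om ~> E).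

Definition point_process := forall w, configuration (eta w).

Definition stationary := forall A t, config_events A ->
  P [set w | A (translate t (eta w))] = P [set w | A (eta w)].

Definition ergodic := forall A, config_events A ->
  (forall (mu : {measure set E -> \bar R}) t, configuration mu ->
     A (translate t mu) <-> A mu) ->
  P [set w | A (eta w)] = 0%E \/ P [set w | A (eta w)] = 1%E.

Definition has_intensity (rho : R) := forall B : set E, measurable B ->
  (\int[P]_w eta w B = rho%:E * lebesgue_rV B)%E.

Definition local_second_moments := forall B : set E, measurable B -> bounded_set B ->
  (\int[P]_w (eta w B ^+ 2) < +oo)%E.

(* M(f); the sum over the points of eta is the integral against the counting
   measure. *)
Definition centered_stat (rho : R) (f : E -> R[i]) (w : Om) : R[i] :=
  Cintegral (eta w) setT f - rho%:C * Cintegral lebesgue_rV setT f.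

Definition bartlett_measure (rho : R) (sigma : {measure set E -> \bar R}) :=
  forall f g : E -> R[i], Cschwartz f -> Cschwartz g ->
    sigma.-integrable setT
      (fun xi => (normc (fourier f xi) * normc (fourier g xi))%:E) /\
    Cintegral P setT (fun w => centered_stat rho f w * (centered_stat rho g w)^*)
    = Cintegral sigma setT (fun xi => fourier f xi * (fourier g xi)^*).

(* Z_R(xi), with [rad] for R. *)
Definition windowed_dft (rho : R) (h : E -> R[i]) (rad : R) (xi : E)
    (w : Om) : R[i] :=
  (rad `^ (- (d%:R / 2)))%:C *
  centered_stat rho (fun x => h (rad^-1 *: x) * chi xi x) w.

Definition fourier_condition (rho : R) (S : E -> R) (h : E -> R[i]) :=
  forall n, (0 < n)%N -> exists O : set (n.-tuple E),
  [/\ measurable O,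
      measure_pow lebesgue_rV n (~` O) = 0%E,
      O `<=` [set u | (forall i, tnth u i != 0) /\
                forall i j, i != j ->
                  tnth u i != tnth u j /\ tnth u i != - tnth u j]
    & forall u, O u ->
      exists (dG : measure_display) (TG : measurableType dG)
        (Q : probability TG R) (G : 'I_n -> TG -> R[i]),
      [/\ forall j, circular_gaussian Q (G j),
          independent Q (fun j => sigma_of (fun w => (Re (G j w), Im (G j w)))),
          forall j, (\int[Q]_w (normc (G j w) ^+ 2)%:E)%E
                    = (rho * S (tnth u j))%:E,
          forall j, Cintegral Q setT (fun w => G j w ^+ 2) = 0
        & cvg_in_distribution P
            (fun rad w => real_coords
               (fun j => windowed_dft rho h rad (tnth u j) w))
            Q (fun w => real_coords (G ^~ w))]].

Definition intensity_estimator (rad : R) (w : Om) : R :=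
  fine (eta w (eball rad)) / fine (lebesgue_rV (eball rad : set E)).

(* I_{R,h}(u), with [rad] for R. *)
Definition periodogram (h : E -> R[i]) (rad : R) (u : E) (w : Om) : R :=
  if 0 < intensity_estimator rad w then
    (intensity_estimator rad w)^-1 * rad `^ (- d%:R) *
    normc (Cintegral (eta w) (eball rad)
             (fun x => h (rad^-1 *: x) * chi u x)) ^+ 2
  else 0.

Definition sigma_of_process : set_system Om :=
  preimage_set_system setT (fun w => eta w : set E -> \bar R) config_events.

End defs.

Definition structure_factor (sigma : {measure set E -> \bar R}) (rho : R)
    (S : E -> R) :=
  [/\ measurable_fun setT S, forall x, 0 <= S x
    & forall B : set E, measurable B ->
        sigma B = (\int[lebesgue_rV]_(x in B) (rho * S x)%:E)%E].

Definition ball_average (sigma : {measure set E -> \bar R}) (rho r : R) : R :=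
  fine (sigma (eball r)) / (rho * fine (lebesgue_rV (eball r : set E))).

End point_process.

(* Arrays are indexed by the radius (false for r, true for kappa * r) and by
   the index of the frequency. *)
Section estimator.
Context {R : realType}.
Variables (alpha beta L kappa : R).

Definition sampling_radius (r : R) (a : bool) : R := if a then kappa * r else r.

Definition bias_bound (r : R) : R :=
  L * ((kappa `^ alpha + kappa `^ beta) / (kappa `^ alpha - 1)) * r `^ beta.

Definition normal_quantile (q : R) : R :=
  inf [set x : R | q <= fine (normal_prob 0 1 `]-oo, x])].

Section array.
Context {m : nat}.
Variable y : bool -> 'I_m -> R.

Definition sample_mean (a : bool) : R := m%:R^-1 * \sum_(j < m) y a j.

Definition sample_variance (a : bool) : R :=
  (m%:R - 1)^-1 * \sum_(j < m) (y a j - sample_mean a) ^+ 2.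

Definition s_hat : R :=
  (kappa `^ alpha * sample_mean false - sample_mean true) /
  (kappa `^ alpha - 1).

Definition std_error : R :=
  Num.sqrt ((kappa `^ (2 * alpha) * sample_variance false
             + sample_variance true) /
            (m%:R * (kappa `^ alpha - 1) ^+ 2)).

Definition confidence_interval (r gamma : R) : set R :=
  `[s_hat - bias_bound r - normal_quantile (1 - gamma / 2) * std_error,
    s_hat + bias_bound r + normal_quantile (1 - gamma / 2) * std_error]
  `&` `[0, +oo[.

End array.
End estimator.

(* The frequencies U_{a,j}: uniform on the balls B_a, mutually independent and
   jointly independent of eta. *)
Definition sampled_frequencies (R : realType) (d : nat)
    (dO : measure_display) (Om : measurableType dO) (P : probability Om R)
    (eta : R.-ker Om ~> 'rV[R]_d) (kappa r : R) (m : nat)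
    (U : bool -> 'I_m -> Om -> 'rV[R]_d) :=
  [/\ forall a j, measurable_fun setT (U a j),
      forall a j, uniform_on P lebesgue_rV (eball (sampling_radius kappa r a))
                    (U a j),
      independent P (fun i : bool * 'I_m => sigma_of (U i.1 i.2))
    & independent P (fun b : bool =>
        if b then sigma_of_process eta
        else <<s \bigcup_(i in [set: bool * 'I_m]) sigma_of (U i.1 i.2) >>)].

(* Main.v *)
Require Import Defs.
From HB Require Import structures.
From mathcomp Require Import all_boot all_order all_algebra.
From mathcomp Require Import all_classical all_reals all_analysis.
From mathcomp Require Import measurable_realfun.
From mathcomp.real_closed Require Import complex.
From mathcomp Require Import ring lra.
Set Implicit Arguments.
Unset Strict Implicit.
Unset Printing Implicit Defensive.
Import Order.TTheory GRing.Theory Num.Theory.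
Import numFieldNormedType.Exports.
Local Open Scope classical_set_scope.
Local Open Scope ring_scope.

(** The coverage of the interval is first proved for an idealized array, independent samples of the
    limit law of the periodograms at random frequencies, and then transferred to the observed array.

    At fixed frequencies, the Fourier condition provides independent circular Gaussian limits for the centered
    windowed transforms. The periodograms are built from the uncentered transforms and from the
    estimated intensity. The difference between centered and uncentered transforms is a window
    integrated against a nonconstant character, normalized by [rad ^ (- d / 2)]; repeated finite
    differences over half a period show that the integral is bounded ([window_mean_small]). The
    estimated intensity is consistent, because the variance of a smoothed count is a spectral integral
    that tends to 0 when the spectral measure has no atom at the origin
    ([intensity_estimator_consistent]). Coverage, written with the strict inequality
    [`|s_hat - s| < b + z * std_error], is an open condition on all these quantities, so that a
    portmanteau inequality bounds its probability from below by the probability in the Gaussian limit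
    ([coverage_limit]).

    The frequencies are independent of the process and almost surely avoid the exceptional set of the
    Fourier condition. Conditioning on them and dominated convergence give the same bound for the average
    over the frequencies ([mixture_lower_limit], [coverage_transfer]). In the limit a periodogram at the frequency [u] is
    [S u] times an exponential variable of mean 1. Averaged over frequencies that are uniform on the
    balls, the limit array therefore consists of [m] independent pairs, with independent coordinates of
    means [A_r] and [A_(kappa r)] ([limit_tuple_law], [limit_mean]); square integrability of [S] on the
    ball makes the second moments finite.

    For such pairs coverage is classical. The extrapolation removes the term in [r ^ alpha] from the mean
    and leaves a bias of at most [bias_bound] ([extrapolation_bias]); a central limit theorem for the
    numerator and weak laws for the standard error do the rest ([coverage_nondegenerate]). The variance
    vanishes only if [S] is 0 almost everywhere on the larger ball, since the exponential factor doubles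
    the squared mean. Then all the averages up to that radius are 0, hence [s = 0], and coverage
    holds because the bias bound is positive ([degenerate_coverage]). *)

(** * Change of variables and the standard normal law *)

Lemma ge0_integral_mpushforward d1 d2 (T1 : measurableType d1) (T2 : measurableType d2)
    (R : realType) (m : {measure set T1 -> \bar R}) (f : {mfun T1 >-> T2})
    (g : T2 -> \bar R) : measurable_fun setT g -> (forall y, 0 <= g y)%E ->
  (\int[mpushforward m f]_y g y = \int[m]_x g (f x))%E.
Proof. by move=> mg g0; rewrite /mpushforward ge0_integral_pushforward. Qed.

Lemma Rintegral_mpushforward d1 d2 (T1 : measurableType d1) (T2 : measurableType d2)
    (R : realType) (m : {measure set T1 -> \bar R}) (f : {mfun T1 >-> T2})
    (g : T2 -> R) : measurable_fun setT g ->
  \int[mpushforward m f]_y g y = \int[m]_x g (f x).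
Proof.
move=> mg; have mG : measurable_fun setT (EFin \o g) by exact/measurable_EFinP.
rewrite /Rintegral [in LHS]integralE [in RHS]integralE; apply: congr1.
have -> : (\int[m]_x (fun x => (g (f x))%:E)^\+ x = \int[m]_x (EFin \o g)^\+ (f x))%E.
  by apply: eq_integral => x _; rewrite !funeposE.
have -> : (\int[m]_x (fun x => (g (f x))%:E)^\- x = \int[m]_x (EFin \o g)^\- (f x))%E.
  by apply: eq_integral => x _; rewrite !funenegE.
rewrite -(ge0_integral_mpushforward m f (measurable_funepos mG))//.
by rewrite -(ge0_integral_mpushforward m f (measurable_funeneg mG)).
Qed.

Section nonneg_induction.
Context d (T : measurableType d) (R : realType).
Import HBNNSimple.

(** The monotone class induction for nonnegative functions: indicators, multiples, sums,
    and monotone limits. *)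
Lemma ge0_measurable_ind (Q : (T -> \bar R) -> Prop) :
  (forall A, measurable A -> Q (fun x => (\1_A x)%:E)) ->
  (forall (k : R) f, 0 <= k -> measurable_fun setT f -> (forall x, 0 <= f x)%E ->
     Q f -> Q (fun x => k%:E * f x)%E) ->
  (forall f g, measurable_fun setT f -> (forall x, 0 <= f x)%E ->
     measurable_fun setT g -> (forall x, 0 <= g x)%E ->
     Q f -> Q g -> Q (fun x => f x + g x)%E) ->
  (forall (u : nat -> T -> \bar R) f,
     (forall n, measurable_fun setT (u n)) -> (forall n x, 0 <= u n x)%E ->
     (forall x, {homo u ^~ x : m n / (m <= n)%N >-> (m <= n)%E}) ->
     (forall x, u n x @[n --> \oo] --> f x) ->
     (forall n, Q (u n)) -> Q f) ->
  forall f, measurable_fun setT f -> (forall x, 0 <= f x)%E -> Q f.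
Proof.
move=> Q1 QZ QD Qlim f mf f0.
pose u := nnsfun_approx measurableT mf.
apply: (Qlim (fun n x => (u n x)%:E)).
- by move=> n; exact/measurable_EFinP.
- by move=> n x; rewrite lee_fin.
- by move=> x m n mn; rewrite lee_fin; exact/lefP/nd_nnsfun_approx.
- by move=> x; exact: cvg_nnsfun_approx.
move=> n.
pose s := finmap.enum_fset (fset_set (range (u n))).
rewrite (_ : (fun _ => _) =
    (fun x => \sum_(r <- s) r%:E * (\1_(u n @^-1` [set r]) x)%:E)%E); last first.
  apply/funext => x; rewrite fimfunE fsbig_finite//= -sumEFin.
  by apply: eq_bigr => r _; rewrite EFinM.
have : forall r, r \in s -> 0 <= r.
  by move=> r; rewrite /s in_fset_set// inE => -[x _ <-].
elim: s => [_|r s IHs s0].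
  rewrite (_ : (fun _ => _) = (fun x => (\1_set0 x)%:E)); first exact/Q1/measurable0.
  by apply/funext => x; rewrite big_nil indic0.
have r0 : 0 <= r by apply: s0; rewrite mem_head.
have m1 k : measurable_fun setT (fun x => (\1_(u n @^-1` [set k]) x)%:E : \bar R).
  by apply/measurable_EFinP; exact: measurable_indic.
have p1 k x : (0 <= (\1_(u n @^-1` [set k]) x)%:E :> \bar R)%E by rewrite lee_fin.
rewrite (_ : (fun _ => _) = (fun x => r%:E * (\1_(u n @^-1` [set r]) x)%:E +
    \sum_(k <- s) k%:E * (\1_(u n @^-1` [set k]) x)%:E)%E); last first.
  by apply/funext => x; rewrite big_cons.
have s0' k : k \in s -> 0 <= k by move=> ks; apply: s0; rewrite in_cons ks orbT.
apply: QD.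
- exact: measurable_funeM.
- by move=> x; rewrite mule_ge0 ?lee_fin.
- by apply: emeasurable_sum => k; exact: measurable_funeM.
- move=> x; rewrite big_seq; apply: sume_ge0 => k ks.
  by apply: mule_ge0 => //; rewrite lee_fin s0'.
- by apply: QZ => //; exact: Q1.
- exact: IHs.
Qed.

Lemma ge0_integral_density (nu mu : {measure set T -> \bar R}) (p : T -> R) :
  measurable_fun setT p -> (forall x, 0 <= p x) ->
  (forall A, measurable A -> nu A = \int[mu]_(x in A) (p x)%:E)%E ->
  forall f, measurable_fun setT f -> (forall x, 0 <= f x)%E ->
  (\int[nu]_x f x = \int[mu]_x (f x * (p x)%:E))%E.
Proof.
move=> mp p0 nuE; have mp' : measurable_fun setT (EFin \o p) by exact/measurable_EFinP.
apply: ge0_measurable_ind.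
- move=> A mA; rewrite integral_indic// setIT nuE// integral_mkcond.
  apply: eq_integral => x _; rewrite patchE indicE.
  by case: ifPn => _ /=; rewrite ?mul1e ?mul0e.
- move=> k f k0 mf f0 IH; rewrite ge0_integralZl// IH -ge0_integralZl//.
  + by apply: eq_integral => x _; rewrite muleA.
  + exact: emeasurable_funM.
  + by move=> x _; rewrite mule_ge0 ?lee_fin.
- move=> f g mf f0 mg g0 IHf IHg; rewrite ge0_integralD// IHf IHg -ge0_integralD//.
  + by apply: eq_integral => x _; rewrite ge0_muleDl.
  + by move=> x _; rewrite mule_ge0 ?lee_fin.
  + exact: emeasurable_funM.
  + by move=> x _; rewrite mule_ge0 ?lee_fin.
  + exact: emeasurable_funM.
- move=> u f mu_ u0 nd uf IH.
  have c1 := @cvg_monotone_convergence _ _ _ nu _ measurableT _ mu_ (fun n x _ => u0 n x)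
    (fun x _ => nd x).
  have c2 : (\int[mu]_x (u n x * (p x)%:E) @[n --> \oo] -->
      \int[mu]_x (limn (fun n => u n x * (p x)%:E)))%E.
    apply: cvg_monotone_convergence => //.
    - by move=> n; exact: emeasurable_funM.
    - by move=> n x _; rewrite mule_ge0 ?lee_fin.
    - by move=> x _ m n mn; apply: lee_wpmul2r; [rewrite lee_fin|exact: nd].
  have -> : (\int[nu]_x f x = \int[nu]_x (limn (u ^~ x)))%E.
    by apply: eq_integral => x _; apply/esym/cvg_lim => //; exact: uf.
  have -> : (\int[mu]_x (f x * (p x)%:E) = \int[mu]_x (limn (fun n => u n x * (p x)%:E)))%E.
    apply: eq_integral => x _; apply/esym/cvg_lim => //.
    by apply: cvgeZr => //; exact: uf.
  apply: (cvg_unique _ c1) => //.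
  move: c2; apply: cvg_trans; apply: near_eq_cvg; apply: nearW => n.
  by rewrite IH.
Qed.

End nonneg_induction.

Section lebesgue_affine.
Context {R : realType}.
Local Notation mu := (@lebesgue_measure R).

Definition affine (s t : R) : measurableTypeR R -> measurableTypeR R :=
  fun x => s * x + t.

Lemma measurable_affine (s t : R) : measurable_fun setT (affine s t).
Proof. by apply: measurable_funD => //; apply: measurable_funM. Qed.

HB.instance Definition _ s t := isMeasurableFun.Build _ _ _ _ (affine s t)
  (measurable_affine s t).

Lemma lebesgue_measure_affine (s t : R) (A : set (measurableTypeR R)) :
  0 < s -> measurable A -> (s%:E * mu (affine s t @^-1` A) = mu A)%E.
Proof.
move=> s0 mA; pose s' := NngNum (ltW s0).
transitivity (mscale s' (mpushforward mu (affine s t)) A); first by [].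
apply/esym; apply: lebesgue_measure_unique => // _ [[a b]] _ <-.
transitivity (s%:E * mu (affine s t @^-1` `]a, b]%classic))%E; last by [].
rewrite (_ : affine s t @^-1` _ = `](a - t) / s, (b - t) / s]%classic); last first.
  apply/seteqP; split => x /=; rewrite !in_itv/= ltr_pdivrMr// ler_pdivlMr//;
  by rewrite ltrBlDr lerBrDr mulrC.
rewrite !lebesgue_measure_itv/= !lte_fin ltr_pM2r ?invr_gt0// ltrD2r.
case: ifPn => _; last by rewrite mule0.
rewrite -!EFinB -EFinM; congr EFin; field; exact: lt0r_neq0.
Qed.

Lemma ge0_integral_affine (s t : R) (f : R -> \bar R) : 0 < s ->
  measurable_fun [set: measurableTypeR R] f -> (forall x, 0 <= f x)%E ->
  (\int[mu]_x f x = s%:E * \int[mu]_x f (s * x + t)%R)%E.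
Proof.
move=> s0 mf f0; pose s' := NngNum (ltW s0).
rewrite (eq_measure_integral (mscale s' (mpushforward mu (affine s t)))); last first.
  by move=> A mA _ /=; rewrite -(lebesgue_measure_affine t s0 mA).
rewrite (ge0_integral_mscale (mpushforward mu (affine s t)))//.
by rewrite ge0_integral_mpushforward.
Qed.

End lebesgue_affine.

Section standard_normal.
Context {R : realType}.
Local Notation mu := (@lebesgue_measure R).
Local Notation N := (@normal_prob R 0 1).
Local Notation phi := (@normal_pdf R 0 1).

Lemma normal_pdf01E (x : R) : phi x = normal_peak 1 * expR (- (x ^+ 2 / 2)).
Proof.
by rewrite normal_pdfE ?oner_neq0// /normal_fun subr0 expr1n mulNr.
Qed.

Lemma mnormal_pdf01 : measurable_fun [set: measurableTypeR R] phi.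
Proof. exact: measurable_normal_pdf. Qed.

Lemma ge0_integral_normal (f : R -> \bar R) :
  measurable_fun [set: measurableTypeR R] f -> (forall x, 0 <= f x)%E ->
  (\int[N]_x f x = \int[mu]_x (f x * (phi x)%:E))%E.
Proof.
by move=> mf f0; apply: ge0_integral_density => //; [exact: mnormal_pdf01|exact: normal_pdf_ge0].
Qed.

(** The rotation invariance of the Gaussian measure of the plane. After the substitution
    [c * u = a * x + b * y] with [c ^+ 2 = a ^+ 2 + b ^+ 2], completing the square in [y]
    factors the joint density. *)
Lemma ge0_integral_normal2 (f : R -> \bar R) (a b : R) : 0 < a -> 0 <= b ->
  measurable_fun [set: measurableTypeR R] f -> (forall x, 0 <= f x)%E ->
  (\int[N]_y \int[N]_x f (a * x + b * y)%R =
   \int[N]_x f (Num.sqrt (a ^+ 2 + b ^+ 2) * x)%R)%E.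
Proof.
move=> a0 b0 mf f0; set c := Num.sqrt _.
have c2 : c ^+ 2 = a ^+ 2 + b ^+ 2 by rewrite sqr_sqrtr// addr_ge0// sqr_ge0.
have c0 : 0 < c by rewrite sqrtr_gt0 ltr_wpDr ?exprn_gt0// sqr_ge0.
have an0 := lt0r_neq0 a0; have cn0 := lt0r_neq0 c0.
have maff s t : measurable_fun [set: measurableTypeR R] (fun x : R => s * x + t).
  exact: measurable_affine.
have maff0 s : measurable_fun [set: measurableTypeR R] (fun x : R => s * x).
  by apply: measurable_funM.
have mphi := mnormal_pdf01.
pose K (z : measurableTypeR R * measurableTypeR R) : \bar R :=
  (f (c * z.2)%R * ((c / a) * phi ((c * z.2 - b * z.1) / a) * phi z.1)%:E)%E.
have mK : measurable_fun setT K.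
  apply: emeasurable_funM.
    by apply: measurableT_comp => //; apply: measurable_funM.
  apply/measurable_EFinP; apply: measurable_funM.
    apply: measurable_funM => //; apply: measurableT_comp => //.
    by apply: measurable_funM => //; apply: measurable_funB; apply: measurable_funM.
  by apply: measurableT_comp.
have K0 z : (0 <= K z)%E.
  by rewrite /K mule_ge0// lee_fin !mulr_ge0 ?normal_pdf_ge0 ?ltW ?invr_gt0.
transitivity (\int[mu]_y \int[mu]_u K (y, u))%E.
  have mG : measurable_fun [set: measurableTypeR R]
      (fun y : R => (\int[N]_x f (a * x + b * y)%R)%E).
    apply: (@measurable_fun_fubini_tonelli_F _ _ _ _ _ N
      (fun z : measurableTypeR R * measurableTypeR R => f (a * z.2 + b * z.1)%R)) => //.
    apply: measurableT_comp => //.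
    by apply: measurable_funD => //; apply: measurable_funM.
  rewrite ge0_integral_normal//; last by move=> y; exact: integral_ge0.
  apply: eq_integral => y _.
  rewrite ge0_integral_normal//; last first.
    by apply: (measurableT_comp mf); exact: maff.
  have m1 : measurable_fun [set: measurableTypeR R]
     (fun x : R => (f (a * x + b * y)%R * (phi x)%:E)%E).
    apply: emeasurable_funM; first by apply: (measurableT_comp mf); exact: maff.
    exact/measurable_EFinP.
  rewrite -ge0_integralZr//; last 2 first.
    by move=> x _; rewrite mule_ge0// lee_fin normal_pdf_ge0.
    by rewrite lee_fin normal_pdf_ge0.
  rewrite [LHS](@ge0_integral_affine _ (c / a) (- (b * y / a))); last 3 first.
    by rewrite divr_gt0.
    apply: emeasurable_funM => //; exact: measurable_cst.
    by move=> x; rewrite !mule_ge0// lee_fin normal_pdf_ge0.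
  rewrite -ge0_integralZl//; last 3 first.
    apply: emeasurable_funM => //.
    by apply: (measurableT_comp m1); exact: maff.
    by move=> x _; rewrite !mule_ge0// lee_fin normal_pdf_ge0.
    by rewrite lee_fin divr_ge0 ?ltW.
  apply: eq_integral => u _.
  rewrite /K/= (_ : a * (c / a * u - b * y / a) + b * y = c * u); last by field.
  rewrite (_ : c / a * u - b * y / a = (c * u - b * y) / a); last by field.
  by rewrite muleC -!muleA -!EFinM; congr (_ * _%:E)%E; ring.
rewrite (@fubini_tonelli _ _ _ _ _ mu mu K)//.
rewrite ge0_integral_normal//; last by apply: (measurableT_comp mf); exact: maff0.
apply: eq_integral => u _.
rewrite /K/= ge0_integralZl//; last 2 first.
  apply/measurable_EFinP; apply: measurable_funM => //; apply: measurable_funM => //.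
  apply: measurableT_comp => //; apply: measurable_funM => //.
  by apply: measurable_funB => //; apply: measurable_funM.
  by move=> y _; rewrite lee_fin !mulr_ge0 ?normal_pdf_ge0 ?ltW ?invr_gt0.
congr (_ * _)%E.
transitivity ((phi u)%:E * ((c / a)%:E *
   \int[mu]_y (phi (c / a * y + - (b * u / a)))%:E))%E; last first.
  rewrite -(@ge0_integral_affine _ _ _ (fun x => (phi x)%:E)) ?divr_gt0//.
  - by rewrite integral_normal_pdf mule1.
  - exact/measurable_EFinP.
  - by move=> x; rewrite lee_fin normal_pdf_ge0.
have m2 : measurable_fun [set: measurableTypeR R]
    (fun y : R => (phi (c / a * y + - (b * u / a)))%:E).
  by apply/measurable_EFinP; apply: (measurableT_comp mphi); exact: maff.
have e0 : (0 <= (phi u)%:E * (c / a)%:E :> \bar R)%E.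
  by rewrite mule_ge0// lee_fin ?normal_pdf_ge0// divr_ge0 ?ltW.
rewrite muleA; apply: esym; apply: etrans.
  apply: esym; apply: (ge0_integralZl mu measurableT m2) e0.
  by move=> y _; rewrite lee_fin normal_pdf_ge0.
apply: esym.
apply: eq_integral => y _; rewrite -!EFinM; congr EFin.
have -> : phi (c / a * y + - (b * u / a)) = phi ((c * y - b * u) / a).
  by congr (phi _); field.
suff E : phi ((c * u - b * y) / a) * phi y = phi u * phi ((c * y - b * u) / a).
  by rewrite -mulrA E; ring.
rewrite !normal_pdf01E mulrACA [RHS]mulrACA -!expRD; congr (_ * expR _).
apply/eqP; rewrite -subr_eq0; apply/eqP.
transitivity (- ((u ^+ 2 - y ^+ 2) * (c ^+ 2 - (a ^+ 2 + b ^+ 2)) / (2 * a ^+ 2))).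
  by field.
by rewrite c2 subrr mulr0 mul0r oppr0.
Qed.
End standard_normal.

Section normal_moments.
Context {R : realType}.
Local Notation mu := (@lebesgue_measure R).
Local Notation N := (@normal_prob R 0 1).
Local Notation phi := (@normal_pdf R 0 1).

(** Half of the exponent absorbs the fourth power; the other half is the exponent of the
    normal density of variance 2, which is integrable. *)
Lemma normal_pdf01_tail (x : R) :
  x ^+ 4 * phi x <= 32 * normal_peak 1 / normal_peak (Num.sqrt 2) * normal_pdf 0 (Num.sqrt 2) x.
Proof.
have s2 : Num.sqrt (2 : R) != 0 by rewrite lt0r_neq0// sqrtr_gt0.
have p2 := normal_peak_gt0 s2; have p1 := @normal_peak_gt0 R 1 (oner_neq0 _).
rewrite (normal_pdfE _ s2) mulrA divfK ?lt0r_neq0// normal_pdf01E /normal_fun subr0.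
rewrite sqr_sqrtr// mulrCA -mulrA [X in _ <= X]mulrCA ler_pM2l//.
set t := x ^+ 2 / 4.
have t0 : 0 <= t by rewrite divr_ge0 ?sqr_ge0.
have -> : - (x ^+ 2 / 2) = - t - t by rewrite /t; field.
have -> : - x ^+ 2 / (2 *+ 2) = - t by rewrite /t; field.
rewrite expRB (_ : x ^+ 4 = 16 * t ^+ 2); last by rewrite /t; field.
rewrite mulrA ler_pdivrMr ?expR_gt0//.
rewrite [leRHS]mulrAC ler_pM2r ?expR_gt0//.
have := expR_ge1Dxn 1 t0; rewrite (_ : 2`! = 2)%N// => h.
by lra.
Qed.

Lemma normal_fourth_moment : (\int[N]_x (x ^+ 4)%:E < +oo)%E.
Proof.
have mX : measurable_fun [set: measurableTypeR R] (fun x : R => (x ^+ 4)%:E).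
  by apply/measurable_EFinP; exact: measurable_funX.
have x4 (x : R) : 0 <= x ^+ 4 by rewrite exprn_even_ge0.
rewrite ge0_integral_normal//.
set K := 32 * normal_peak 1 / normal_peak (Num.sqrt 2) : R.
have K0 : 0 <= K by rewrite /K !mulr_ge0// ?invr_ge0 ?normal_peak_ge0.
have mp : measurable_fun [set: measurableTypeR R] (fun x => (normal_pdf 0 (Num.sqrt 2) x)%:E).
  by apply/measurable_EFinP; exact: measurable_normal_pdf.
apply: (@le_lt_trans _ _ (\int[mu]_x (K%:E * (normal_pdf 0 (Num.sqrt 2) x)%:E))%E).
  apply: ge0_le_integral => //.
  - by move=> x _; rewrite -EFinM lee_fin mulr_ge0// normal_pdf_ge0.
  - by apply: emeasurable_funM => //; apply/measurable_EFinP; exact: mnormal_pdf01.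
  - by apply: emeasurable_funM.
  - by move=> x _; rewrite -!EFinM lee_fin; exact: normal_pdf01_tail.
rewrite ge0_integralZl//; last by move=> x _; rewrite lee_fin normal_pdf_ge0.
by rewrite integral_normal_pdf mule1 ltry.
Qed.

(** Integration by parts on symmetric segments: [- phi] is a primitive of [x * phi x], and the
    boundary terms vanish in the limit. *)
Lemma normal_second_moment : (\int[N]_x (x ^+ 2)%:E = 1)%E.
Proof.
have mX : measurable_fun [set: measurableTypeR R] (fun x : R => (x ^+ 2)%:E).
  by apply/measurable_EFinP; exact: measurable_funX.
have mphi := @mnormal_pdf01 R.
have mXp : measurable_fun [set: measurableTypeR R] (fun x : R => (x ^+ 2 * phi x)%:E).
  apply/measurable_EFinP; apply: measurable_funM => //; exact: measurable_funX.
rewrite ge0_integral_normal//; last by move=> x; rewrite lee_fin sqr_ge0.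
under eq_integral do rewrite -EFinM.
pose I n : set (measurableTypeR R) := `[- n.+1%:R, n.+1%:R]%classic.
have UI : \bigcup_n I n = setT.
  apply/seteqP; split => // x _; exists (Num.truncn `|x|) => //=.
  by rewrite /I/= in_itv/= -ler_norml ltW// truncnS_gt.
have ndI : nondecreasing_seq I.
  move=> n m nm; rewrite subsetEset => x /=; rewrite /I/= !in_itv/= -!ler_norml => /le_trans; apply.
  by rewrite ler_nat.
have mI n : measurable (I n) by exact: measurable_itv.
have c1 : (\int[mu]_(x in I n) (x ^+ 2 * phi x)%:E @[n --> \oo] -->
    \int[mu]_x (x ^+ 2 * phi x)%:E)%E.
  rewrite -UI; apply: ge0_nondecreasing_set_cvg_integral => //.
  - by move=> n; apply: measurable_funTS.
  - by move=> n x _; rewrite lee_fin mulr_ge0 ?sqr_ge0 ?normal_pdf_ge0.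
have c2 : (\int[mu]_(x in I n) (phi x)%:E @[n --> \oo] --> (1 : \bar R))%E.
  rewrite -(@integral_normal_pdf R 0 1) -UI; apply: ge0_nondecreasing_set_cvg_integral => //.
  - by move=> n; apply: measurable_funTS; apply/measurable_EFinP.
  - by move=> n x _; rewrite lee_fin normal_pdf_ge0.
have E n : (\int[mu]_(x in I n) (x ^+ 2 * phi x)%:E =
  \int[mu]_(x in I n) (phi x)%:E + (- (2 * n.+1%:R * phi n.+1%:R))%:E)%E.
  have nn : (- n.+1%:R : R) < n.+1%:R by rewrite -subr_gt0 opprK addr_gt0.
  have dphi (x : R) : is_derive x 1 phi (- x * phi x).
    rewrite (_ : phi = (fun x => normal_peak 1 * expR (- (x ^+ 2 / 2)))); last first.
      by apply/funext => y; rewrite normal_pdf01E.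
    by apply: is_derive_eq; rewrite /GRing.scale/=; field.
  have dF (x : R) : is_derive x 1 (fun x => - x * phi x) (x ^+ 2 * phi x - phi x).
    by apply: is_derive_eq; rewrite /GRing.scale/=; ring.
  have cphi : continuous phi by apply: continuous_normal_pdf; exact: oner_neq0.
  have cf : continuous (fun x : R => x ^+ 2 * phi x - phi x).
    move=> x; apply: cvgB; last exact: cphi.
    apply: cvgM; last exact: cphi.
    exact: exprn_continuous.
  have := @continuous_FTC2 R _ (fun x => - x * phi x) _ _ nn
    (continuous_subspaceT cf).
  have LR : derivable_oo_LRcontinuous (fun x => - x * phi x : R^o) (- n.+1%:R) n.+1%:R.
    have cF : continuous (fun x : R => - x * phi x).
      move=> x; apply: differentiable_continuous; apply/derivable1_diffP; by case: (dF x).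
    split.
    - by move=> x _; by case: (dF x).
    - exact/cvg_at_right_filter/cF.
    - exact/cvg_at_left_filter/cF.
  move=> /(_ LR).
  have D : {in `](- n.+1%:R), n.+1%:R[, ((fun x : R => - x * phi x)^`())%classic =1 (fun x => x ^+ 2 * phi x - phi x)}.
    by move=> x _; rewrite derive1E; by case: (dF x).
  move=> /(_ D) H.
  have ip : mu.-integrable (I n) (fun x => (phi x)%:E).
    by apply: (integrableS measurableT) => //; exact: integrable_normal_pdf.
  have ix : mu.-integrable (I n) (fun x => (x ^+ 2 * phi x - phi x)%:E).
    apply: continuous_compact_integrable; first exact: segment_compact.
    exact: continuous_subspaceT.
  have -> : (\int[mu]_(x in I n) (x ^+ 2 * phi x)%:E =
     \int[mu]_(x in I n) ((phi x)%:E + (x ^+ 2 * phi x - phi x)%:E))%E.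
    by apply: eq_integral => x _; rewrite -EFinD; congr EFin; ring.
  rewrite integralD// H opprK; congr (_ + _)%E; rewrite -EFinB; congr EFin.
  have -> : phi (- n.+1%:R) = phi n.+1%:R by rewrite !normal_pdf01E sqrrN.
  by ring.
have c3 : ((- (2 * n.+1%:R * phi n.+1%:R))%:E : \bar R) @[n --> \oo] --> 0%E.
  apply: cvg_EFin; first exact: nearW.
  rewrite -[X in _ --> X]oppr0; apply: cvgN.
  set P := normal_peak 1 : R.
  have P0 : 0 <= P by exact: normal_peak_ge0.
  apply: (@squeeze_cvgr _ _ _ _ (cst 0) (fun n => 4 * P * n.+1%:R^-1)).
  - apply: nearW => n /=; rewrite !mulr_ge0 ?normal_pdf_ge0//=.
    rewrite normal_pdf01E -/P expRN; set u : R := n.+1%:R.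
    have u0 : 0 < u by rewrite ltr0n.
    have := expR_ge1Dx (u ^+ 2 / 2) => h.
    rewrite mulrA ler_pdivrMr ?expR_gt0// [leRHS]mulrAC ler_pdivlMr//.
    have -> : 2 * u * P * u = 4 * P * (u ^+ 2 / 2) by field.
    by rewrite ler_wpM2l ?mulr_ge0//; lra.
  - exact: cvg_cst.
  - rewrite -[X in _ --> X](mulr0 (4 * P)); apply: cvgMr.
    exact: cvg_harmonic.
suff h : (\int[mu]_(x in I n) (x ^+ 2 * phi x)%:E @[n --> \oo] --> (1 : \bar R))%E.
  by apply: (cvg_unique _ c1 h).
rewrite -[X in _ --> X](adde0 1%E).
rewrite (_ : (fun n => _) = (fun n => \int[mu]_(x in I n) (phi x)%:E +
  (- (2 * n.+1%:R * phi n.+1%:R))%:E)%E); last by apply/funext => n; exact: E.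
by apply: cvgeD.
Qed.

Lemma ge0_integral_normalN (f : R -> \bar R) :
  measurable_fun [set: measurableTypeR R] f -> (forall x, 0 <= f x)%E ->
  (\int[N]_x f (- x)%R = \int[N]_x f x)%E.
Proof.
move=> mf f0.
have mN : measurable_fun [set: measurableTypeR R] (fun x : R => f (- x)).
  by apply: measurableT_comp => //; exact: measurable_oppr.
have mphi : measurable_fun [set: measurableTypeR R] (EFin \o phi).
  by apply/measurable_EFinP; exact: mnormal_pdf01.
rewrite !ge0_integral_normal//.
rewrite [RHS](eq_measure_integral (mpushforward mu (affine (-1) 0))); last first.
  move=> A mA _; rewrite /mpushforward/= -(lebesgue_measureN mA).
  by rewrite /pushforward/= (_ : affine (-1) 0 = -%R)//; apply/funext => x; rewrite /affine mulN1r addr0.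
rewrite (ge0_integral_mpushforward mu (affine (-1) 0)).
- apply: eq_integral => x _ /=.
  by rewrite (_ : affine (-1) 0 x = - x) ?normal_pdf01E ?sqrrN// /affine mulN1r addr0.
- exact: emeasurable_funM.
- by move=> y; rewrite mule_ge0// lee_fin normal_pdf_ge0.
Qed.

Lemma normal_integrable_sqr : N.-integrable setT (fun x => (x ^+ 2)%:E).
Proof.
apply/integrableP; split; first by apply/measurable_EFinP; exact: measurable_funX.
under eq_integral do rewrite abse_EFin ger0_norm ?sqr_ge0//.
by rewrite normal_second_moment ltry.
Qed.

Lemma normal_integrable_id : N.-integrable setT (fun x => x%:E).
Proof.
apply: (le_integrable measurableT _ _ (g := fun x : measurableTypeR R => (1 + x ^+ 2)%:E)) => //.
- by apply/measurable_EFinP.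
- move=> x _; rewrite !abse_EFin lee_fin [leRHS]ger0_norm ?addr_ge0 ?sqr_ge0//.
  rewrite ler_norml; apply/andP; split; have := sqr_ge0 (x + 1); have := sqr_ge0 (x - 1); nra.
- under eq_fun do rewrite EFinD.
  apply: integrableD => //; last exact: normal_integrable_sqr.
  exact: finite_measure_integrable_cst.
Qed.

Lemma normal_first_moment : (\int[N]_x x%:E = 0)%E.
Proof.
rewrite integralE.
have -> : (\int[N]_x ((fun x : R => x%:E)^\- x) = \int[N]_x ((fun x : R => x%:E)^\+ x))%E.
  rewrite -[RHS]ge0_integral_normalN.
  - by apply: eq_integral => x _; rewrite funeposE funenegE.
  - by apply: measurable_funepos; apply/measurable_EFinP.
  - by move=> x; exact: funepos_ge0.
rewrite subee//.
have := integrable_pos_fin_num measurableT normal_integrable_id.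
by [].
Qed.

End normal_moments.

(** * Expectations of bounded functions and Taylor remainders *)

Section bounded_expectation.
Context d (T : measurableType d) (R : realType) (mu : {measure set T -> \bar R}).
Hypothesis mu1 : mu setT = 1%E.

Lemma bounded_integrable (f : T -> R) (K : R) : measurable_fun setT f ->
  (forall x, `|f x| <= K) -> mu.-integrable setT (EFin \o f).
Proof.
move=> mf fK; apply: measurable_bounded_integrable => //.
  by rewrite mu1 ltry.
exists K; split; first exact: num_real.
by move=> M KM x _ /=; rewrite (le_trans (fK x))// ltW.
Qed.

Lemma Rintegral_cst1 (k : R) : \int[mu]_x k = k.
Proof. by rewrite Rintegral_cst// mu1 mulr1. Qed.

Lemma bounded_Rintegral (f : T -> R) (K : R) : measurable_fun setT f ->
  (forall x, `|f x| <= K) -> `|\int[mu]_x f x| <= K.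
Proof.
move=> mf fK; have fi := bounded_integrable mf fK.
apply: (le_trans (le_normr_Rintegral measurableT fi)).
rewrite -[leRHS]Rintegral_cst1; apply: le_Rintegral => //.
- by have := integrable_norm fi.
- by apply: (@bounded_integrable (cst K) `|K|).
Qed.

End bounded_expectation.

Section Rintegral_fubini.
Context d1 d2 (T1 : measurableType d1) (T2 : measurableType d2) (R : realType).
Variables (m1 : {sigma_finite_measure set T1 -> \bar R})
          (m2 : {sigma_finite_measure set T2 -> \bar R}).
Hypotheses (m11 : m1 setT = 1%E) (m21 : m2 setT = 1%E).

Lemma product_measure_setT1 : (m1 \x m2)%E setT = 1%E.
Proof.
have : (m1 \x m2)%E ([set: T1] `*` [set: T2]) = (m1 [set: T1] * m2 [set: T2])%E.
  exact: product_measure1E.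
by rewrite m11 m21 mule1 setXTT.
Qed.

Lemma bounded_Rintegral_fubini (f : T1 * T2 -> R) (K : R) : measurable_fun setT f ->
  (forall x, `|f x| <= K) ->
  \int[(m1 \x m2)%E]_z f z = \int[m1]_x \int[m2]_y f (x, y).
Proof.
move=> mf fK.
have fi := bounded_integrable product_measure_setT1 mf fK.
rewrite /Rintegral -(integral12_prod_meas1 fi); congr fine.
apply: eq_integral => x _; rewrite fineK//.
apply: integrable_fin_num => //; apply: (bounded_integrable m21 _ (fun y => fK (x, y))).
exact: measurableT_comp (measurable_pair1 x).
Qed.

Lemma bounded_measurable_fubini (f : T1 * T2 -> R) (K : R) : measurable_fun setT f ->
  (forall x, `|f x| <= K) -> measurable_fun setT (fun x => \int[m2]_y f (x, y)).
Proof.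
move=> mf fK.
have fi := bounded_integrable product_measure_setT1 mf fK.
apply: measurableT_comp => //; exact: (measurable_fubini_F fi).
Qed.

End Rintegral_fubini.

Section measure_pow_facts.
Context d (T : measurableType d) (R : realType) (P : probability T R).

Lemma measure_pow_setT n : measure_pow P n setT = 1%E.
Proof.
have := @measure_powE _ _ _ P n (fun _ => setT) (fun _ => measurableT).
rewrite big1; last by move=> i _; exact: probability_setT.
by move=> <-; congr (measure_pow _ _ _); apply/seteqP; split.
Qed.

Lemma Rintegral_measure_powS n (f : n.+1.-tuple T -> R) (K : R) : measurable_fun setT f ->
  (forall x, `|f x| <= K) ->
  \int[measure_pow P n.+1]_t f t =
  \int[P]_x \int[measure_pow P n]_t f (tcons (x, t)).
Proof.
move=> mf fK.
rewrite -(@bounded_Rintegral_fubini _ _ _ _ _ P (measure_pow P n) _ _ (fun z => f (tcons z)) K)//.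
- exact: (Rintegral_mpushforward (P \x measure_pow P n)%E (@tcons _ T n) mf).
- exact: probability_setT.
- exact: measure_pow_setT.
- exact: measurableT_comp (@measurable_tcons _ T n).
Qed.

End measure_pow_facts.

Section taylor.
Context {R : realType}.

(** The remainder is measured by the minimum of a square and a cube because the random
    variables to which expansions are applied have only two moments: the square makes the
    remainder integrable, the cube makes it small. *)
Definition taylor2 (K : R) (g a b : R -> R) := forall x y : R,
  `|g (x + y) - g x - a x * y - b x * y ^+ 2| <= K * Num.min (y ^+ 2) (`|y| ^+ 3).

Lemma mvt_bound (F F' : R -> R) (B y : R) : (forall z : R, is_derive z 1 F (F' z)) ->
  (forall z, `|z| <= `|y| -> `|F' z| <= B) -> `|F y - F 0| <= B * `|y|.
Proof.
move=> dF FB.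
have cF (A : set R) : {within A, continuous F}.
  apply: continuous_subspaceT => z; apply: differentiable_continuous.
  by apply/derivable1_diffP; case: (dF z).
have [y0|y0] := leP 0 y.
  have [c] := MVT_segment y0 (fun x _ => dF x) (cF _).
  rewrite in_itv/= => /andP[c0 cy] ->.
  by rewrite subr0 normrM ler_wpM2r// FB// !ger0_norm.
have [c] := MVT_segment (ltW y0) (fun x _ => dF x) (cF _).
rewrite in_itv/= => /andP[cy c0]; rewrite distrC => ->.
rewrite sub0r normrM normrN ler_wpM2r// FB// !ler0_norm ?lerN2// ltW//.
Qed.

Lemma is_derive_translate (f : R -> R) (x y df : R) : is_derive (x + y) 1 f df ->
  is_derive y 1 (fun z => f (x + z)) df.
Proof.
move=> h; have h' : is_derive (y : R) 1 (fun z : R => x + z) (0 + 1) by exact: is_deriveD.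
by have := is_derive1_comp h h'; rewrite add0r mulr1.
Qed.

Lemma taylor2_C3 (f f1 f2 f3 : R -> R) (M2 M3 : R) :
  (forall x : R, is_derive x 1 f (f1 x)) -> (forall x : R, is_derive x 1 f1 (f2 x)) ->
  (forall x : R, is_derive x 1 f2 (f3 x)) ->
  (forall x, `|f2 x| <= M2) -> (forall x, `|f3 x| <= M3) ->
  taylor2 (2 * M2 + M3) f f1 (fun x => f2 x / 2).
Proof.
move=> d1 d2 d3 b2 b3 x y.
have M20 : 0 <= M2 by apply: le_trans (b2 0).
have M30 : 0 <= M3 by apply: le_trans (b3 0).
have e2 z : `|f2 (x + z) - f2 x| <= M3 * `|z|.
  have := @mvt_bound (fun z => f2 (x + z)) (fun z => f3 (x + z)) M3 z
    (fun z => is_derive_translate (d3 _)) (fun z _ => b3 _).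
  by rewrite addr0.
have e1 z : `|f1 (x + z) - f1 x| <= M2 * `|z|.
  have := @mvt_bound (fun z => f1 (x + z)) (fun z => f2 (x + z)) M2 z
    (fun z => is_derive_translate (d2 _)) (fun z _ => b2 _).
  by rewrite addr0.
have e1' z : `|f1 (x + z) - f1 x - f2 x * z| <= M3 * `|z| * `|z|.
  have := @mvt_bound (fun z => f1 (x + z) - f2 x * z) (fun z => f2 (x + z) - f2 x) (M3 * `|z|) z.
  rewrite addr0 mulr0 subr0 addrAC; apply.
    move=> u; have := is_derive_translate (d2 (x + u)) => h.
    by apply: is_derive_eq; rewrite /GRing.scale/=; ring.
  by move=> u uz; rewrite (le_trans (e2 u))// ler_wpM2l.
have e0 : `|f (x + y) - f x - f1 x * y| <= M2 * `|y| * `|y|.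
  have := @mvt_bound (fun z => f (x + z) - f1 x * z) (fun z => f1 (x + z) - f1 x) (M2 * `|y|) y.
  rewrite addr0 mulr0 subr0 addrAC; apply.
    move=> u; have := is_derive_translate (d1 (x + u)) => h.
    by apply: is_derive_eq; rewrite /GRing.scale/=; ring.
  by move=> u uz; rewrite (le_trans (e1 u))// ler_wpM2l.
have e0' : `|f (x + y) - f x - f1 x * y - f2 x / 2 * y ^+ 2| <= M3 * `|y| * `|y| * `|y|.
  have := @mvt_bound (fun z => f (x + z) - f1 x * z - f2 x / 2 * z ^+ 2)
    (fun z => f1 (x + z) - f1 x - f2 x * z) (M3 * `|y| * `|y|) y.
  rewrite addr0 !mulr0 expr0n/= mulr0 !subr0.
  rewrite (_ : f (x + y) - f1 x * y - f2 x / 2 * y ^+ 2 - f x =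
    f (x + y) - f x - f1 x * y - f2 x / 2 * y ^+ 2); last by ring.
  apply.
    move=> u; have := is_derive_translate (d1 (x + u)) => h.
    by apply: is_derive_eq; rewrite /GRing.scale/=; field.
  by move=> u uz; rewrite (le_trans (e1' u))// ler_pM// ?mulr_ge0// ler_wpM2l.
rewrite /Num.min; case: ifPn => _.
  apply: (@le_trans _ _ (M2 * `|y| * `|y| + M2 / 2 * y ^+ 2)).
    apply: (le_trans (ler_normB _ _)); apply: lerD => //.
    rewrite normrM normrM normfV (ger0_norm (sqr_ge0 y)) (ger0_norm (ler0n _ 2)).
    by rewrite ler_wpM2r ?sqr_ge0// ler_wpM2r ?invr_ge0.
  rewrite -mulrA -expr2 real_normK ?num_real// -mulrDl ler_wpM2r ?sqr_ge0//; lra.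
apply: (le_trans e0').
rewrite (_ : M3 * `|y| * `|y| * `|y| = M3 * `|y| ^+ 3); last by ring.
rewrite ler_wpM2r ?exprn_ge0//; lra.
Qed.

End taylor.

Section logistic.
Context {R : realType}.

(** With a steep slope it approximates the indicator of a half-line. Its derivatives are polynomials in
    the function itself, which makes them bounded without further computation. *)
Definition logistic (x : R) : R := (1 + expR x)^-1.

Lemma logistic_gt0 x : 0 < logistic x.
Proof. by rewrite invr_gt0 addr_gt0 ?expR_gt0. Qed.

Lemma logistic_le1 x : logistic x <= 1.
Proof. by rewrite invf_le1 ?addr_gt0 ?expR_gt0// lerDl expR_ge0. Qed.

Lemma is_derive_logistic (k t x : R) :
  is_derive x 1 (fun x => logistic (k * (x - t)))
    (k * (logistic (k * (x - t)) ^+ 2 - logistic (k * (x - t)))).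
Proof.
have n0 : 1 + expR (k * (x - t)) != 0 by rewrite lt0r_neq0// addr_gt0 ?expR_gt0.
by rewrite /logistic; apply: is_derive_eq; rewrite /GRing.scale/=; field.
Qed.

Lemma logistic_taylor2 (k t : R) : exists K a b, [/\ taylor2 K (fun x => logistic (k * (x - t))) a b,
   measurable_fun setT a, measurable_fun setT b &
   forall x, `|a x| <= K /\ `|b x| <= K].
Proof.
pose g x := logistic (k * (x - t)).
pose g1 x := k * (g x ^+ 2 - g x).
pose g2 x := k * ((2 * g x - 1) * g1 x).
pose g3 x := k * (2 * g1 x ^+ 2 + (2 * g x - 1) * g2 x).
have d0 (x : R) : is_derive x 1 g (g1 x) by exact: is_derive_logistic.
have d1 (x : R) : is_derive x 1 g1 (g2 x).
  by apply: is_derive_eq; rewrite /GRing.scale/= /g2; ring.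
have d2 (x : R) : is_derive x 1 g2 (g3 x).
  by apply: is_derive_eq; rewrite /GRing.scale/= /g3; ring.
have gp x : 0 < g x by exact: logistic_gt0.
have gl x : g x <= 1 by exact: logistic_le1.
have b1 x : `|g1 x| <= `|k|.
  rewrite normrM ler_piMr// ler_norml; apply/andP; split; have := gp x; have := gl x; nra.
have bg x : `|2 * g x - 1| <= 1.
  rewrite ler_norml; apply/andP; split; have := gp x; have := gl x; lra.
have b2 x : `|g2 x| <= `|k| ^+ 2.
  rewrite normrM expr2 ler_wpM2l// normrM (le_trans (ler_piMl _ (bg x)))//.
have b3 x : `|g3 x| <= 3 * `|k| ^+ 3.
  rewrite normrM (_ : 3 * `|k| ^+ 3 = `|k| * (3 * `|k| ^+ 2)); last by ring.
  rewrite ler_wpM2l// (le_trans (ler_normD _ _))//.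
  rewrite (_ : 3 * `|k| ^+ 2 = 2 * `|k| ^+ 2 + `|k| ^+ 2); last by ring.
  apply: lerD.
    by rewrite normrM ger0_norm// ler_wpM2l// normrX lerXn2r ?nnegrE.
  by rewrite normrM (le_trans (ler_piMl _ (bg x))).
have mder (f f' : R -> R) : (forall x : R, is_derive x 1 f (f' x)) -> measurable_fun [set: R] f.
  move=> df; apply: continuous_measurable_fun => x; apply: differentiable_continuous.
  by apply/derivable1_diffP; case: (df x).
exists (2 * `|k| ^+ 2 + 3 * `|k| ^+ 3 + `|k|), g1, (fun x => g2 x / 2); split.
- move=> x y; have := taylor2_C3 d0 d1 d2 b2 b3 x y => h; apply: (le_trans h).
  rewrite ler_wpM2r ?lerDl// le_min sqr_ge0 exprn_ge0//.
- exact: mder d1.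
- by apply: measurable_funM => //; exact: mder d2.
- move=> x; split.
    by rewrite (le_trans (b1 x))// lerDr addr_ge0 ?mulr_ge0 ?exprn_ge0.
  rewrite normrM normfV (@ger0_norm _ 2)// (@le_trans _ _ (`|k| ^+ 2))//.
    by rewrite ler_pdivrMr// (le_trans (b2 x))// ler_peMr ?exprn_ge0// ler1n.
  have k2 : 0 <= `|k| ^+ 2 by rewrite exprn_ge0.
  have k3 : 0 <= `|k| ^+ 3 by rewrite exprn_ge0.
  have k1 : 0 <= `|k| by []. lra.
Qed.

End logistic.

(** * The central limit theorem by the Lindeberg replacement method *)

Section taylor_average.
Context d (W : measurableType d) (R : realType) (Q : {measure set W -> \bar R}).
Hypothesis Q1 : Q setT = 1%E.

Lemma measurable_translate (g : R -> R) (x : R) (f : W -> R) : measurable_fun setT g ->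
  measurable_fun setT f -> measurable_fun setT (fun w => g (x + f w)).
Proof. by move=> mg mf; apply: measurableT_comp => //; exact: measurable_funD. Qed.

(** Averaging over a translation keeps the constant of the remainder. It is applied to the
    Gaussian average of the test function, in which one variable is then replaced. *)
Lemma taylor2_average (phi : W -> R) (K K0 : R) (g a b : R -> R) :
  measurable_fun setT phi -> measurable_fun setT g -> measurable_fun setT a ->
  measurable_fun setT b ->
  (forall x, [/\ `|g x| <= K0, `|a x| <= K0 & `|b x| <= K0]) ->
  taylor2 K g a b ->
  taylor2 K (fun x => \int[Q]_w g (x + phi w)) (fun x => \int[Q]_w a (x + phi w))
    (fun x => \int[Q]_w b (x + phi w)).
Proof.
move=> mphi mg ma mb K0b H x y.
have bi (f : R -> R) z : measurable_fun setT f -> (forall x, `|f x| <= K0) ->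
    Q.-integrable setT (EFin \o (fun w => f (z + phi w))).
  by move=> mf fK; apply: (bounded_integrable Q1 (K := K0)) => //; exact: measurable_translate.
have ig z : Q.-integrable setT (EFin \o (fun w => g (z + phi w))) by apply: bi => // u; case: (K0b u).
have ia z : Q.-integrable setT (EFin \o (fun w => a (z + phi w))) by apply: bi => // u; case: (K0b u).
have ib z : Q.-integrable setT (EFin \o (fun w => b (z + phi w))) by apply: bi => // u; case: (K0b u).
set L := K * _.
have iZ f c : Q.-integrable setT (EFin \o f) -> Q.-integrable setT (EFin \o (fun w => f w * c)).
  move=> jf; apply: (eq_integrable measurableT (fun w => (f w)%:E * c%:E)%E) => //.
  exact: integrableZr.
have iB (f1 f2 : W -> R) : Q.-integrable setT (EFin \o f1) -> Q.-integrable setT (EFin \o f2) ->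
    Q.-integrable setT (EFin \o (fun w => f1 w - f2 w)).
  move=> j1 j2; apply: (eq_integrable measurableT (fun w => (f1 w)%:E - (f2 w)%:E)%E) => //.
  exact: integrableB.
have -> : \int[Q]_w g (x + y + phi w) - \int[Q]_w g (x + phi w) - \int[Q]_w a (x + phi w) * y -
   \int[Q]_w b (x + phi w) * y ^+ 2 = \int[Q]_w (g (x + y + phi w) - g (x + phi w) -
     a (x + phi w) * y - b (x + phi w) * y ^+ 2).
  have jA := iB _ _ (ig (x + y)) (ig x); have jB := iB _ _ jA (iZ _ y (ia x)).
  rewrite (RintegralB measurableT jB (iZ _ (y ^+ 2) (ib x))).
  rewrite (RintegralB measurableT jA (iZ _ y (ia x))).
  by rewrite (RintegralB measurableT (ig _) (ig _)) !RintegralZr.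
apply: (bounded_Rintegral Q1) => [|w].
  by apply: measurable_funB; [apply: measurable_funB;[apply: measurable_funB|apply: measurable_funM]|apply: measurable_funM]; rewrite // ; apply: measurable_translate.
by rewrite (addrAC x); exact: H.
Qed.

(** The linear term vanishes on average, so that two variables with the same variance give
    averages that differ by the remainders only. *)
Lemma taylor2_step (xi : W -> R) (K K0 : R) (g a b : R -> R) :
  measurable_fun setT xi -> measurable_fun setT g ->
  (forall x, `|g x| <= K0) ->
  Q.-integrable setT (EFin \o xi) ->
  Q.-integrable setT (EFin \o (fun w => xi w ^+ 2)) ->
  \int[Q]_w xi w = 0 ->
  taylor2 K g a b -> forall h x,
  `|\int[Q]_w g (x + h * xi w) - g x - b x * h ^+ 2 * \int[Q]_w (xi w ^+ 2)| <=
   K * \int[Q]_w Num.min ((h * xi w) ^+ 2) (`|h * xi w| ^+ 3).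
Proof.
move=> mxi mg K0b i1 i2 xi0 H h x.
have mh : measurable_fun setT (fun w => h * xi w) by exact: measurable_funM.
have ig : Q.-integrable setT (EFin \o (fun w => g (x + h * xi w))).
  by apply: (bounded_integrable Q1 (K := K0)) => //; exact: measurable_translate.
have iZ f c : Q.-integrable setT (EFin \o f) -> Q.-integrable setT (EFin \o (fun w => c * f w)).
  move=> jf; apply: (eq_integrable measurableT (fun w => c%:E * (f w)%:E)%E) => //.
  exact: integrableZl.
have iB (f1 f2 : W -> R) : Q.-integrable setT (EFin \o f1) -> Q.-integrable setT (EFin \o f2) ->
    Q.-integrable setT (EFin \o (fun w => f1 w - f2 w)).
  move=> j1 j2; apply: (eq_integrable measurableT (fun w => (f1 w)%:E - (f2 w)%:E)%E) => //.
  exact: integrableB.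
have ic (c : R) : Q.-integrable setT (EFin \o (fun=> c)).
  by apply: (@bounded_integrable _ _ _ Q Q1 (cst c) `|c|).
have mm : measurable_fun setT (fun w => Num.min ((h * xi w) ^+ 2) (`|h * xi w| ^+ 3)).
  apply: measurable_minr; first exact: measurable_funX.
  by apply: measurable_funX; apply: measurableT_comp.
have im : Q.-integrable setT (EFin \o (fun w => Num.min ((h * xi w) ^+ 2) (`|h * xi w| ^+ 3))).
  apply: (le_integrable measurableT _ _ (iZ _ (h ^+ 2) i2)); first exact/measurable_EFinP.
  move=> w _ /=; rewrite lee_fin -exprMn [leRHS]ger0_norm ?sqr_ge0//.
  by rewrite ger0_norm ?ge_min ?lexx// le_min sqr_ge0 exprn_ge0.
have jA := iB _ _ ig (ic (g x)); have jB := iB _ _ jA (iZ _ (a x * h) i1).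
have jC := iZ _ (b x * h ^+ 2) i2.
have -> : \int[Q]_w g (x + h * xi w) - g x - b x * h ^+ 2 * \int[Q]_w (xi w ^+ 2) =
   \int[Q]_w (g (x + h * xi w) - g x - a x * h * xi w - b x * h ^+ 2 * xi w ^+ 2).
  rewrite (RintegralB measurableT jB jC) (RintegralB measurableT jA (iZ _ (a x * h) i1)).
  rewrite (RintegralB measurableT ig (ic (g x))).
  by rewrite (Rintegral_cst1 Q1) !RintegralZl// xi0 mulr0 subr0.
have iL : Q.-integrable setT (EFin \o (fun w => g (x + h * xi w) - g x - a x * h * xi w - b x * h ^+ 2 * xi w ^+ 2)).
  exact: iB jB jC.
apply: (le_trans (le_normr_Rintegral measurableT iL)).
rewrite -RintegralZl//; apply: le_Rintegral => //.
- by have := integrable_norm iL.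
- exact: iZ.
- move=> w _; have := H x (h * xi w).
  by rewrite exprMn !mulrA.
Qed.

End taylor_average.

Section normal_convolution.
Context {R : realType}.
Local Notation N := (@normal_prob R 0 1).

Lemma normal_prob_setT : N setT = 1%E. Proof. exact: probability_setT. Qed.

(** The sum of independent centered normal variables is normal, tested on bounded functions. *)
Lemma Rintegral_normal_conv (g : R -> R) (u a b : R) : 0 <= a -> 0 <= b ->
  measurable_fun [set: R] g -> (forall x, 0 <= g x <= 1) ->
  \int[N]_y \int[N]_x g (u + b * y + a * x) =
  \int[N]_x g (u + Num.sqrt (a ^+ 2 + b ^+ 2) * x).
Proof.
rewrite le_eqVlt => /predU1P[<-|a0] b0 mg g01.
  rewrite expr0n add0r sqrtr_sqr ger0_norm//.
  apply: eq_Rintegral => y _; under eq_Rintegral do rewrite mul0r addr0.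
  by rewrite Rintegral_cst1//; exact: normal_prob_setT.
have gK x : `|g x| <= 1 by have /andP[? ?] := g01 x; rewrite ger0_norm.
pose f x := (g (u + x))%:E : \bar R.
have mf : measurable_fun [set: measurableTypeR R] f.
  by apply/measurable_EFinP; apply: (measurableT_comp mg); exact: measurable_funD.
have f0 x : (0 <= f x)%E by rewrite lee_fin; have /andP[] := g01 (u + x).
have := ge0_integral_normal2 a0 b0 mf f0.
rewrite /Rintegral => <-; congr fine; apply: eq_integral => y _.
under eq_integral do rewrite -addrA (addrC (b * y)).
rewrite fineK//; apply: integrable_fin_num => //.
apply: (@bounded_integrable _ _ _ N normal_prob_setT (fun x => g (u + (a * x + b * y))) 1) => //.
by apply: (measurableT_comp mg); apply: measurable_funD => //; apply: measurable_funD => //; apply: measurable_funM.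
Qed.

End normal_convolution.

Section lindeberg.
Context d (W : measurableType d) (R : realType) (nu : probability W R).
Variables (xi : W -> R) (tau : R).
Local Notation N := (@normal_prob R 0 1).
Hypotheses (mxi : measurable_fun setT xi) (tau0 : 0 <= tau).
Hypotheses (ixi : nu.-integrable setT (EFin \o xi)).
Hypotheses (ixi2 : nu.-integrable setT (EFin \o (fun w => xi w ^+ 2))).
Hypotheses (xi_mean : \int[nu]_w xi w = 0) (xi_var : \int[nu]_w (xi w ^+ 2) = tau ^+ 2).

Definition truncated_moment d' (W' : measurableType d') (Q : {measure set W' -> \bar R})
    (z : W' -> R) (h : R) : R :=
  \int[Q]_w Num.min ((h * z w) ^+ 2) (`|h * z w| ^+ 3).

Definition iid_sum n (t : n.-tuple W) : R := \sum_(i < n) xi (tnth t i).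

Lemma measurable_iid_sum n : measurable_fun setT (@iid_sum n).
Proof.
apply: measurable_sum => i; apply: measurableT_comp => //; exact: measurable_tnth.
Qed.

Lemma iid_sumS n (x : W) (t : n.-tuple W) : iid_sum (tcons (x, t)) = xi x + iid_sum t.
Proof.
rewrite /iid_sum big_ord_recl; congr (xi _ + _).
by apply: eq_bigr => i _; rewrite tnthS.
Qed.

Section test_function.
Variables (g a b : R -> R) (K K0 h : R).
Hypotheses (mg : measurable_fun setT g) (ma : measurable_fun setT a) (mb : measurable_fun setT b).
Hypotheses (g01 : forall x, 0 <= g x <= 1) (Kb : forall x, `|a x| <= K0 /\ `|b x| <= K0).
Hypotheses (K01 : 1 <= K0) (h0 : 0 <= h) (gab : taylor2 K g a b).

Let g1 x : `|g x| <= 1. Proof. by have /andP[? ?] := g01 x; rewrite ger0_norm. Qed.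

(** Replacing the summands one at a time by Gaussian variables of the same variance: each
    replacement costs the two truncated moments, and the sum of the Gaussian variables
    is Gaussian again. The induction is on the number of summands, uniformly in the base
    point [x]. *)
Lemma lindeberg_swap n x :
  `|\int[measure_pow nu n]_t g (x + h * iid_sum t) -
    \int[N]_z g (x + Num.sqrt n%:R * (h * tau) * z)| <=
  n%:R * (K * (truncated_moment nu xi h + truncated_moment N (fun z => tau * z) h)).
Proof.
have N1 := @normal_prob_setT R.
have mz (c : R) : measurable_fun [set: measurableTypeR R] (fun z : measurableTypeR R => c * z) by exact: measurable_funM.
elim: n x => [|n IHn] x.
  under eq_Rintegral do rewrite /iid_sum big_ord0 mulr0 addr0.
  under [X in _ - X]eq_Rintegral do rewrite sqrtr0 !mul0r addr0.
  rewrite !Rintegral_cst1//; last exact: measure_pow_setT.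
  by rewrite subrr normr0 mul0r.
set Mx := truncated_moment nu xi h; set MN := truncated_moment N _ h.
pose V y := \int[measure_pow nu n]_t g (y + h * iid_sum t).
pose G y := \int[N]_z g (y + Num.sqrt n%:R * (h * tau) * z).
have mV : measurable_fun [set: R] V.
  pose ff (z : R * n.-tuple W) := g (z.1 + h * iid_sum z.2).
  apply: (@bounded_measurable_fubini _ _ R _ R (\d_(0 : R)) (measure_pow nu n) _ _ ff 1) => //.
  - exact: probability_setT.
  - exact: measure_pow_setT.
  - apply: measurableT_comp => //; apply: measurable_funD => //; apply: measurable_funM => //.
    by apply: measurableT_comp => //; exact: measurable_iid_sum.
  - by move=> z; exact: g1.
have mG : measurable_fun [set: R] G.
  pose fG (z : R * measurableTypeR R) := g (z.1 + Num.sqrt n%:R * (h * tau) * z.2).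
  apply: (@bounded_measurable_fubini _ _ R _ R (\d_(0 : R)) N _ _ fG 1) => //.
  - exact: probability_setT.
  - by apply: measurableT_comp => //; apply: measurable_funD => //; apply: measurable_funM.
  - by move=> z; exact: g1.
have Vb y : `|V y| <= 1.
  apply: bounded_Rintegral => //; first exact: measure_pow_setT.
  by apply: measurable_translate => //; apply: measurable_funM => //; exact: measurable_iid_sum.
have Gb y : `|G y| <= 1.
  by apply: bounded_Rintegral => //; apply: measurable_translate => //.
have VS : \int[measure_pow nu n.+1]_t g (x + h * iid_sum t) = \int[nu]_w V (x + h * xi w).
  rewrite (@Rintegral_measure_powS _ _ _ nu n (fun t => g (x + h * iid_sum t)) 1).
  - apply: eq_Rintegral => w _; apply: eq_Rintegral => t _.
    by rewrite iid_sumS mulrDr addrA.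
  - by apply: measurable_translate => //; apply: measurable_funM => //; exact: measurable_iid_sum.
  - by move=> t; exact: g1.
have GS : \int[N]_z g (x + Num.sqrt n.+1%:R * (h * tau) * z) = \int[N]_y G (x + h * (tau * y)).
  rewrite /G; under [RHS]eq_Rintegral do rewrite mulrA.
  rewrite Rintegral_normal_conv ?mulr_ge0 ?sqrtr_ge0//.
  apply: eq_Rintegral => z _; congr (g (x + _ * z)).
  rewrite exprMn sqr_sqrtr// -[X in _ + X]mul1r -mulrDl natr1 sqrtrM// sqrtr_sqr ger0_norm ?mulr_ge0//.
have mhxi : measurable_fun setT (fun w => h * xi w) by exact: measurable_funM.
have iV : nu.-integrable setT (EFin \o (fun w => V (x + h * xi w))).
  apply: (@bounded_integrable _ _ _ nu _ _ 1) => //; first exact: probability_setT.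
  exact: measurable_translate.
have iG : nu.-integrable setT (EFin \o (fun w => G (x + h * xi w))).
  apply: (@bounded_integrable _ _ _ nu _ _ 1) => //; first exact: probability_setT.
  exact: measurable_translate.
have step1 : `|\int[nu]_w V (x + h * xi w) - \int[nu]_w G (x + h * xi w)| <= n%:R * (K * (Mx + MN)).
  rewrite -RintegralB//; apply: bounded_Rintegral; first exact: probability_setT.
    by apply: measurable_funB; exact: measurable_translate.
  by move=> w; exact: IHn.
have Kb' y : [/\ `|g y| <= K0, `|a y| <= K0 & `|b y| <= K0].
  by have [? ?] := Kb y; split => //; exact: le_trans K01.
have TG := taylor2_average N1 (mz (Num.sqrt n%:R * (h * tau))) mg ma mb Kb' gab.
have step2 := taylor2_step (probability_setT nu) mxi mG Gb ixi ixi2 xi_mean TG h x.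
have i1 : N.-integrable setT (EFin \o (fun z : measurableTypeR R => tau * z)).
  exact: (integrableZl measurableT tau normal_integrable_id).
have i2 : N.-integrable setT (EFin \o (fun z : measurableTypeR R => (tau * z) ^+ 2)).
  have := integrableZl measurableT (tau ^+ 2) normal_integrable_sqr.
  by apply: eq_integrable => // z _; rewrite -EFinM -exprMn.
have e1 : \int[N]_z (tau * z) = 0.
  rewrite RintegralZl//; last exact: normal_integrable_id.
  by rewrite /Rintegral normal_first_moment mulr0.
have e2 : \int[N]_z ((tau * z) ^+ 2) = tau ^+ 2.
  under eq_Rintegral do rewrite exprMn.
  rewrite RintegralZl//; last exact: normal_integrable_sqr.
  by rewrite /Rintegral normal_second_moment mulr1.
have step3 := taylor2_step N1 (mz tau) mG Gb i1 i2 e1 TG h x.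
rewrite VS GS; move: step2 step3; rewrite xi_var e2 -/Mx -/MN.
set v := \int[nu]_w V _ ; set v' := \int[nu]_w _; set v'' := \int[N]_w _; set c := _ * tau ^+ 2.
move=> step2 step3.
rewrite (_ : v - _ = (v - v') + ((v' - G x - c) - (v'' - G x - c))); last by rewrite /v''; ring.
rewrite (le_trans (ler_normD _ _))// -natr1 mulrDl mul1r lerD//.
by rewrite (le_trans (ler_normB _ _))// mulrDr lerD.
Qed.

End test_function.
End lindeberg.

Section truncated_limit.
Context d (W : measurableType d) (R : realType) (Q : {measure set W -> \bar R}).
Variable z : W -> R.
Hypotheses (mz : measurable_fun setT z) (iz2 : Q.-integrable setT (EFin \o (fun w => z w ^+ 2))).

(** With the scale [1 / sqrt n] the integrand is at most [z ^+ 2] and also at most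
    [|z| ^+ 3 / sqrt n]; dominated convergence applies. *)
Lemma truncated_moment_cvg0 :
  n%:R * truncated_moment Q z (Num.sqrt n%:R)^-1 @[n --> \oo] --> (0 : R).
Proof.
rewrite -cvg_shiftS.
pose f n w : R := n.+1%:R * Num.min (((Num.sqrt n.+1%:R)^-1 * z w) ^+ 2) (`|(Num.sqrt n.+1%:R)^-1 * z w| ^+ 3).
have f0 n w : 0 <= f n w by rewrite mulr_ge0// le_min sqr_ge0 exprn_ge0.
have s0 n : 0 < Num.sqrt (n.+1%:R : R) by rewrite sqrtr_gt0.
have s2 n : Num.sqrt (n.+1%:R : R) ^+ 2 = n.+1%:R by rewrite sqr_sqrtr.
have fz n w : f n w <= z w ^+ 2.
  rewrite /f (@le_trans _ _ (n.+1%:R * ((Num.sqrt n.+1%:R)^-1 * z w) ^+ 2))//.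
    by rewrite ler_wpM2l// ge_min lexx.
  by rewrite exprMn exprVn s2 mulrA divff ?mul1r// pnatr_eq0.
have fz3 n w : f n w <= (Num.sqrt n.+1%:R)^-1 * `|z w| ^+ 3.
  rewrite /f (@le_trans _ _ (n.+1%:R * `|(Num.sqrt n.+1%:R)^-1 * z w| ^+ 3))//.
    by rewrite ler_wpM2l// ge_min lexx orbT.
  have es (u : R) : u != 0 -> u ^+ 2 * u^-1 ^+ 3 = u^-1 by move=> u0; field.
  have -> : `|(Num.sqrt n.+1%:R)^-1 * z w| = (Num.sqrt n.+1%:R)^-1 * `|z w|.
    by rewrite normrM ger0_norm// invr_ge0.
  by rewrite exprMn mulrA -[X in X * _ * _]s2 es// lt0r_neq0.
have mf n : measurable_fun setT (f n).
  apply: measurable_funM => //; apply: measurable_minr.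
    by apply: measurable_funX; exact: measurable_funM.
  by apply: measurable_funX; apply: measurableT_comp => //; exact: measurable_funM.
have E n : n.+1%:R * truncated_moment Q z (Num.sqrt n.+1%:R)^-1 = \int[Q]_w f n w.
  rewrite /truncated_moment -RintegralZl//.
  apply: (le_integrable measurableT _ _ iz2).
    apply/measurable_EFinP; apply: measurable_minr.
      by apply: measurable_funX; exact: measurable_funM.
    by apply: measurable_funX; apply: measurableT_comp => //; exact: measurable_funM.
  move=> w _ /=; rewrite lee_fin [leRHS]ger0_norm ?sqr_ge0// ger0_norm; last first.
    by rewrite le_min sqr_ge0 exprn_ge0.
  apply: le_trans (fz n w); rewrite /f ler_peMl// ?ler1n//.
  by rewrite le_min sqr_ge0 exprn_ge0.
suff : \int[Q]_w f n w @[n --> \oo] --> (0 : R).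
  by apply: cvg_trans; apply: near_eq_cvg; apply: nearW => n; rewrite /= E.
have -> : (0 : R) = fine (\int[Q]_w (cst 0 w)) by rewrite integral0.
apply: fine_cvg.
rewrite integral0; have := @dominated_cvg _ _ _ Q setT measurableT (fun n w => (f n w)%:E) (cst 0%E)
  (EFin \o (fun w => z w ^+ 2)); rewrite integral0; apply => //.
- by move=> n; exact/measurable_EFinP.
- move=> w _; apply: cvg_EFin; first exact: nearW.
  apply: (@squeeze_cvgr _ _ _ _ (cst 0) (fun n => (Num.sqrt n.+1%:R)^-1 * `|z w| ^+ 3)).
  + by apply: nearW => n /=; rewrite f0 fz3.
  + exact: cvg_cst.
  + rewrite -[X in _ --> X](mul0r (`|z w| ^+ 3)); apply: cvgM; last exact: cvg_cst.
    have : Num.sqrt (harmonic n) @[n --> \oo] --> Num.sqrt (0 : R).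
      by apply: continuous_cvg; [exact: sqrt_continuous|exact: cvg_harmonic].
    rewrite sqrtr0; apply: cvg_trans; apply: near_eq_cvg; apply: nearW => n.
    by rewrite /= sqrtrV.
- by move=> n w _; rewrite /= lee_fin ger0_norm.
Qed.

End truncated_limit.

Section clt.
Context d (W : measurableType d) (R : realType) (nu : probability W R).
Variables (xi : W -> R) (tau : R).
Local Notation N := (@normal_prob R 0 1).
Hypotheses (mxi : measurable_fun setT xi) (tau0 : 0 <= tau).
Hypotheses (ixi : nu.-integrable setT (EFin \o xi)).
Hypotheses (ixi2 : nu.-integrable setT (EFin \o (fun w => xi w ^+ 2))).
Hypotheses (xi_mean : \int[nu]_w xi w = 0) (xi_var : \int[nu]_w (xi w ^+ 2) = tau ^+ 2).

Lemma measurable_logistic (k c : R) : measurable_fun [set: R] (fun x : R => logistic (k * (x - c))).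
Proof.
apply: continuous_measurable_fun => x; apply: differentiable_continuous.
by apply/derivable1_diffP; case: (is_derive_logistic k c x).
Qed.

Lemma clt_logistic (k c : R) :
  \int[measure_pow nu n]_t logistic (k * ((Num.sqrt n%:R)^-1 * iid_sum xi t - c)) @[n --> \oo] -->
  \int[N]_z logistic (k * (tau * z - c)).
Proof.
have [K [a [b [T ma mb Kb]]]] := @logistic_taylor2 R k c.
set g := fun x => logistic (k * (x - c)) in T.
have mg : measurable_fun [set: R] g by exact: measurable_logistic.
have g01 x : 0 <= g x <= 1 by rewrite ltW ?logistic_gt0//= logistic_le1.
have Kb' x : `|a x| <= `|K| + 1 /\ `|b x| <= `|K| + 1.
  by have [h1 h2] := Kb x; have := ler_norm K; split; lra.
have K1 : 1 <= `|K| + 1 by rewrite lerDr.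
pose M n := n%:R * (K * (truncated_moment nu xi (Num.sqrt n%:R)^-1 +
  truncated_moment N (fun z => tau * z) (Num.sqrt n%:R)^-1)).
have M0 : M n @[n --> \oo] --> (0 : R).
  have c1 := truncated_moment_cvg0 mxi ixi2.
  have mz : measurable_fun [set: measurableTypeR R] (fun z : measurableTypeR R => tau * z) by exact: measurable_funM.
  have i2 : N.-integrable setT (EFin \o (fun z : measurableTypeR R => (tau * z) ^+ 2)).
    have := integrableZl measurableT (tau ^+ 2) normal_integrable_sqr.
    by apply: eq_integrable => // z _; rewrite -EFinM -exprMn.
  have c2 := truncated_moment_cvg0 mz i2.
  have : K * (n%:R * truncated_moment nu xi (Num.sqrt n%:R)^-1 +
     n%:R * truncated_moment N (fun z => tau * z) (Num.sqrt n%:R)^-1) @[n --> \oo] --> K * (0 + 0).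
    by apply: cvgM; [exact: cvg_cst|exact: cvgD].
  rewrite addr0 mulr0; apply: cvg_trans; apply: near_eq_cvg; apply: nearW => n.
  by rewrite /M /=; ring.
apply/cvgrPdist_le => e e0; near=> n.
have h0 : 0 <= (Num.sqrt (n%:R : R))^-1 by rewrite invr_ge0.
have n0 : (0 < n)%N by near: n; exists 1%N.
have := lindeberg_swap mxi tau0 ixi ixi2 xi_mean xi_var mg ma mb g01 Kb' K1 h0 T n 0.
have -> : \int[N]_z g (0 + Num.sqrt n%:R * ((Num.sqrt n%:R)^-1 * tau) * z) = \int[N]_z logistic (k * (tau * z - c)).
  apply: eq_Rintegral => z _; rewrite /g add0r mulrA divff ?mul1r//.
  by rewrite lt0r_neq0// sqrtr_gt0 ltr0n.
under [X in `|X - _|]eq_Rintegral do rewrite add0r.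
rewrite distrC => /le_trans; apply.
suff : `|M n| <= e by move/(le_trans (ler_norm _)).
near: n; move/cvgrPdist_le : M0 => /(_ e e0); apply: filterS => n.
by rewrite sub0r normrN.
Unshelve. all: by end_near. Qed.

Lemma logistic_le_inv (y : R) : 0 < y -> logistic y <= y^-1.
Proof.
move=> y0; rewrite /logistic lef_pV2 ?posrE ?addr_gt0 ?expR_gt0//.
by have := expR_ge1Dx y; lra.
Qed.

Lemma logisticN (y : R) : 1 - logistic y = logistic (- y).
Proof.
have h : expR y != 0 by rewrite expR_eq0.
have h1 : 1 + expR y != 0 by rewrite lt0r_neq0// addr_gt0 ?expR_gt0.
have h2 : expR y + 1 != 0 by rewrite addrC.
by rewrite /logistic expRN; field; apply/andP; split.
Qed.

Lemma fine_measure_indic d' (T : measurableType d') (Q : {measure set T -> \bar R}) (A : set T) :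
  measurable A -> fine (Q A) = \int[Q]_x \1_A x.
Proof. by move=> mA; rewrite /Rintegral integral_indic// setIT. Qed.

(** The central limit theorem in the one-sided form that coverage requires. A steep logistic
    function separates the half-lines from [t] on and before [s], up to [e / 4]. *)
Lemma clt_upper_tail (s t e : R) : s < t -> 0 < e ->
  \forall n \near \oo,
    fine (measure_pow nu n [set u | t <= (Num.sqrt n%:R)^-1 * iid_sum xi u]) <=
    fine (N [set z | s <= tau * z]) + e.
Proof.
move=> st e0; pose c := (s + t) / 2; pose w := (t - s) / 2; pose k := - (4 / (e * w)).
have w0 : 0 < w by rewrite divr_gt0// subr_gt0.
have k0 : k < 0 by rewrite oppr_lt0 divr_gt0// mulr_gt0.
(* the slope is such that [logistic] is within e / 4 of 0 and 1 at distance w from c *)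
have e4 : (4 / e)^-1 = e / 4 by rewrite invf_div.
have ge : 0 < 4 / e by rewrite divr_gt0.
pose g x := logistic (k * (x - c)).
have kw : k * w = - (4 / e) by rewrite /k; field; rewrite !lt0r_neq0.
have up x : t <= x -> 1 <= g x + e / 4.
  move=> tx; rewrite -lerBlDl logisticN.
  have h : 4 / e <= - (k * (x - c)).
    rewrite -lerN2 opprK -kw ler_nM2l//; rewrite /w /c; lra.
  by rewrite (le_trans (logistic_le_inv (lt_le_trans ge h)))// -e4 lef_pV2 ?posrE// (lt_le_trans ge).
have lo x : x < s -> g x <= e / 4.
  move=> xs; have h : 4 / e <= k * (x - c).
    rewrite -[leLHS]opprK -kw -mulrN ler_nM2l//; rewrite /w /c; lra.
  by rewrite (le_trans (logistic_le_inv (lt_le_trans ge h)))// -e4 lef_pV2 ?posrE// (lt_le_trans ge).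
have g0 x : 0 <= g x by rewrite ltW ?logistic_gt0.
have g1 x : `|g x| <= 1 by rewrite ger0_norm// logistic_le1.
have mg : measurable_fun [set: R] g by exact: measurable_logistic.
have := @clt_logistic k c => /cvgrPdist_le /(_ (e / 4)) => /(_ (ltac:(by rewrite divr_gt0))).
apply: filterS => n; rewrite -/(g _).
have mS : measurable_fun setT (fun u : n.-tuple W => (Num.sqrt n%:R)^-1 * iid_sum xi u).
  by apply: measurable_funM => //; exact: measurable_iid_sum.
have P1 := measure_pow_setT nu n.
have mA : measurable [set u : n.-tuple W | t <= (Num.sqrt n%:R)^-1 * iid_sum xi u].
  rewrite -[X in measurable X]setTI; exact: (measurable_fun_ler (measurable_cst t) mS measurableT).
have mB : measurable ([set z | s <= tau * z] : set (measurableTypeR R)).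
  rewrite -[X in measurable X]setTI; apply: measurable_fun_ler => //; exact: measurable_funM.
have h1 : fine (measure_pow nu n [set u | t <= (Num.sqrt n%:R)^-1 * iid_sum xi u]) <=
    \int[measure_pow nu n]_u g ((Num.sqrt n%:R)^-1 * iid_sum xi u) + e / 4.
  have ig : (measure_pow nu n).-integrable setT (EFin \o (fun u => g ((Num.sqrt n%:R)^-1 * iid_sum xi u))).
    by apply: (bounded_integrable P1 (K := 1)) => //; exact: measurableT_comp.
  have ic : (measure_pow nu n).-integrable setT (EFin \o (fun u => e / 4)).
    by apply: (bounded_integrable P1 (K := `|e / 4|)).
  rewrite fine_measure_indic// -[X in _ + X](Rintegral_cst1 P1) -RintegralD//.
  apply: le_Rintegral => //.
  - by apply: (bounded_integrable P1 (K := 1)) => // x; rewrite indicE ger0_norm// ; case: (_ \in _).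
  - have := integrableD measurableT ig ic; apply: eq_integrable => //.
  - move=> u _; rewrite indicE; have [|] := boolP (u \in _).
      by rewrite inE => /up.
    by move=> _; rewrite addr_ge0// divr_ge0// ltW.
have h2 : \int[N]_z g (tau * z) <= fine (N [set z | s <= tau * z]) + e / 4.
  have N1 := @normal_prob_setT R.
  have ig : N.-integrable setT (EFin \o (fun z : measurableTypeR R => g (tau * z))).
    by apply: (bounded_integrable N1 (K := 1)) => //; apply: measurableT_comp => //; exact: measurable_funM.
  have ic : N.-integrable setT (EFin \o (fun u : measurableTypeR R => e / 4)).
    by apply: (bounded_integrable N1 (K := `|e / 4|)).
  have i1 : N.-integrable setT (EFin \o (\1_[set z : measurableTypeR R | s <= tau * z])).
    by apply: (bounded_integrable N1 (K := 1)) => // x; rewrite indicE ger0_norm// ; case: (_ \in _).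
  rewrite fine_measure_indic// -[X in _ + X](Rintegral_cst1 N1) -RintegralD//.
  apply: le_Rintegral => //.
  - have := integrableD measurableT i1 ic; apply: eq_integrable => //.
  - move=> u _; rewrite indicE; have [|] := boolP (u \in _).
      by move=> _; rewrite (le_trans (logistic_le1 _))// lerDl divr_ge0// ltW.
    rewrite notin_setE/= => /negP; rewrite -ltNge add0r; exact: lo.
rewrite ler_distlC => /andP[_ h3].
rewrite (le_trans h1)//; move: h2 h3; rewrite /g; lra.
Qed.

End clt.

(** * Quantiles of the standard normal law *)

Section normal_quantile.
Context {R : realType}.
Local Notation N := (@normal_prob R 0 1).

Definition normal_cdf (x : R) : R := fine (N `]-oo, x]).

Lemma normal_fin_num A : measurable A -> N A \is a fin_num.
Proof. by move=> mA; rewrite fin_num_measure. Qed.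

Lemma normal_cdf_nondecreasing (x y : R) : x <= y -> normal_cdf x <= normal_cdf y.
Proof.
move=> xy; apply: fine_le; [exact: normal_fin_num|exact: normal_fin_num|].
by apply: le_measure; rewrite ?inE//; apply: subset_itvl; rewrite bnd_simp.
Qed.

Lemma normal_cdf_lipschitz (x y : R) : x <= y ->
  normal_cdf y <= normal_cdf x + normal_peak 1 * (y - x).
Proof.
move=> xy.
have -> : normal_cdf y = normal_cdf x + fine (N `]x, y]).
  rewrite /normal_cdf -fineD ?normal_fin_num// -measureU//.
    by rewrite -itv_bndbnd_setU// bnd_simp.
  rewrite -subset0 => z [/=]; rewrite !in_itv/= => zx /andP[xz _].
  by move: (lt_le_trans xz zx); rewrite ltxx.
rewrite lerD2l -lee_fin fineK ?normal_fin_num//.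
rewrite /normal_prob (@le_trans _ _ (\int[lebesgue_measure]_(z in `]x, y]) (normal_peak 1)%:E)%E)//.
  apply: ge0_le_integral => //.
  - by move=> z _; rewrite lee_fin normal_pdf_ge0.
  - by apply/measurable_EFinP; apply: measurable_funTS; exact: mnormal_pdf01.
  - by move=> z _; rewrite lee_fin normal_pdf_ub ?oner_neq0.
rewrite integral_cst//= lebesgue_measure_itv/= lte_fin EFinM.
case: ltP => [_|yx]; first by rewrite -EFinB.
by rewrite mule0 -EFinM lee_fin mulr_ge0 ?normal_peak_ge0 ?subr_ge0.
Qed.

(** A crude tail bound, used for the existence of quantiles and for the weak law of large
    numbers. *)
Lemma normal_tail_chebyshev (s tau : R) : 0 < s ->
  fine (N [set z | s <= tau * z]) <= tau ^+ 2 / s ^+ 2.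
Proof.
move=> s0.
have mA : measurable ([set z | s <= tau * z] : set (measurableTypeR R)).
  rewrite -[X in measurable X]setTI; apply: measurable_fun_ler => //; exact: measurable_funM.
have i2 := integrableZl measurableT (tau ^+ 2 / s ^+ 2) normal_integrable_sqr.
have -> : tau ^+ 2 / s ^+ 2 = \int[N]_z (tau ^+ 2 / s ^+ 2 * z ^+ 2).
  rewrite RintegralZl//; last exact: normal_integrable_sqr.
  by rewrite /Rintegral normal_second_moment mulr1.
rewrite fine_measure_indic//; apply: le_Rintegral => //.
- apply: (bounded_integrable (@normal_prob_setT R) (K := 1)) => // x.
  by rewrite indicE ger0_norm//; case: (_ \in _).
- move=> z _; rewrite indicE; have [|_] := boolP (z \in _); last first.
    by rewrite mulr_ge0 ?sqr_ge0// divr_ge0 ?sqr_ge0.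
  rewrite inE/= => sz; rewrite mulrAC ler_pdivlMr ?exprn_gt0// mul1r -exprMn.
  by rewrite lerXn2r ?nnegrE ?(ltW s0)// (le_trans (ltW s0)).
Qed.

Lemma normal_probN (A : set (measurableTypeR R)) : measurable A -> N (-%R @^-1` A) = N A.
Proof.
move=> mA.
have mNA : measurable (-%R @^-1` A : set (measurableTypeR R)).
  have -> : -%R @^-1` A = affine (-1) 0 @^-1` A.
    by rewrite /preimage; apply/funext => x; rewrite /affine/= mulN1r addr0.
  rewrite -[X in measurable X]setTI; exact: measurable_affine.
have m1 : measurable_fun [set: measurableTypeR R] (fun x => (\1_A x)%:E : \bar R).
  by apply/measurable_EFinP; exact: measurable_indic.
have := ge0_integral_normalN m1 (fun x => (ltac:(by rewrite lee_fin) : 0 <= (\1_A x)%:E)%E).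
have -> : (\int[N]_x (\1_A (- x))%:E = \int[N]_x (\1_(-%R @^-1` A) x)%:E)%E by [].
by rewrite !integral_indic// !setIT.
Qed.

Lemma normal_cdf0 : normal_cdf 0 = 1 / 2.
Proof.
have E : N `]-oo, 0] = N `[0, +oo[.
  rewrite -normal_probN//; congr (N _); apply/seteqP; split => x /=;
  by rewrite !in_itv/= ?andbT oppr_le0// ?andbT.
have E0 : N [set 0 : R] = 0%E by rewrite /normal_prob integral_set1.
have : N [set: measurableTypeR R] = (N `]-oo, 0%R[ + N `[0%R, +oo[)%E.
  rewrite -measureU//; last first.
    rewrite -subset0 => z [/=]; rewrite !in_itv/= andbT => z0 /(lt_le_trans z0).
    by rewrite ltxx.
  congr (N _); apply/seteqP; split => z // _ /=; rewrite !in_itv/= andbT.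
  by case: (ltP z 0); [left|right].
have -> : N `]-oo, 0[ = N `]-oo, 0].
  have -> : `]-oo, 0]%classic = `]-oo, 0[%classic `|` [set (0 : R)].
    apply/seteqP; split => z /=; rewrite !in_itv/= le_eqVlt.
      by move=> /predU1P[->|]; [right|left].
    by move=> [->|->]; rewrite ?eqxx ?orbT.
  rewrite measureU//; first by rewrite [X in (_ + X)%E]E0 adde0.
  by rewrite -subset0 => z [/=]; rewrite in_itv/= => /[swap] ->; rewrite ltxx.
rewrite normal_prob_setT -E => /esym /(congr1 fine).
rewrite fineD ?normal_fin_num// -/(normal_cdf 0) /=; lra.
Qed.

Section quantile.
Variable q : R.
Hypotheses (q_gt : 1 / 2 < q) (q_lt : q < 1).

Lemma normal_quantile_set_nonempty : [set x : R | q <= normal_cdf x] !=set0.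
Proof.
pose x := Num.sqrt (1 - q)^-1.
have q1 : 0 < 1 - q by rewrite subr_gt0.
have x0 : 0 < x by rewrite sqrtr_gt0 invr_gt0.
exists x => /=.
have x2 : x ^+ 2 = (1 - q)^-1 by rewrite sqr_sqrtr// invr_ge0 ltW.
have := @normal_tail_chebyshev x 1 x0; rewrite expr1n mul1r x2 invrK.
have m1 : measurable ([set z | x <= 1 * z] : set (measurableTypeR R)).
  rewrite -[X in measurable X]setTI; apply: measurable_fun_ler => //; exact: measurable_funM.
have : (1 <= N `]-oo, x] + N [set z | (x <= 1 * z)%R])%E.
  rewrite -normal_prob_setT; apply: le_trans (measureU2 _ _ _) => //.
  apply: le_measure; rewrite ?inE//; first exact: measurableU.
  by move=> z _ /=; rewrite in_itv/= mul1r; case: (leP z x) => [|/ltW]; [left|right].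
rewrite -[N `]-oo, x]]fineK ?normal_fin_num// -[X in (_ + X)%E]fineK ?normal_fin_num//.
rewrite -EFinD lee_fin -/(normal_cdf x); lra.
Qed.

Lemma normal_quantile_gt0 : 0 < normal_quantile q.
Proof.
have p0 := @normal_peak_gt0 R 1 (oner_neq0 _).
pose eta := (q - 1 / 2) / (2 * normal_peak 1).
have eta0 : 0 < eta by rewrite divr_gt0 ?mulr_gt0// subr_gt0.
apply: (lt_le_trans eta0); apply: lb_le_inf; first exact: normal_quantile_set_nonempty.
move=> x /= qx; rewrite leNgt; apply/negP => xeta.
have := normal_cdf_lipschitz (ltW eta0); rewrite subr0 normal_cdf0.
have -> : normal_peak 1 * eta = (q - 1 / 2) / 2.
  by rewrite /eta; field; rewrite lt0r_neq0.
have := normal_cdf_nondecreasing (ltW xeta).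
move=> h1 h2; have h3 := le_trans qx (le_trans h1 h2).
suff : 1 / 2 < 1 / 2 :> R by rewrite ltxx.
move: q_gt h3; lra.
Qed.

(** The distribution function is Lipschitz, so that the tail from a point slightly below the
    quantile is still close to [1 - q]. The strict inequality leaves room for an estimated
    standard deviation. *)
Lemma normal_quantile_tail (e : R) : 0 < e -> exists s, [/\ 0 < s, s < normal_quantile q &
  fine (N [set z | s <= z]) <= 1 - q + e].
Proof.
move=> e0; set z := normal_quantile q; have z0 : 0 < z := normal_quantile_gt0.
have p0 := @normal_peak_gt0 R 1 (oner_neq0 _).
(* small against the quantile, and against [e] after multiplication by the Lipschitz constant *)
pose eta := Num.min (z / 2) (e / (3 * normal_peak 1)).
have eta0 : 0 < eta by rewrite lt_min; apply/andP; split; rewrite divr_gt0// mulr_gt0.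
have etaz : eta <= z / 2 by rewrite ge_min lexx.
have etae : normal_peak 1 * (3 * eta) <= e.
  rewrite mulrCA mulrA -ler_pdivlMl ?mulr_gt0// mulrC.
  by rewrite /eta ge_min lexx orbT.
exists (z - eta); split; [lra|lra|].
have h1 : q <= normal_cdf (z + eta).
  have hz : has_inf [set x : R | q <= normal_cdf x].
    split; first exact: normal_quantile_set_nonempty.
    exists 0 => x /= qx; rewrite leNgt; apply/negP => x0.
    have {}qx : q <= normal_cdf x by [].
    have := normal_cdf_nondecreasing (ltW x0); rewrite normal_cdf0 => h.
    by have := lt_le_trans q_gt (le_trans qx h); rewrite ltxx.
  have [x /= qx xz] := inf_adherent eta0 hz.
  by apply: (le_trans qx); apply: normal_cdf_nondecreasing; exact: ltW.
have h2 := @normal_cdf_lipschitz (z - 2 * eta) (z + eta) (ltac:(lra)).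
have m1 : measurable ([set x | z - eta <= x] : set (measurableTypeR R)).
  rewrite -[X in measurable X]setTI; exact: measurable_fun_ler.
have h3 : fine (N [set x | z - eta <= x]) + normal_cdf (z - 2 * eta) <= 1.
  rewrite /normal_cdf -fineD ?normal_fin_num// -measureU//; last first.
    rewrite -subset0 => x [/=]; rewrite in_itv/=; lra.
  rewrite -lee_fin fineK; last by apply: normal_fin_num; exact: measurableU.
  by apply: probability_le1; exact: measurableU.
move: h2; rewrite (_ : z + eta - (z - 2 * eta) = 3 * eta); last by ring.
lra.
Qed.

End quantile.
End normal_quantile.

(** * Coverage for independent identically distributed pairs *)

Section unit_mass.
Context d (T : measurableType d) (R : realType) (mu : {measure set T -> \bar R}).
Hypothesis mu1 : mu setT = 1%E.

Lemma unit_mass_fin_num (A : set T) : measurable A -> mu A \is a fin_num.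
Proof.
move=> mA; rewrite ge0_fin_numE//; apply: (@le_lt_trans _ _ (mu setT)).
  by apply: le_measure; rewrite ?inE.
by rewrite mu1 ltry.
Qed.

Lemma unit_mass_fine_le (A B : set T) : measurable A -> measurable B -> A `<=` B ->
  fine (mu A) <= fine (mu B).
Proof.
move=> mA mB AB; apply: fine_le; [exact: unit_mass_fin_num|exact: unit_mass_fin_num|].
by apply: le_measure; rewrite ?inE.
Qed.

Lemma unit_mass_fineU (A B : set T) : measurable A -> measurable B ->
  fine (mu (A `|` B)) <= fine (mu A) + fine (mu B).
Proof.
move=> mA mB; rewrite -fineD ?unit_mass_fin_num//; apply: fine_le.
- by apply: unit_mass_fin_num; exact: measurableU.
- by rewrite fin_numD !unit_mass_fin_num.
- exact: measureU2.
Qed.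

End unit_mass.

Section wlln.
Context d (W : measurableType d) (R : realType) (nu : probability W R).
Variables (zeta : W -> R).
Hypotheses (mz : measurable_fun setT zeta).
Hypotheses (iz : nu.-integrable setT (EFin \o zeta)).
Hypotheses (iz2 : nu.-integrable setT (EFin \o (fun w => zeta w ^+ 2))).
Hypotheses (z_mean : \int[nu]_w zeta w = 0).

(** A weak law of large numbers read off from the central limit theorem: [delta * sqrt n]
    eventually exceeds a level [s + 1] whose normal tail is small by Chebyshev. *)
Lemma wlln_upper (delta e : R) : 0 < delta -> 0 < e ->
  \forall n \near \oo,
    fine (measure_pow nu n [set u | delta <= n%:R^-1 * iid_sum zeta u]) <= e.
Proof.
move=> d0 e0; pose v := \int[nu]_w (zeta w ^+ 2); pose tau := Num.sqrt v.
have v0 : 0 <= v by apply: Rintegral_ge0 => w _; exact: sqr_ge0.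
have t2 : tau ^+ 2 = v by rewrite sqr_sqrtr.
(* by Chebyshev the normal tail from s on is at most e / 2 *)
pose s := Num.sqrt (2 * v / e) + 1.
have s0 : 0 < s by rewrite ltr_wpDl.
have hs : tau ^+ 2 / s ^+ 2 <= e / 2.
  rewrite t2 ler_pdivrMr ?exprn_gt0// mulrC -ler_pdivrMr ?divr_gt0//.
  rewrite (_ : v / (e / 2) = 2 * v / e); last by field; rewrite lt0r_neq0.
  have q0 : 0 <= 2 * v / e by rewrite divr_ge0 ?mulr_ge0// ltW.
  rewrite -[leLHS](sqr_sqrtr q0) lerXn2r ?nnegrE ?sqrtr_ge0 ?(ltW s0)//.
  by rewrite /s lerDl.
have e2 : 0 < e / 2 by rewrite divr_gt0.
have st : s < s + 1 by rewrite ltrDl.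
have := clt_upper_tail mz (sqrtr_ge0 v) iz iz2 z_mean (esym t2) st e2.
have F2 : \forall n \near \oo, (0 < n)%N /\ s + 1 <= delta * Num.sqrt n%:R.
  exists (Num.truncn ((delta^-1 * (s + 1)) ^+ 2)).+1 => // k /= hk; split; first exact: leq_trans hk.
  rewrite -ler_pdivrMl//.
  have a0 : 0 <= delta^-1 * (s + 1) by rewrite mulr_ge0 ?invr_ge0 ?ltW// addr_gt0.
  rewrite -[leLHS]ger0_norm// -sqrtr_sqr ler_wsqrtr// (le_trans (ltW (truncnS_gt _)))// ler_nat//.
move=> H1; apply: filter_app H1; apply: filterS F2 => n [n0 nbig] H.
apply: (le_trans _ (_ : e / 2 + e / 2 <= e)); last by lra.
have := @normal_tail_chebyshev R s tau s0 => H2.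
apply: (le_trans _ (le_trans H (lerD (le_trans H2 hs) (lexx _)))).
have rn0 : 0 < Num.sqrt (n%:R : R) by rewrite sqrtr_gt0 ltr0n.
have nE : (n%:R : R) = Num.sqrt n%:R * Num.sqrt n%:R by rewrite -expr2 sqr_sqrtr.
have mS : measurable_fun setT (fun u : n.-tuple W => (Num.sqrt n%:R)^-1 * iid_sum zeta u).
  by apply: measurable_funM => //; exact: measurable_iid_sum.
have mS' : measurable_fun setT (fun u : n.-tuple W => n%:R^-1 * iid_sum zeta u).
  by apply: measurable_funM => //; exact: measurable_iid_sum.
have mA : measurable [set u : n.-tuple W | delta <= n%:R^-1 * iid_sum zeta u].
  rewrite -[X in measurable X]setTI; exact: measurable_fun_ler.
have mB : measurable [set u : n.-tuple W | s + 1 <= (Num.sqrt n%:R)^-1 * iid_sum zeta u].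
  rewrite -[X in measurable X]setTI; exact: measurable_fun_ler.
have P1 := measure_pow_setT nu n.
apply: (unit_mass_fine_le P1) => // u /= hu.
apply: (le_trans nbig); rewrite -ler_pdivlMr// (le_trans hu)//.
have -> : (n%:R^-1 : R) = (Num.sqrt n%:R)^-1 * (Num.sqrt n%:R)^-1 by rewrite -invfM -nE.
by rewrite mulrAC lexx.
Qed.

End wlln.

Section coverage_deterministic.
Context {R : realType}.
Variables (alpha beta L kappa : R).
Local Notation c := (kappa `^ alpha).

Lemma sum_sqr_center m (y : 'I_m -> R) (A : R) : (0 < m)%N ->
  \sum_(j < m) (y j - m%:R^-1 * \sum_(i < m) y i) ^+ 2 =
  \sum_(j < m) (y j - A) ^+ 2 - m%:R * (m%:R^-1 * (\sum_(i < m) y i) - A) ^+ 2.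
Proof.
move=> m0; have mn0 : m%:R != 0 :> R by rewrite pnatr_eq0 -lt0n.
set mu := m%:R^-1 * _.
have smu : \sum_(j < m) y j = m%:R * mu by rewrite /mu mulrA divff// mul1r.
have E (B : R) : \sum_(j < m) (y j - B) ^+ 2 =
    \sum_(j < m) y j ^+ 2 - 2 * B * (m%:R * mu) + m%:R * B ^+ 2.
  rewrite -smu mulr_sumr -sumrB.
  have -> : m%:R * B ^+ 2 = \sum_(j < m) B ^+ 2.
    by rewrite sumr_const card_ord mulr_natl.
  by rewrite -big_split/=; apply: eq_bigr => j _; ring.
by rewrite !E; ring.
Qed.

(** The event that implies coverage. The numerator is [S / m] up to the bias, the squared
    standard error is a mean of squared deviations, and a normalized sum below [t' * tau]
    with [t' < z] is compatible with an estimated deviation that is only slightly too small. *)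
Lemma coverage_deterministic m (y : bool -> 'I_m -> R) (A : bool -> R) (tau t' z eta b s : R) :
  (2 <= m)%N -> 1 < c -> 0 < tau -> 0 < t' -> t' < z ->
  (c ^+ 2 + 1) * eta ^+ 2 <= tau ^+ 2 * (1 - (t' / z) ^+ 2) / 2 ->
  let S := \sum_(j < m) (c * (y false j - A false) - (y true j - A true)) in
  `|(Num.sqrt m%:R)^-1 * S| < t' * tau ->
  tau ^+ 2 - tau ^+ 2 * (1 - (t' / z) ^+ 2) / 2 <
    m%:R^-1 * \sum_(j < m) (c ^+ 2 * (y false j - A false) ^+ 2 + (y true j - A true) ^+ 2) ->
  (forall a, `|sample_mean y a - A a| < eta) ->
  `|(c * A false - A true) / (c - 1) - s| <= b ->
  `|s_hat alpha kappa y - s| < b + z * std_error alpha kappa y.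
Proof.
move=> m2 c1 tau0 t'0 t'z heta S hS hD hmean hb.
have z0 : 0 < z := lt_trans t'0 t'z.
have c10 : 0 < c - 1 by rewrite subr_gt0.
have m0 : (0 < m)%N by exact: leq_trans m2.
have M0 : 0 < m%:R :> R by rewrite ltr0n.
have M1 : 0 < m%:R - 1 :> R by rewrite subr_gt0 ltr1n.
have rM0 : 0 < Num.sqrt (m%:R : R) by rewrite sqrtr_gt0.
have ME : (m%:R : R) = Num.sqrt m%:R ^+ 2 by rewrite sqr_sqrtr// ltW.
have SE : c * sample_mean y false - sample_mean y true = (c * A false - A true) + m%:R^-1 * S.
  have mE a : \sum_(j < m) (y a j - A a) = m%:R * sample_mean y a - m%:R * A a.
    rewrite sumrB sumr_const card_ord -[A a *+ m]mulr_natl; congr (_ - _).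
    by rewrite /sample_mean mulrA divff ?mul1r// lt0r_neq0.
  rewrite /S sumrB -mulr_sumr !mE.
  set u := sample_mean y false; set v := sample_mean y true.
  by field; rewrite lt0r_neq0.
set V := kappa `^ (2 * alpha) * sample_variance y false + sample_variance y true.
have VE : V = (m%:R - 1)^-1 * (\sum_(j < m) (c ^+ 2 * (y false j - A false) ^+ 2 + (y true j - A true) ^+ 2)
   - m%:R * (c ^+ 2 * (sample_mean y false - A false) ^+ 2 + (sample_mean y true - A true) ^+ 2)).
  rewrite /V (mulrC 2 alpha) powRrM powR_mulrn ?powR_ge0// /sample_variance.
  rewrite (sum_sqr_center _ (A false) m0) (sum_sqr_center _ (A true) m0).
  rewrite big_split/= -mulr_sumr /sample_mean; ring.
have V0 : 0 <= V.
  rewrite addr_ge0// ?mulr_ge0 ?powR_ge0// ?invr_ge0 ?(ltW M1)//; apply: sumr_ge0 => j _; exact: sqr_ge0.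
have devs : c ^+ 2 * (sample_mean y false - A false) ^+ 2 + (sample_mean y true - A true) ^+ 2 <=
    (c ^+ 2 + 1) * eta ^+ 2.
  have sq a : (sample_mean y a - A a) ^+ 2 <= eta ^+ 2.
    have h := ltW (hmean a); rewrite -[leLHS]real_normK ?num_real//.
    by rewrite lerXn2r ?nnegrE// (le_trans (normr_ge0 _) h).
  by rewrite mulrDl mul1r lerD// ler_wpM2l ?sqr_ge0.
have VL : tau ^+ 2 * (t' / z) ^+ 2 <= V.
  set B := _ - m%:R * _ in VE.
  have B0 : 0 <= B by move: V0; rewrite VE pmulr_rge0// invr_gt0.
  apply: (@le_trans _ _ (m%:R^-1 * B)); last first.
    by rewrite VE ler_wpM2r// lef_pV2 ?posrE// lerBlDr lerDl.
  rewrite /B mulrBr mulKf ?lt0r_neq0//; move: hD devs heta; set X := m%:R^-1 * _.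
  set Y := c ^+ 2 * _ ^+ 2 + _; set T1 := (c ^+ 2 + 1) * _; lra.
rewrite /s_hat SE /std_error -/V.
rewrite (_ : _ / (c - 1) - s = ((c * A false - A true) / (c - 1) - s) + m%:R^-1 * S / (c - 1)); last by ring.
apply: (le_lt_trans (ler_normD _ _)); apply: ler_ltD => //.
rewrite normrM normfV (gtr0_norm c10).
have -> : m%:R^-1 * S = (Num.sqrt m%:R)^-1 * ((Num.sqrt m%:R)^-1 * S).
  by rewrite mulrA -invfM -expr2 -ME.
rewrite normrM (gtr0_norm (_ : 0 < (Num.sqrt m%:R)^-1)) ?invr_gt0//.
have h1 : tau * (t' / z) / (Num.sqrt m%:R * (c - 1)) <= Num.sqrt (V / (m%:R * (c - 1) ^+ 2)).
  have p0 : 0 <= tau * (t' / z) / (Num.sqrt m%:R * (c - 1)).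
    apply: divr_ge0; apply: mulr_ge0; rewrite ?(ltW tau0) ?(ltW rM0) ?(ltW c10)//.
    by apply: divr_ge0; exact: ltW.
  rewrite -[leLHS]ger0_norm// -sqrtr_sqr ler_wsqrtr//.
  have -> : (tau * (t' / z) / (Num.sqrt m%:R * (c - 1))) ^+ 2 =
      tau ^+ 2 * (t' / z) ^+ 2 / (m%:R * (c - 1) ^+ 2).
    by rewrite [in RHS]ME; field; rewrite !lt0r_neq0.
  by rewrite ler_wpM2r// invr_ge0 mulr_ge0 ?sqr_ge0// ltW.
apply: (@lt_le_trans _ _ (z * (tau * (t' / z) / (Num.sqrt m%:R * (c - 1))))); last first.
  by rewrite ler_pM2l.
rewrite (_ : z * _ = (Num.sqrt m%:R)^-1 * (t' * tau) / (c - 1)); last first.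
  by field; rewrite !lt0r_neq0.
by rewrite ltr_pM2r ?invr_gt0// ltr_pM2l ?invr_gt0.
Qed.

End coverage_deterministic.

(** The arithmetic of the union bound over the seven exceptional events in [coverage_nondegenerate]. *)
Lemma union_bound7 (R : realType) (g u1 u2 u3 u4 u5 u6 u7 p1 p2 p3 p4 p5 p6 p7 n e gamma : R) :
  0 < e -> u1 <= g + p1 -> u2 <= u1 + p2 -> u3 <= u2 + p3 -> u4 <= u3 + p4 -> u5 <= u4 + p5 ->
  u6 <= u5 + p6 -> u7 <= u6 + p7 -> 1 <= u7 ->
  p1 <= n + e / 16 -> p2 <= n + e / 16 -> p3 <= e / 8 -> p4 <= e / 8 -> p5 <= e / 8 ->
  p6 <= e / 8 -> p7 <= e / 8 -> n <= gamma / 2 + e / 16 -> 1 - gamma - e <= g.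
Proof.
move=> e0 h1 h2 h3 h4 h5 h6 h7 h8 H1 H2 H3 G1 G2 G3 G4 NT.
lra.
Qed.

Section array_measurability.
Context d (T : measurableType d) (R : realType) (m : nat) (alpha kappa : R).
Variable Y : T -> bool -> 'I_m -> R.
Hypothesis mY : forall a j, measurable_fun setT (fun t => Y t a j).

Let measurable_sample_mean a : measurable_fun setT (fun t => sample_mean (Y t) a).
Proof. by apply: measurable_funM => //; exact: measurable_sum. Qed.

Lemma measurable_s_hat : measurable_fun setT (fun t => s_hat alpha kappa (Y t)).
Proof.
by apply: measurable_funM => //; apply: measurable_funB => //; exact: measurable_funM.
Qed.

Lemma measurable_std_error : measurable_fun setT (fun t => std_error alpha kappa (Y t)).
Proof.
have mv a : measurable_fun setT (fun t => sample_variance (Y t) a).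
  apply: measurable_funM => //; apply: measurable_sum => j.
  by apply: measurable_funX; exact: measurable_funB.
apply: measurableT_comp.
  by apply: continuous_measurable_fun; exact: sqrt_continuous.
by apply: measurable_funM => //; apply: measurable_funD => //; exact: measurable_funM.
Qed.

Lemma measurable_coverage (s b z : R) : measurable [set t |
  `|s_hat alpha kappa (Y t) - s| < b + z * std_error alpha kappa (Y t)].
Proof.
rewrite -[X in measurable X]setTI; apply: measurable_fun_ltr => //.
- apply: measurableT_comp => //; apply: measurable_funB => //; exact: measurable_s_hat.
- by apply: measurable_funD => //; apply: measurable_funM => //; exact: measurable_std_error.
Qed.

End array_measurability.

Section coverage.
Context d (W : measurableType d) (R : realType) (nu : probability W R).
Variables (Y : bool -> W -> R) (alpha kappa : R).
Local Notation c := (kappa `^ alpha).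
Local Notation N := (@normal_prob R 0 1).
Hypothesis mY : forall a, measurable_fun setT (Y a).
Hypothesis iY : forall a, nu.-integrable setT (EFin \o Y a).
Hypothesis iY2 : forall a, nu.-integrable setT (EFin \o (fun w => Y a w ^+ 2)).
Hypothesis c1 : 1 < c.
Let A a := \int[nu]_w Y a w.
Let zeta a w := Y a w - A a.
Let D w := c ^+ 2 * zeta false w ^+ 2 + zeta true w ^+ 2.
Let xi w := c * zeta false w - zeta true w.
Hypothesis uncorrelated : \int[nu]_w (xi w ^+ 2) = \int[nu]_w D w.
Hypothesis D_gt0 : 0 < \int[nu]_w D w.

Definition sample_array m (t : m.-tuple W) (a : bool) (j : 'I_m) : R := Y a (tnth t j).

Let nu1 := probability_setT nu.

Let integrable_cst (k : R) : nu.-integrable setT (EFin \o (fun=> k)).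
Proof. exact: (@bounded_integrable _ _ _ nu nu1 (cst k) `|k|). Qed.

Let integrableRB (f g : W -> R) : nu.-integrable setT (EFin \o f) ->
  nu.-integrable setT (EFin \o g) -> nu.-integrable setT (EFin \o (fun w => f w - g w)).
Proof. by move=> i1 i2; have := integrableB measurableT i1 i2; apply: eq_integrable. Qed.

Let integrableRD (f g : W -> R) : nu.-integrable setT (EFin \o f) ->
  nu.-integrable setT (EFin \o g) -> nu.-integrable setT (EFin \o (fun w => f w + g w)).
Proof. by move=> i1 i2; have := integrableD measurableT i1 i2; apply: eq_integrable. Qed.

Let integrableRZ (k : R) (f : W -> R) : nu.-integrable setT (EFin \o f) ->
  nu.-integrable setT (EFin \o (fun w => k * f w)).
Proof. by move=> i1; have := integrableZl measurableT k i1; apply: eq_integrable. Qed.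

Let mzeta a : measurable_fun setT (zeta a). Proof. exact: measurable_funB. Qed.

Let izeta a : nu.-integrable setT (EFin \o zeta a). Proof. exact: integrableRB. Qed.

Let izeta2 a : nu.-integrable setT (EFin \o (fun w => zeta a w ^+ 2)).
Proof.
have := integrableRD (integrableRB (iY2 a) (integrableRZ (2 * A a) (iY a))) (integrable_cst (A a ^+ 2)).
by apply: eq_integrable => // w _; rewrite /zeta /=; congr EFin; ring.
Qed.

Let zeta_mean a : \int[nu]_w zeta a w = 0.
Proof. by rewrite (RintegralB measurableT (iY a) (integrable_cst (A a))) (Rintegral_cst1 nu1) subrr. Qed.

Let mD : measurable_fun setT D.
Proof.
apply: measurable_funD; last exact: measurable_funX.
by apply: measurable_funM => //; exact: measurable_funX.
Qed.

Let iD : nu.-integrable setT (EFin \o D).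
Proof. by apply: integrableRD => //; exact: integrableRZ. Qed.

Let D_ge0 w : 0 <= D w.
Proof. by apply: addr_ge0; rewrite ?sqr_ge0//; apply: mulr_ge0; exact: sqr_ge0. Qed.

Let mxi : measurable_fun setT xi.
Proof. by apply: measurable_funB => //; exact: measurable_funM. Qed.

Let ixi : nu.-integrable setT (EFin \o xi).
Proof. by apply: integrableRB => //; exact: integrableRZ. Qed.

Let ixi2 : nu.-integrable setT (EFin \o (fun w => xi w ^+ 2)).
Proof.
apply: (le_integrable measurableT _ _ (integrableRZ 2 iD)).
  by apply/measurable_EFinP; exact: measurable_funX.
move=> w _ /=; rewrite lee_fin ger0_norm ?sqr_ge0// ger0_norm ?mulr_ge0//.
have := sqr_ge0 (c * zeta false w + zeta true w); rewrite /xi /D; nra.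
Qed.

Let xi_mean : \int[nu]_w xi w = 0.
Proof.
rewrite (RintegralB measurableT (integrableRZ c (izeta false)) (izeta true)).
by rewrite RintegralZl// !zeta_mean mulr0 subr0.
Qed.

Let minD (K : R) w := Num.min (D w) K.

Let mminD K : measurable_fun setT (minD K). Proof. exact: measurable_minr. Qed.

Let minD_bound K w : 0 <= K -> `|minD K w| <= K.
Proof. by move=> K0; rewrite ger0_norm ?ge_min ?lexx ?orbT// le_min D_ge0. Qed.

(** The weak law is available for variables with two moments, but [D] itself is a square of
    such a variable; its truncation is bounded and loses little of the mean. *)
Lemma truncated_variance (e : R) : 0 < e -> exists2 K : R, 0 <= K &
  \int[nu]_w D w - e <= \int[nu]_w minD K w.
Proof.
move=> e0.
have : \int[nu]_w minD n%:R w @[n --> \oo] --> \int[nu]_w D w.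
  apply: fine_cvg; rewrite fineK; last exact: integrable_fin_num.
  apply: (@dominated_cvg _ _ _ nu setT measurableT (fun n w => (minD n%:R w)%:E) _ (EFin \o D)) => //.
  - by move=> n; exact/measurable_EFinP.
  - move=> w _; apply: cvg_near_cst; exists (Num.truncn (D w)).+1 => // n /= hn.
    congr EFin; apply/min_idPl; rewrite (le_trans (ltW (truncnS_gt _)))// ler_nat; exact: hn.
  - by move=> n w _; rewrite /= lee_fin ger0_norm ?ge_min ?lexx// le_min D_ge0/=.
move/cvgrPdist_le => /(_ e e0) [n _ /(_ n (leqnn n)) /=].
rewrite ler_distlC => /andP[h _]; by exists n%:R.
Qed.

Lemma measurable_sample_array m a j :
  measurable_fun setT (fun t : m.-tuple W => sample_array t a j).
Proof. by apply: measurableT_comp => //; exact: measurable_tnth. Qed.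

(** Studentized coverage. The numerator has a normal limit of variance [tau ^+ 2], the mean of
    [D]; the truncated squares bound the standard error from below by the weak law; the weak
    law for both coordinates controls the centering by sample means. Outside seven events
    of small probability [coverage_deterministic] applies. *)
Lemma coverage_nondegenerate (gamma e s b : R) : 0 < gamma < 1 -> 0 < e ->
  `|(c * A false - A true) / (c - 1) - s| <= b ->
  \forall m \near \oo, 1 - gamma - e <= fine (measure_pow nu m [set t |
    `|s_hat alpha kappa (sample_array t) - s| <
    b + normal_quantile (1 - gamma / 2) * std_error alpha kappa (sample_array t)]).
Proof.
move=> /andP[g0 g1] e0 hb.
have q1 : 1 / 2 < 1 - gamma / 2 by lra.
have q2 : 1 - gamma / 2 < 1 by lra.
have e16 : 0 < e / 16 by rewrite divr_gt0.
have e8 : 0 < e / 8 by rewrite divr_gt0.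
have [s1 [s10 s1z Ns1]] := normal_quantile_tail q1 q2 e16.
set z := normal_quantile _ in s1z *.
pose tau := Num.sqrt (\int[nu]_w D w).
have tau0 : 0 < tau by rewrite sqrtr_gt0.
have tau2 : tau ^+ 2 = \int[nu]_w D w by rewrite sqr_sqrtr// ltW.
pose t' := (s1 + z) / 2.
have t'0 : 0 < t' by rewrite /t'; lra.
have s1t' : s1 < t' by rewrite /t'; lra.
have t'z : t' < z by rewrite /t'; lra.
have z0 : 0 < z by lra.
(* the gap between t' / z and 1 pays for the truncation, the centering and the weak law *)
pose delta := tau ^+ 2 * (1 - (t' / z) ^+ 2).
have delta0 : 0 < delta.
  have tz : t' / z < 1 by rewrite ltr_pdivrMr// mul1r.
  have tz0 : 0 <= t' / z by rewrite divr_ge0// ltW.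
  by rewrite mulr_gt0 ?exprn_gt0// subr_gt0 expr_lt1.
have d4 : 0 < delta / 4 by rewrite divr_gt0.
have [K K0 hK] := truncated_variance d4.
pose eta := Num.sqrt (delta / 2 / (c ^+ 2 + 1)).
have c20 : 0 < c ^+ 2 + 1 by rewrite addr_gt0 ?exprn_gt0// (lt_trans ltr01).
have eta0 : 0 < eta by rewrite sqrtr_gt0 !divr_gt0.
have heta : (c ^+ 2 + 1) * eta ^+ 2 <= delta / 2.
  rewrite sqr_sqrtr; last by rewrite ltW// !divr_gt0.
  by rewrite mulrC divfK// lt0r_neq0.
have NT : fine (N [set x | s1 * tau <= tau * x]) <= gamma / 2 + e / 16.
  rewrite (_ : [set x | _] = [set x | s1 <= x]); last first.
    by apply/seteqP; split => x /=; rewrite mulrC ler_pM2l.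
  by apply: (le_trans Ns1); lra.
have st : s1 * tau < t' * tau by rewrite ltr_pM2r.
have F1 := clt_upper_tail mxi (ltW tau0) ixi ixi2 xi_mean
  (etrans uncorrelated (esym tau2)) st e16.
have iN (f : W -> R) : nu.-integrable setT (EFin \o f) -> nu.-integrable setT (EFin \o (fun w => - f w)).
  by move=> /(integrableRZ (-1)); apply: eq_integrable => // w _; rewrite /= mulN1r.
have iN2 (f : W -> R) : nu.-integrable setT (EFin \o (fun w => f w ^+ 2)) ->
    nu.-integrable setT (EFin \o (fun w => (- f w) ^+ 2)).
  by apply: eq_integrable => // w _; rewrite /= sqrrN.
have mN (f : W -> R) : measurable_fun setT f -> measurable_fun setT (fun w => - f w).
  by move=> mf; exact: measurableT_comp.
have meanN (f : W -> R) : nu.-integrable setT (EFin \o f) -> \int[nu]_w f w = 0 ->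
    \int[nu]_w (- f w) = 0.
  move=> jf f0; rewrite (_ : \int[nu]_w _ = \int[nu]_w (-1 * f w)).
    by rewrite RintegralZl// f0 mulr0.
  by apply: eq_Rintegral => w _; rewrite mulN1r.
have varN : \int[nu]_w ((- xi w) ^+ 2) = tau ^+ 2.
  by rewrite tau2 -uncorrelated; apply: eq_Rintegral => w _; rewrite sqrrN.
have F2 := clt_upper_tail (mN _ mxi) (ltW tau0) (iN _ ixi) (iN2 _ ixi2) (meanN _ ixi xi_mean)
  varN st e16.
have im : nu.-integrable setT (EFin \o minD K).
  by apply: (bounded_integrable nu1 (K := K)) => // w; exact: minD_bound.
pose muK := \int[nu]_w minD K w.
have F3 : \forall n \near \oo, fine (measure_pow nu n
    [set u | delta / 4 <= n%:R^-1 * iid_sum (fun w => muK - minD K w) u]) <= e / 8.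
  have mm : measurable_fun setT (fun w => muK - minD K w) by exact: measurable_funB.
  apply: wlln_upper => //.
  - exact: integrableRB.
  - apply: (bounded_integrable nu1 (K := (`|muK| + K) ^+ 2)); first exact: measurable_funX.
    move=> w; rewrite normrX lerXn2r ?nnegrE// ?addr_ge0//.
    by rewrite (le_trans (ler_normB _ _))// lerD2l minD_bound.
  - by rewrite (RintegralB measurableT (integrable_cst muK) im) (Rintegral_cst1 nu1) subrr.
have F4 a : \forall n \near \oo, fine (measure_pow nu n
    [set u | eta <= n%:R^-1 * iid_sum (zeta a) u]) <= e / 8.
  exact: wlln_upper.
have F5 a : \forall n \near \oo, fine (measure_pow nu n
    [set u | eta <= n%:R^-1 * iid_sum (fun w => - zeta a w) u]) <= e / 8.
  by apply: wlln_upper => //; [exact: mN|exact: iN|exact: iN2|exact: meanN].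
have F0 : \forall n \near \oo, (2 <= n)%N by exists 2%N.
near=> m.
have m2 : (2 <= m)%N by near: m.
have H1 : fine (measure_pow nu m [set u | t' * tau <= (Num.sqrt m%:R)^-1 * iid_sum xi u]) <=
   fine (N [set z | s1 * tau <= tau * z]) + e / 16 by near: m.
have H2 : fine (measure_pow nu m [set u | t' * tau <= (Num.sqrt m%:R)^-1 * iid_sum (fun w => - xi w) u]) <=
   fine (N [set z | s1 * tau <= tau * z]) + e / 16 by near: m.
have H3 : fine (measure_pow nu m
    [set u | delta / 4 <= m%:R^-1 * iid_sum (fun w => muK - minD K w) u]) <= e / 8 by near: m.
have G1 : fine (measure_pow nu m [set u | eta <= m%:R^-1 * iid_sum (zeta false) u]) <= e / 8.
  by near: m; exact: F4.
have G2 : fine (measure_pow nu m [set u | eta <= m%:R^-1 * iid_sum (zeta true) u]) <= e / 8.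
  by near: m; exact: F4.
have G3 : fine (measure_pow nu m [set u | eta <= m%:R^-1 * iid_sum (fun w => - zeta false w) u]) <= e / 8.
  by near: m; exact: F5.
have G4 : fine (measure_pow nu m [set u | eta <= m%:R^-1 * iid_sum (fun w => - zeta true w) u]) <= e / 8.
  by near: m; exact: F5.
have P1 := measure_pow_setT nu m.
have mB (k x : R) (f : W -> R) : measurable_fun setT f ->
    measurable [set u : m.-tuple W | x <= k * iid_sum f u].
  move=> mf; rewrite -[X in measurable X]setTI; apply: measurable_fun_ler => //.
  by apply: measurable_funM => //; exact: measurable_iid_sum.
set B1 := [set u | _] in H1; set B2 := [set u | _] in H2; set B3 := [set u | _] in H3.
set C1 := [set u | _] in G1; set C2 := [set u | _] in G2.
set C3 := [set u | _] in G3; set C4 := [set u | _] in G4.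
set G := [set t | _].
have mG : measurable G.
  by apply: measurable_coverage => a j; exact: measurable_sample_array.
have mB1 : measurable B1 by exact: mB.
have mB2 : measurable B2 by apply: mB; exact: mN.
have mB3 : measurable B3 by apply: mB; exact: measurable_funB.
have mC1 : measurable C1 by exact: mB.
have mC2 : measurable C2 by exact: mB.
have mC3 : measurable C3 by apply: mB; exact: mN.
have mC4 : measurable C4 by apply: mB; exact: mN.
have cover : setT `<=` G `|` B1 `|` B2 `|` B3 `|` C1 `|` C2 `|` C3 `|` C4.
  move=> t _.
  have [|nB1] := pselect (B1 t); first by do 6 left; right.
  have [|nB2] := pselect (B2 t); first by do 5 left; right.
  have [|nB3] := pselect (B3 t); first by do 4 left; right.
  have [|nC1] := pselect (C1 t); first by do 3 left; right.
  have [|nC2] := pselect (C2 t); first by do 2 left; right.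
  have [|nC3] := pselect (C3 t); first by left; right.
  have [|nC4] := pselect (C4 t); first by right.
  do 7 left.
  have sN (f : W -> R) : iid_sum (fun w => - f w) t = - iid_sum f t by rewrite /iid_sum sumrN.
  move/negP: nB1; rewrite -ltNge => nB1.
  move/negP: nB2; rewrite sN mulrN -ltNge => nB2.
  move/negP: nB3; rewrite -ltNge => nB3.
  move/negP: nC1; rewrite -ltNge => nC1.
  move/negP: nC2; rewrite -ltNge => nC2.
  move/negP: nC3; rewrite sN mulrN -ltNge => nC3.
  move/negP: nC4; rewrite sN mulrN -ltNge => nC4.
  have m0 : (0 < m)%N by exact: leq_trans m2.
  have mn0 : m%:R != 0 :> R by rewrite pnatr_eq0 -lt0n.
  apply: (coverage_deterministic (A := A) m2 c1 tau0 t'0 t'z heta) hb.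
  - rewrite ltr_norml; apply/andP; split; last exact: nB1.
    by rewrite ltrNl; exact: nB2.
  - rewrite -/delta; move: nB3; rewrite /iid_sum sumrB sumr_const card_ord mulrBr.
    rewrite -[muK *+ m]mulr_natl mulKf// => nB3.
    have : m%:R^-1 * \sum_(i < m) minD K (tnth t i) <= m%:R^-1 * \sum_(i < m) D (tnth t i).
      by rewrite ler_wpM2l ?invr_ge0//; apply: ler_sum => i _; rewrite ge_min lexx.
    move: hK nB3; rewrite -/muK -tau2 /D /zeta /sample_array.
    set X1 := _ * \sum_(i < m) minD K _; set X2 := _ * \sum_(i < m) (_ + _).
    lra.
  - have mean a : sample_mean (sample_array t) a - A a = m%:R^-1 * iid_sum (zeta a) t.
      rewrite /iid_sum sumrB sumr_const card_ord mulrBr -[A a *+ m]mulr_natl mulKf//.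
    by case; rewrite mean ltr_norml; apply/andP; split => //; rewrite ltrNl.
have H := @unit_mass_fineU _ _ _ (measure_pow nu m) P1.
have h1 := H _ _ mG mB1; have m1 := measurableU _ _ mG mB1.
have h2 := H _ _ m1 mB2; have m2' := measurableU _ _ m1 mB2.
have h3 := H _ _ m2' mB3; have m3 := measurableU _ _ m2' mB3.
have h4 := H _ _ m3 mC1; have m4 := measurableU _ _ m3 mC1.
have h5 := H _ _ m4 mC2; have m5 := measurableU _ _ m4 mC2.
have h6 := H _ _ m5 mC3; have m6 := measurableU _ _ m5 mC3.
have h7 := H _ _ m6 mC4; have m7 := measurableU _ _ m6 mC4.
have := unit_mass_fine_le P1 measurableT m7 cover.
rewrite [X in X <= _](congr1 fine P1 : _ = 1) => h8.
exact: (union_bound7 e0 h1 h2 h3 h4 h5 h6 h7 h8 H1 H2 H3 G1 G2 G3 G4 NT).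
Unshelve. all: by end_near. Qed.

End coverage.

(** * Rectangles, Lebesgue measure and balls of the Euclidean space *)

Section rectangles.
Context d d' (T : measurableType d) (T' : measurableType d') (R : realType).
Context (I : finType) (X : I -> T -> T').
Hypothesis mX : forall i, measurable_fun setT (X i).
Hypothesis genX : @measurable _ T `<=`
  <<s [set A | exists i B, measurable B /\ A = X i @^-1` B] >>.

(** Intersections of preimages under a finite family of maps: boxes of a product space,
    without reference to how the product is encoded. *)
Definition rectangle (A : I -> set T') : set T := [set t | forall i, A i (X i t)].

Lemma measurable_rectangle (A : I -> set T') : (forall i, measurable (A i)) ->
  measurable (rectangle A).
Proof.
move=> mA; rewrite (_ : rectangle A = \bigcap_(i in [set: I]) (X i @^-1` A i)).
  apply: fin_bigcap_measurable => // i _.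
  by rewrite -[X in measurable X]setTI; exact: mX.
by apply/seteqP; split => t /= h i; [move=> _|]; exact: h.
Qed.

(** Rectangles form a generating system that is closed under intersection. *)
Lemma measure_unique_rectangle (m1 m2 : {measure set T -> \bar R}) (g : nat -> set T') :
  (forall k, measurable (g k)) ->
  \bigcup_k rectangle (fun=> g k) = setT ->
  (forall k, m1 (rectangle (fun=> g k)) < +oo)%E ->
  (forall A : I -> set T', (forall i, measurable (A i)) ->
     m1 (rectangle A) = m2 (rectangle A)) ->
  forall A, measurable A -> m1 A = m2 A.
Proof.
move=> mg gT gfin agree.
apply: (@measure_unique _ _ _ [set B | exists2 A : I -> set T', (forall i, measurable (A i)) & B = rectangle A]
   (fun k => rectangle (fun=> g k))) => //.
- apply/seteqP; split; last first.
    apply: smallest_sub; first exact: sigma_algebra_measurable.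
    by move=> B [A mA ->]; exact: measurable_rectangle.
  move=> B /genX; apply: smallest_sub; first exact: smallest_sigma_algebra.
  move=> _ [i [C [mC ->]]]; apply: sub_sigma_algebra.
  exists (fun j => if j == i then C else setT) => [j|]; first by case: ifPn.
  apply/seteqP; split => t /= Ct; first by move=> j; case: ifPn => // /eqP ->.
  by have := Ct i; rewrite eqxx.
- move=> _ _ [A mA ->] [B mB ->]; exists (fun i => A i `&` B i).
    by move=> i; exact: measurableI.
  apply/seteqP; split => t /=; first by move=> [At Bt] i; split.
  by move=> ABt; split => i; have [] := ABt i.
- by move=> k; exists (fun=> g k).
- by move=> _ [A mA ->]; exact: agree.
Qed.

End rectangles.

Lemma measurable_rV_gen (R : realType) n :
  @measurable _ 'rV[R]_n `<=` <<s [set A | exists (i : 'I_n) B, measurable B /\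
     A = (fun x : 'rV[R]_n => x ord0 i) @^-1` B] >>.
Proof.
move=> A; apply; split; first exact: smallest_sigma_algebra.
rewrite -bigcup_seq/= => C [i _ [Y mY <-]]; apply: sub_sigma_algebra.
by exists i, Y; split => //; rewrite setTI.
Qed.

Section lebesgue_rV_affine.
Context {R : realType} {n : nat}.
Local Notation E := 'rV[R]_n.
Local Notation leb := (@lebesgue_rV R n).

Let mcoord (i : 'I_n) : measurable_fun [set: E] (fun x : E => (x ord0 i : measurableTypeR R)).
Proof. exact: measurable_rV_coord. Qed.

Let genE : @measurable _ E `<=` <<s [set A | exists (i : 'I_n) (B : set (measurableTypeR R)),
  measurable B /\ A = (fun x : E => (x ord0 i : measurableTypeR R)) @^-1` B] >>.
Proof. exact: measurable_rV_gen. Qed.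

Local Notation rect := (rectangle (fun (i : 'I_n) (x : E) => (x ord0 i : measurableTypeR R))).

Lemma lebesgue_rV_rectangle (A : 'I_n -> set (measurableTypeR R)) :
  (forall i, measurable (A i)) ->
  leb (rect A) = (\prod_(i < n) (@lebesgue_measure R) (A i))%E.
Proof.
move=> mA; rewrite -measure_powE//.
rewrite /lebesgue_rV /mpushforward /pushforward; congr (measure_pow _ _ _).
by apply/seteqP; split => t /= h i; have := h i; rewrite mxE.
Qed.

Definition dilate (s : R) (a x : E) : E := s *: x + a.

Lemma measurable_dilate s a : measurable_fun [set: E] (dilate s a).
Proof.
apply: measurable_fun_rVP => i.
rewrite (_ : (fun _ => _) = (fun x : E => s * x ord0 i + a ord0 i)); last first.
  by apply/funext => x; rewrite !mxE.
by apply: measurable_funD => //; apply: measurable_funM => //; exact: measurable_rV_coord.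
Qed.

HB.instance Definition _ s a := isMeasurableFun.Build _ _ _ _ (dilate s a)
  (measurable_dilate s a).

(** Both sides agree on rectangles, by the one-dimensional change of variables in each
    coordinate. *)
Lemma lebesgue_rV_dilate (s : R) (a : E) (A : set E) : 0 < s -> measurable A ->
  ((s ^+ n)%:E * leb (dilate s a @^-1` A) = leb A)%E.
Proof.
move=> s0 mA; pose s' := NngNum (exprn_ge0 n (ltW s0)).
transitivity (mscale s' (mpushforward leb (dilate s a)) A); first by [].
apply/esym.
pose g (k : nat) : set (measurableTypeR R) := `[(- k%:R), k%:R]%classic.
have mg k : measurable (g k) by exact: measurable_itv.
apply: (@measure_unique_rectangle _ _ _ _ R _ _ mcoord genE leb
    (mscale s' (mpushforward leb (dilate s a))) g) => //.
- apply/seteqP; split => // x _.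
  exists (\max_(i < n) (Num.truncn `|x ord0 i|).+1)%N => // i.
  rewrite /g /= in_itv/= -ler_norml (le_trans (ltW (truncnS_gt _)))// ler_nat.
  exact: (leq_bigmax_cond (F := fun i => (Num.truncn `|x ord0 i|).+1)).
- move=> k; rewrite [ltLHS](lebesgue_rV_rectangle (fun=> mg k)).
  suff : (\prod_(i < n) (@lebesgue_measure R) (g k))%E \is a fin_num.
    by rewrite fin_numElt => /andP[].
  apply: (big_ind (fun x : \bar R => x \is a fin_num)) => // [u v|i _]; first exact: fin_numM.
  by rewrite lebesgue_measure_itv/=; case: ifP => _.
- move=> B mB; apply: (etrans (lebesgue_rV_rectangle mB)).
  transitivity ((s ^+ n)%:E * leb (dilate s a @^-1` rect B))%E; last by [].
  have -> : dilate s a @^-1` rect B = rect (fun i => affine s (a ord0 i) @^-1` (B i)).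
    by apply/seteqP; split => x /= h i; have := h i; rewrite /dilate /affine !mxE.
  have mB' i : measurable (affine s (a ord0 i) @^-1` B i).
    by rewrite -[X in measurable X]setTI; exact: measurable_affine.
  rewrite lebesgue_rV_rectangle//.
  under eq_bigr => i _ do rewrite -(lebesgue_measure_affine (a ord0 i) s0 (mB i)).
  rewrite big_split/=; congr (_ * _)%E.
  by rewrite prodEFin prodr_const card_ord.
Qed.

Lemma ge0_integral_dilate (s : R) (a : E) (f : E -> \bar R) : 0 < s ->
  measurable_fun [set: E] f -> (forall x, 0 <= f x)%E ->
  (\int[leb]_x f x = (s ^+ n)%:E * \int[leb]_x f (dilate s a x))%E.
Proof.
move=> s0 mf f0; pose s' := NngNum (exprn_ge0 n (ltW s0)).
rewrite (eq_measure_integral (mscale s' (mpushforward leb (dilate s a)))); last first.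
  by move=> A mA _ /=; rewrite -(lebesgue_rV_dilate a s0 mA).
rewrite (ge0_integral_mscale (mpushforward leb (dilate s a)))//.
by rewrite (ge0_integral_mpushforward leb (dilate s a)).
Qed.

Lemma integrable_dilate (s : R) (a : E) (f : E -> R) : 0 < s ->
  leb.-integrable setT (EFin \o f) -> leb.-integrable setT (EFin \o (fun x => f (dilate s a x))).
Proof.
move=> s0 /integrableP[mf fi]; apply/integrableP; split.
  exact: (measurableT_comp mf (measurable_dilate s a)).
move: fi; rewrite (@ge0_integral_dilate s a (fun x => `|(f x)%:E|)%E)//; last first.
  exact: measurableT_comp.
have sn : (0 < (s ^+ n)%:E)%E by rewrite lte_fin exprn_gt0.
have h (J : \bar R) : ((s ^+ n)%:E * J < +oo -> J < +oo)%E.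
  by case: J => [r|//|//]; rewrite ?ltry// gt0_muley.
exact: h.
Qed.

Lemma Rintegral_dilate (s : R) (a : E) (f : E -> R) : 0 < s ->
  leb.-integrable setT (EFin \o f) ->
  \int[leb]_x f x = s ^+ n * \int[leb]_x f (dilate s a x).
Proof.
move=> s0 fi; have mF := measurable_int leb fi.
have sn0 : 0 < s ^+ n by rewrite exprn_gt0.
have fi' := integrable_dilate a s0 fi.
rewrite /Rintegral [in LHS]integralE [in RHS]integralE.
have Ep : (\int[leb]_x (fun x => (f (dilate s a x))%:E)^\+ x = \int[leb]_x (EFin \o f)^\+ (dilate s a x))%E.
  by apply: eq_integral => x _; rewrite !funeposE.
have En : (\int[leb]_x (fun x => (f (dilate s a x))%:E)^\- x = \int[leb]_x (EFin \o f)^\- (dilate s a x))%E.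
  by apply: eq_integral => x _; rewrite !funenegE.
have hp := integrable_pos_fin_num measurableT fi'.
have hn := integrable_neg_fin_num measurableT fi'.
rewrite Ep in hp *; rewrite En in hn *.
rewrite (ge0_integral_dilate a s0 (measurable_funepos mF))//.
rewrite (ge0_integral_dilate a s0 (measurable_funeneg mF))//.
by rewrite -(fineK hp) -(fineK hn) -!EFinM -!EFinB /= mulrBr.
Qed.

End lebesgue_rV_affine.

Section euclidean_geometry.
Context {R : realType} {n : nat}.
Local Notation E := 'rV[R]_n.
Local Notation leb := (@lebesgue_rV R n).
Implicit Types x y : E.

Lemma dotvC x y : dotv x y = dotv y x.
Proof. by apply: eq_bigr => i _; rewrite mulrC. Qed.

Lemma dotvDl x y z : dotv (x + y) z = dotv x z + dotv y z.
Proof. by rewrite /dotv -big_split; apply: eq_bigr => i _; rewrite mxE mulrDl. Qed.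

Lemma dotvZl (a : R) x y : dotv (a *: x) y = a * dotv x y.
Proof. by rewrite /dotv mulr_sumr; apply: eq_bigr => i _; rewrite mxE mulrA. Qed.

Lemma dotvDr x y z : dotv x (y + z) = dotv x y + dotv x z.
Proof. by rewrite dotvC dotvDl !(dotvC x). Qed.

Lemma dotvZr (a : R) x y : dotv x (a *: y) = a * dotv x y.
Proof. by rewrite dotvC dotvZl dotvC. Qed.

Lemma dotvNl x y : dotv (- x) y = - dotv x y.
Proof. by rewrite -scaleN1r dotvZl mulN1r. Qed.

Lemma dotv_ge0 x : 0 <= dotv x x.
Proof. by apply: sumr_ge0 => i _; rewrite -expr2 sqr_ge0. Qed.

Lemma enorm_ge0 x : 0 <= enorm x. Proof. exact: sqrtr_ge0. Qed.

Lemma enorm_sqr x : enorm x ^+ 2 = dotv x x.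
Proof. by rewrite sqr_sqrtr// dotv_ge0. Qed.

Lemma enormZ (a : R) x : enorm (a *: x) = `|a| * enorm x.
Proof. by rewrite /enorm dotvZl dotvZr mulrA -expr2 sqrtrM ?sqr_ge0// sqrtr_sqr. Qed.

Lemma enormN x : enorm (- x) = enorm x.
Proof. by rewrite -scaleN1r enormZ normrN1 mul1r. Qed.

Lemma dotv_cauchy x y : dotv x y <= enorm x * enorm y.
Proof.
have [y0|y0] := eqVneq (enorm y) 0.
  have yi i : y ord0 i = 0.
    apply/eqP; rewrite -sqrf_eq0 expr2.
    have := enorm_sqr y; rewrite y0 expr0n /= => /esym/eqP.
    rewrite psumr_eq0; last by move=> j _; rewrite -expr2 sqr_ge0.
    by move=> /allP /(_ i) /=; rewrite mem_index_enum => /(_ isT).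
  by rewrite y0 mulr0 /dotv big1// => i _; rewrite yi mulr0.
have y1 : 0 < enorm y by rewrite lt_def y0 enorm_ge0.
have x1 := enorm_ge0 x.
have := dotv_ge0 (enorm y *: x - enorm x *: y).
rewrite -scaleNr dotvDl !dotvDr !dotvZl !dotvZr (dotvC y x) -!enorm_sqr => h.
rewrite -subr_ge0 -(pmulr_rge0 _ y1).
have [x0|xn0] := eqVneq (enorm x) 0.
  have xi i : x ord0 i = 0.
    apply/eqP; rewrite -sqrf_eq0 expr2.
    have := enorm_sqr x; rewrite x0 expr0n /= => /esym/eqP.
    rewrite psumr_eq0; last by move=> j _; rewrite -expr2 sqr_ge0.
    by move=> /allP /(_ i) /=; rewrite mem_index_enum => /(_ isT).
  by rewrite x0 mul0r sub0r /dotv big1 ?oppr0 ?mulr0// => i _; rewrite xi mul0r.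
have x2 : 0 < enorm x by rewrite lt_def xn0 x1.
have xy : 0 < 2 * enorm x by rewrite mulr_gt0.
rewrite -(pmulr_rge0 _ xy); apply: le_trans h _; rewrite le_eqVlt; apply/orP; left.
by apply/eqP; ring.
Qed.

Lemma enormD x y : enorm (x + y) <= enorm x + enorm y.
Proof.
rewrite -(@ler_pXn2r _ 2)// ?nnegrE ?addr_ge0 ?enorm_ge0//.
rewrite enorm_sqr dotvDl !dotvDr (dotvC y x) sqrrD !enorm_sqr.
have := dotv_cauchy x y; lra.
Qed.

Lemma enormB x y : enorm (x - y) <= enorm x + enorm y.
Proof. by rewrite -(enormN y) enormD. Qed.

Lemma coord_le_enorm x i : `|x ord0 i| <= enorm x.
Proof.
rewrite -(@ler_pXn2r _ 2)// ?nnegrE ?enorm_ge0// enorm_sqr real_normK ?num_real//.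
rewrite /dotv (bigD1 i)//= -expr2 lerDl; apply: sumr_ge0 => j _; rewrite -expr2 sqr_ge0//.
Qed.

Lemma measurable_dotv y : measurable_fun [set: E] (fun x => dotv x y).
Proof.
apply: measurable_sum => i; apply: measurable_funM => //; exact: measurable_rV_coord.
Qed.

Lemma measurable_enorm : measurable_fun [set: E] (@enorm R n).
Proof.
rewrite (_ : @enorm R n = Num.sqrt \o (fun x => dotv x x))//; apply: measurableT_comp.
  by apply: continuous_measurable_fun; exact: sqrt_continuous.
by apply: measurable_sum => i; apply: measurable_funM; exact: measurable_rV_coord.
Qed.

Lemma measurable_eball (r : R) : measurable (eball r : set E).
Proof.
by rewrite -[X in measurable X]setTI; apply: measurable_fun_ltr => //; exact: measurable_enorm.
Qed.

Lemma bounded_eball (r : R) : bounded_set (eball r : set E).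
Proof.
exists `|r|; split; first exact: num_real.
move=> M rM x xr /=; rewrite /eball/= in xr.
have -> : `|x| = mx_norm x by [].
rewrite mx_normrE.
have r0 : 0 <= M by rewrite (le_trans (normr_ge0 r))// ltW.
apply/bigmax_leP; split => // -[i j] _ /=; rewrite ord1.
by rewrite (le_trans (coord_le_enorm _ _))// ltW// (lt_trans xr)// (le_lt_trans (ler_norm _)).
Qed.

Lemma lebesgue_eball_fin (r : R) : (leb (eball r) < +oo)%E.
Proof.
have [r0|r0] := ltP r 0.
  rewrite (_ : eball r = set0) ?measure0//; apply/seteqP; split => x //=.
  by move=> /lt_trans /(_ r0); rewrite ltNge enorm_ge0.
apply: (@le_lt_trans _ _ (leb [set x : E | forall i, - r <= x ord0 i <= r])).
  have mb : measurable [set x : E | forall i, - r <= x ord0 i <= r].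
    apply: (@measurable_rectangle _ _ E (measurableTypeR R) 'I_n (fun i x => x ord0 i) _
      (fun=> [set z | - r <= z <= r])).
      by move=> i; exact: measurable_rV_coord.
    move=> i; rewrite (_ : mkset _ = `[- r, r]%classic); first exact: measurable_itv.
    by apply/seteqP; split => z /=; rewrite in_itv.
  apply: le_measure; rewrite ?inE//; first exact: measurable_eball.
  by move=> x /= xr i; rewrite -ler_norml (le_trans (coord_le_enorm x i))// ltW.
rewrite (lebesgue_rV_box (a := fun=> - r) (b := fun=> r)); first exact: ltry.
by move=> i; rewrite -subr_ge0 opprK addr_ge0.
Qed.

Definition ball_volume (r : R) : R := fine (leb (eball r)).

Lemma ball_volumeE (r : R) : leb (eball r) = (ball_volume r)%:E.
Proof. by rewrite /ball_volume fineK// ge0_fin_numE// lebesgue_eball_fin. Qed.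

Lemma ball_volume_scale (r : R) : 0 < r -> ball_volume r = r ^+ n * ball_volume 1.
Proof.
move=> r0; apply: EFin_inj; rewrite EFinM -!ball_volumeE.
rewrite -(lebesgue_rV_dilate 0 r0 (measurable_eball r)); congr (_ * leb _)%E.
apply/seteqP; split => x /=; rewrite /eball /dilate /= addr0 enormZ gtr0_norm// mulrC -ltr_pdivlMr//;
by rewrite divff ?lt0r_neq0.
Qed.

(** The unit ball contains a cube around the origin. *)
Lemma ball_volume1_gt0 : 0 < ball_volume 1.
Proof.
(* a half side for which the vertices of the cube have norm less than 1, also for n = 0 *)
pose e : R := (2 * n.+1%:R)^-1.
have e0 : 0 < e by rewrite invr_gt0 mulr_gt0.
have mb : measurable [set x : E | forall i, - e <= x ord0 i <= e].
  apply: (@measurable_rectangle _ _ E (measurableTypeR R) 'I_n (fun i x => x ord0 i) _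
      (fun=> [set z | - e <= z <= e])).
    by move=> i; exact: measurable_rV_coord.
  move=> i; rewrite (_ : mkset _ = `[- e, e]%classic); first exact: measurable_itv.
  by apply/seteqP; split => z /=; rewrite in_itv.
rewrite -lte_fin -ball_volumeE; apply: (@lt_le_trans _ _ (leb [set x : E | forall i, - e <= x ord0 i <= e])).
  rewrite (lebesgue_rV_box (a := fun=> - e) (b := fun=> e)); last first.
    by move=> i; rewrite -subr_ge0 opprK addr_ge0// ltW.
  by rewrite lte_fin; apply: prodr_gt0 => i _; rewrite opprK addr_gt0.
apply: le_measure; rewrite ?inE//; first exact: measurable_eball.
move=> x /= xe; rewrite /eball /enorm /= -(@ltr_pXn2r _ 2)// ?nnegrE ?sqrtr_ge0// sqr_sqrtr ?dotv_ge0// expr1n.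
apply: (@le_lt_trans _ _ (\sum_(i < n) e ^+ 2)).
  apply: ler_sum => i _; rewrite -expr2 -real_normK ?num_real// lerXn2r ?nnegrE ?(ltW e0)// ler_norml.
  exact: xe.
rewrite sumr_const card_ord -mulr_natl.
have n1 : 0 < n.+1%:R :> R by [].
have ee : e * n.+1%:R = 1 / 2 by rewrite /e invfM; field; rewrite lt0r_neq0.
have ne : n%:R * e <= 1 / 2 by rewrite -ee mulrC ler_wpM2l ?ler_nat// ltW.
have e1 : e <= 1 / 2 by rewrite -ee ler_peMr ?ler1n// ltW.
rewrite expr2 mulrA; nra.
Qed.

Lemma ball_volume_gt0 (r : R) : 0 < r -> 0 < ball_volume r.
Proof. by move=> r0; rewrite ball_volume_scale// mulr_gt0 ?exprn_gt0 ?ball_volume1_gt0. Qed.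

End euclidean_geometry.

(** * Measurability through coordinates *)

Section coordinate_rounding.
Context d (T : measurableType d) (R : realType) (m n : nat).
Variable X : T -> 'M[R]_(m, n).
Hypothesis mX : forall i j, measurable_fun setT (fun t => X t i j).

(** Points of a grid of mesh [k.+1%:R^-1], which is a countable family: this gives access
    to measurability with respect to the coordinates from topological hypotheses. *)
Definition rounding (k : nat) (M : 'M[int]_(m, n)) : 'M[R]_(m, n) :=
  \matrix_(i, j) (k.+1%:R^-1 * (M i j)%:~R).

Definition rounded (k : nat) (x : 'M[R]_(m, n)) : 'M[int]_(m, n) :=
  \matrix_(i, j) Num.floor (k.+1%:R * x i j).

Lemma rounding_close (k : nat) (x : 'M[R]_(m, n)) i j :
  `|x i j - rounding k (rounded k x) i j| < k.+1%:R^-1.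
Proof.
have k0 : 0 < k.+1%:R :> R by [].
rewrite !mxE; have /andP[h1 h2] := floor_itv (k.+1%:R * x i j).
rewrite -[X in X - _](@mulKf _ (k.+1%:R : R)) ?lt0r_neq0// -mulrBr normrM gtr0_norm ?invr_gt0//.
rewrite gtr_pMr ?invr_gt0// ger0_norm ?subr_ge0// ltrBlDr addrC.
by move: h2; rewrite intrD.
Qed.

Lemma measurable_rounded k M : measurable [set t | rounded k (X t) = M].
Proof.
rewrite (_ : mkset _ = \bigcap_(p in [set: 'I_m * 'I_n])
    [set t | Num.floor (k.+1%:R * X t p.1 p.2) = M p.1 p.2]).
  apply: fin_bigcap_measurable => // -[i j] _ /=.
  have mf : measurable_fun setT (fun t => k.+1%:R * X t i j).
    by apply: measurable_funM.
  rewrite (_ : mkset _ = (fun t => k.+1%:R * X t i j) @^-1`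
    [set y | (M i j)%:~R <= y < (M i j + 1)%:~R]).
    rewrite -[X in measurable X]setTI; apply: mf => //.
    rewrite (_ : mkset _ = `[(M i j)%:~R, (M i j + 1)%:~R[%classic); first exact: measurable_itv.
    by apply/seteqP; split => z /=; rewrite in_itv.
  apply/seteqP; split => t /=; first by move=> <-; exact: floor_itv.
  exact: floor_def.
apply/seteqP; split => t /=; first by move=> h [i j] _ /=; rewrite -h mxE.
by move=> h; apply/matrixP => i j; rewrite mxE; exact: (h (i, j) I).
Qed.

Lemma rounding_cvg (x : 'M[R]_(m, n)) : rounding k (rounded k x) @[k --> \oo] --> x.
Proof.
apply/cvgrPdist_lt => e e0; near=> k.
have ke : k.+1%:R^-1 < e by near: k; exact: (near_infty_natSinv_lt (PosNum e0)).
have e0' : 0 < k.+1%:R^-1 :> R by rewrite invr_gt0.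
apply: le_lt_trans ke.
have -> : `|x - rounding k (rounded k x)| = mx_norm (x - rounding k (rounded k x)) by [].
rewrite mx_normrE; apply/bigmax_leP; split; first exact: ltW.
by move=> -[i j] _; rewrite /= [X in `|X|]mxE [X in _ + X]mxE ltW// rounding_close.
Unshelve. all: end_near. Qed.

(** The value at [X t] is the limit of the values at the grid points nearest to [X t], where
    the parameter runs through a countable set. *)
Lemma caratheodory_measurable (f : T -> 'M[R]_(m, n) -> R) :
  (forall x, measurable_fun setT (f ^~ x)) -> (forall t, continuous (f t)) ->
  measurable_fun setT (fun t => f t (X t)).
Proof.
move=> mf cf.
apply: (@measurable_fun_cvg _ _ _ _ (fun k t => f t (rounding k (rounded k (X t))))).
  move=> k _ A mA; rewrite setTI.
  rewrite (_ : _ @^-1` _ = \bigcup_(M : 'M[int]_(m, n))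
    ([set t | rounded k (X t) = M] `&` (f ^~ (rounding k M)) @^-1` A)).
    apply: countable_bigcupT_measurable => // M; apply: measurableI.
      exact: measurable_rounded.
    by rewrite -[X in measurable X]setTI; exact: mf.
  apply/seteqP; split => t /=; first by move=> h; exists (rounded k (X t)).
  by move=> [M _ [<-]].
move=> t _; exact: (cvg_comp _ _ (@rounding_cvg (X t)) (cf t (X t))).
Qed.

Lemma continuous_measurable_coords (f : 'M[R]_(m, n) -> R) : continuous f ->
  measurable_fun setT (f \o X).
Proof. by move=> cf; apply: (caratheodory_measurable (f := fun _ => f)). Qed.

(** An open set is the union of the cells whose ball around the grid point it contains. *)
Lemma open_measurable_coords (U : set 'M[R]_(m, n)) : open U -> measurable (X @^-1` U).
Proof.
move=> oU.
pose box k (M : 'M[int]_(m, n)) := ball (rounding k M) (k.+1%:R^-1 : R).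
rewrite (_ : X @^-1` U = \bigcup_(k : nat) \bigcup_(M : 'M[int]_(m, n))
   (if `[< box k M `<=` U >] then [set t | rounded k (X t) = M] else set0)).
  apply: bigcupT_measurable => k; apply: countable_bigcupT_measurable => // M.
  by case: ifPn => // _; exact: measurable_rounded.
have inbox k (x : 'M[R]_(m, n)) : ball (rounding k (rounded k x)) (k.+1%:R^-1 : R) x.
  split=> [|i j]; first by rewrite invr_gt0.
  by have := rounding_close k x i j; rewrite distrC.
apply/seteqP; split => t /=; last first.
  move=> [k _] [M _]; case: ifPn => // /asboolP kMU /= tM.
  by apply: kMU; rewrite /box -tM; exact: inbox.
move=> Ut; have : nbhs (X t) U by apply: open_nbhs_nbhs.
move=> /nbhs_ballP[e /= e0 he].
have e20 : 0 < e / 2 by rewrite divr_gt0.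
have [k _ /(_ k (leqnn _)) ke] := near_infty_natSinv_lt (PosNum e20).
exists k => //; exists (rounded k (X t)) => //; case: ifPn => //= /asboolP; apply.
move=> y ky; apply: he.
apply: (ball_split (z := rounding k (rounded k (X t)))).
  by apply: ball_sym; apply: le_ball (inbox k (X t)); exact: ltW.
by apply: le_ball ky; exact: ltW.
Qed.

End coordinate_rounding.

(** * Smooth functions and smoothing by a probability *)

Section smooth_functions.
Context {R : realType} {d : nat}.
Local Notation E := 'rV[R]_d.
Local Notation e i := (delta_mx ord0 i : E).
Implicit Types f g : E -> R.

Lemma smooth_continuous f : smooth f -> continuous f.
Proof. by move=> sf; exact: (sf [::]).1. Qed.

Lemma smooth_derivable f x i : smooth f -> derivable f x (e i).
Proof. by move=> sf; exact: (sf [::]).2. Qed.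

Lemma pderive_cat s s' f : pderive (s ++ s') f = pderive s (pderive s' f).
Proof. by rewrite /pderive foldr_cat. Qed.

Lemma smooth_pderive s f : smooth f -> smooth (pderive s f).
Proof. by move=> sf s'; rewrite -pderive_cat; exact: sf. Qed.

Lemma is_derive_line f x i (t : R) : derivable f (x + t *: e i) (e i) ->
  is_derive t 1 (fun z : R => f (x + z *: e i)) ('D_(e i) f (x + t *: e i)).
Proof.
have E1 : (fun h : R => h^-1 *: (((fun z : R => f (x + z *: e i)) \o shift t) (h *: 1) -
      f (x + t *: e i))) =
    (fun h : R => h^-1 *: ((f \o shift (x + t *: e i)) (h *: e i) - f (x + t *: e i))).
  apply/funext => h; congr (_ *: (f _ - _)).
  by rewrite /shift/= [_%:A]mulr1 scalerDl addrCA.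
move=> df; apply: DeriveDef; first by rewrite /derivable E1.
by rewrite /derive E1.
Qed.

Lemma smooth_line_bound f i (C : R) : smooth f ->
  (forall x, `|pderive [:: i] f x| <= C) ->
  forall x (t : R), `|f (x + t *: e i) - f x| <= C * `|t|.
Proof.
move=> sf fC x t.
have := @mvt_bound _ (fun z : R => f (x + z *: e i)) (fun z => 'D_(e i) f (x + z *: e i)) C t.
rewrite scale0r addr0; apply => // z; last by move=> _; exact: fC.
by apply: is_derive_line; exact: smooth_derivable.
Qed.

Definition bounded_derivatives f :=
  smooth f /\ forall s, exists C : R, forall x, `|pderive s f x| <= C.

Lemma bounded_derivatives_pderive s f :
  bounded_derivatives f -> bounded_derivatives (pderive s f).
Proof.
move=> [sf fC]; split; first exact: smooth_pderive.
by move=> s'; have [C hC] := fC (s' ++ s); exists C => x; rewrite -pderive_cat.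
Qed.

(** The mean value inequality along the coordinates, one after the other. *)
Lemma bounded_derivatives_lipschitz f : bounded_derivatives f ->
  exists2 C : R, 0 <= C & forall x v : E, `|f (x + v) - f x| <= C * `|v|.
Proof.
move=> [sf fC].
have [C0 hC0] : exists C : 'I_d -> R, forall i x, `|pderive [:: i] f x| <= C i.
  by have /choice[C hC] := fun i => fC [:: i]; exists C.
pose C := \sum_(i < d) `|C0 i|.
have hC i x : `|pderive [:: i] f x| <= C.
  apply: (le_trans (hC0 i x)); apply: (le_trans (ler_norm _)).
  by rewrite /C (bigD1 i)//= lerDl sumr_ge0.
have C_ge0 : 0 <= C by apply: sumr_ge0.
have seqb (l : seq 'I_d) (v : 'I_d -> R) (K : R) x : (forall i, `|v i| <= K) ->
    `|f (x + \sum_(i <- l) v i *: e i) - f x| <= C * K * (size l)%:R.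
  move=> vK; elim: l x => [|i l IH] x.
    by rewrite big_nil addr0 subrr normr0 mulr0.
  rewrite big_cons addrA.
  have := IH (x + v i *: e i); have := smooth_line_bound sf (hC i) x (v i).
  set a := f (x + _ + _); set b := f (x + _); set c := f x => h1 h2.
  rewrite /= -natr1 mulrDr mulr1.
  have -> : a - c = (a - b) + (b - c) by ring.
  rewrite (le_trans (ler_normD _ _))// lerD// (le_trans h1)// ler_wpM2l//.
exists (C * d%:R) => [|x v]; first by rewrite mulr_ge0.
have := seqb (index_enum 'I_d) (v ord0) `|v| x; rewrite -row_sum_delta.
have -> : size (index_enum 'I_d) = d by rewrite -[RHS](card_ord d) cardT enumT.
rewrite [C * d%:R * _]mulrAC; apply.
move=> i; have -> : `|v| = mx_norm v by [].
rewrite mx_normrE; apply/bigmax_geP; right; exists (ord0, i) => //.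
Qed.

Lemma is_derive_mulr (k z : R) : is_derive z 1 (fun t : R => t * k) k.
Proof. by apply: is_derive_eq; rewrite /GRing.scale/=; ring. Qed.

Section smoothing.
Variable mu : {measure set E -> \bar R}.
Hypothesis mu1 : mu setT = 1%E.

(** The average of the translates of [f], which is the convolution with the reflected measure. *)
Definition smoothing f (x : E) : R := \int[mu]_y f (x + y).

Lemma measurable_shift f (x : E) : continuous f ->
  measurable_fun [set: E] (fun y : E => f (x + y)).
Proof.
move=> cf; apply: (@continuous_measurable_coords _ E R 1 d (fun y => x + y)) => //.
move=> i j; rewrite ord1.
rewrite (_ : (fun _ => _) = (fun y : E => x ord0 j + y ord0 j)); last first.
  by apply/funext => y; rewrite !mxE.
by apply: measurable_funD => //; exact: measurable_rV_coord.
Qed.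

Lemma smoothing_integrable f (C : R) x : continuous f -> (forall y, `|f y| <= C) ->
  mu.-integrable setT (EFin \o (fun y : E => f (x + y))).
Proof. by move=> cf fC; apply: (bounded_integrable mu1 (K := C)) => //; exact: measurable_shift. Qed.

Lemma smoothing_bounded f (C : R) x : continuous f -> (forall y, `|f y| <= C) ->
  `|smoothing f x| <= C.
Proof. by move=> cf fC; apply: bounded_Rintegral => //; exact: measurable_shift. Qed.

Lemma smoothing_continuous f : bounded_derivatives f -> continuous (smoothing f).
Proof.
move=> bf; have [C C0 hC] := bounded_derivatives_lipschitz bf.
have cf := smooth_continuous bf.1; have [B hB] := bf.2 [::].
move=> x; apply/(@cvgrPdist_le _ _ _ _ (nbhs_filter x)) => ep ep0.
have Cp : 0 < C + 1 by rewrite ltr_wpDl.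
near=> z.
have zx : `|z - x| <= ep / (C + 1).
  by rewrite distrC; near: z; apply: cvgr_dist_le => //; rewrite divr_gt0.
rewrite distrC /smoothing -RintegralB//; last 2 first.
  exact: (smoothing_integrable (C := B)).
  exact: (smoothing_integrable (C := B)).
apply: bounded_Rintegral => //.
  by apply: measurable_funB; exact: measurable_shift.
move=> y; have := hC (x + y) (z - x).
have -> : x + y + (z - x) = z + y by apply/rowP => j; rewrite !mxE; ring.
move=> h; rewrite (le_trans h)//.
rewrite (@le_trans _ _ (C * (ep / (C + 1))))//; first by rewrite ler_wpM2l.
by rewrite mulrCA ler_piMr ?(ltW ep0)// ler_pdivrMr// mul1r lerDl.
Unshelve. all: end_near. Qed.

(** The Taylor remainder along a coordinate is bounded uniformly, hence also on average. *)
Lemma smoothing_derive f x i : bounded_derivatives f ->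
  is_derive x (e i) (smoothing f) (smoothing (pderive [:: i] f) x).
Proof.
move=> bf; have cf := smooth_continuous bf.1; have [B hB] := bf.2 [::].
have bf1 := bounded_derivatives_pderive [:: i] bf.
have cf1 := smooth_continuous bf1.1; have [B1 hB1] := bf1.2 [::].
have [C hC] := bf1.2 [:: i].
have est (t : R) : `|smoothing f (t *: e i + x) - smoothing f x -
    t * smoothing (pderive [:: i] f) x| <= C * `|t| * `|t|.
  rewrite /smoothing -RintegralZl//; last exact: (smoothing_integrable (C := B1)).
  rewrite -RintegralB//; last 2 first.
    exact: (smoothing_integrable (C := B)).
    exact: (smoothing_integrable (C := B)).
  have mm : measurable_fun [set: E] (fun y : E => t * pderive [:: i] f (x + y)).
    by apply: measurable_funM => //; exact: measurable_shift.
  have mm2 : measurable_fun [set: E] (fun y : E => f (t *: e i + x + y) - f (x + y)).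
    by apply: measurable_funB; exact: measurable_shift.
  rewrite -RintegralB//; last 2 first.
  - apply: (bounded_integrable mu1 (K := B + B)) => // y.
    by rewrite (le_trans (ler_normB _ _))// lerD.
  - apply: (bounded_integrable mu1 (K := `|t| * B1)) => // y.
    by rewrite normrM ler_wpM2l//; exact: hB1.
  apply: bounded_Rintegral => //; first exact: measurable_funB.
  move=> y; have -> : t *: e i + x + y = (x + y) + t *: e i by rewrite -addrA addrC.
  move: (x + y) => w.
  have := @mvt_bound _ (fun z : R => f (w + z *: e i) - z * pderive [:: i] f w)
    (fun z => pderive [:: i] f (w + z *: e i) - pderive [:: i] f w) (C * `|t|) t.
  rewrite scale0r addr0 mul0r subr0 addrAC; apply.
    move=> z; apply: is_deriveB.
      exact: (is_derive_line (@smooth_derivable f (w + z *: e i) i bf.1)).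
    exact: is_derive_mulr.
  move=> z zt; apply: (le_trans (smooth_line_bound bf1.1 hC w z)).
  by rewrite ler_wpM2l// (le_trans _ (hC 0)).
have cv : h^-1 *: ((smoothing f \o shift x) (h *: e i) - smoothing f x) @[h --> 0^'] -->
    smoothing (pderive [:: i] f) x.
  apply/cvgrPdist_le => /= ep ep0.
  have C0 : 0 <= C by exact: le_trans (hC 0).
  have Cp : 0 < C + 1 by rewrite ltr_wpDl.
  near=> h.
  have h0 : h != 0 by near: h; exact: nbhs_dnbhs_neq.
  have hh : `|h| <= ep / (C + 1).
    by near: h; apply: dnbhs0_le; rewrite divr_gt0.
  rewrite distrC -(@ler_pM2l _ `|h|) ?normr_gt0// -normrM mulrBr /GRing.scale/= mulVKf//.
  rewrite (le_trans (est h))// mulrC ler_wpM2l//.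
  rewrite (@le_trans _ _ (C * (ep / (C + 1))))//; first by rewrite ler_wpM2l.
  by rewrite mulrCA ler_piMr ?(ltW ep0)// ler_pdivrMr// mul1r lerDl.
apply: DeriveDef; first by apply/cvg_ex; eexists; exact: cv.
exact: cvg_lim cv.
Unshelve. all: end_near. Qed.

Lemma pderive_smoothing s f : bounded_derivatives f ->
  pderive s (smoothing f) = smoothing (pderive s f).
Proof.
move=> bf; elim: s => //= i s ->; apply/funext => x.
by have [_ ->] := smoothing_derive x i (bounded_derivatives_pderive s bf).
Qed.

Lemma bounded_derivatives_smoothing f : bounded_derivatives f ->
  bounded_derivatives (smoothing f).
Proof.
move=> bf; split=> s; rewrite pderive_smoothing//.
  have bs := bounded_derivatives_pderive s bf.
  split; first exact: smoothing_continuous.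
  by move=> x i; case: (smoothing_derive x i bs).
have [C hC] := bf.2 s; exists C => x; apply: smoothing_bounded => //.
exact: (smooth_continuous (smooth_pderive s bf.1)).
Qed.

End smoothing.
End smooth_functions.

Lemma continuous_sumr (T : topologicalType) (R : realType) (I : Type) (r : seq I)
    (f : I -> T -> R) : (forall i, continuous (f i)) ->
  continuous (fun x => \sum_(i <- r) f i x).
Proof.
move=> cf; elim: r => [|i r IH] x.
  under eq_fun do rewrite big_nil.
  exact: cst_continuous.
under eq_fun do rewrite big_cons.
exact: (continuousD (cf i x) (IH x)).
Qed.

Section compactly_supported.
Context {R : realType} {d : nat}.
Local Notation E := 'rV[R]_d.
Local Notation e i := (delta_mx ord0 i : E).
Implicit Types f g : E -> R.

Lemma pderive_rcons s i f : pderive (rcons s i) f = pderive s ('D_(e i) f).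
Proof. by rewrite -cats1 pderive_cat. Qed.

Lemma pderive0 (U : set E) f s : open U -> (forall x, U x -> f x = 0) ->
  forall x, U x -> pderive s f x = 0.
Proof.
move=> oU f0; elim: s => //= i s IH x Ux.
rewrite (near_eq_derive (g := cst 0)); first by rewrite derive_cst.
by have := open_nbhs_nbhs (conj oU Ux); apply: filterS => y /IH.
Qed.

Lemma compact_bounded_derivatives (K : set E) f : smooth f -> compact K ->
  (forall x, ~ K x -> f x = 0) -> bounded_derivatives f.
Proof.
move=> sf cK f0; split=> // s.
have oK : open (~` K) by apply: closed_openC; apply: compact_closed => //; exact: norm_hausdorff.
have [K0|/set0P Kn] := eqVneq K set0.
  exists 0 => x; rewrite (pderive0 s oK)// ?normr0// K0//.
have cs : {within K, continuous (fun x => `|pderive s f x|)}.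
  apply: continuous_subspaceT => x.
  exact: (continuous_comp ((sf s).1 x) (@norm_continuous _ R _)).
have [c cK' hc] := @compact_EVT_max _ _ _ K Kn cK cs.
exists `|pderive s f c| => x; have [xK|xK] := pselect (K x).
  by apply: hc; rewrite inE.
by rewrite (pderive0 s oK)// normr0.
Qed.

Definition smooth_upto (k : nat) f := forall s : seq 'I_d, (size s <= k)%N ->
  continuous (pderive s f) /\ forall x i, derivable (pderive s f) x (e i).

Lemma smooth_uptoS k f : smooth_upto k.+1 f <->
  (continuous f /\ forall i, (forall x, derivable f x (e i)) /\ smooth_upto k ('D_(e i) f)).
Proof.
split=> [sf|[cf df]].
  split; first exact: (sf [::] _).1.
  move=> i; split=> [x|s sk]; first exact: (sf [::] _).2.
  by rewrite -pderive_rcons; apply: sf; rewrite size_rcons.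
case/lastP => [_|s i]; first by split=> // x i; exact: (df i).1.
by rewrite size_rcons pderive_rcons; exact: (df i).2.
Qed.

Lemma smooth_uptoW k f : smooth_upto k.+1 f -> smooth_upto k f.
Proof. by move=> sf s sk; apply: sf; exact: leqW. Qed.

Lemma smooth_uptoD k f g : smooth_upto k f -> smooth_upto k g -> smooth_upto k (fun x => f x + g x).
Proof.
elim: k f g => [|k IH] f g sf sg.
  case=> //= _; have [cf df] := sf [::] isT; have [cg dg] := sg [::] isT.
  by split=> [x|x i]; [exact: (continuousD (cf x) (cg x))|exact: derivableD (df x i) (dg x i)].
have [cf df] := (smooth_uptoS k f).1 sf; have [cg dg] := (smooth_uptoS k g).1 sg.
apply/smooth_uptoS; split=> [x|i]; first exact: (continuousD (cf x) (cg x)).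
have [df1 sf1] := df i; have [dg1 sg1] := dg i.
split=> [x|]; first exact: derivableD.
have -> : 'D_(e i) (fun x => f x + g x) = (fun x => 'D_(e i) f x + 'D_(e i) g x).
  by apply/funext => x; exact: deriveD.
exact: (IH _ _ sf1 sg1).
Qed.

(** The product rule expresses the derivatives by products in which one factor is a derivative,
    hence differentiable one time less often: this forces an induction on a finite order. *)
Lemma smooth_uptoM k f g : smooth_upto k f -> smooth_upto k g -> smooth_upto k (fun x => f x * g x).
Proof.
elim: k f g => [|k IH] f g sf sg.
  case=> //= _; have [cf df] := sf [::] isT; have [cg dg] := sg [::] isT.
  by split=> [x|x i]; [exact: (continuousM (cf x) (cg x))|exact: derivableM (df x i) (dg x i)].
have [cf df] := (smooth_uptoS k f).1 sf; have [cg dg] := (smooth_uptoS k g).1 sg.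
apply/smooth_uptoS; split=> [x|i]; first exact: (continuousM (cf x) (cg x)).
have [df1 sf1] := df i; have [dg1 sg1] := dg i.
split=> [x|]; first exact: derivableM.
have -> : 'D_(e i) (fun x => f x * g x) = (fun x => f x * 'D_(e i) g x + g x * 'D_(e i) f x).
  by apply/funext => x; exact: deriveM.
apply: smooth_uptoD; first exact: (IH _ _ (smooth_uptoW sf) sg1).
exact: (IH _ _ (smooth_uptoW sg) sf1).
Qed.

Lemma smoothD f g : smooth f -> smooth g -> smooth (fun x => f x + g x).
Proof.
by move=> sf sg s; apply: (smooth_uptoD (k := size s)) => //.
Qed.

Lemma smoothM f g : smooth f -> smooth g -> smooth (fun x => f x * g x).
Proof.
by move=> sf sg s; apply: (smooth_uptoM (k := size s)) => //.
Qed.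

Lemma enorm_continuous : continuous (@enorm R d).
Proof.
move=> x.
have cd : continuous (fun y : E => dotv y y).
  by apply: continuous_sumr => i y; apply: continuousM; exact: coord_continuous.
exact: (continuous_comp (cd x) (@sqrt_continuous R _)).
Qed.

(** All the derivatives vanish outside the ball, where alone the weights could grow. *)
Lemma compact_support_schwartz (r : R) f : bounded_derivatives f ->
  (forall x, r < enorm x -> f x = 0) -> schwartz f.
Proof.
move=> [sf fC] f0; split=> // k s; have [C hC] := fC s.
have C0 : 0 <= C by exact: le_trans (hC 0).
exists ((1 + `|r|) ^+ k * C) => x.
have [rx|xr] := ltP r (enorm x).
  rewrite (@pderive0 [set x | r < enorm x] f s) ?normr0 ?mulr0 ?mulr_ge0 ?exprn_ge0 ?addr_ge0//.
  rewrite (_ : mkset _ = @enorm R d @^-1` [set z | r < z])//.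
  by apply: open_comp => [y _|]; [exact: enorm_continuous|exact: open_gt].
rewrite ler_pM// ?exprn_ge0 ?addr_ge0 ?enorm_ge0// lerXn2r ?nnegrE ?addr_ge0 ?enorm_ge0//.
by rewrite lerD2l (le_trans xr)// ler_norm.
Qed.

End compactly_supported.

Section window_energy.
Context {R : realType} {d : nat}.
Local Notation E := 'rV[R]_d.
Local Notation leb := (@lebesgue_rV R d).
Variable h : E -> R[i].
Hypothesis h_test : test_function (eball 1) h.

(** The nonnegative test function of integral 1 by which indicators of balls are smoothed. *)
Definition energy (x : E) : R := complex.Re (h x) ^+ 2 + complex.Im (h x) ^+ 2.

Lemma energyE x : energy x = Normc.normc (h x) ^+ 2.
Proof. by rewrite /energy; case: (h x) => a b /=; rewrite sqr_sqrtr// addr_ge0 ?sqr_ge0. Qed.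

Lemma energy_ge0 x : 0 <= energy x.
Proof. by rewrite /energy addr_ge0 ?sqr_ge0. Qed.

Lemma test_function_outside x : 1 <= enorm x -> h x = 0.
Proof.
case: h_test => _ _ sub hx; apply/eqP/negP => /negP hn0.
have : closure [set x | h x != 0] x by apply: subset_closure.
by move=> /sub; rewrite /eball/= ltNge hx.
Qed.

Lemma energy_outside x : 1 <= enorm x -> energy x = 0.
Proof. by move=> hx; rewrite /energy test_function_outside//= expr0n/= addr0. Qed.

Lemma test_bounded_derivatives :
  bounded_derivatives (fun x => complex.Re (h x)) /\
  bounded_derivatives (fun x => complex.Im (h x)).
Proof.
case: h_test => -[sr si] cK _.
have hK x : ~ closure [set x | h x != 0] x -> h x = 0.
  move=> xK; apply/eqP/negP => /negP hn0; apply: xK.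
  exact: subset_closure.
by split; apply: (compact_bounded_derivatives _ cK) => // x /hK ->.
Qed.

Lemma energy_bounded_derivatives : bounded_derivatives energy.
Proof.
case: (h_test) => -[sr si] cK _; apply: (compact_bounded_derivatives _ cK).
  rewrite (_ : energy = (fun x => complex.Re (h x) * complex.Re (h x) + complex.Im (h x) * complex.Im (h x))).
    exact: (smoothD (smoothM sr sr) (smoothM si si)).
  by apply/funext => x; rewrite /energy !expr2.
move=> x xK; have hx : h x = 0.
  apply/eqP/negP => /negP hn0; apply: xK; exact: subset_closure.
by rewrite /energy hx /= expr0n/= addr0.
Qed.

Lemma energy_schwartz : schwartz energy.
Proof.
apply: (compact_support_schwartz (r := 1)) energy_bounded_derivatives _ => x xr.
by apply: energy_outside; exact: ltW.
Qed.

End window_energy.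

(** * The uniform law on a ball and its Fourier transform *)

Section density.
Context d (T : measurableType d) (R : realType).
Variables (mu nu : {measure set T -> \bar R}) (p : T -> R).
Hypotheses (mp : measurable_fun setT p) (p0 : forall x, 0 <= p x).
Hypothesis nuE : forall A, measurable A -> nu A = (\int[mu]_(x in A) (p x)%:E)%E.

Lemma Rintegral_density (f : T -> R) : measurable_fun setT f ->
  \int[nu]_x f x = \int[mu]_x (f x * p x).
Proof.
move=> mf; rewrite /Rintegral; congr fine; rewrite integralE [RHS]integralE.
have mF : measurable_fun setT (EFin \o f) by exact/measurable_EFinP.
have mP : measurable_fun setT (EFin \o p) by exact/measurable_EFinP.
rewrite (ge0_integral_density _ _ nuE)//; last exact: measurable_funepos.
rewrite (ge0_integral_density _ _ nuE)//; last exact: measurable_funeneg.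
congr (_ - _)%E; apply: eq_integral => x _.
  by rewrite !funeposE EFinM maxe_pMl ?lee_fin// mul0e.
by rewrite !funenegE EFinM -mulNe maxe_pMl ?lee_fin// mul0e.
Qed.

End density.

(** The memberships of a point in two translates of a ball, in an outer ball and in an inner
    ball: the translates differ only in the shell between the latter. *)
Lemma indicator_shell (R : realType) (b1 b2 b3 b4 : bool) :
  (b4 -> [&& b1, b2 & b3]) -> (~~ b3 -> ~~ b1 && ~~ b2) ->
  `|b1%:R - b2%:R| <= b3%:R - b4%:R :> R.
Proof.
by case: b1 b2 b3 b4 => [] [] [] [] //= h1 h2;
  rewrite ?subrr ?sub0r ?subr0 ?normrN ?normr1 ?normr0//;
  solve [by have := h1 isT|by have := h2 isT].
Qed.

Section uniform_ball.
Context {R : realType} {n : nat}.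
Local Notation E := 'rV[R]_n.
Local Notation leb := (@lebesgue_rV R n).

Lemma in_eball (r : R) (x : E) : (x \in eball r) = (enorm x < r).
Proof. by apply/idP/idP; rewrite inE. Qed.

Lemma integrable_indic_eball (r : R) :
  leb.-integrable setT (EFin \o (\1_(eball r) : E -> R)).
Proof.
have mB := @measurable_eball R n r.
apply/integrableP; split; first by apply/measurable_EFinP; exact: measurable_indic.
rewrite (eq_integral (fun x => (\1_(eball r) x)%:E)); last first.
  by move=> x _ /=; rewrite ger0_norm.
by rewrite (integral_indic leb measurableT mB) setIT lebesgue_eball_fin.
Qed.

Lemma Rintegral_indic_eball (r : R) : \int[leb]_x (\1_(eball r) x : R) = ball_volume (n := n) r.
Proof.
have mB := @measurable_eball R n r.
by rewrite /Rintegral (integral_indic leb measurableT mB) setIT.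
Qed.

Definition uniform_ball (r : R) : probability E R :=
  mnormalize (mrestr leb (measurable_eball r)) \d_(0 : E).

Definition ball_density (r : R) (x : E) : R := (ball_volume (n := n) r)^-1 * \1_(eball r) x.

Lemma measurable_ball_density r : measurable_fun setT (ball_density r).
Proof. by apply: measurable_funM => //; apply: measurable_indic; exact: measurable_eball. Qed.

Lemma ball_density_ge0 r x : 0 < r -> 0 <= ball_density r x.
Proof. by move=> r0; rewrite mulr_ge0 ?invr_ge0 ?(ltW (ball_volume_gt0 _))//. Qed.

Lemma uniform_ballE (r : R) (A : set E) : 0 < r -> measurable A ->
  uniform_ball r A = ((ball_volume (n := n) r)^-1%:E * leb (A `&` eball r))%E.
Proof.
move=> r0 mA; have v0 := @ball_volume_gt0 R n r r0.
rewrite /uniform_ball /mnormalize /= /mnormalize /= /mrestr setTI ball_volumeE eqe (gt_eqF v0)/=.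
by rewrite muleC.
Qed.

Lemma uniform_ball_density (r : R) (A : set E) : 0 < r -> measurable A ->
  uniform_ball r A = (\int[leb]_(x in A) (ball_density r x)%:E)%E.
Proof.
move=> r0 mA; rewrite uniform_ballE//.
have v0 := @ball_volume_gt0 R n r r0.
under eq_integral => x _ do rewrite EFinM.
rewrite ge0_integralZl//.
- by rewrite (integral_indic leb mA (measurable_eball r)) setIC.
- by apply: measurable_funTS; apply/measurable_EFinP; apply: measurable_indic; exact: measurable_eball.
- by rewrite lee_fin invr_ge0 ltW.
Qed.

Lemma Rintegral_uniform_ball (r : R) (f : E -> R) : 0 < r -> measurable_fun setT f ->
  \int[uniform_ball r]_x f x = \int[leb]_x (f x * ball_density r x).
Proof.
move=> r0 mf; apply: Rintegral_density => //; first exact: measurable_ball_density.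
  by move=> x; exact: ball_density_ge0.
by move=> A mA; exact: uniform_ball_density.
Qed.

(** Shifting the ball by a half period [a] of [k] changes the sign of [k], while only
    a shell of relative volume tending to 0 is affected by the shift. *)
Lemma ball_average_half_period (r : R) (a : E) (k : E -> R) : enorm a < r ->
  measurable_fun setT k -> (forall x, `|k x| <= 1) -> (forall x, k (x + a) = - k x) ->
  `|\int[uniform_ball r]_x k x| <=
    (ball_volume (n := n) (r + enorm a) - ball_volume (n := n) (r - enorm a)) / ball_volume (n := n) r.
Proof.
move=> ar mk k1 ka; have a0 := enorm_ge0 a.
have r0 : 0 < r by exact: le_lt_trans ar.
have v0 := @ball_volume_gt0 R n r r0.
rewrite Rintegral_uniform_ball//.
have mball s : measurable (eball s : set E) by exact: measurable_eball.
have bint (A : set E) (s : R) : measurable A -> A `<=` eball s ->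
    leb.-integrable setT (EFin \o (fun x => k x * \1_A x)).
  move=> mA As.
  have i1 : leb.-integrable setT (EFin \o (\1_(eball s) : E -> R)).
    exact: integrable_indic_eball.
  apply: (le_integrable measurableT _ _ i1).
    by apply/measurable_EFinP; apply: measurable_funM => //; exact: measurable_indic.
  move=> x _ /=; rewrite lee_fin normrM.
  apply: (@le_trans _ _ (1 * `|\1_(eball s) x|)); last by rewrite mul1r.
  apply: ler_pM => //.
  by rewrite !ger0_norm// !indicE ler_nat; case: (boolP (x \in A)) => //; rewrite inE => /As xs; rewrite mem_set.
pose B' : set E := [set x | eball r (x + a)].
have mB' : measurable B'.
  rewrite (_ : B' = dilate 1 a @^-1` eball r).
    by rewrite -[X in measurable X]setTI; exact: measurable_dilate.
  by apply/seteqP; split => x /=; rewrite /B' /dilate /= scale1r.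
have B'r : B' `<=` eball (r + enorm a).
  move=> x; rewrite /B' /eball /= => xr; rewrite -[x](addrK a).
  by rewrite (le_lt_trans (enormB _ _))// ltrD2r.
have Ir := bint _ _ (mball r) (fun x h => h).
have Ir' := bint _ _ mB' B'r.
set I := (X in `|X| <= _).
have I1 : I = (ball_volume (n := n) r)^-1 * \int[leb]_x (k x * \1_(eball r) x).
  rewrite -RintegralZl//; apply: eq_Rintegral => x _; rewrite /ball_density; ring.
have I2 : \int[leb]_x (k x * \1_(eball r) x) = - \int[leb]_x (k x * \1_B' x).
  rewrite (Rintegral_dilate a ltr01 Ir) expr1n mul1r -[RHS]mulN1r -RintegralZl//.
  apply: eq_Rintegral => x _; rewrite /dilate /= scale1r ka mulN1r -mulNr; congr (_ * _).
have I3 : \int[leb]_x (k x * \1_(eball r) x) *+ 2 =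
    \int[leb]_x (k x * \1_(eball r) x - k x * \1_B' x).
  by rewrite RintegralB// mulr2n {1}I2 addrC.
have shell x : `|k x * \1_(eball r) x - k x * \1_B' x| <=
    \1_(eball (r + enorm a)) x - \1_(eball (r - enorm a)) x.
  rewrite -mulrBr normrM (@le_trans _ _ (`|\1_(eball r) x - \1_B' x|))//.
    by rewrite ler_piMl.
  have hB' : (x \in B') = (enorm (x + a) < r) by apply/idP/idP; rewrite inE.
  have h1 := enormB (x + a) a; rewrite addrK in h1.
  have h2 := enormD x a.
  rewrite !indicE hB' !in_eball; apply: indicator_shell => [h3|].
    by apply/and3P; split; lra.
  rewrite -leNgt => h3; rewrite -!leNgt; apply/andP; split; lra.
rewrite I1 normrM ger0_norm ?invr_ge0 ?(ltW v0)// mulrC ler_pM2r ?invr_gt0//.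
have intd : leb.-integrable setT (EFin \o (fun x => k x * \1_(eball r) x - k x * \1_B' x)).
  exact: (integrableB measurableT Ir Ir').
have ints : leb.-integrable setT (EFin \o (fun x : E => \1_(eball (r + enorm a)) x - \1_(eball (r - enorm a)) x)).
  exact: (integrableB measurableT (integrable_indic_eball _) (integrable_indic_eball _)).
apply: (@le_trans _ _ `|(\int[leb]_x (k x * \1_(eball r) x)) *+ 2|).
  by rewrite normrMn mulr2n lerDl.
rewrite I3 (le_trans (le_normr_Rintegral measurableT intd))//.
rewrite -!Rintegral_indic_eball -RintegralB//; try exact: integrable_indic_eball.
by apply: le_Rintegral => //; exact: integrable_norm.
Qed.

End uniform_ball.

Lemma integrableM_bounded d (T : measurableType d) (R : realType)
    (mu : {measure set T -> \bar R}) (f g : T -> R) (K : R) :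
  mu.-integrable setT (EFin \o f) -> measurable_fun setT g -> (forall x, `|g x| <= K) ->
  mu.-integrable setT (EFin \o (fun x => f x * g x)).
Proof.
move=> fi mg gK; have /measurable_EFinP mf := measurable_int mu fi.
apply: (le_integrable measurableT _ _ (integrableZl measurableT K fi)).
  by apply/measurable_EFinP; exact: measurable_funM.
move=> x _ /=; rewrite lee_fin !normrM mulrC; apply: ler_pM => //.
by apply: le_trans (gK x) _; exact: ler_norm.
Qed.

Section smoothing_fourier.
Context {R : realType} {d : nat}.
Local Notation E := 'rV[R]_d.
Local Notation leb := (@lebesgue_rV R d).
Variable mu : probability E R.

Lemma measurable_continuous_rV (f : E -> R) : continuous f -> measurable_fun setT f.
Proof.
move=> cf; apply: (@continuous_measurable_coords _ E R 1 d id _ f cf) => i j.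
by rewrite ord1; exact: measurable_rV_coord.
Qed.

(** Fubini, then the invariance of Lebesgue measure under the translation by [y]. *)
Lemma smoothing_fubini (f g : E -> R) (C K : R) : continuous f -> (forall x, `|f x| <= C) ->
  leb.-integrable setT (EFin \o f) -> measurable_fun setT g -> (forall x, `|g x| <= K) ->
  leb.-integrable setT (EFin \o (fun x => smoothing mu f x * g x)) /\
  \int[leb]_x (smoothing mu f x * g x) = \int[mu]_y \int[leb]_x (f x * g (x - y)).
Proof.
move=> cf fC fi mg gK.
have mf := measurable_continuous_rV cf.
pose H (z : E * E) : R := f (z.1 + z.2) * g z.1.
have mH : measurable_fun setT H.
  apply: measurable_funM; last by apply: measurableT_comp.
  apply: (@continuous_measurable_coords _ (E * E)%type R 1 d (fun z => z.1 + z.2)) => // i j.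
  rewrite ord1 (_ : (fun _ => _) = (fun z : E * E => z.1 ord0 j + z.2 ord0 j)); last first.
    by apply/funext => z; rewrite mxE.
  apply: measurable_funD; first exact: (measurableT_comp (measurable_rV_coord j) measurable_fst).
  exact: (measurableT_comp (measurable_rV_coord j) measurable_snd).
have mH' : measurable_fun setT (EFin \o H) by exact/measurable_EFinP.
have fi' y : leb.-integrable setT (EFin \o (fun x => f (x + y))).
  by have := integrable_dilate y ltr01 fi; congr (leb.-integrable _ _); apply/funext => x; rewrite /= /dilate scale1r.
have gi y : leb.-integrable setT (EFin \o (fun x => f (x + y) * g x)).
  exact: integrableM_bounded (fi' y) mg gK.
have Hi : (leb \x mu)%E.-integrable setT (EFin \o H).
  apply/integrable21ltyP => //.
  apply: (@le_lt_trans _ _ (\int[mu]_y (`|K|%:E * \int[leb]_x `|(f x)%:E|))%E).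
    apply: ge0_le_integral => //.
    - by move=> y _; apply: integral_ge0.
    - have := @measurable_fun_fubini_tonelli_G _ _ E E R leb (fun z => `|(H z)%:E|)%E.
      by apply => //; exact: measurableT_comp.
    - move=> y _; have Ey : (\int[leb]_x `|(f x)%:E| = \int[leb]_x `|(f (x + y))%:E|)%E.
        rewrite (@ge0_integral_dilate R d 1 y (fun x => `|(f x)%:E|)%E)//.
          by rewrite expr1n mul1e; apply: eq_integral => x _; rewrite /dilate scale1r.
        by apply: measurableT_comp => //; exact/measurable_EFinP.
      rewrite Ey -ge0_integralZl//; last first.
        apply: measurableT_comp => //; by have /measurable_int := fi' y.
      apply: ge0_le_integral => //.
      + by apply: measurableT_comp => //; have /measurable_int := gi y.
      + apply: measurable_funeM; apply: measurableT_comp => //; by have /measurable_int := fi' y.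
      + move=> x _; rewrite /H/= -EFinM lee_fin normrM mulrC ler_wpM2r//.
        by rewrite (le_trans (gK x))// ler_norm.
  set c := (_ * _)%E; have -> : (\int[mu]__ c)%E = (c * mu setT)%E by exact: integral_cst.
  rewrite probability_setT mule1 /c.
  have /integrableP[_] := fi.
  set J := (\int[leb]_x `|(EFin \o f) x|)%E => Jf.
  have J0 : (0 <= J)%E by apply: integral_ge0.
  have Jfin : J \is a fin_num by rewrite ge0_fin_numE.
  by rewrite -(fineK Jfin) -EFinM ltry.
have mui x : mu.-integrable setT (EFin \o (fun y => f (x + y))).
  exact: (smoothing_integrable (probability_setT mu) x cf fC).
have inner x : (smoothing mu f x * g x)%:E = (\int[mu]_y (H (x, y))%:E)%E.
  rewrite /smoothing -RintegralZr// /Rintegral fineK//.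
  apply: integrable_fin_num => //.
  have := integrableZl measurableT (g x) (mui x).
  by congr (mu.-integrable _ _); apply/funext => y /=; rewrite /H /= mulrC.
split.
  have := integrable_fubini_F Hi; congr (leb.-integrable _ _).
  by apply/funext => x /=; rewrite inner.
rewrite /Rintegral; congr fine.
under eq_integral => x _ do rewrite inner.
rewrite (Fubini Hi); apply: eq_integral => y _ /=.
rewrite -[LHS]fineK; last exact: (integrable_fin_num measurableT (gi y)).
congr EFin; transitivity (\int[leb]_x (f (x + y) * g x)) => //.
have hi : leb.-integrable setT (EFin \o (fun x => f x * g (x - y))).
  have := integrable_dilate (- y) ltr01 (gi y); congr (leb.-integrable _ _).
  by apply/funext => x; rewrite /= /dilate scale1r subrK.
rewrite -[RHS]/(\int[leb]_x (f x * g (x - y))) (Rintegral_dilate y ltr01 hi) expr1n mul1r.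
by apply: eq_Rintegral => x _; rewrite /dilate scale1r addrK.
Qed.

Definition phase (xi x : E) : R := - (2 * pi * dotv x xi).

Definition cos_transform (m : {measure set E -> \bar R}) (f : E -> R) (xi : E) : R :=
  \int[m]_x (f x * cos (phase xi x)).
Definition sin_transform (m : {measure set E -> \bar R}) (f : E -> R) (xi : E) : R :=
  \int[m]_x (f x * sin (phase xi x)).

Lemma measurable_phase xi : measurable_fun setT (phase xi).
Proof. by apply: measurableT_comp => //; apply: measurable_funM => //; exact: measurable_dotv. Qed.

Lemma measurable_cos_phase xi : measurable_fun setT (fun x => cos (phase xi x)).
Proof.
apply: measurableT_comp (measurable_phase xi).
by apply: continuous_measurable_fun; exact: continuous_cos.
Qed.

Lemma measurable_sin_phase xi : measurable_fun setT (fun x => sin (phase xi x)).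
Proof.
apply: measurableT_comp (measurable_phase xi).
by apply: continuous_measurable_fun; exact: continuous_sin.
Qed.

Lemma cos_abs1 (t : R) : `|cos t| <= 1. Proof. by rewrite ler_norml cos_geN1 cos_le1. Qed.
Lemma sin_abs1 (t : R) : `|sin t| <= 1. Proof. by rewrite ler_norml sin_geN1 sin_le1. Qed.

Lemma phaseB xi x y : phase xi (x - y) = phase xi x - phase xi y.
Proof. by rewrite /phase dotvDl dotvNl; ring. Qed.

Lemma fourier_realE (f : E -> R) xi :
  Normc.normc (fourier (fun x => (f x)%:C%C) xi) ^+ 2 =
  cos_transform leb f xi ^+ 2 + sin_transform leb f xi ^+ 2.
Proof.
rewrite /fourier /Cintegral /= sqr_sqrtr ?addr_ge0 ?sqr_ge0//.
congr (_ ^+ 2 + _ ^+ 2); apply: eq_Rintegral => x _ /=; rewrite /phase; ring.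
Qed.

Section transform.
Variables (f : E -> R) (C : R) (xi : E).
Hypotheses (cf : continuous f) (fC : forall x, `|f x| <= C).
Hypothesis fi : leb.-integrable setT (EFin \o f).

Let intc : leb.-integrable setT (EFin \o (fun x => f x * cos (phase xi x))).
Proof. by apply: (integrableM_bounded (K := 1)) => //; [exact: measurable_cos_phase|move=> x; exact: cos_abs1]. Qed.

Let ints : leb.-integrable setT (EFin \o (fun x => f x * sin (phase xi x))).
Proof. by apply: (integrableM_bounded (K := 1)) => //; [exact: measurable_sin_phase|move=> x; exact: sin_abs1]. Qed.

Let c1 : mu.-integrable setT (EFin \o (fun y => cos (phase xi y))).
Proof.
apply: (bounded_integrable (probability_setT mu) (K := 1)); first exact: measurable_cos_phase.
by move=> x; exact: cos_abs1.
Qed.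

Let s1 : mu.-integrable setT (EFin \o (fun y => sin (phase xi y))).
Proof.
apply: (bounded_integrable (probability_setT mu) (K := 1)); first exact: measurable_sin_phase.
by move=> x; exact: sin_abs1.
Qed.

Let Rintegral_lin (m : {measure set E -> \bar R}) (u v : E -> R) (a b : R) :
  m.-integrable setT (EFin \o u) -> m.-integrable setT (EFin \o v) ->
  \int[m]_x (a * u x + b * v x) = a * \int[m]_x u x + b * \int[m]_x v x.
Proof.
move=> ui vi; rewrite RintegralD//; first by rewrite !RintegralZl.
  exact: (integrableZl measurableT a ui).
exact: (integrableZl measurableT b vi).
Qed.

(** The Fourier transform of a convolution is a product. In real terms this is the addition
    theorem for cosine and sine, and the moduli multiply. *)
Lemma smoothing_transform :
  cos_transform leb (smoothing mu f) xi ^+ 2 + sin_transform leb (smoothing mu f) xi ^+ 2 =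
  ((\int[mu]_y cos (phase xi y)) ^+ 2 + (\int[mu]_y sin (phase xi y)) ^+ 2) *
  (cos_transform leb f xi ^+ 2 + sin_transform leb f xi ^+ 2).
Proof.
have -> : cos_transform leb (smoothing mu f) xi =
    cos_transform leb f xi * \int[mu]_y cos (phase xi y) + sin_transform leb f xi * \int[mu]_y sin (phase xi y).
  rewrite [LHS](smoothing_fubini cf fC fi (measurable_cos_phase xi) (fun x => cos_abs1 _)).2.
  rewrite -(Rintegral_lin _ _ c1 s1); apply: eq_Rintegral => y _.
  rewrite /cos_transform /sin_transform mulrC [X in _ = _ + X]mulrC -(Rintegral_lin _ _ intc ints).
  by apply: eq_Rintegral => x _; rewrite phaseB cosB; ring.
have -> : sin_transform leb (smoothing mu f) xi =
    sin_transform leb f xi * \int[mu]_y cos (phase xi y) + (- cos_transform leb f xi) * \int[mu]_y sin (phase xi y).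
  rewrite [LHS](smoothing_fubini cf fC fi (measurable_sin_phase xi) (fun x => sin_abs1 _)).2.
  rewrite -(Rintegral_lin _ _ c1 s1); apply: eq_Rintegral => y _.
  rewrite /cos_transform /sin_transform mulrC mulNr -mulrN [X in _ = _ + X]mulrC -(Rintegral_lin _ _ ints intc).
  by apply: eq_Rintegral => x _; rewrite phaseB sinB; ring.
ring.
Qed.

End transform.
End smoothing_fourier.

Section ball_transform.
Context {R : realType} {d : nat}.
Local Notation E := 'rV[R]_d.

Lemma ball_volume_ratio_cvg (t : R) :
  ball_volume (n := d) (r + t) / ball_volume (n := d) r @[r --> +oo] --> (1 : R).
Proof.
have cv : (1 + t / r) ^+ d @[r --> +oo] --> (1 : R).
  have ct : 1 + t / r @[r --> +oo] --> (1 : R); last first.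
    rewrite -[X in _ --> X](expr1n _ d).
    exact: (cvg_comp _ _ ct (@exprn_continuous R d 1)).
  rewrite -[X in _ --> X](addr0 1); apply: cvgD; first exact: cvg_cst.
  rewrite -[X in _ --> X](mulr0 t); apply: cvgM; first exact: cvg_cst.
  have h : \forall r \near (+oo : set_system R), 0 < r by exact: nbhs_pinfty_gt.
  by apply/(gtr0_cvgV0 h).
apply: cvg_trans cv; apply: near_eq_cvg; near=> r.
have r0 : 0 < r by near: r; exact: nbhs_pinfty_gt.
have rt : 0 < r + t by rewrite -ltrBlDr sub0r; near: r; apply: nbhs_pinfty_gt; exact: num_real.
rewrite ball_volume_scale// (ball_volume_scale r0) -mulf_div divff ?mulr1 ?gt_eqF ?ball_volume1_gt0//.
by rewrite -expr_div_n mulrDl divff ?gt_eqF.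
Unshelve. all: end_near. Qed.

(** The Fourier transform of the uniform law on a large ball vanishes asymptotically away
    from the origin, by a shift over half a period: [a] is chosen such that the phase
    changes by [pi]. *)
Lemma ball_transform_cvg0 (xi : E) : xi != 0 ->
  (\int[uniform_ball r]_y cos (phase xi y)) ^+ 2 +
  (\int[uniform_ball r]_y sin (phase xi y)) ^+ 2 @[r --> +oo] --> (0 : R).
Proof.
move=> xi0.
have xx : 0 < dotv xi xi.
  rewrite lt_def dotv_ge0 andbT; apply: contra xi0 => /eqP x0.
  apply/eqP/rowP => i; rewrite mxE; apply/eqP.
  have := coord_le_enorm xi i; rewrite /enorm x0 sqrtr0.
  by rewrite normr_le0.
pose a : E := (2 * dotv xi xi)^-1 *: xi.
have pa x : phase xi (x + a) = phase xi x - pi.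
  rewrite /phase dotvDl dotvZl; field; rewrite gt_eqF//.
have bnd (k : R -> R) : (forall t, `|k t| <= 1) -> (forall t, k (t - pi) = - k t) -> continuous k ->
    \int[uniform_ball r]_y k (phase xi y) @[r --> +oo] --> (0 : R).
  move=> k1 kpi ck.
  have cv : ball_volume (n := d) (r + enorm a) / ball_volume (n := d) r - ball_volume (n := d) (r - enorm a) / ball_volume (n := d) r
      @[r --> +oo] --> (0 : R).
    rewrite -[X in _ --> X](subrr 1); apply: cvgB; first exact: ball_volume_ratio_cvg.
    exact: (ball_volume_ratio_cvg (- enorm a)).
  apply/cvgrPdist_le => e e0.
  move/cvgrPdist_le : cv => /(_ e e0) cve.
  near=> r; rewrite sub0r normrN.
  have ra : enorm a < r by near: r; apply: nbhs_pinfty_gt; exact: num_real.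
  apply: (le_trans (ball_average_half_period ra _ _ _)).
  - by apply: measurableT_comp (measurable_phase xi); apply: continuous_measurable_fun.
  - by move=> x; exact: k1.
  - by move=> x; rewrite pa kpi.
  - rewrite mulrBl (le_trans (ler_norm _))//.
    have : `|0 - (ball_volume (n := d) (r + enorm a) / ball_volume (n := d) r - ball_volume (n := d) (r - enorm a) / ball_volume (n := d) r)| <= e by near: r.
    by rewrite sub0r normrN.
have cc := bnd cos (@cos_abs1 R) (fun t => _) (@continuous_cos R).
have ss := bnd sin (@sin_abs1 R) (fun t => _) (@continuous_sin R).
rewrite -[X in _ --> X](addr0 0) -{1 2}(mulr0 (0 : R)); apply: cvgD; rewrite ?expr2.
  by apply: cvgM; apply: cc => t; rewrite cosB cospi sinpi; ring.
by apply: cvgM; apply: ss => t; rewrite sinB cospi sinpi; ring.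
Unshelve. all: end_near. Qed.

End ball_transform.

(** * Consistency of the estimated intensity *)

Section kernel_integral.
Context d d' (T : measurableType d) (T' : measurableType d') (R : realType).
Variable k : T -> {measure set T' -> \bar R}.
Hypothesis mk : forall B, measurable B -> measurable_fun setT (fun t => k t B).

Lemma measurable_integral_kernel (f : T' -> \bar R) : measurable_fun setT f ->
  (forall x, 0 <= f x)%E -> measurable_fun setT (fun t => \int[k t]_x f x)%E.
Proof.
move: f; apply: (ge0_measurable_ind (Q := fun f => measurable_fun setT (fun t => \int[k t]_x f x)%E)).
- move=> A mA; rewrite (_ : (fun _ => _) = (fun t => k t A)); first exact: mk.
  by apply/funext => t; rewrite integral_indic// setIT.
- move=> c f c0 mf f0 IH; rewrite (_ : (fun _ => _) = (fun t => c%:E * \int[k t]_x f x)%E).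
    exact: measurable_funeM.
  by apply/funext => t; rewrite ge0_integralZl// lee_fin.
- move=> f1 f2 mf1 f10 mf2 f20 IH1 IH2.
  rewrite (_ : (fun _ => _) = (fun t => \int[k t]_x f1 x + \int[k t]_x f2 x)%E).
    exact: emeasurable_funD.
  by apply/funext => t; rewrite ge0_integralD.
- move=> u f mu0 u0 nd uf IH.
  apply: (emeasurable_fun_cvg (fun n t => \int[k t]_x u n x)%E) => // t _.
  rewrite (eq_integral (fun x => limn (u ^~ x))); last by move=> x _; rewrite (cvg_lim _ (uf x)).
  exact: cvg_monotone_convergence.
Qed.

Lemma measurable_Rintegral_kernel (f : T' -> R) : measurable_fun setT f ->
  measurable_fun setT (fun t => \int[k t]_x f x).
Proof.
move=> mf; have mF : measurable_fun setT (EFin \o f) by exact/measurable_EFinP.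
rewrite (_ : (fun _ => _) = (fun t => fine (\int[k t]_x (EFin \o f)^\+ x - \int[k t]_x (EFin \o f)^\- x)%E)).
  apply: measurableT_comp => //; apply: emeasurable_funB.
    by apply: measurable_integral_kernel => //; exact: measurable_funepos.
  by apply: measurable_integral_kernel => //; exact: measurable_funeneg.
by apply/funext => t; rewrite /Rintegral integralE.
Qed.

End kernel_integral.

Lemma markov_sqr d (T : measurableType d) (R : realType) (P : probability T R)
    (X : T -> R) (e : R) : 0 < e -> measurable_fun setT X ->
  P.-integrable setT (EFin \o (fun t => X t ^+ 2)) ->
  (P [set t | (e <= `|X t|)%R] <= ((\int[P]_t (X t ^+ 2)) / e ^+ 2)%:E)%E.
Proof.
move=> e0 mX X2.
have mA : measurable [set t | (e <= `|X t|)%R].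
  rewrite -[X in measurable X]setTI; apply: measurable_fun_ler => //.
  exact: measurableT_comp.
have e2 : 0 < e ^+ 2 by rewrite exprn_gt0.
rewrite -[leLHS]fineK ?fin_num_measure// lee_fin ler_pdivlMr// mulrC.
rewrite -lee_fin EFinM fineK ?fin_num_measure//.
rewrite [leRHS]fineK; last exact: integrable_fin_num.
rewrite -[X in (_ * P X <= _)%E]setIT -(integral_indic P measurableT mA) -ge0_integralZl//; last 2 first.
- by apply/measurable_EFinP; exact: measurable_indic.
- by rewrite lee_fin ltW.
apply: ge0_le_integral => //.
- by move=> t _; rewrite -EFinM lee_fin mulr_ge0 ?(ltW e2).
- by apply/measurable_EFinP; apply: measurable_funM => //; exact: measurable_indic.
- exact: measurable_int X2.
- move=> t _; rewrite -EFinM lee_fin indicE.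
  case: (boolP (t \in _)) => [|_]; rewrite ?mulr0 ?sqr_ge0// mulr1 inE/= => et.
  by rewrite -(real_normK (num_real (X t))) lerXn2r ?nnegrE ?(ltW e0).
Qed.

Section smoothed_ball.
Context {R : realType} {d : nat}.
Local Notation E := 'rV[R]_d.
Local Notation leb := (@lebesgue_rV R d).
Variable h : E -> R[i].
Hypothesis h_test : test_function (eball 1) h.
Hypothesis h_norm : (\int[leb]_x (Normc.normc (h x) ^+ 2)%:E = 1)%E.
Local Notation p := (energy h).
Local Notation vol := (ball_volume (n := d)).

Lemma energy_continuous : continuous p.
Proof. exact: smooth_continuous (energy_bounded_derivatives h_test).1. Qed.

Lemma energy_measurable : measurable_fun setT p.
Proof. by apply: measurable_continuous_rV; exact: energy_continuous. Qed.

Lemma energy_integral : (\int[leb]_x (p x)%:E = 1)%E.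
Proof. by rewrite -h_norm; apply: eq_integral => x _; rewrite energyE. Qed.

Lemma energy_integrable : leb.-integrable setT (EFin \o p).
Proof.
apply/integrableP; split; first by apply/measurable_EFinP; exact: energy_measurable.
under eq_integral => x _ do rewrite /= ger0_norm ?energy_ge0//.
by rewrite energy_integral ltry.
Qed.

Lemma energy_shift_integral x : \int[leb]_y p (x + y) = 1.
Proof.
have := Rintegral_dilate x ltr01 energy_integrable.
rewrite expr1n mul1r {1}/Rintegral energy_integral /= => ->.
by apply: eq_Rintegral => y _; rewrite /dilate scale1r addrC.
Qed.

Lemma energy_shift_integrable x : leb.-integrable setT (EFin \o (fun y => p (x + y))).
Proof.
have := integrable_dilate x ltr01 energy_integrable; congr (leb.-integrable _ _).
by apply/funext => y; rewrite /= /dilate scale1r addrC.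
Qed.

(** Normalized indicators of balls are not Schwartz functions; their averages over translates
    of an energy are, and they are squeezed between indicators of radii [r - 1] and [r + 1]. *)
Definition smoothed_ball (r : R) : E -> R := smoothing (uniform_ball r) p.

Lemma smoothed_ballE r x : 0 < r ->
  smoothed_ball r x = \int[leb]_y (p (x + y) * ball_density r y).
Proof.
move=> r0; rewrite /smoothed_ball /smoothing Rintegral_uniform_ball//.
apply: measurable_shift; exact: energy_continuous.
Qed.

Let integrand r x : 0 < r ->
  leb.-integrable setT (EFin \o (fun y => p (x + y) * ball_density r y)).
Proof.
move=> r0; apply: (integrableM_bounded (K := (vol r)^-1)) (energy_shift_integrable x) _ _.
  exact: measurable_ball_density.
move=> y; have v0 := @ball_volume_gt0 R d r r0.
rewrite /ball_density normrM !ger0_norm ?invr_ge0 ?(ltW v0)// ler_piMr ?invr_ge0 ?(ltW v0)//.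
Qed.

Lemma smoothed_ball_ge0 r x : 0 < r -> 0 <= smoothed_ball r x.
Proof.
move=> r0; rewrite smoothed_ballE//; apply: Rintegral_ge0 => y _.
by rewrite mulr_ge0 ?energy_ge0 ?ball_density_ge0.
Qed.

Lemma smoothed_ball_le r x : 0 < r ->
  smoothed_ball r x <= (vol r)^-1 * \1_(eball (r + 1)) x.
Proof.
move=> r0; have v0 := @ball_volume_gt0 R d r r0; rewrite smoothed_ballE// indicE in_eball.
case: ltP => xr; last first.
  rewrite mulr0 /Rintegral integral0_eq// => y _; congr EFin.
  rewrite /ball_density indicE in_eball; case: ltP => yr; last by rewrite !mulr0.
  rewrite energy_outside ?mul0r//.
  have := enormB (x + y) y; rewrite addrK; lra.
rewrite mulr1 -[leRHS]mulr1 -(energy_shift_integral x) -RintegralZl//; last exact: energy_shift_integrable.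
apply: le_Rintegral => //; first exact: integrand.
  exact: (integrableZl measurableT _ (energy_shift_integrable x)).
move=> y _; rewrite /ball_density mulrC ler_wpM2r ?energy_ge0//.
rewrite ler_piMr ?invr_ge0 ?(ltW v0)//.
Qed.

Lemma smoothed_ball_ge r x : 0 < r ->
  (vol r)^-1 * \1_(eball (r - 1)) x <= smoothed_ball r x.
Proof.
move=> r0; have v0 := @ball_volume_gt0 R d r r0; rewrite indicE in_eball.
case: ltP => xr; last by rewrite mulr0 smoothed_ball_ge0.
rewrite mulr1 -[leLHS]mulr1 -(energy_shift_integral x) -RintegralZl//; last exact: energy_shift_integrable.
rewrite smoothed_ballE// le_eqVlt; apply/orP; left; apply/eqP.
apply: eq_Rintegral => y _; rewrite /ball_density indicE in_eball.
case: ltP => yr; first by rewrite mulr1 mulrC.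
rewrite energy_outside ?mul0r ?mulr0//.
have := enormB (x + y) x; rewrite addrAC subrr add0r; lra.
Qed.

Lemma smoothed_ball_bounded_derivatives r : bounded_derivatives (smoothed_ball r).
Proof.
by apply: bounded_derivatives_smoothing;
  [exact: probability_setT|exact: energy_bounded_derivatives].
Qed.

Lemma smoothed_ball_continuous r : continuous (smoothed_ball r).
Proof. exact: smooth_continuous (smoothed_ball_bounded_derivatives r).1. Qed.

Lemma smoothed_ball_outside r x : 0 < r -> r + 1 <= enorm x -> smoothed_ball r x = 0.
Proof.
move=> r0 xr; apply/eqP; rewrite eq_le smoothed_ball_ge0// andbT.
by rewrite (le_trans (smoothed_ball_le x r0))// indicE in_eball ltNge xr mulr0.
Qed.

Lemma smoothed_ball_schwartz r : 0 < r -> schwartz (smoothed_ball r).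
Proof.
move=> r0; apply: (compact_support_schwartz (r := r + 1)) (smoothed_ball_bounded_derivatives r) _.
by move=> x /ltW; exact: smoothed_ball_outside.
Qed.

Lemma smoothed_ball_integral r : \int[leb]_x smoothed_ball r x = 1.
Proof.
have [C hC] := (energy_bounded_derivatives h_test).2 [::].
have := (smoothing_fubini (uniform_ball r) (g := fun=> 1) (K := 1) energy_continuous hC energy_integrable
  _ _).2.
have -> : \int[leb]_x (smoothing (uniform_ball r) p x * 1) = \int[leb]_x smoothed_ball r x.
  by apply: eq_Rintegral => x _; rewrite mulr1.
move=> ->//; last by rewrite normr1.
have -> : \int[leb]_x (p x * 1) = 1.
  rewrite -[RHS](energy_shift_integral 0); apply: eq_Rintegral => x _.
  by rewrite add0r mulr1.
exact: (Rintegral_cst1 (probability_setT _)).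
Qed.

(** The transform of the uniform law carries the decay, that of the energy the integrability
    with respect to the spectral measure. *)
Lemma smoothed_ball_fourier r xi :
  Normc.normc (fourier (fun x => (smoothed_ball r x)%:C%C) xi) ^+ 2 =
  ((\int[uniform_ball r]_y cos (phase xi y)) ^+ 2 + (\int[uniform_ball r]_y sin (phase xi y)) ^+ 2) *
  Normc.normc (fourier (fun x => (p x)%:C%C) xi) ^+ 2.
Proof.
have [C hC] := (energy_bounded_derivatives h_test).2 [::].
rewrite !fourier_realE.
exact: (smoothing_transform (uniform_ball r) xi energy_continuous hC energy_integrable).
Qed.

End smoothed_ball.

Section linear_statistics.
Context {R : realType} {d : nat}.
Local Notation E := 'rV[R]_d.
Local Notation leb := (@lebesgue_rV R d).
Context {dO : measure_display} {Om : measurableType dO}.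
Variables (P : probability Om R) (eta : R.-ker Om ~> E) (rho : R).
Hypothesis eta_pp : point_process eta.
Implicit Types (f g : E -> R) (w : Om).

Definition linear_stat (f : E -> R) (w : Om) : R := \int[eta w]_x f x.

Lemma measurable_linear_stat f : measurable_fun setT f ->
  measurable_fun setT (linear_stat f).
Proof.
move=> mf; apply: (measurable_Rintegral_kernel (k := eta)) => // B mB.
exact: measurable_kernel.
Qed.

Lemma point_process_eball w r : (eta w (eball r) < +oo)%E.
Proof.
have [k ->] := eta_pp w (measurable_eball r) (@bounded_eball R d r).
exact: ltry.
Qed.

Definition count (r : R) (w : Om) : R := fine (eta w (eball r)).

Lemma countE w r : eta w (eball r) = (count r w)%:E.
Proof. by rewrite /count fineK// ge0_fin_numE// point_process_eball. Qed.

Lemma count_ge0 r w : 0 <= count r w.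
Proof. by rewrite fine_ge0. Qed.

Lemma count_indic r w : linear_stat (\1_(eball r) : E -> R) w = count r w.
Proof.
by rewrite /linear_stat /Rintegral (integral_indic (eta w) measurableT (measurable_eball r)) setIT.
Qed.

Lemma indic_eball_integrable w r : (eta w).-integrable setT (EFin \o (\1_(eball r) : E -> R)).
Proof.
have mB := @measurable_eball R d r.
apply/integrableP; split; first by apply/measurable_EFinP; exact: measurable_indic.
rewrite (eq_integral (fun x => (\1_(eball r) x)%:E)); last first.
  by move=> x _ /=; rewrite ger0_norm.
by rewrite (integral_indic (eta w) measurableT mB) setIT point_process_eball.
Qed.

(** Only finitely many points lie in the ball. *)
Lemma ball_integrable w f (K r : R) : measurable_fun setT f ->
  (forall x, `|f x| <= K * \1_(eball r) x) -> (eta w).-integrable setT (EFin \o f).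
Proof.
move=> mf fK; apply: (le_integrable measurableT _ _ (integrableZl measurableT K (indic_eball_integrable w r))).
  exact/measurable_EFinP.
by move=> x _ /=; rewrite lee_fin (le_trans (fK x))// ler_norm.
Qed.

Lemma linear_stat_le w f g (K r : R) : measurable_fun setT f -> measurable_fun setT g ->
  (forall x, `|f x| <= K * \1_(eball r) x) -> (forall x, `|g x| <= K * \1_(eball r) x) ->
  (forall x, f x <= g x) -> linear_stat f w <= linear_stat g w.
Proof.
move=> mf mg fK gK fg; apply: le_Rintegral => //; exact: ball_integrable.
Qed.

Lemma linear_stat_norm w f (K r : R) : measurable_fun setT f ->
  (forall x, `|f x| <= K * \1_(eball r) x) -> `|linear_stat f w| <= K * count r w.
Proof.
move=> mf fK; have fi := ball_integrable w mf fK.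
rewrite -count_indic /linear_stat -RintegralZl//; last exact: indic_eball_integrable.
rewrite (le_trans (le_normr_Rintegral measurableT fi))//; apply: le_Rintegral => //.
  exact: integrable_norm fi.
exact: (integrableZl measurableT K (indic_eball_integrable w r)).
Qed.

Hypothesis eta_moments : local_second_moments P eta.

Lemma measurable_count r : measurable_fun setT (count r).
Proof.
rewrite (_ : count r = linear_stat (\1_(eball r) : E -> R)).
  by apply: measurable_linear_stat; apply: measurable_indic; exact: measurable_eball.
by apply/funext => w; rewrite count_indic.
Qed.

Lemma count_sqr_integrable r : P.-integrable setT (EFin \o (fun w => count r w ^+ 2)).
Proof.
apply/integrableP; split.
  by apply/measurable_EFinP; apply: measurable_funX; exact: measurable_count.
have := eta_moments (measurable_eball r) (@bounded_eball R d r).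
rewrite (eq_integral (fun w => `|((count r w) ^+ 2)%:E|)%E)// => w _.
by rewrite countE -EFin_expe gee0_abs// lee_fin sqr_ge0.
Qed.

Lemma linear_stat_sqr_integrable f (K r a : R) : measurable_fun setT f ->
  (forall x, `|f x| <= K * \1_(eball r) x) ->
  P.-integrable setT (EFin \o (fun w => (linear_stat f w - a) ^+ 2)).
Proof.
move=> mf fK.
have bnd : P.-integrable setT (fun w => (2 * K ^+ 2)%:E * (count r w ^+ 2)%:E + (2 * a ^+ 2)%:E)%E.
  apply: integrableD => //; first exact: (integrableZl measurableT _ (count_sqr_integrable r)).
  by apply: finite_measure_integrable_cst.
apply: (le_integrable measurableT _ _ bnd).
  apply/measurable_EFinP; apply: measurable_funX; apply: measurable_funB => //.
  exact: measurable_linear_stat.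
move=> w _ /=; rewrite lee_fin ger0_norm ?sqr_ge0//.
have h1 := linear_stat_norm w mf fK.
have h2 : linear_stat f w ^+ 2 <= K ^+ 2 * count r w ^+ 2.
  rewrite -exprMn -(real_normK (num_real (linear_stat f w))) lerXn2r ?nnegrE//.
  exact: le_trans h1.
have h3 := sqr_ge0 (linear_stat f w + a).
apply: le_trans (ler_norm _); nra.
Qed.

(** The real part of the Bartlett identity for a real function against itself. *)
Lemma bartlett_variance (sigma : {measure set E -> \bar R}) f (K r : R) :
  bartlett_measure P eta rho sigma -> schwartz f -> 
  (forall x, `|f x| <= K * \1_(eball r) x) ->
  \int[P]_w ((linear_stat f w - rho * \int[leb]_x f x) ^+ 2) =
  \int[sigma]_xi (Normc.normc (fourier (fun x => (f x)%:C%C) xi) ^+ 2) /\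
  sigma.-integrable setT (EFin \o (fun xi => Normc.normc (fourier (fun x => (f x)%:C%C) xi) ^+ 2)).
Proof.
move=> bart sf fK; pose F x : R[i] := (f x)%:C%C.
have p0 s : pderive s ((fun=> 0) : E -> R) = (fun=> 0).
  apply/funext => x; apply: (@pderive0 R d setT) => //; exact: openT.
have s0 : schwartz ((fun=> 0) : E -> R).
  split=> [s|k s]; rewrite p0.
    by split=> [|x i]; [exact: cst_continuous|exact: derivable_cst].
  by exists 0 => x; rewrite normr0 mulr0.
have cF : Cschwartz F by [].
have [fi fE] := bart F F cF cF; split; last exact: fi.
have := congr1 (@complex.Re R) fE; rewrite /Cintegral /=.
have -> : \int[sigma]_x complex.Re (fourier F x * (fourier F x)^*%C) =
    \int[sigma]_xi (Normc.normc (fourier (fun x => (f x)%:C%C) xi) ^+ 2).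
  apply: eq_Rintegral => xi _; rewrite -/F; case: (fourier F xi) => a b /=.
  by rewrite sqr_sqrtr ?addr_ge0 ?sqr_ge0//; ring.
move=> <-; apply: eq_Rintegral => w _.
rewrite /centered_stat /Cintegral /= /linear_stat.
have int0 (m : {measure set E -> \bar R}) : \int[m]_x (0 : R) = 0.
  by rewrite /Rintegral integral0.
rewrite !int0; ring.
Qed.

End linear_statistics.

(** The count [c] in the ball of volume [vr] is squeezed by two smoothed counts, at slightly
    different volumes [vp] and [vm]. *)
Lemma sandwich_estimate (R : realType) (rho t dl c vr vp vm Sp Sm : R) :
  0 < vr -> 0 < vp -> 0 < vm -> 0 <= c -> t <= 1 -> t <= rho -> t * (rho + 2) <= dl ->
  `|Sp - rho| < t -> `|Sm - rho| < t -> `|1 - vp / vr| < t -> `|1 - vm / vr| < t ->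
  vp^-1 * c <= Sp -> Sm <= vm^-1 * c -> `|c / vr - rho| < dl.
Proof.
move=> vr0 vp0 vm0 c0 t1 trho tdl; rewrite !ltr_norml.
move=> /andP[p1 p2] /andP[m1 m2] /andP[a1 a2] /andP[b1 b2] up down.
have a0 : 0 < vp / vr by rewrite divr_gt0.
have b0 : 0 < vm / vr by rewrite divr_gt0.
have h1 : c / vr <= Sp * (vp / vr).
  have -> : c / vr = (vp^-1 * c) * (vp / vr) by field; rewrite !gt_eqF.
  by rewrite ler_wpM2r// ltW.
have h2 : Sm * (vm / vr) <= c / vr.
  have -> : c / vr = (vm^-1 * c) * (vm / vr) by field; rewrite !gt_eqF.
  by rewrite ler_wpM2r// ltW.
move: (vp / vr) (vm / vr) (c / vr) a0 b0 a1 a2 b1 b2 h1 h2 => a b q a0 b0 a1 a2 b1 b2 h1 h2.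
have t0 : 0 < t by lra.
have h3 : Sp * a <= (rho + t) * (1 + t).
  apply: (@le_trans _ _ ((rho + t) * a)); first by rewrite ler_wpM2r ?ltW//; lra.
  by rewrite ler_wpM2l//; lra.
have h4 : (rho - t) * (1 - t) <= Sm * b.
  apply: (@le_trans _ _ ((rho - t) * b)); first by rewrite ler_wpM2l//; lra.
  by rewrite ler_wpM2r ?ltW//; lra.
by apply/andP; split; nra.
Qed.

Section intensity_consistency.
Context {R : realType} {d : nat}.
Local Notation E := 'rV[R]_d.
Local Notation leb := (@lebesgue_rV R d).
Local Notation vol := (ball_volume (n := d)).
Context {dO : measure_display} {Om : measurableType dO}.
Variables (P : probability Om R) (eta : R.-ker Om ~> E) (rho : R).
Variables (sigma : {measure set E -> \bar R}) (h : E -> R[i]).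
Hypothesis d_gt0 : (0 < d)%N.
Hypothesis eta_pp : point_process eta.
Hypothesis eta_moments : local_second_moments P eta.
Hypothesis sigma_bartlett : bartlett_measure P eta rho sigma.
Hypothesis sigma_ac : sigma `<< leb.
Hypothesis h_test : test_function (eball 1) h.
Hypothesis h_norm : (\int[leb]_x (Normc.normc (h x) ^+ 2)%:E = 1)%E.

Lemma rV_set1E : [set 0 : E] = [set x | forall i, 0 <= x ord0 i <= 0].
Proof.
apply/seteqP; split => x /=; first by move=> -> i; rewrite mxE lexx.
by move=> x0; apply/rowP => i; rewrite mxE; apply/eqP; rewrite eq_le andbC.
Qed.

Lemma measurable_rV_set1 : measurable [set 0 : E].
Proof.
rewrite rV_set1E; apply: (@measurable_rectangle _ _ E (measurableTypeR R) 'I_d (fun i x => x ord0 i) _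
  (fun=> [set z | 0 <= z <= 0])).
  by move=> i; exact: measurable_rV_coord.
move=> i; rewrite (_ : mkset _ = `[0, 0]%classic); first exact: measurable_itv.
by apply/seteqP; split => z /=; rewrite in_itv.
Qed.

Lemma lebesgue_rV_set1 : leb [set 0 : E] = 0%E.
Proof.
rewrite rV_set1E (lebesgue_rV_box (a := fun=> 0) (b := fun=> 0))// prodr_const card_ord subrr.
by rewrite expr0n eqn0Ngt d_gt0.
Qed.

Lemma spectral_atom0 : sigma [set 0 : E] = 0%E.
Proof.
have /null_content_dominatesP := sigma_ac; apply; first exact: measurable_rV_set1.
exact: lebesgue_rV_set1.
Qed.

Local Notation fr := (smoothed_ball h).
Let kernel_sq (r : R) (xi : E) : R :=
  (\int[uniform_ball r]_y cos (phase xi y)) ^+ 2 + (\int[uniform_ball r]_y sin (phase xi y)) ^+ 2.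
Let q (xi : E) : R := Normc.normc (fourier (fun x => (energy h x)%:C%C) xi) ^+ 2.

Lemma smoothed_ball_variance r : 0 < r ->
  \int[P]_w ((linear_stat eta (fr r) w - rho) ^+ 2) =
    \int[sigma]_xi (kernel_sq r xi * q xi) /\
  sigma.-integrable setT (EFin \o (fun xi => kernel_sq r xi * q xi)).
Proof.
move=> r0; have v0 := @ball_volume_gt0 R d r r0.
have := @bartlett_variance R d dO Om P eta rho sigma (fr r) ((vol r)^-1) (r + 1) sigma_bartlett
  (smoothed_ball_schwartz h_test h_norm r0).
have bnd x : `|fr r x| <= (vol r)^-1 * \1_(eball (r + 1)) x.
  by rewrite ger0_norm ?(smoothed_ball_ge0 h_test)// (smoothed_ball_le h_test h_norm).
move=> /(_ bnd); rewrite (smoothed_ball_integral h_test h_norm) mulr1.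
rewrite (_ : (fun xi => _ ^+ 2) = (fun xi => kernel_sq r xi * q xi))//.
by apply/funext => xi; exact: smoothed_ball_fourier.
Qed.

Lemma kernel_sq_le2 r xi : 0 <= kernel_sq r xi <= 2.
Proof.
have c1 : `|\int[uniform_ball r]_y cos (phase xi y)| <= 1.
  apply: (bounded_Rintegral (probability_setT _)); first exact: measurable_cos_phase.
  by move=> x; exact: cos_abs1.
have s1 : `|\int[uniform_ball r]_y sin (phase xi y)| <= 1.
  apply: (bounded_Rintegral (probability_setT _)); first exact: measurable_sin_phase.
  by move=> x; exact: sin_abs1.
move: c1 s1; rewrite !ler_norml /kernel_sq => /andP[c1 c2] /andP[s1 s2].
by apply/andP; split; nra.
Qed.

(** The variance is the spectral integral of a bounded multiple of an integrable function that
    tends to 0 away from the origin, and the origin has no spectral mass. *)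
Lemma smoothed_ball_variance_cvg0 :
  \int[P]_w ((linear_stat eta (fr r) w - rho) ^+ 2) @[r --> +oo] --> (0 : R).
Proof.
(* the spectral formula needs positive radii, which [u] may have only from some rank on *)
apply/cvg_pinftyP => u uoo; pose u' n := Num.max (u n) 1.
have u'0 n : 0 < u' n by rewrite /u' lt_max ltr01 orbT.
have u'oo : u' n @[n --> \oo] --> +oo.
  apply/cvgryPge => A; have /cvgryPge /(_ A) := uoo.
  by apply: filterS => n An; rewrite /u' le_max An.
have qi : sigma.-integrable setT (EFin \o q).
  have [K hK] := (energy_bounded_derivatives h_test).2 [::].
  apply: (@bartlett_variance R d dO Om P eta rho sigma (energy h) K 1 sigma_bartlett (energy_schwartz h_test) _).2.
  move=> x; rewrite indicE in_eball; case: ltP => x1; first by rewrite mulr1; exact: hK.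
  by rewrite energy_outside// normr0 mulr0.
have main : (\int[sigma]_xi (kernel_sq (u' n) xi * q xi)%:E)%E @[n --> \oo] --> 0%E.
  have [] := @dominated_convergence _ _ _ sigma setT measurableT
    (fun n xi => (kernel_sq (u' n) xi * q xi)%:E) (cst 0%E) (fun xi => 2%:E * (q xi)%:E)%E.
  - by move=> n; exact: measurable_int (smoothed_ball_variance (u'0 n)).2.
  - exact: measurable_cst.
  - exists [set 0]; split; [exact: measurable_rV_set1|exact: spectral_atom0|].
    move=> xi /=; apply: contra_notP => /eqP xi0 _.
    apply: cvg_EFin; first exact: nearW.
    rewrite -[X in _ --> X](mul0r (q xi)); apply: cvgM; last exact: cvg_cst.
    exact: (cvg_comp _ _ u'oo (ball_transform_cvg0 xi0)).
  - exact: (integrableZl measurableT 2 qi).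
  - apply: aeW => xi n _; have /andP[k0 k2] := kernel_sq_le2 (u' n) xi.
    have q0 : 0 <= q xi by rewrite sqr_ge0.
    by rewrite abse_EFin -EFinM lee_fin normrM !ger0_norm// ler_wpM2r.
  by rewrite integral0.
have main' : fine (\int[sigma]_xi (kernel_sq (u' n) xi * q xi)%:E)%E @[n --> \oo] --> (0 : R).
  exact: (fine_cvg main).
apply: cvg_trans main'; apply: near_eq_cvg; near=> n.
have un : u' n = u n.
  rewrite /u'; apply/max_idPl; near: n.
  by move/cvgryPge : uoo; exact.
by rewrite un (smoothed_ball_variance _).1// -un.
Unshelve. all: end_near. Qed.

Lemma linear_stat_consistent (e dl : R) : 0 < e -> 0 < dl ->
  \forall r \near (+oo : set_system R),
    (P [set w | (dl <= `|linear_stat eta (fr r) w - rho|)%R] <= e%:E)%E.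
Proof.
move=> e0 dl0; have dl2 : 0 < dl ^+ 2 by rewrite exprn_gt0.
have ed : 0 < e * dl ^+ 2 by rewrite mulr_gt0.
have := smoothed_ball_variance_cvg0 => /cvgrPdist_le /(_ _ ed) hV.
near=> r.
have r0 : 0 < r by near: r; exact: nbhs_pinfty_gt.
have v0 := @ball_volume_gt0 R d r r0.
have mf : measurable_fun setT (fr r).
  by apply: measurable_continuous_rV; exact: smoothed_ball_continuous.
have bnd x : `|fr r x| <= (vol r)^-1 * \1_(eball (r + 1)) x.
  by rewrite ger0_norm ?(smoothed_ball_ge0 h_test)// (smoothed_ball_le h_test h_norm).
apply: (le_trans (markov_sqr dl0 _ _)).
- by apply: measurable_funB => //; exact: measurable_linear_stat.
- exact: (linear_stat_sqr_integrable eta_pp eta_moments rho mf bnd).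
- rewrite lee_fin ler_pdivrMr// (le_trans (ler_norm _))//.
  have : `|0 - \int[P]_w ((linear_stat eta (fr r) w - rho) ^+ 2)| <= e * dl ^+ 2 by near: r.
  by rewrite sub0r normrN.
Unshelve. all: end_near. Qed.

Lemma intensity_estimatorE r w : intensity_estimator eta r w = count eta r w / vol r.
Proof. by []. Qed.

Hypothesis rho_gt0 : 0 < rho.

(** Chebyshev for the smoothed counts of radii [r + 1] and [r - 1], whose volumes are
    asymptotically the same as that of radius [r]. *)
Lemma intensity_estimator_consistent (e dl : R) : 0 < e -> 0 < dl ->
  \forall r \near (+oo : set_system R),
    (P [set w | (dl <= `|intensity_estimator eta r w - rho|)%R] <= e%:E)%E.
Proof.
(* small enough for [sandwich_estimate] *)
move=> e0 dl0; pose t := Num.min (Num.min 1 rho) (dl / (rho + 2)).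
have t0 : 0 < t by rewrite !lt_min ltr01 rho_gt0 divr_gt0// addr_gt0.
have t1 : t <= 1 by rewrite /t !ge_min lexx.
have trho : t <= rho by rewrite /t !ge_min lexx orbT.
have tdl : t * (rho + 2) <= dl by rewrite -ler_pdivlMr ?addr_gt0// /t ge_min lexx orbT.
have e20 : 0 < e / 2 by rewrite divr_gt0.
have shift (s : R) (Q : R -> Prop) : (\forall r \near (+oo : set_system R), Q r) ->
    \forall r \near (+oo : set_system R), Q (r + s).
  move=> [M [Mr hM]]; exists (M - s); split; first exact: num_real.
  by move=> r; rewrite ltrBlDr => /hM.
pose A s := [set w | (t <= `|linear_stat eta (fr s) w - rho|)%R].
pose small s := (P (A s) <= (e / 2)%:E)%E.
have hp : \forall r \near (+oo : set_system R), small (r + 1).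
  exact: (shift 1 small (linear_stat_consistent e20 t0)).
have hm : \forall r \near (+oo : set_system R), small (r - 1).
  exact: (shift (- 1) small (linear_stat_consistent e20 t0)).
have := @ball_volume_ratio_cvg R d 1 => /cvgrPdist_lt /(_ _ t0) rp.
have := @ball_volume_ratio_cvg R d (- 1) => /cvgrPdist_lt /(_ _ t0) rm.
have hall := filterI (filterI hp hm) (filterI rp rm); clear hp hm rp rm.
near=> r.
have [[Pp Pm] [Rp Rm]] : ((small (r + 1) /\ small (r - 1)) /\
    (`|1 - vol (r + 1) / vol r| < t /\ `|1 - vol (r - 1) / vol r| < t)).
  near: r; exact (hall _ _ _).
have r1 : 1 < r by near: r; apply: nbhs_pinfty_gt; exact: num_real.
have r0 : 0 < r by exact: lt_trans r1.
have rm0 : 0 < r - 1 by rewrite subr_gt0.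
have rp0 : 0 < r + 1 by rewrite addr_gt0.
have mf s : measurable_fun setT (fr s).
  by apply: measurable_continuous_rV; exact: smoothed_ball_continuous.
have mA s : measurable (A s).
  rewrite -[X in measurable X]setTI; apply: measurable_fun_ler => //.
  by apply: measurableT_comp => //; apply: measurable_funB => //; exact: measurable_linear_stat.
have mD : measurable [set w | (dl <= `|intensity_estimator eta r w - rho|)%R].
  rewrite -[X in measurable X]setTI; apply: measurable_fun_ler => //.
  apply: measurableT_comp => //; apply: measurable_funB => //.
  by apply: measurable_funM => //; exact: measurable_count.
apply: (@le_trans _ _ (P (A (r + 1) `|` A (r - 1)))); last first.
  apply: (le_trans (measureU2 P (mA _) (mA _))).
  rewrite (splitr e) EFinD; exact: (leeD Pp Pm).
apply: le_measure; rewrite ?inE//; first exact: measurableU.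
move=> w; apply: contraPP => /not_orP[] /negP; rewrite -ltNge => hP /negP; rewrite -ltNge => hM.
apply/negP; rewrite -ltNge intensity_estimatorE.
have vr := @ball_volume_gt0 R d r r0; have vp := @ball_volume_gt0 R d _ rp0; have vm := @ball_volume_gt0 R d _ rm0.
have bnd (s : R) (x : E) : 0 < s -> `|fr s x| <= (vol s)^-1 * \1_(eball (s + 1)) x.
  by move=> s0; rewrite ger0_norm ?(smoothed_ball_ge0 h_test)// (smoothed_ball_le h_test h_norm).
have ind_bnd (s s' c : R) (x : E) : 0 <= c -> s <= s' -> `|c * \1_(eball s) x| <= c * \1_(eball s') x.
  move=> c0 ss'; rewrite normrM !ger0_norm// ler_wpM2l// !indicE !in_eball ler_nat.
  by case: (ltP _ s) => // xs; rewrite (lt_le_trans xs ss').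
have mind (c s : R) : measurable_fun setT (fun x : E => c * \1_(eball s) x).
  by apply: measurable_funM => //; apply: measurable_indic; exact: measurable_eball.
have stat_ind (c s : R) : linear_stat eta (fun x => c * \1_(eball s) x) w = c * count eta s w.
  rewrite -count_indic /linear_stat RintegralZl//; exact: indic_eball_integrable.
have ip : 0 <= (vol (r + 1))^-1 by rewrite invr_ge0 ltW.
have im : 0 <= (vol (r - 1))^-1 by rewrite invr_ge0 ltW.
have lep : r <= r + 1 + 1 by rewrite -addrA lerDl addr_ge0.
have lem : r <= r - 1 + 1 by rewrite subrK.
have up : (vol (r + 1))^-1 * count eta r w <= linear_stat eta (fr (r + 1)) w.
  rewrite -stat_ind; apply: (@linear_stat_le _ _ _ _ eta eta_pp w _ _ (vol (r + 1))^-1 (r + 1 + 1)) => //.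
  - move=> x; exact (ind_bnd _ _ _ x ip lep).
  - move=> x; exact (bnd _ x rp0).
  - move=> x; have := smoothed_ball_ge h_test h_norm x rp0.
    by rewrite addrK.
have down : linear_stat eta (fr (r - 1)) w <= (vol (r - 1))^-1 * count eta r w.
  rewrite -stat_ind; apply: (@linear_stat_le _ _ _ _ eta eta_pp w _ _ (vol (r - 1))^-1 (r - 1 + 1)) => //.
  - move=> x; exact (bnd _ x rm0).
  - move=> x; exact (ind_bnd _ _ _ x im lem).
  - move=> x; have := smoothed_ball_le h_test h_norm x rm0.
    by rewrite subrK.
exact (sandwich_estimate vr vp vm (count_ge0 eta r w) t1 trho tdl hP hM Rp Rm up down).
Unshelve. all: end_near. Qed.

End intensity_consistency.

(** * Decay of the mean of the windowed sums *)

Section finite_differences.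
Context {R : realType} {d : nat}.
Local Notation E := 'rV[R]_d.
Local Notation leb := (@lebesgue_rV R d).
Local Notation e i := (delta_mx ord0 i : E).
Implicit Types (f k : E -> R) (v : E).

(** A substitute for integration by parts against a function that changes sign under the
    translation by [v]: differences of a scaled window at a fixed step are small. *)
Definition fdiff v f (x : E) : R := f (x + v) - f x.

Lemma iter_fdiffS v n f x :
  iter n.+1 (fdiff v) f x = iter n (fdiff v) f (x + v) - iter n (fdiff v) f x.
Proof. by []. Qed.

Lemma is_derive_iter_fdiff n i (s : R) f : smooth f -> forall x (z : R),
  is_derive z 1 (fun z : R => iter n (fdiff (s *: e i)) f (x + z *: e i))
    (iter n (fdiff (s *: e i)) (pderive [:: i] f) (x + z *: e i)).
Proof.
move=> sf; elim: n => [|n IH] x z.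
  exact: (is_derive_line (@smooth_derivable _ _ f (x + z *: e i) i sf)).
have E1 (g : E -> R) (t : R) : iter n.+1 (fdiff (s *: e i)) g (x + t *: e i) =
   iter n (fdiff (s *: e i)) g (x + s *: e i + t *: e i) - iter n (fdiff (s *: e i)) g (x + t *: e i).
  by rewrite iter_fdiffS addrAC.
rewrite E1; under eq_fun do rewrite E1.
apply: is_deriveB; exact: IH.
Qed.

Lemma iter_fdiff_bound n i (s C : R) f : smooth f ->
  (forall x, `|pderive (nseq n i) f x| <= C) ->
  forall x, `|iter n (fdiff (s *: e i)) f x| <= `|s| ^+ n * C.
Proof.
elim: n f => [|n IH] f sf fC x; first by rewrite expr0 mul1r; exact: fC.
have sf1 := smooth_pderive [:: i] sf.
have fC1 y : `|pderive (nseq n i) (pderive [:: i] f) y| <= C.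
  rewrite -pderive_cat (_ : nseq n i ++ [:: i] = nseq n.+1 i)//.
  by elim: (n) => //= m ->.
have := @mvt_bound _ (fun z : R => iter n (fdiff (s *: e i)) f (x + z *: e i))
  (fun z => iter n (fdiff (s *: e i)) (pderive [:: i] f) (x + z *: e i)) (`|s| ^+ n * C) s.
rewrite scale0r addr0 iter_fdiffS exprSr mulrAC; apply.
  by move=> z; exact: is_derive_iter_fdiff.
by move=> z _; exact: IH.
Qed.

Lemma iter_fdiff_outside n v f (r : R) : (forall x, r <= enorm x -> f x = 0) ->
  forall x, r + n%:R * enorm v <= enorm x -> iter n (fdiff v) f x = 0.
Proof.
move=> f0; elim: n => [|n IH] x; first by rewrite mul0r addr0; exact: f0.
rewrite -natr1 mulrDl mul1r iter_fdiffS => xr.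
have v0 := enorm_ge0 v; have := enormB (x + v) v; rewrite addrK => h1.
by rewrite !IH ?subrr//; lra.
Qed.

(** Translating by [v] reverses the sign of [k], so that the difference counts the integral
    twice. *)
Lemma half_period_fdiff v f k : (forall x, k (x + v) = - k x) ->
  leb.-integrable setT (EFin \o (fun x => f x * k x)) ->
  leb.-integrable setT (EFin \o (fun x => fdiff v f x * k x)) /\
  \int[leb]_x (fdiff v f x * k x) = - 2 * \int[leb]_x (f x * k x).
Proof.
move=> kv fk; have fkv := integrable_dilate v ltr01 fk.
have fkv' : leb.-integrable setT (EFin \o (fun x => f (x + v) * k x)).
  have := integrableZl measurableT (-1) fkv; congr (leb.-integrable _ _).
  by apply/funext => x; rewrite /= /dilate scale1r kv -EFinM; congr EFin; ring.
have shiftE : \int[leb]_x (f (x + v) * k x) = - \int[leb]_x (f x * k x).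
  rewrite [in RHS](Rintegral_dilate v ltr01 fk) expr1n mul1r -[RHS]mulN1r -RintegralZl//.
  by apply: eq_Rintegral => x _; rewrite /dilate scale1r kv; ring.
split.
  have := integrableB measurableT fkv' fk; congr (leb.-integrable _ _).
  by apply/funext => x; rewrite /= -EFinB; congr EFin; rewrite /fdiff mulrBl.
transitivity (\int[leb]_x (f (x + v) * k x - f x * k x)).
  by apply: eq_Rintegral => x _; rewrite /fdiff mulrBl.
by rewrite RintegralB// shiftE; ring.
Qed.

Lemma half_period_iter_fdiff n v f k : (forall x, k (x + v) = - k x) ->
  leb.-integrable setT (EFin \o (fun x => f x * k x)) ->
  leb.-integrable setT (EFin \o (fun x => iter n (fdiff v) f x * k x)) /\
  `|\int[leb]_x (f x * k x)| <= `|\int[leb]_x (iter n (fdiff v) f x * k x)|.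
Proof.
move=> kv fk; elim: n => [|n [IH1 IH2]]; first by [].
have [h1 h2] := half_period_fdiff kv IH1; split; first exact: h1.
rewrite [leRHS](_ : _ = `|- 2 * \int[leb]_x (iter n (fdiff v) f x * k x)|); last by rewrite -h2.
rewrite normrM; have -> : `|- 2 : R| = 2 by rewrite normrN ger0_norm.
by rewrite (le_trans IH2)// ler_peMl// ler1n.
Qed.

Lemma scaled_fdiff n (rad : R) v f x : rad != 0 ->
  iter n (fdiff v) (fun y => f (rad^-1 *: y)) x = iter n (fdiff (rad^-1 *: v)) f (rad^-1 *: x).
Proof.
by move=> r0; elim: n x => [//|n IH] x; rewrite !iter_fdiffS !IH scalerDr.
Qed.

Lemma scaled_outside f (rad : R) : (forall x, 1 <= enorm x -> f x = 0) -> 0 < rad ->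
  forall x, rad <= enorm x -> f (rad^-1 *: x) = 0.
Proof.
move=> f0 r0 x rx; apply: f0; rewrite enormZ gtr0_norm ?invr_gt0//.
by rewrite ler_pdivlMl// mulr1.
Qed.

Lemma measurable_scaled f (rad : R) : continuous f ->
  measurable_fun setT (fun x : E => f (rad^-1 *: x)).
Proof.
move=> cf; apply: (@continuous_measurable_coords _ E R 1 d (fun x => rad^-1 *: x)) => // a b.
rewrite ord1 (_ : (fun _ => _) = (fun x : E => rad^-1 * x ord0 b)); last by apply/funext => x; rewrite mxE.
by apply: measurable_funM => //; exact: measurable_rV_coord.
Qed.

Lemma scaled_bound f k (B rad : R) : (forall x, 1 <= enorm x -> f x = 0) -> 0 < rad ->
  (forall x, `|f x| <= B) -> (forall x, `|k x| <= 1) ->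
  forall x, `|f (rad^-1 *: x) * k x| <= B * \1_(eball rad) x.
Proof.
move=> f0 r0 hB k1 x; rewrite normrM indicE in_eball.
case: ltP => rx; last by rewrite (scaled_outside f0 r0 rx) normr0 mul0r mulr0.
by rewrite mulr1 (@le_trans _ _ (B * 1))//; [apply: ler_pM => //; exact: hB|rewrite mulr1].
Qed.

Lemma scaled_integrable f k (rad : R) : bounded_derivatives f ->
  (forall x, 1 <= enorm x -> f x = 0) -> 0 < rad ->
  measurable_fun setT k -> (forall x, `|k x| <= 1) ->
  leb.-integrable setT (EFin \o (fun x => f (rad^-1 *: x) * k x)).
Proof.
move=> bf f0 r0 mk k1; have [B hB] := bf.2 [::].
apply: (le_integrable measurableT _ _ (integrableZl measurableT B (integrable_indic_eball rad))).
  apply/measurable_EFinP; apply: measurable_funM => //; apply: measurable_scaled.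
  exact: smooth_continuous bf.1.
move=> x _ /=; rewrite lee_fin; apply: le_trans (ler_norm _).
exact: scaled_bound f0 r0 hB k1 x.
Qed.

(** After [d] differences the integrand is of order [rad ^- d], because the step is of order
    [rad^-1] on the scale of the window, and it lives on a ball of volume of order
    [rad ^+ d]. *)
Lemma oscillatory_integral_bound f k i (c : R) : (0 < d)%N -> bounded_derivatives f ->
  (forall x, 1 <= enorm x -> f x = 0) ->
  measurable_fun setT k -> (forall x, `|k x| <= 1) -> (forall x, k (x + c *: e i) = - k x) ->
  exists K : R, \forall rad \near (+oo : set_system R),
    `|\int[leb]_x (f (rad^-1 *: x) * k x)| <= K.
Proof.
move=> d0 bf f0 mk k1 kc; have [C hC] := bf.2 (nseq d i).
have [B hB] := bf.2 [::].
have cf := smooth_continuous bf.1.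
exists (`|c| ^+ d * C * (2 * ball_volume (n := d) 1)).
pose s := d%:R * enorm (c *: e i).
have s0 : 0 <= s by rewrite mulr_ge0 ?enorm_ge0.
have := @ball_volume_ratio_cvg R d s => /cvgrPdist_le /(_ _ ltr01) rp.
near=> rad.
have r0 : 0 < rad by near: rad; exact: nbhs_pinfty_gt.
have rn0 : rad != 0 by rewrite gt_eqF.
have ratio : `|1 - ball_volume (n := d) (rad + s) / ball_volume (n := d) rad| <= 1.
  by near: rad; exact rp.
have vr := @ball_volume_gt0 R d rad r0.
have frk := scaled_integrable bf f0 r0 mk k1.
have fr0 := scaled_outside f0 r0.
have [ik h] := half_period_iter_fdiff d kc frk.
apply: (le_trans h); apply: (le_trans (le_normr_Rintegral measurableT ik)).
have C0 : 0 <= C by exact: le_trans (hC 0).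
have A0 : 0 <= `|rad^-1 * c| ^+ d * C by rewrite mulr_ge0 ?exprn_ge0.
apply: (@le_trans _ _ (\int[leb]_x (`|rad^-1 * c| ^+ d * C * \1_(eball (rad + s)) x))).
  apply: le_Rintegral => //.
  - exact: integrable_norm ik.
  - exact: (integrableZl measurableT _ (integrable_indic_eball (rad + s))).
  - move=> x _; rewrite indicE in_eball.
    case: ltP => rx; last first.
      by rewrite (iter_fdiff_outside (r := rad)) ?mul0r ?normr0 ?mulr0.
    rewrite mulr1 normrM scaled_fdiff// scalerA -[leRHS]mulr1; apply: ler_pM => //.
    exact: iter_fdiff_bound bf.1 hC _.
rewrite RintegralZl//; last exact: integrable_indic_eball.
rewrite Rintegral_indic_eball normrM exprMn.
rewrite (@ger0_norm _ rad^-1) ?invr_ge0 ?(ltW r0)//.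
apply: (@le_trans _ _ (rad^-1 ^+ d * `|c| ^+ d * C * (2 * ball_volume (n := d) rad))).
  apply: ler_wpM2l; first by rewrite !mulr_ge0 ?exprn_ge0 ?invr_ge0 ?(ltW r0).
  rewrite -ler_pdivrMr//; move: ratio; rewrite ler_norml => /andP[]; lra.
rewrite (ball_volume_scale r0) exprVn le_eqVlt; apply/orP; left; apply/eqP; field.
by rewrite expf_neq0.
Unshelve. all: end_near. Qed.

End finite_differences.

Lemma powR_pinfty_small (R : realType) (a K ep : R) : 0 < a -> 0 < ep ->
  \forall rad \near (+oo : set_system R), rad `^ (- a) * K <= ep.
Proof.
move=> a0 ep0; pose M := (ep^-1 * (`|K| + 1)) `^ (a^-1).
have K1 : 0 < `|K| + 1 by rewrite ltr_wpDl.
have eK : 0 < ep^-1 * (`|K| + 1) by rewrite mulr_gt0 ?invr_gt0.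
near=> rad.
have r0 : 0 < rad by near: rad; exact: nbhs_pinfty_gt.
have rM : M <= rad by near: rad; apply: nbhs_pinfty_ge; exact: num_real.
have h : ep^-1 * (`|K| + 1) <= rad `^ a.
  rewrite (_ : ep^-1 * _ = M `^ a).
    by apply: ge0_ler_powR => //; rewrite ?nnegrE ?powR_ge0// ltW.
  by rewrite /M -powRrM mulVf ?gt_eqF// powRr1// ltW.
have ra : 0 < rad `^ a by rewrite powR_gt0.
rewrite powRN mulrC ler_pdivrMr//.
apply: (@le_trans _ _ (`|K| + 1)); first by rewrite (le_trans (ler_norm _))// lerDl.
by rewrite -ler_pdivrMl.
Unshelve. all: end_near. Qed.

Section window_mean.
Context {R : realType} {d : nat}.
Local Notation E := 'rV[R]_d.
Local Notation leb := (@lebesgue_rV R d).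
Variable h : E -> R[i].
Hypothesis h_test : test_function (eball 1) h.

Definition windowed (rad : R) (u x : E) : R[i] := h (rad^-1 *: x) * chi u x.

Lemma dotvNr (x y : E) : dotv x (- y) = - dotv x y.
Proof. by rewrite dotvC dotvNl dotvC. Qed.

Lemma re_windowed rad u x : complex.Re (windowed rad u x) =
  complex.Re (h (rad^-1 *: x)) * cos (phase (- u) x) - complex.Im (h (rad^-1 *: x)) * sin (phase (- u) x).
Proof.
by rewrite /windowed /chi /cis /phase dotvNr mulrN opprK; case: (h _).
Qed.

Lemma im_windowed rad u x : complex.Im (windowed rad u x) =
  complex.Re (h (rad^-1 *: x)) * sin (phase (- u) x) + complex.Im (h (rad^-1 *: x)) * cos (phase (- u) x).
Proof.
by rewrite /windowed /chi /cis /phase dotvNr mulrN opprK; case: (h _).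
Qed.

Let re_out x : 1 <= enorm x -> complex.Re (h x) = 0.
Proof. by move=> x1; rewrite (test_function_outside h_test). Qed.

Let im_out x : 1 <= enorm x -> complex.Im (h x) = 0.
Proof. by move=> x1; rewrite (test_function_outside h_test). Qed.

Lemma window_mean_bounded u : u != 0 -> exists K : R,
  \forall rad \near (+oo : set_system R),
    `|\int[leb]_x complex.Re (windowed rad u x)| <= K /\
    `|\int[leb]_x complex.Im (windowed rad u x)| <= K.
Proof.
move=> u0; have [i ui] : exists i, u ord0 i != 0.
  apply: contrapT => /forallNP ui; move/eqP: u0; apply; apply/rowP => i.
  by rewrite mxE; apply/eqP; apply: contrapT => /negP; exact: ui.
have d0 : (0 < d)%N by exact: leq_ltn_trans (ltn_ord i).
have [br bi] := test_bounded_derivatives h_test.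
(* translating by [c] in the direction i shifts the phase by pi *)
pose c := (2 * u ord0 i)^-1.
have dv : dotv (delta_mx ord0 i) u = u ord0 i.
  rewrite /dotv (bigD1 i)//= big1 ?addr0.
    by rewrite mxE !eqxx mul1r.
  by move=> j ji; rewrite mxE eqxx/= (negbTE ji) mul0r.
have ph x : phase (- u) (x + c *: delta_mx ord0 i) = phase (- u) x + pi.
  rewrite /phase dotvDl dotvZl !dotvNr dv /c; field.
  by rewrite ui.
have kc x : cos (phase (- u) (x + c *: delta_mx ord0 i)) = - cos (phase (- u) x).
  by rewrite ph cosD cospi sinpi; ring.
have ks x : sin (phase (- u) (x + c *: delta_mx ord0 i)) = - sin (phase (- u) x).
  by rewrite ph sinD cospi sinpi; ring.
have mc := measurable_cos_phase (- u); have ms := measurable_sin_phase (- u).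
have c1 x := cos_abs1 (phase (- u) x); have s1 x := sin_abs1 (phase (- u) x).
have [K1 h1] := oscillatory_integral_bound d0 br re_out mc c1 kc.
have [K2 h2] := oscillatory_integral_bound d0 br re_out ms s1 ks.
have [K3 h3] := oscillatory_integral_bound d0 bi im_out mc c1 kc.
have [K4 h4] := oscillatory_integral_bound d0 bi im_out ms s1 ks.
exists (Num.max (K1 + K4) (K2 + K3)).
near=> rad.
have r0 : 0 < rad by near: rad; exact: nbhs_pinfty_gt.
have i1 := scaled_integrable br re_out r0 mc c1.
have i2 := scaled_integrable br re_out r0 ms s1.
have i3 := scaled_integrable bi im_out r0 mc c1.
have i4 := scaled_integrable bi im_out r0 ms s1.
have e1 : `|\int[leb]_x (complex.Re (h (rad^-1 *: x)) * cos (phase (- u) x))| <= K1 by near: rad.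
have e2 : `|\int[leb]_x (complex.Re (h (rad^-1 *: x)) * sin (phase (- u) x))| <= K2 by near: rad.
have e3 : `|\int[leb]_x (complex.Im (h (rad^-1 *: x)) * cos (phase (- u) x))| <= K3 by near: rad.
have e4 : `|\int[leb]_x (complex.Im (h (rad^-1 *: x)) * sin (phase (- u) x))| <= K4 by near: rad.
split; rewrite le_max; apply/orP; [left|right].
- under eq_Rintegral => x _ do rewrite re_windowed.
  by rewrite RintegralB// (le_trans (ler_normB _ _))// lerD.
- under eq_Rintegral => x _ do rewrite im_windowed.
  by rewrite RintegralD// (le_trans (ler_normD _ _))// lerD.
Unshelve. all: end_near. Qed.

(** The integral of the window against a nonconstant character is bounded, so that the
    normalization makes it negligible. *)
Lemma window_mean_small u (rho ep : R) : (0 < d)%N -> u != 0 -> 0 < ep ->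
  \forall rad \near (+oo : set_system R),
    `|rad `^ (- (d%:R / 2)) * (rho * \int[leb]_x complex.Re (windowed rad u x))| <= ep /\
    `|rad `^ (- (d%:R / 2)) * (rho * \int[leb]_x complex.Im (windowed rad u x))| <= ep.
Proof.
move=> d0 u0 ep0; have [K hK] := window_mean_bounded u0.
have d20 : 0 < d%:R / 2 :> R by rewrite divr_gt0// ltr0n.
have := powR_pinfty_small (`|rho| * K) d20 ep0.
apply: filter_app; apply: filterS hK => rad [h1 h2] h3.
have p0 : 0 <= rad `^ (- (d%:R / 2)) by rewrite powR_ge0.
by split; rewrite normrM (ger0_norm p0) (le_trans _ h3)// ler_wpM2l// normrM ler_wpM2l.
Qed.

End window_mean.

(** * The portmanteau inequality with a random parameter *)

Section distance_to_closed.
Context {R : realType} {V : normedModType R}.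
Variable O : set V.

(** The distance to the complement of [O], capped at 1 so that the infimum is over a nonempty
    set even when the complement is empty. *)
Definition capped_distances (z : V) : set R :=
  [set 1] `|` [set `|z - y| | y in ~` O].

Definition capped_distance (z : V) : R := inf (capped_distances z).

Lemma capped_distances_lb z : lbound (capped_distances z) 0.
Proof. by move=> t [->//|[y _ <-]]. Qed.

Lemma capped_distances_nonempty z : capped_distances z !=set0.
Proof. by exists 1; left. Qed.

Lemma capped_distance_ge0 z : 0 <= capped_distance z.
Proof. by apply: lb_le_inf; [exact: capped_distances_nonempty|exact: capped_distances_lb]. Qed.

Lemma capped_distance_le z t : capped_distances z t -> capped_distance z <= t.
Proof. by move=> zt; apply: ge_inf => //; exists 0; exact: capped_distances_lb. Qed.

Lemma capped_distance_lipschitz z z' : capped_distance z <= capped_distance z' + `|z - z'|.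
Proof.
rewrite -lerBlDr; apply: lb_le_inf; first exact: capped_distances_nonempty.
move=> t [->|[y yO <-]].
  by rewrite lerBlDr (@le_trans _ _ 1)// ?lerDl//; apply: capped_distance_le; left.
rewrite lerBlDr (@le_trans _ _ `|z - y|)//.
  by apply: capped_distance_le; right; exists y.
have -> : z - y = (z - z') + (z' - y) by rewrite addrA subrK.
by rewrite addrC; apply: le_trans (ler_normD _ _) _; rewrite addrC.
Qed.

Lemma capped_distance_continuous : continuous capped_distance.
Proof.
move=> z; apply/(@cvgrPdist_le _ _ _ _ (nbhs_filter z)) => e e0; near=> y.
have zy : `|z - y| <= e by near: y; apply: cvgr_dist_le => //; exact: cvg_id.
have h1 := capped_distance_lipschitz y z; have h2 := capped_distance_lipschitz z y.
rewrite distrC in h1; rewrite ler_norml; apply/andP; split; lra.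
Unshelve. all: end_near. Qed.

Lemma capped_distance_out z : ~ O z -> capped_distance z = 0.
Proof.
move=> zO; apply/eqP; rewrite eq_le capped_distance_ge0 andbT.
by apply: capped_distance_le; right; exists z => //; rewrite subrr normr0.
Qed.

Lemma capped_distance_in z : open O -> O z -> 0 < capped_distance z.
Proof.
move=> oO Oz; have : nbhs z O by apply: open_nbhs_nbhs.
move=> /nbhs_ballP[e /= e0 he].
apply: (@lt_le_trans _ _ (Num.min 1 e)); first by rewrite lt_min ltr01.
apply: lb_le_inf; first exact: capped_distances_nonempty.
move=> t [->|[y yO <-]]; first by rewrite ge_min lexx.
rewrite ge_min; apply/orP; right; rewrite leNgt; apply/negP => zy; apply: yO; apply: he.
by rewrite -ball_normE.
Qed.

(** Bounded continuous functions that increase to the indicator of an open set. *)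
Definition bump (j : nat) (z : V) : R := Num.min 1 (j%:R * capped_distance z).

Lemma bump_continuous j : continuous (bump j).
Proof.
move=> z.
have c1 : {for z, continuous (fun z => (j%:R : R) * capped_distance z)}.
  by apply: continuousM; [exact: cst_continuous|exact: capped_distance_continuous].
have c0 : {for z, continuous (fun _ : V => 1 : R)} by exact: cst_continuous.
exact: (continuous_min c0 c1).
Qed.

Lemma bump01 j z : 0 <= bump j z <= 1.
Proof. by rewrite /bump ge_min lexx/= le_min ler01 mulr_ge0 ?capped_distance_ge0. Qed.

Lemma bump_le_indic j z : bump j z <= \1_O z.
Proof.
rewrite indicE; have [zO|zO] := boolP (z \in O); first by have /andP[] := bump01 j z.
rewrite /bump capped_distance_out ?mulr0 ?ge_min ?lexx ?orbT//.
by move=> Oz; rewrite mem_set in zO.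
Qed.

Lemma bump_cvg z : open O -> bump j z @[j --> \oo] --> (\1_O z : R).
Proof.
move=> oO; rewrite indicE; have [|] := boolP (z \in O); rewrite ?inE ?notin_setE => zO.
  have d0 := capped_distance_in oO zO.
  apply: cvg_near_cst; near=> j.
  apply/min_idPl; rewrite -ler_pdivrMr//.
  by near: j; exact: nbhs_infty_ger.
apply: cvg_near_cst; apply: nearW => j.
by rewrite /bump capped_distance_out// mulr0; apply/min_idPr.
Unshelve. all: end_near. Qed.

End distance_to_closed.

Section portmanteau.
Context {R : realType} {m n : nat} {Th : pseudoMetricType R}.
Local Notation V := ('M[R]_(m, n)).
Context d (T : measurableType d) (P : probability T R) (X : R -> T -> V).
Context d' (T' : measurableType d') (Q : probability T' R) (G : T' -> V).
Hypothesis mX : forall rad i j, measurable_fun setT (fun w => X rad w i j).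
Hypothesis mG : forall i j, measurable_fun setT (fun w => G w i j).
Hypothesis XG : cvg_in_distribution P X Q G.

(** Approximating the indicator of the open set from below by a bump function. *)
Lemma portmanteau_open (O : set V) (e : R) : open O -> 0 < e ->
  \forall rad \near (+oo : set_system R),
    fine (Q (G @^-1` O)) - e <= fine (P (X rad @^-1` O)).
Proof.
move=> oO e0; have e20 : 0 < e / 2 by rewrite divr_gt0.
have mGO := open_measurable_coords mG oO.
have mbG j : measurable_fun setT (fun w => bump O j (G w)).
  exact: (@continuous_measurable_coords _ T' R m n G mG _ (@bump_continuous R _ O j)).
have mbX rad j : measurable_fun setT (fun w => bump O j (X rad w)).
  exact: (@continuous_measurable_coords _ T R m n (X rad) (mX rad) _ (@bump_continuous R _ O j)).
have b1 j z : `|bump O j z| <= 1.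
  by have /andP[b0 b1] := bump01 O j z; rewrite ger0_norm.
have cvQ : (\int[Q]_w (bump O j (G w))%:E)%E @[j --> \oo] --> (\int[Q]_w (\1_(G @^-1` O) w)%:E)%E.
  apply: (@dominated_cvg _ _ _ Q setT measurableT _ _ (cst 1%E)) => //.
  - by move=> j; apply/measurable_EFinP; exact: mbG.
  - move=> w _; apply: cvg_EFin; first exact: nearW.
    rewrite (_ : \1_(G @^-1` O) w = \1_O (G w))//.
    exact: (@bump_cvg _ _ O (G w) oO).
  - exact: finite_measure_integrable_cst.
  - by move=> j w _; rewrite abse_EFin lee_fin b1.
rewrite (integral_indic Q measurableT mGO) setIT in cvQ.
have /cvgrPdist_le /(_ _ e20) [j _ /(_ j (leqnn _)) hj] : \int[Q]_w (bump O j (G w)) @[j --> \oo] --> fine (Q (G @^-1` O)).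
  by apply: fine_cvg; rewrite fineK ?fin_num_measure.
have /cvgrPdist_le /(_ _ e20) := XG (@bump_continuous R _ O j) (ex_intro _ 1 (b1 j)).
apply: filterS => rad hr.
have mXO := open_measurable_coords (mX rad) oO.
have : \int[P]_w bump O j (X rad w) <= fine (P (X rad @^-1` O)).
  have -> : fine (P (X rad @^-1` O)) = \int[P]_w (\1_(X rad @^-1` O) w).
    by rewrite /Rintegral (integral_indic P measurableT mXO) setIT.
  apply: le_Rintegral => //.
  - exact: (bounded_integrable (probability_setT P) (mbX rad j) (fun w => b1 j _)).
  - apply: (bounded_integrable (probability_setT P) (K := 1)); first exact: measurable_indic.
    by move=> w; rewrite ger0_norm// indicE lern1 leq_b1.
  - by move=> w _; have := bump_le_indic O j (X rad w); rewrite !indicE.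
by move: hj hr; rewrite !ler_norml => /andP[_ h1] /andP[_ h2]; lra.
Qed.

Variables (theta : R -> T -> Th) (theta0 : Th).
Hypothesis mtheta : forall rad k, measurable [set w | ~ ball theta0 k (theta rad w)].
Hypothesis theta_cvg : forall (k e : R), 0 < k -> 0 < e ->
  \forall rad \near (+oo : set_system R),
    (P [set w | ~ ball theta0 k (theta rad w)] <= e%:E)%E.

(** A Slutsky form of the portmanteau inequality. The open sets of those [z] for which a whole
    ball around [(z, theta0)] in the second variable lies in [U] exhaust the section of
    [U] at [theta0], and the parameter is in that ball with large probability. *)
Lemma portmanteau_parameter (U : set (V * Th)) (e : R) : open U -> 0 < e ->
  (forall rad, measurable [set w | U (X rad w, theta rad w)]) ->
  \forall rad \near (+oo : set_system R),
    fine (Q [set w | U (G w, theta0)]) - e <= fine (P [set w | U (X rad w, theta rad w)]).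
Proof.
move=> oU e0 mU; have e30 : 0 < e / 3 by rewrite divr_gt0.
pose ki (k : nat) : R := k.+1%:R^-1.
have ki0 k : 0 < ki k by rewrite invr_gt0.
pose O k : set V := interior [set z | forall t, ball theta0 (ki k) t -> U (z, t)].
have oO k : open (O k) by exact: open_interior.
have mGO k := open_measurable_coords mG (oO k).
have UE : \bigcup_k (G @^-1` O k) = [set w | U (G w, theta0)].
  apply/seteqP; split=> w /= => [[k _] /interior_subset /=|UG].
    by apply; exact: ballxx.
  have : nbhs (G w, theta0) U by apply: open_nbhs_nbhs.
  move=> [[A B] /= [nA nB] AB].
  have /nbhs_ballP[r /= r0 rB] := nB.
  have [k _ /(_ k (leqnn _)) hk] := near_infty_natSinv_lt (PosNum r0).
  exists k => //=; rewrite /O /interior; apply: filterS nA => z Az t zt.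
  apply: (AB (z, t)); split => //=; apply: rB; apply: le_ball zt.
  exact: ltW hk.
have ndO : nondecreasing_seq (fun k => G @^-1` O k).
  move=> k l kl; apply/subsetPset => w /=; rewrite /O /interior.
  apply: filterS => z zk t zt; apply: zk; apply: le_ball zt.
  by rewrite /ki lef_pV2 ?posrE// ler_nat.
have := nondecreasing_cvg_mu (mu := Q) mGO (bigcup_measurable (fun k _ => mGO k)) ndO.
rewrite UE => cvO.
have mUG : measurable [set w | U (G w, theta0)].
  by rewrite -UE; exact: bigcup_measurable.
have /cvgrPdist_le /(_ _ e30) [k _ /(_ k (leqnn _)) hk] :
    fine (Q (G @^-1` O k)) @[k --> \oo] --> fine (Q [set w | U (G w, theta0)]).
  by apply: fine_cvg; rewrite fineK ?fin_num_measure.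
have := portmanteau_open (oO k) e30; apply: filter_app.
have := theta_cvg (ki0 k) e30; apply: filterS => rad ht hp.
have mXO := open_measurable_coords (mX rad) (oO k).
have sub : X rad @^-1` O k `<=` [set w | U (X rad w, theta rad w)] `|` [set w | ~ ball theta0 (ki k) (theta rad w)].
  move=> w /= /interior_subset /= Xw; have [h|h] := pselect (ball theta0 (ki k) (theta rad w)).
    by left; exact: Xw.
  by right.
have : (P (X rad @^-1` O k) <= P [set w | U (X rad w, theta rad w)] + (e / 3)%:E)%E.
  apply: le_trans (leeD (lexx _) ht).
  apply: le_trans (measureU2 P (mU rad) (mtheta rad _)).
  by apply: le_measure; rewrite ?inE//; exact: measurableU.
rewrite -(fineK (fin_num_measure P _ mXO)) -(fineK (fin_num_measure P _ (mU rad))) -EFinD lee_fin => h.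
by move: hk; rewrite ler_norml => /andP[_ h1]; lra.
Qed.

End portmanteau.

(** * Coverage at fixed frequencies *)

Section estimator_limits.
Context {R : realType} (T : Type) (F : set_system T) {FF : ProperFilter F}.
Context (m : nat) (alpha kappa : R).
Variables (Y : T -> bool -> 'I_m -> R) (y : bool -> 'I_m -> R).
Hypothesis Yy : forall a j, Y t a j @[t --> F] --> y a j.

Lemma cvg_sumr (I : Type) (r : seq I) (f : T -> I -> R) (l : I -> R) :
  (forall i, f t i @[t --> F] --> l i) ->
  \sum_(i <- r) f t i @[t --> F] --> \sum_(i <- r) l i.
Proof.
move=> fl; elim: r => [|i r IH].
  by under eq_fun do rewrite big_nil; rewrite big_nil; exact: cvg_cst.
by under eq_fun do rewrite big_cons; rewrite big_cons; exact: cvgD.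
Qed.

Lemma sample_mean_cvg a : sample_mean (Y t) a @[t --> F] --> sample_mean y a.
Proof. by apply: cvgM; [exact: cvg_cst|exact: cvg_sumr]. Qed.

Lemma s_hat_cvg : s_hat alpha kappa (Y t) @[t --> F] --> s_hat alpha kappa y.
Proof.
apply: cvgM; last exact: cvg_cst.
apply: cvgB; last exact: sample_mean_cvg.
by apply: cvgM; [exact: cvg_cst|exact: sample_mean_cvg].
Qed.

Lemma std_error_cvg : std_error alpha kappa (Y t) @[t --> F] --> std_error alpha kappa y.
Proof.
have cv a : sample_variance (Y t) a @[t --> F] --> sample_variance y a.
  apply: cvgM; first exact: cvg_cst.
  apply: cvg_sumr => j; rewrite expr2; under eq_fun do rewrite expr2.
  by apply: cvgM; apply: cvgB => //; exact: sample_mean_cvg.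
have ci : (kappa `^ (2 * alpha) * sample_variance (Y t) false + sample_variance (Y t) true) /
      (m%:R * (kappa `^ alpha - 1) ^+ 2) @[t --> F] -->
    (kappa `^ (2 * alpha) * sample_variance y false + sample_variance y true) /
      (m%:R * (kappa `^ alpha - 1) ^+ 2).
  apply: cvgM; last exact: cvg_cst.
  by apply: cvgD => //; apply: cvgM => //; exact: cvg_cst.
exact: (cvg_comp _ _ ci (@sqrt_continuous R _)).
Qed.

End estimator_limits.

Section coverage_set.
Context {R : realType} (m n : nat) (alpha kappa s b z : R) (idx : bool -> 'I_m -> 'I_n).

(** The periodograms as a function of the centered windowed transforms [x], of their
   means [t.1] and of the estimated intensity [t.2]. *)
Definition periodogram_array (x : 'M[R]_(n, 2)) (t : 'M[R]_(n, 2) * R) (a : bool) (j : 'I_m) : R :=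
  ((x (idx a j) ord0 + t.1 (idx a j) ord0) ^+ 2 +
   (x (idx a j) ord_max + t.1 (idx a j) ord_max) ^+ 2) / t.2.

(** Coverage with a strict inequality: an open condition on the array, which implies that the
    interval contains [s]. *)
Definition covers (y : bool -> 'I_m -> R) : bool :=
  `|s_hat alpha kappa y - s| < b + z * std_error alpha kappa y.

Definition coverage_set : set ('M[R]_(n, 2) * ('M[R]_(n, 2) * R)) :=
  [set p | 0 < p.2.2 /\ covers (periodogram_array p.1 p.2)].

Local Notation TT := ('M[R]_(n, 2) * ('M[R]_(n, 2) * R))%type.

(** The estimators are continuous in the array, and the array is continuous where the
    intensity is positive. *)
Lemma open_coverage_set : open coverage_set.
Proof.
rewrite openE => -[x [D p]] [/= p0 hc].
pose q0 : TT := (x, (D, p)).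
have cx (i : 'I_n) (k : 'I_2) : (fun q : TT => q.1 i k) q @[q --> nbhs q0] --> x i k.
  have c1 : (fun q : TT => q.1) q @[q --> nbhs q0] --> x by exact: cvg_fst.
  exact: (cvg_comp _ _ c1 (@coord_continuous R n 2 i k x)).
have cD (i : 'I_n) (k : 'I_2) : (fun q : TT => q.2.1 i k) q @[q --> nbhs q0] --> D i k.
  have c21 : (fun q : TT => q.2.1) q @[q --> nbhs q0] --> D.
    have c2 : (fun q : TT => q.2) q @[q --> nbhs q0] --> (D, p) by exact: cvg_snd.
    exact: (cvg_comp _ _ c2 (@cvg_fst _ _ _ _ _)).
  exact: (cvg_comp _ _ c21 (@coord_continuous R n 2 i k D)).
have cp : (fun q : TT => q.2.2) q @[q --> nbhs q0] --> p.
  have c2 : (fun q : TT => q.2) q @[q --> nbhs q0] --> (D, p) by exact: cvg_snd.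
  exact: (cvg_comp _ _ c2 (@cvg_snd _ _ _ _ _)).
have cy a j : (fun q : TT => periodogram_array q.1 q.2 a j) q @[q --> nbhs q0] --> periodogram_array x (D, p) a j.
  apply: cvgM; last by apply: cvgV => //=; rewrite gt_eqF.
  rewrite !expr2; under eq_fun do rewrite !expr2.
  by apply: cvgD; apply: cvgM; apply: cvgD; [exact: cx|exact: cD|exact: cx|exact: cD|exact: cx|exact: cD|exact: cx|exact: cD].
have cl : (fun q : TT => `|s_hat alpha kappa (periodogram_array q.1 q.2) - s|) q @[q --> nbhs q0] -->
    `|s_hat alpha kappa (periodogram_array x (D, p)) - s|.
  by apply: cvg_norm; apply: cvgB; [exact: s_hat_cvg|exact: cvg_cst].
have cr : (fun q : TT => b + z * std_error alpha kappa (periodogram_array q.1 q.2)) q @[q --> nbhs q0] -->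
    b + z * std_error alpha kappa (periodogram_array x (D, p)).
  apply: cvgD; first exact: cvg_cst.
  by apply: cvgM; [exact: cvg_cst|exact: std_error_cvg].
have cd := cvgB cr cl.
have hc' : 0 < b + z * std_error alpha kappa (periodogram_array x (D, p)) -
  `|s_hat alpha kappa (periodogram_array x (D, p)) - s| by rewrite subr_gt0.
have h1 : \forall q \near nbhs q0, 0 < q.2.2 by apply: (cvgr_gt p).
have h2 : \forall q \near nbhs q0, 0 < b + z * std_error alpha kappa (periodogram_array q.1 q.2) -
    `|s_hat alpha kappa (periodogram_array q.1 q.2) - s|.
  by apply: (cvgr_gt _ (cd _)).
apply: filter_app h1; apply: filterS h2 => -[x' [D' p']] /= h2 h1.
by split => //; move: h2; rewrite subr_gt0.
Qed.

End coverage_set.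

Section periodogram.
Context {R : realType} {d : nat}.
Local Notation E := 'rV[R]_d.
Local Notation leb := (@lebesgue_rV R d).
Context {dO : measure_display} {Om : measurableType dO}.
Variables (eta : R.-ker Om ~> E) (h : E -> R[i]).
Hypothesis eta_pp : point_process eta.
Hypothesis h_test : test_function (eball 1) h.

Lemma cos_lipschitz (x y : R) : `|cos x - cos y| <= `|x - y|.
Proof.
have := @mvt_bound _ (fun z => cos (y + z)) (fun z => - sin (y + z)) 1 (x - y).
have -> : y + (x - y) = x by rewrite addrC subrK.
rewrite addr0 mul1r; apply.
  by move=> z; apply: is_derive_translate; exact: is_derive_cos.
by move=> z _; rewrite normrN; exact: sin_abs1.
Qed.

Lemma sin_lipschitz (x y : R) : `|sin x - sin y| <= `|x - y|.
Proof.
have := @mvt_bound _ (fun z => sin (y + z)) (fun z => cos (y + z)) 1 (x - y).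
have -> : y + (x - y) = x by rewrite addrC subrK.
rewrite addr0 mul1r; apply.
  by move=> z; apply: is_derive_translate; exact: is_derive_sin.
by move=> z _; exact: cos_abs1.
Qed.

Lemma phase_lipschitz (x u v : E) :
  `|phase (- u) x - phase (- v) x| <= 2 * pi * enorm x * enorm (u - v).
Proof.
rewrite /phase (_ : _ - _ = 2 * pi * dotv x (u - v)); last first.
  by rewrite dotvDr !dotvNr; ring.
have p0 : 0 <= 2 * pi :> R by rewrite mulr_ge0// pi_ge0.
rewrite normrM ger0_norm// -mulrA ler_wpM2l// ler_norml dotv_cauchy andbT.
rewrite lerNl -dotvNr (le_trans (dotv_cauchy _ _))//.
by rewrite enormN.
Qed.

Let hre := (test_bounded_derivatives h_test).1.
Let him := (test_bounded_derivatives h_test).2.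

Let re_out x : 1 <= enorm x -> complex.Re (h x) = 0.
Proof. by move=> x1; rewrite (test_function_outside h_test). Qed.

Let im_out x : 1 <= enorm x -> complex.Im (h x) = 0.
Proof. by move=> x1; rewrite (test_function_outside h_test). Qed.

Lemma test_function_bound : exists B : R, 0 <= B /\
  forall x, `|complex.Re (h x)| <= B /\ `|complex.Im (h x)| <= B.
Proof.
have [B1 h1] := hre.2 [::]; have [B2 h2] := him.2 [::].
exists (Num.max B1 B2); split; first by rewrite le_max (le_trans _ (h1 0)).
by move=> x; rewrite !le_max h1 h2 orbT.
Qed.

Lemma measurable_windowed rad u :
  measurable_fun setT (fun x => complex.Re (windowed h rad u x)) /\
  measurable_fun setT (fun x => complex.Im (windowed h rad u x)).
Proof.
have cr := @measurable_scaled R d _ rad (smooth_continuous hre.1).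
have ci := @measurable_scaled R d _ rad (smooth_continuous him.1).
have mc := measurable_cos_phase (- u); have ms := measurable_sin_phase (- u).
split.
  under eq_fun do rewrite re_windowed.
  by apply: measurable_funB; exact: measurable_funM.
under eq_fun do rewrite im_windowed.
by apply: measurable_funD; exact: measurable_funM.
Qed.

Lemma windowed_outside rad u x : 0 < rad -> rad <= enorm x -> windowed h rad u x = 0.
Proof.
move=> r0 rx; rewrite /windowed (test_function_outside h_test) ?mul0r//.
by rewrite enormZ gtr0_norm ?invr_gt0// ler_pdivlMl// mulr1.
Qed.

Lemma windowed_bound rad u : 0 < rad -> exists K : R, forall x,
  `|complex.Re (windowed h rad u x)| <= K * \1_(eball rad) x /\
  `|complex.Im (windowed h rad u x)| <= K * \1_(eball rad) x.
Proof.
move=> r0; have [B [B0 hB]] := test_function_bound.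
exists (2 * B) => x; rewrite indicE in_eball; case: ltP => rx; last first.
  by rewrite windowed_outside//= normr0 mulr0.
have [h1 h2] := hB (rad^-1 *: x).
have c1 := cos_abs1 (phase (- u) x); have s1 := sin_abs1 (phase (- u) x).
have bnd (p q : R) : `|p| <= B -> `|q| <= 1 -> `|p * q| <= B.
  by move=> pB q1; rewrite normrM -[leRHS]mulr1; exact: ler_pM.
rewrite mulr1 re_windowed im_windowed mulr_natl mulr2n; split.
  by rewrite (le_trans (ler_normB _ _))// lerD ?bnd.
by rewrite (le_trans (ler_normD _ _))// lerD ?bnd.
Qed.

Lemma windowed_lipschitz rad : 0 < rad -> exists2 K : R, 0 <= K & forall u v x,
  `|complex.Re (windowed h rad u x) - complex.Re (windowed h rad v x)| <= K * enorm (u - v) * \1_(eball rad) x /\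
  `|complex.Im (windowed h rad u x) - complex.Im (windowed h rad v x)| <= K * enorm (u - v) * \1_(eball rad) x.
Proof.
move=> r0; have [B [B0 hB]] := test_function_bound.
have p0 : 0 <= 2 * pi :> R by rewrite mulr_ge0// pi_ge0.
exists (2 * (B * (2 * pi * rad))) => [|u v x].
  by rewrite !mulr_ge0 ?(ltW r0)// pi_ge0.
rewrite indicE in_eball; case: ltP => rx; last first.
  by rewrite !windowed_outside//= subrr normr0 mulr0.
have [h1 h2] := hB (rad^-1 *: x).
have ph : `|phase (- u) x - phase (- v) x| <= 2 * pi * rad * enorm (u - v).
  apply: le_trans (phase_lipschitz x u v) _.
  by rewrite ler_wpM2r ?enorm_ge0// ler_wpM2l// ltW.
have hc := le_trans (cos_lipschitz (phase (- u) x) (phase (- v) x)) ph.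
have hs := le_trans (sin_lipschitz (phase (- u) x) (phase (- v) x)) ph.
have bnd (p q : R) : `|p| <= B -> `|q| <= 2 * pi * rad * enorm (u - v) ->
    `|p * q| <= B * (2 * pi * rad) * enorm (u - v).
  by move=> pB q1; rewrite normrM -mulrA; exact: ler_pM.
rewrite mulr1 !re_windowed !im_windowed -[2 * _ * enorm _]mulrA mulr_natl mulr2n.
set a := complex.Re _ in h1 *; set b := complex.Im _ in h2 *.
set cu := cos (phase (- u) x) in hc *; set cv := cos (phase (- v) x) in hc *.
set su := sin (phase (- u) x) in hs *; set sv := sin (phase (- v) x) in hs *.
split.
  have -> : a * cu - b * su - (a * cv - b * sv) = a * (cu - cv) - b * (su - sv) by ring.
  by rewrite (le_trans (ler_normB _ _))// lerD ?bnd.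
have -> : a * su + b * cu - (a * sv + b * cv) = a * (su - sv) + b * (cu - cv) by ring.
by rewrite (le_trans (ler_normD _ _))// lerD ?bnd.
Qed.

Definition re_stat rad u w : R := linear_stat eta (fun x => complex.Re (windowed h rad u x)) w.
Definition im_stat rad u w : R := linear_stat eta (fun x => complex.Im (windowed h rad u x)) w.

(** The characters are Lipschitz in the frequency on a ball, and the ball contains
    finitely many points. *)
Lemma windowed_stat_continuous rad w : 0 < rad ->
  continuous (fun u => re_stat rad u w) /\ continuous (fun u => im_stat rad u w).
Proof.
move=> r0; have [K K0 hK] := windowed_lipschitz r0.
have C0 : 0 <= K * count eta rad w by rewrite mulr_ge0 ?count_ge0.
have lip (f : E -> E -> R) :
    (forall u, measurable_fun setT (f u)) ->
    (forall u, exists K' : R, forall x, `|f u x| <= K' * \1_(eball rad) x) ->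
    (forall u v x, `|f u x - f v x| <= K * enorm (u - v) * \1_(eball rad) x) ->
    continuous (fun u => linear_stat eta (f u) w).
  move=> mf fb fl u; apply/(@cvgrPdist_le _ _ _ _ (nbhs_filter u)) => ep ep0.
  have Cp : 0 < K * count eta rad w + 1 by rewrite ltr_wpDl.
  near=> v.
  have uv : enorm (u - v) <= ep / (K * count eta rad w + 1).
    near: v.
    have ce : {for u, continuous (fun v : E => enorm (u - v))}.
      apply: (continuous_comp (g := @enorm R d)); last exact: enorm_continuous.
      by apply: continuousB; [exact: cst_continuous|exact: cvg_id].
    have /cvgrPdist_le /(_ (ep / (K * count eta rad w + 1))) := ce.
    rewrite subrr; have -> : enorm (0 : E) = 0.
      by rewrite -(scale0r (0 : E)) enormZ normr0 mul0r.
    rewrite divr_gt0// => /(_ isT); apply: filterS => v.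
    by rewrite sub0r normrN ger0_norm ?enorm_ge0.
  have [K1 h1] := fb u; have [K2 h2] := fb v.
  have i1 := ball_integrable eta_pp w (mf u) h1.
  have i2 := ball_integrable eta_pp w (mf v) h2.
  rewrite /linear_stat -RintegralB//.
  apply: (le_trans (linear_stat_norm eta_pp w _ (fl u v))).
    exact: measurable_funB.
  rewrite mulrAC (le_trans (ler_wpM2l C0 uv))//.
  by rewrite mulrCA ler_piMr ?(ltW ep0)// ler_pdivrMr// mul1r lerDl.
split; apply: lip.
- by move=> u; exact: (measurable_windowed rad u).1.
- by move=> u; have [K' hK'] := windowed_bound u r0; exists K' => x; exact: (hK' x).1.
- by move=> u v x; exact: (hK u v x).1.
- by move=> u; exact: (measurable_windowed rad u).2.
- by move=> u; have [K' hK'] := windowed_bound u r0; exists K' => x; exact: (hK' x).2.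
- by move=> u v x; exact: (hK u v x).2.
Unshelve. all: end_near. Qed.

Lemma periodogramE rad u w : 0 < rad -> periodogram eta h rad u w =
  if 0 < intensity_estimator eta rad w then
    (intensity_estimator eta rad w)^-1 * rad `^ (- d%:R) * (re_stat rad u w ^+ 2 + im_stat rad u w ^+ 2)
  else 0.
Proof.
move=> r0; rewrite /periodogram; case: ifP => // _; congr (_ * _).
rewrite /Cintegral /= sqr_sqrtr ?addr_ge0 ?sqr_ge0//.
have restr (g : R[i] -> R) : g 0 = 0 ->
    \int[eta w]_(x in eball rad) g (windowed h rad u x) = linear_stat eta (fun x => g (windowed h rad u x)) w.
  move=> g0; rewrite Rintegral_mkcond /linear_stat; apply: eq_Rintegral => x _.
  rewrite patchE in_eball; case: ltP => // rx.
  by rewrite windowed_outside.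
by rewrite /re_stat /im_stat -(restr (@complex.Re R))// -(restr (@complex.Im R)).
Qed.

Lemma periodogram_continuous rad w : 0 < rad -> continuous (fun u => periodogram eta h rad u w).
Proof.
move=> r0; have [cr ci] := windowed_stat_continuous w r0.
under eq_fun do rewrite periodogramE//.
case: (0 < intensity_estimator eta rad w); last exact: cst_continuous.
move=> u.
have c2 := continuousD (continuousM (cr u) (cr u)) (continuousM (ci u) (ci u)).
exact: (continuousM (@cst_continuous _ _ _ u) c2).
Qed.

Lemma measurable_intensity_estimator rad : measurable_fun setT (intensity_estimator eta rad).
Proof. by apply: measurable_funM => //; exact: measurable_count. Qed.

Lemma measurable_stat rad u :
  measurable_fun setT (re_stat rad u) /\ measurable_fun setT (im_stat rad u).
Proof. by have [m1 m2] := measurable_windowed rad u; split; exact: measurable_linear_stat. Qed.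

Lemma measurable_periodogram rad u : 0 < rad -> measurable_fun setT (periodogram eta h rad u).
Proof.
move=> r0; have [m1 m2] := measurable_stat rad u.
have mi := measurable_intensity_estimator rad.
rewrite (_ : periodogram eta h rad u = fun w => if 0 < intensity_estimator eta rad w then
    (intensity_estimator eta rad w) `^ (- 1) * rad `^ (- d%:R) * (re_stat rad u w ^+ 2 + im_stat rad u w ^+ 2)
  else 0); last first.
  by apply/funext => w; rewrite periodogramE//; case: ifP => // /ltW i0; rewrite powR_inv1.
apply: measurable_fun_ifT => //; first exact: measurable_fun_ltr.
apply: measurable_funM.
  by apply: measurable_funM => //; exact: (measurableT_comp (measurable_powR (-1)) mi).
by apply: measurable_funD; exact: measurable_funX.
Qed.

End periodogram.

Section per_frequency.
Context {R : realType} {d : nat}.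
Local Notation E := 'rV[R]_d.
Local Notation leb := (@lebesgue_rV R d).
Context {dO : measure_display} {Om : measurableType dO}.
Variables (P : probability Om R) (eta : R.-ker Om ~> E) (rho : R).
Variables (sigma : {measure set E -> \bar R}) (h : E -> R[i]).
Hypothesis d_gt0 : (0 < d)%N.
Hypothesis eta_pp : point_process eta.
Hypothesis eta_moments : local_second_moments P eta.
Hypothesis sigma_bartlett : bartlett_measure P eta rho sigma.
Hypothesis sigma_ac : sigma `<< leb.
Hypothesis h_test : test_function (eball 1) h.
Hypothesis h_norm : (\int[leb]_x (Normc.normc (h x) ^+ 2)%:E = 1)%E.
Hypothesis rho_gt0 : 0 < rho.
Variables (m n : nat) (alpha kappa s b z : R) (idx : bool -> 'I_m -> 'I_n).
Variable u : n.-tuple E.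
Local Notation cset := (@coverage_set R m n alpha kappa s b z idx).

(** Positivity is required because the periodogram is discontinuous where the estimated
    intensity vanishes. *)
Definition coverage_event (rad : R) (w : Om) : Prop :=
  0 < intensity_estimator eta rad w /\
  covers alpha kappa s b z (fun a j => periodogram eta h rad (tnth u (idx a j)) w).

Definition dft_matrix (rad : R) (w : Om) : 'M[R]_(n, 2) :=
  real_coords (fun j => windowed_dft eta rho h rad (tnth u j) w).

Definition mean_matrix (rad : R) : 'M[R]_(n, 2) :=
  \matrix_(j < n, k < 2) (rad `^ (- (d%:R / 2)) * (rho *
    if k == ord0 then \int[leb]_x complex.Re (windowed h rad (tnth u j) x)
    else \int[leb]_x complex.Im (windowed h rad (tnth u j) x))).

Lemma dft_matrixE rad w j : dft_matrix rad w j ord0 + mean_matrix rad j ord0 =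
    rad `^ (- (d%:R / 2)) * re_stat eta h rad (tnth u j) w /\
  dft_matrix rad w j ord_max + mean_matrix rad j ord_max =
    rad `^ (- (d%:R / 2)) * im_stat eta h rad (tnth u j) w.
Proof.
rewrite /dft_matrix /mean_matrix /real_coords !mxE /= /windowed_dft /centered_stat /Cintegral /=.
by split; rewrite /re_stat /im_stat /linear_stat /windowed; ring.
Qed.

Lemma periodogram_arrayE rad w a j : 0 < rad -> 0 < intensity_estimator eta rad w ->
  periodogram_array idx (dft_matrix rad w) (mean_matrix rad, intensity_estimator eta rad w) a j =
  periodogram eta h rad (tnth u (idx a j)) w.
Proof.
move=> r0 i0; rewrite periodogramE// i0 /periodogram_array /=.
have [-> ->] := dft_matrixE rad w (idx a j).
have -> : rad `^ (- d%:R) = (rad `^ (- (d%:R / 2))) ^+ 2.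
  by rewrite expr2 -powRD ?(gt_eqF r0) ?implybT//; congr (_ `^ _); field.
by rewrite !exprMn; ring.
Qed.

Lemma coverage_eventE rad : 0 < rad ->
  [set w | cset (dft_matrix rad w, (mean_matrix rad, intensity_estimator eta rad w))] =
  [set w | coverage_event rad w].
Proof.
move=> r0; apply/seteqP; split => w [/= i0 hc]; split => //; move: hc;
  rewrite (_ : periodogram_array _ _ _ = (fun a j => periodogram eta h rad (tnth u (idx a j)) w))//;
  by apply/funext => a; apply/funext => j; exact: periodogram_arrayE.
Qed.

Lemma measurable_dft_matrix rad i j : measurable_fun setT (fun w => dft_matrix rad w i j).
Proof.
have [m1 m2] := measurable_stat eta h_test rad (tnth u i).
have [->|jn] := eqVneq j ord0.
  rewrite (_ : (fun _ => _) = (fun w => rad `^ (- (d%:R / 2)) * re_stat eta h rad (tnth u i) w - mean_matrix rad i ord0)).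
    by apply: measurable_funB => //; exact: measurable_funM.
  by apply/funext => w; rewrite -(dft_matrixE rad w i).1 addrK.
have -> : j = ord_max by apply/val_inj; case: j jn => [[|[|]]].
rewrite (_ : (fun _ => _) = (fun w => rad `^ (- (d%:R / 2)) * im_stat eta h rad (tnth u i) w - mean_matrix rad i ord_max)).
  by apply: measurable_funB => //; exact: measurable_funM.
by apply/funext => w; rewrite -(dft_matrixE rad w i).2 addrK.
Qed.

Lemma measurable_coverage_set dT (T : measurableType dT) (X : T -> 'M[R]_(n, 2)) (D : 'M[R]_(n, 2)) (p : T -> R) :
  (forall i j, measurable_fun setT (fun w => X w i j)) -> measurable_fun setT p ->
  measurable [set w | cset (X w, (D, p w))].
Proof.
move=> mX mp.
pose Y w (a : bool) (j : 'I_m) : R := ((X w (idx a j) ord0 + D (idx a j) ord0) ^+ 2 +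
   (X w (idx a j) ord_max + D (idx a j) ord_max) ^+ 2) * (p w) `^ (- 1).
rewrite (_ : mkset _ = [set w | 0 < p w] `&` [set w | covers alpha kappa s b z (Y w)]).
  apply: measurableI.
    by rewrite -[X in measurable X]setTI; apply: measurable_fun_ltr.
  apply: measurable_coverage => a j; apply: measurable_funM.
    by apply: measurable_funD; apply: measurable_funX; exact: measurable_funD.
  exact: (measurableT_comp (measurable_powR (-1)) mp).
have YE w : 0 < p w -> periodogram_array idx (X w) (D, p w) = Y w.
  by move=> p0; apply/funext => a; apply/funext => j; rewrite /Y powR_inv1// ltW.
apply/seteqP; split => w /= [p0 hc]; split => //.
  by rewrite -YE.
by rewrite YE.
Qed.

Hypothesis u_neq0 : forall i, tnth u i != 0.
Context (dG : measure_display) (TG : measurableType dG) (Q : probability TG R) (G : 'I_n -> TG -> R[i]).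
Hypothesis mG : forall i, Cmeasurable (G i).
Hypothesis dft_cvg : cvg_in_distribution P dft_matrix Q (fun w => real_coords (G ^~ w)).

Lemma mean_matrix_cvg0 (k : R) : 0 < k ->
  \forall rad \near (+oo : set_system R), ball (0 : 'M[R]_(n, 2)) k (mean_matrix rad).
Proof.
move=> k0; have k20 : 0 < k / 2 by rewrite divr_gt0.
have : \forall rad \near (+oo : set_system R), forall i : 'I_n,
    `|rad `^ (- (d%:R / 2)) * (rho * \int[leb]_x complex.Re (windowed h rad (tnth u i) x))| <= k / 2 /\
    `|rad `^ (- (d%:R / 2)) * (rho * \int[leb]_x complex.Im (windowed h rad (tnth u i) x))| <= k / 2.
  apply: filter_forall => i; exact: window_mean_small.
apply: filterS => rad hr; split => // i j.
have [h1 h2] := hr i.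
rewrite /ball /= !mxE sub0r normrN.
case: (j == ord0); [apply: le_lt_trans h1 _|apply: le_lt_trans h2 _];
  by rewrite ltr_pdivrMr// ltr_pMr// ltr1n.
Qed.

(** The array is a function of the centered transforms, which converge in law by assumption, and
    of a parameter that converges in probability to [(0, rho)]; coverage is an open
    condition on both. *)
Lemma coverage_limit (e : R) : 0 < e ->
  \forall rad \near (+oo : set_system R),
    fine (Q [set w | covers alpha kappa s b z (fun a j => Normc.normc (G (idx a j) w) ^+ 2 / rho)]) - e <=
    fine (P [set w | coverage_event rad w]).
Proof.
move=> e0.
pose theta rad w : 'M[R]_(n, 2) * R := (mean_matrix rad, intensity_estimator eta rad w).
pose th0 : 'M[R]_(n, 2) * R := (0, rho).
have mi rad := measurable_intensity_estimator eta rad.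
have mGc i j : measurable_fun setT (fun w => real_coords (G ^~ w) i j).
  rewrite (_ : (fun _ => _) = (fun w => if j == ord0 then complex.Re (G i w) else complex.Im (G i w))).
    by case: (j == ord0); [exact: (mG i).1|exact: (mG i).2].
  by apply/funext => w; rewrite mxE.
have mtheta rad k : measurable [set w | ~ ball th0 k (theta rad w)].
  rewrite (_ : mkset _ = ~` [set w | ball th0 k (theta rad w)])//.
  apply: measurableC; have [hD|hD] := pselect (ball (0 : 'M[R]_(n, 2)) k (mean_matrix rad)).
    rewrite (_ : mkset _ = [set w | (`|rho - intensity_estimator eta rad w| < k)%R]).
      rewrite -[X in measurable X]setTI; apply: measurable_fun_ltr => //.
      by apply: measurableT_comp => //; exact: measurable_funB.
    by apply/seteqP; split => w /= => [[]//|wk]; split.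
  rewrite (_ : mkset _ = set0)//; apply/seteqP; split => w //= -[] //.
have theta_cvg (k e' : R) : 0 < k -> 0 < e' -> \forall rad \near (+oo : set_system R),
    (P [set w | ~ ball th0 k (theta rad w)] <= e'%:E)%E.
  move=> k0 e'0; have := mean_matrix_cvg0 k0; apply: filter_app.
  have := intensity_estimator_consistent d_gt0 eta_pp eta_moments sigma_bartlett sigma_ac h_test h_norm rho_gt0 e'0 k0.
  apply: filterS => rad hP hD; apply: le_trans hP.
  apply: le_measure; rewrite ?inE//.
    rewrite -[X in measurable X]setTI; apply: measurable_fun_ler => //.
    by apply: measurableT_comp => //; exact: measurable_funB.
  move=> w /=; apply: contra_notP => /negP; rewrite -ltNge distrC => hk.
  by split.
have mU rad : measurable [set w | cset (dft_matrix rad w, theta rad w)].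
  by apply: measurable_coverage_set => // i j; exact: measurable_dft_matrix.
have := portmanteau_parameter measurable_dft_matrix mGc dft_cvg mtheta theta_cvg
  (@open_coverage_set R m n alpha kappa s b z idx) e0 mU.
rewrite (_ : [set w | cset (real_coords (G ^~ w), (0, rho))] =
  [set w | covers alpha kappa s b z (fun a j => Normc.normc (G (idx a j) w) ^+ 2 / rho)]); last first.
  have YE w : periodogram_array idx (real_coords (G ^~ w)) (0, rho) =
     (fun a j => Normc.normc (G (idx a j) w) ^+ 2 / rho).
    apply/funext => a; apply/funext => j.
    rewrite /periodogram_array /= !mxE /= !addr0; case: (G (idx a j) w) => p q /=.
    by rewrite sqr_sqrtr ?addr_ge0 ?sqr_ge0.
  apply/seteqP; split => w /=; first by move=> [_] /=; rewrite YE.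
  by move=> hc; split => //=; rewrite YE.
move=> hp; near=> rad.
have r0 : 0 < rad by near: rad; exact: nbhs_pinfty_gt.
rewrite -(coverage_eventE r0); near: rad; exact hp.
Unshelve. all: end_near. Qed.

End per_frequency.

(** * Gaussian limit of the periodograms *)

Section centered_normal_law.
Context {R : realType}.
Local Notation N := (@normal_prob R 0 1).
Local Notation mu := (@lebesgue_measure R).

(** A centered normal law of any variance, including the degenerate one, is a dilation of the
    standard normal law. *)
Lemma centered_normalE (v : R) (A : set (measurableTypeR R)) : 0 <= v -> measurable A ->
  centered_normal v A = N (affine (Num.sqrt v) 0 @^-1` A).
Proof.
move=> v0 mA; rewrite /centered_normal; have [->|vn0] := eqVneq v 0.
  rewrite sqrtr0 diracE; have [A0|A0] := boolP (0 \in A).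
    rewrite (_ : _ @^-1` A = setT); first by rewrite normal_prob_setT.
    by apply/seteqP; split => x //= _; rewrite /affine mul0r addr0; move: A0; rewrite inE.
  rewrite (_ : _ @^-1` A = set0) ?measure0//; apply/seteqP; split => x //=.
  by rewrite /affine mul0r addr0 => /mem_set; rewrite (negbTE A0).
have s0 : 0 < Num.sqrt v by rewrite sqrtr_gt0 lt_def vn0.
set s := Num.sqrt v in s0 *.
have mA' : measurable (affine s 0 @^-1` A).
  by rewrite -[X in measurable X]setTI; exact: measurable_affine.
rewrite /normal_prob [LHS]integral_mkcond [RHS]integral_mkcond.
rewrite (ge0_integral_affine 0 s0); last 2 first.
- apply/(measurable_restrictT _ mA); apply: measurable_funTS; apply/measurable_EFinP.
  exact: measurable_normal_pdf.
- by move=> x; rewrite patchE; case: ifPn => // _; rewrite lee_fin normal_pdf_ge0.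
rewrite -ge0_integralZl//; last 3 first.
- apply: (measurableT_comp (f := (fun x => (normal_pdf 0 s x)%:E) \_ A)) (measurable_affine s 0).
  apply/(measurable_restrictT _ mA); apply: measurable_funTS; apply/measurable_EFinP.
  exact: measurable_normal_pdf.
- by move=> x _; rewrite patchE; case: ifPn => // _; rewrite lee_fin normal_pdf_ge0.
- by rewrite lee_fin ltW.
apply: eq_integral => x _; rewrite !patchE.
have -> : (s * x + 0 \in A) = (x \in affine s 0 @^-1` A) by apply/idP/idP; rewrite !inE.
case: ifPn => _; last by rewrite mule0.
rewrite -EFinM; congr EFin; rewrite !normal_pdfE ?oner_neq0 ?gt_eqF//.
rewrite /normal_fun addr0 !subr0 expr1n.
have -> : normal_peak s = s^-1 * normal_peak 1.
  rewrite /normal_peak expr1n mul1r -mulrnAr sqrtrM ?sqr_ge0// sqrtr_sqr gtr0_norm//.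
  by rewrite invfM.
rewrite mulrA mulrA divff ?gt_eqF// mul1r; congr (_ * expR _).
by field; rewrite gt_eqF.
Qed.

End centered_normal_law.

Section generation.
Context d d' (T : measurableType d) (T' : measurableType d') (R : realType).
Context (I : finType) (X : I -> T -> T').
Local Notation G := [set A | exists i B, measurable B /\ A = X i @^-1` B].

Lemma measurable_generator i :
  measurable_fun [set: g_sigma_algebraType G] (X i : g_sigma_algebraType G -> T').
Proof. by move=> _ B mB; rewrite setTI; apply: sub_sigma_algebra; exists i, B. Qed.

(** Generation is a measurability statement about the identity, to which the measurability
    lemmas of products apply. *)
Lemma generation_id :
  measurable_fun [set: g_sigma_algebraType G] (id : g_sigma_algebraType G -> T) ->
  @measurable _ T `<=` <<s G >>.
Proof. by move=> mid A mA; have := mid measurableT A mA; rewrite setTI. Qed.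

Hypothesis mX : forall i, measurable_fun setT (X i).
Hypothesis genX : @measurable _ T `<=` <<s G >>.

Lemma probability_unique_rectangle (m1 m2 : {measure set T -> \bar R}) :
  (m1 setT < +oo)%E ->
  (forall A : I -> set T', (forall i, measurable (A i)) ->
     m1 (rectangle X A) = m2 (rectangle X A)) ->
  forall A, measurable A -> m1 A = m2 A.
Proof.
move=> m1T agree.
have rT : rectangle X (fun=> setT) = setT by apply/seteqP; split.
apply: (measure_unique_rectangle mX genX (g := fun=> setT)) => //.
  by rewrite rT; apply/seteqP; split => // t _; exists 0%N.
by rewrite rT.
Qed.

End generation.

Section circular_gaussian_law.
Context {R : realType}.
Local Notation RR := (measurableTypeR R * measurableTypeR R)%type.
Local Notation N := (@normal_prob R 0 1).
Local Notation N2 := (N \x N)%E.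

Definition pair_coord (b : bool) (z : RR) : measurableTypeR R := if b then z.1 else z.2.

Lemma measurable_pair_coord b : measurable_fun setT (pair_coord b).
Proof. by case: b; [exact: measurable_fst|exact: measurable_snd]. Qed.

Lemma pair_generation : @measurable _ RR `<=`
  <<s [set A | exists (b : bool) B, measurable B /\ A = pair_coord b @^-1` B] >>.
Proof.
apply: generation_id; apply/measurable_fun_pairP; split.
  exact: (measurable_generator (X := pair_coord) true).
exact: (measurable_generator (X := pair_coord) false).
Qed.

Lemma circular_gaussian_law d (T : measurableType d) (Q : probability T R) (G : T -> R[i])
    (v : R) : Cmeasurable G -> 0 <= v ->
  has_centered_normal_law Q (@complex.Re R \o G) v ->
  has_centered_normal_law Q (@complex.Im R \o G) v ->
  independent Q (fun b : bool => sigma_of (if b then @complex.Re R \o G else @complex.Im R \o G)) ->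
  forall C : set RR, measurable C ->
  Q [set w | C (complex.Re (G w), complex.Im (G w))] =
  N2 [set z | C (Num.sqrt v * z.1, Num.sqrt v * z.2)].
Proof.
move=> [mRe mIm] v0 hRe hIm ind.
have mp : measurable_fun setT (fun w => ((complex.Re (G w), complex.Im (G w)) : RR)).
  by apply/measurable_fun_pairP; split.
have ms : measurable_fun setT (fun z : RR => ((Num.sqrt v * z.1, Num.sqrt v * z.2) : RR)).
  by apply/measurable_fun_pairP; split; apply: measurable_funM.
pose pm : {mfun T >-> RR} := HB.pack (fun w => ((complex.Re (G w), complex.Im (G w)) : RR))
  (isMeasurableFun.Build _ _ _ _ _ mp).
pose sm : {mfun RR >-> RR} := HB.pack (fun z : RR => ((Num.sqrt v * z.1, Num.sqrt v * z.2) : RR))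
  (isMeasurableFun.Build _ _ _ _ _ ms).
have := @probability_unique_rectangle _ _ RR _ R _ pair_coord measurable_pair_coord pair_generation
  (mpushforward Q pm) (mpushforward N2 sm).
apply.
  have Q1 : (Q setT < +oo)%E by rewrite probability_setT ltry.
  exact: Q1.
move=> A mA.
suff : Q (pm @^-1` rectangle pair_coord A) = N2 (sm @^-1` rectangle pair_coord A) by [].
have -> : pm @^-1` rectangle pair_coord A =
    \bigcap_(b in [set: bool]) ((if b then @complex.Re R \o G else @complex.Im R \o G) @^-1` A b).
  apply/seteqP; split => w /= h; first by move=> [] _; [have := h true|have := h false].
  by move=> []; [exact: (h true)|exact: (h false)].
rewrite ind; last first.
  by move=> b; exists (A b); [exact: mA|rewrite setTI].
rewrite big_bool /= -!/(preimage _ _) (hRe _ (mA true)) (hIm _ (mA false)).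
rewrite !centered_normalE//.
have -> : sm @^-1` rectangle pair_coord A =
   (affine (Num.sqrt v) 0 @^-1` A true) `*` (affine (Num.sqrt v) 0 @^-1` A false).
  apply/seteqP; split => z /=.
    by move=> h; split; rewrite /affine /= addr0; [have := h true|have := h false].
  by rewrite /affine !addr0 => -[h1 h2] [].
by rewrite product_measure1E//; rewrite -[X in measurable X]setTI; exact: measurable_affine.
Qed.

End circular_gaussian_law.

Section product_probability.
Context d1 d2 (T1 : measurableType d1) (T2 : measurableType d2) (R : realType).

Section product.
Variables (m1 : probability T1 R) (m2 : probability T2 R).

Definition product_probability := (m1 \x m2)%E.

HB.instance Definition _ := Measure.on product_probability.

Let product_probability_setT : product_probability setT = 1%E.
Proof. by apply: product_measure_setT1; exact: probability_setT. Qed.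

HB.instance Definition _ := Measure_isProbability.Build _ _ _ product_probability
  product_probability_setT.
End product.

Section law.
Variables (m : probability T1 R) (f : {mfun T1 >-> T2}).

Definition law := mpushforward m f.

HB.instance Definition _ := Measure.on law.

Let law_setT : law setT = 1%E.
Proof. exact: (probability_setT m). Qed.

HB.instance Definition _ := Measure_isProbability.Build _ _ _ law law_setT.
End law.

End product_probability.

Lemma ge0_integral_product d1 d2 (T1 : measurableType d1) (T2 : measurableType d2) (R : realType)
    (m1 : {sigma_finite_measure set T1 -> \bar R}) (m2 : {sigma_finite_measure set T2 -> \bar R})
    (f : T1 -> \bar R) (g : T2 -> \bar R) :
  measurable_fun setT f -> measurable_fun setT g ->
  (forall x, 0 <= f x)%E -> (forall y, 0 <= g y)%E ->
  (\int[(m1 \x m2)%E]_z (f z.1 * g z.2) = \int[m1]_x f x * \int[m2]_y g y)%E.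
Proof.
move=> mf mg f0 g0; rewrite fubini_tonelli1//; last 2 first.
- by apply: emeasurable_funM; exact: measurableT_comp.
- by move=> z; exact: mule_ge0.
under eq_integral => x _.
  rewrite (_ : fubini_F _ _ _ = f x * \int[m2]_y g y)%E; first over.
  by rewrite /fubini_F /= ge0_integralZl.
by rewrite ge0_integralZr//; exact: integral_ge0.
Qed.

Section integral_of_product.
Context d (T : measurableType d) (R : realType).
Variable mu : {sigma_finite_measure set T -> \bar R}.

Lemma ge0_integral_prod_tuple n (f : 'I_n -> T -> \bar R) :
  (forall i, measurable_fun setT (f i)) -> (forall i x, 0 <= f i x)%E ->
  (\int[measure_pow mu n]_t \prod_(i < n) f i (tnth t i) = \prod_(i < n) \int[mu]_x f i x)%E.
Proof.
elim: n f => [|n IH] f mf f0.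
  rewrite big_ord0 /=; under eq_integral do rewrite big_ord0.
  by rewrite (integral_dirac _ measurableT)// diracE in_setT mul1e.
have mprod k (g : 'I_k -> T -> \bar R) : (forall i, measurable_fun setT (g i)) ->
    measurable_fun setT (fun t : k.-tuple T => (\prod_(i < k) g i (tnth t i))%E).
  move=> mg; elim: (index_enum _) => [|i r IHr].
    by under eq_fun do rewrite big_nil; exact: measurable_cst.
  under eq_fun do rewrite big_cons; apply: emeasurable_funM => //.
  exact: (measurableT_comp (mg i) (measurable_tnth i)).
have prod0 k (g : 'I_k -> T -> \bar R) (t : k.-tuple T) : (forall i x, 0 <= g i x)%E ->
    (0 <= \prod_(i < k) g i (tnth t i))%E.
  by move=> g0; apply: prode_ge0.
rewrite /= /measure_cons (ge0_integral_mpushforward (mu \x measure_pow mu n)%E (@tcons _ T n)); last 2 first.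
- exact: mprod.
- by move=> t; exact: prod0.
rewrite big_ord_recl -IH//.
pose g (t : n.-tuple T) : \bar R := (\prod_(i < n) f (lift ord0 i) (tnth t i))%E.
transitivity (\int[(mu \x measure_pow mu n)%E]_z (f ord0 z.1 * g z.2))%E.
  apply: eq_integral => -[x t] _ /=; rewrite big_ord_recl; congr (_ * _)%E.
  by apply: eq_bigr => i _; rewrite tnthS.
have mg : measurable_fun setT g by exact: (mprod n (fun i => f (lift ord0 i))).
have g0 t : (0 <= g t)%E by exact: (prod0 n (fun i => f (lift ord0 i))).
by rewrite ge0_integral_product.
Qed.

End integral_of_product.

Section gaussian_periodogram.
Context {R : realType}.
Local Notation RR := (measurableTypeR R * measurableTypeR R)%type.
Local Notation N := (@normal_prob R 0 1).

Definition gauss2 : probability RR R := product_probability N N.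

(** Half the squared modulus of a standard Gaussian vector is exponential of mean 1; this is
    the limit of a periodogram at a frequency where the structure factor is [s]. *)
Definition scaled_modulus (s : R) (g : RR) : measurableTypeR R :=
  s * ((g.1 ^+ 2 + g.2 ^+ 2) / 2).

Lemma measurable_modulus : measurable_fun setT (fun g : RR => (g.1 ^+ 2 + g.2 ^+ 2) / 2 : R).
Proof.
apply: measurable_funM => //; apply: measurable_funD; apply: measurable_funX.
  exact: measurable_fst.
exact: measurable_snd.
Qed.

Context d (T : measurableType d) (Q : probability T R).

Lemma centered_normal_variance (X : T -> R) (v : R) : 0 <= v -> measurable_fun setT X ->
  has_centered_normal_law Q X v -> (\int[Q]_w (X w ^+ 2)%:E = v%:E)%E.
Proof.
move=> v0 mX hX.
pose Xm : {mfun T >-> measurableTypeR R} := HB.pack (X : T -> measurableTypeR R)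
  (isMeasurableFun.Build _ _ _ _ (X : T -> measurableTypeR R) mX).
have mX2 : measurable_fun [set: measurableTypeR R] (fun x : R => (x ^+ 2)%:E).
  by apply/measurable_EFinP; exact: measurable_funX.
have x20 (x : measurableTypeR R) : (0 <= (x ^+ 2)%:E)%E by rewrite lee_fin sqr_ge0.
transitivity (\int[mpushforward Q Xm]_x (x ^+ 2)%:E)%E.
  by rewrite (ge0_integral_mpushforward Q Xm mX2 x20).
rewrite (eq_measure_integral (mpushforward N (affine (Num.sqrt v) 0))); last first.
  by move=> A mA _; rewrite [LHS]hX// centered_normalE.
rewrite (ge0_integral_mpushforward N (affine (Num.sqrt v) 0) mX2 x20).
under eq_integral => x _ do rewrite /= /affine addr0 exprMn sqr_sqrtr// EFinM.
by rewrite ge0_integralZl// normal_second_moment mule1.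
Qed.

(** The second moment determines the common variance [rho * s / 2] of the real and imaginary
    parts. *)
Lemma circular_gaussian_modulus (G : T -> R[i]) (rho s : R) : 0 < rho ->
  circular_gaussian Q G -> (\int[Q]_w (Normc.normc (G w) ^+ 2)%:E)%E = (rho * s)%:E ->
  forall B, measurable B ->
  Q [set w | B (Normc.normc (G w) ^+ 2 / rho)] = gauss2 [set g | B (scaled_modulus s g)].
Proof.
move=> rho0 [mG [v v0 [hRe hIm ind]]] varE B mB.
have [mRe mIm] := mG.
have normcE w : Normc.normc (G w) ^+ 2 = complex.Re (G w) ^+ 2 + complex.Im (G w) ^+ 2.
  by case: (G w) => a b /=; rewrite sqr_sqrtr// addr_ge0 ?sqr_ge0.
have vE : v = rho * s / 2.
  have : (\int[Q]_w (Normc.normc (G w) ^+ 2)%:E = v%:E + v%:E)%E.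
    rewrite -{1}(centered_normal_variance v0 mRe hRe) -(centered_normal_variance v0 mIm hIm).
    rewrite -ge0_integralD//.
    - by apply: eq_integral => w _; rewrite normcE EFinD.
    - by move=> w _; rewrite lee_fin sqr_ge0.
    - by apply/measurable_EFinP; exact: measurable_funX.
    - by move=> w _; rewrite lee_fin sqr_ge0.
    - by apply/measurable_EFinP; exact: measurable_funX.
  by rewrite varE -EFinD => -[->]; field.
pose C : set RR := [set z | B ((z.1 ^+ 2 + z.2 ^+ 2) / rho)].
have mC : measurable C.
  rewrite (_ : C = (fun z : RR => (z.1 ^+ 2 + z.2 ^+ 2) / rho) @^-1` B)//.
  rewrite -[X in measurable X]setTI.
  have mf : measurable_fun setT (fun z : RR => (z.1 ^+ 2 + z.2 ^+ 2) / rho : measurableTypeR R).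
    apply: measurable_funM => //; apply: measurable_funD; apply: measurable_funX.
      exact: measurable_fst.
    exact: measurable_snd.
  exact: mf.
rewrite (_ : mkset _ = [set w | C (complex.Re (G w), complex.Im (G w))]); last first.
  by apply/seteqP; split => w /=; rewrite /C /= normcE.
rewrite (circular_gaussian_law mG v0 hRe hIm ind mC); congr ((N \x N)%E _).
have E1 (g : RR) : ((Num.sqrt v * g.1) ^+ 2 + (Num.sqrt v * g.2) ^+ 2) / rho = scaled_modulus s g.
  rewrite !exprMn sqr_sqrtr// vE /scaled_modulus; field; rewrite gt_eqF//.
by apply/seteqP; split => g /=; rewrite /C /= E1.
Qed.

End gaussian_periodogram.

(** * Frequencies uniform on balls *)

Section tuple_generation.
Context d (T : measurableType d) (R : realType) (n : nat).

Lemma tuple_generation : @measurable _ (n.-tuple T) `<=`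
  <<s [set A | exists (i : 'I_n) B, measurable B /\ A = (fun t : n.-tuple T => tnth t i) @^-1` B] >>.
Proof.
apply: generation_id; apply/measurable_fun_tnthP => i.
exact: (measurable_generator (X := fun (i : 'I_n) (t : n.-tuple T) => tnth t i) i).
Qed.

End tuple_generation.

Section sampling_law.
Context {R : realType} {d : nat}.
Local Notation E := 'rV[R]_d.
Local Notation leb := (@lebesgue_rV R d).
Local Notation vol := (ball_volume (n := d)).
Variables (n : nat) (radius : 'I_n -> R).
Hypothesis radius_gt0 : forall i, 0 < radius i.

Definition sampling_box : set (n.-tuple E) := [set t | forall i, eball (radius i) (tnth t i)].

Lemma measurable_sampling_box : measurable sampling_box.
Proof.
apply: (@measurable_rectangle _ _ (n.-tuple E) E 'I_n (fun i t => tnth t i) _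
  (fun i => eball (radius i))) => i; first exact: measurable_tnth.
exact: measurable_eball.
Qed.

(** Independent coordinates, uniform on balls of different radii: the normalized restriction
    of the product Lebesgue measure to the product of the balls. In this form null sets of
    the product Lebesgue measure are visibly null. *)
Definition sampling_law : probability (n.-tuple E) R :=
  mnormalize (mrestr (measure_pow leb n) measurable_sampling_box) \d_([tuple (0 : E) | _ < n]).

Lemma sampling_box_volume : measure_pow leb n sampling_box = (\prod_(i < n) vol (radius i))%:E.
Proof.
rewrite /sampling_box (measure_powE leb (A := fun i => eball (radius i))); last first.
  by move=> i; exact: measurable_eball.
transitivity (\prod_(i < n) (vol (radius i))%:E)%E; last exact: prodEFin.
by apply: eq_bigr => i _; exact: (ball_volumeE (radius i)).
Qed.

Lemma sampling_lawE (A : set (n.-tuple E)) : measurable A ->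
  sampling_law A = ((\prod_(i < n) vol (radius i))^-1%:E * measure_pow leb n (A `&` sampling_box))%E.
Proof.
move=> mA; have v0 : 0 < \prod_(i < n) vol (radius i).
  by apply: prodr_gt0 => i _; exact: ball_volume_gt0.
rewrite /sampling_law /mnormalize /= /mnormalize /= /mrestr setTI sampling_box_volume eqe (gt_eqF v0)/=.
by rewrite muleC.
Qed.

Lemma sampling_law_rectangle (A : 'I_n -> set E) : (forall i, measurable (A i)) ->
  sampling_law (rectangle (fun (i : 'I_n) (t : n.-tuple E) => tnth t i) A) =
  (\prod_(i < n) uniform_ball (radius i) (A i))%E.
Proof.
move=> mA; rewrite sampling_lawE; last first.
  by apply: measurable_rectangle => // i; exact: measurable_tnth.
have -> : rectangle (fun (i : 'I_n) (t : n.-tuple E) => tnth t i) A `&` sampling_box =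
    [set t | forall i, (A i `&` eball (radius i)) (tnth t i)].
  apply/seteqP; split => t /= => [[At Bt] i|h]; first by split; [exact: At|exact: Bt].
  by split => i; have [] := h i.
rewrite (measure_powE leb (A := fun i => A i `&` eball (radius i))); last first.
  by move=> i; apply: measurableI => //; exact: measurable_eball.
rewrite -prodfV -prodEFin -big_split/=; apply: eq_bigr => i _.
by rewrite uniform_ballE.
Qed.

Definition sampling_density (t : n.-tuple E) : R := \prod_(i < n) ball_density (radius i) (tnth t i).

Lemma sampling_law_density (A : set (n.-tuple E)) : measurable A ->
  sampling_law A = (\int[measure_pow leb n]_(t in A) (sampling_density t)%:E)%E.
Proof.
move=> mA; rewrite sampling_lawE//.
have dE t : sampling_density t = (\prod_(i < n) vol (radius i))^-1 * \1_sampling_box t.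
  rewrite /sampling_density /ball_density big_split/= prodfV; congr (_ * _).
  rewrite indicE; case: (boolP (t \in sampling_box)) => [|tB].
    by rewrite inE => tB; apply: big1 => i _; rewrite indicE mem_set//; exact: tB.
  have [i ti] : exists i, ~ eball (radius i) (tnth t i).
    apply: contrapT => /forallNP h; move/negP: tB; apply; rewrite inE => i.
    by apply: contrapT; exact: h.
  by rewrite (bigD1 i)//= indicE memNset// mul0r.
under eq_integral do rewrite dE EFinM.
rewrite ge0_integralZl//.
- by rewrite (integral_indic (measure_pow leb n) mA measurable_sampling_box) setIC.
- by apply: measurable_funTS; apply/measurable_EFinP; apply: measurable_indic; exact: measurable_sampling_box.
- by rewrite lee_fin invr_ge0; apply: prodr_ge0 => i _; rewrite ltW// ball_volume_gt0.
Qed.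

Lemma measurable_sampling_density : measurable_fun setT sampling_density.
Proof.
rewrite /sampling_density; elim: (index_enum _) => [|i r IHr].
  by under eq_fun do rewrite big_nil; exact: measurable_cst.
under eq_fun do rewrite big_cons; apply: measurable_funM => //.
exact: (measurableT_comp (measurable_ball_density (radius i)) (measurable_tnth i)).
Qed.

Lemma ge0_integral_sampling_prod (f : 'I_n -> E -> \bar R) :
  (forall i, measurable_fun setT (f i)) -> (forall i x, 0 <= f i x)%E ->
  (\int[sampling_law]_t \prod_(i < n) f i (tnth t i) =
   \prod_(i < n) \int[uniform_ball (radius i)]_x f i x)%E.
Proof.
move=> mf f0.
have bd0 (i : 'I_n) (x : E) : 0 <= ball_density (radius i) x by exact: ball_density_ge0.
have mprod : measurable_fun setT (fun t : n.-tuple E => (\prod_(i < n) f i (tnth t i))%E).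
  elim: (index_enum _) => [|i r IHr].
    by under eq_fun do rewrite big_nil; exact: measurable_cst.
  under eq_fun do rewrite big_cons; apply: emeasurable_funM => //.
  exact: (measurableT_comp (mf i) (measurable_tnth i)).
rewrite (ge0_integral_density measurable_sampling_density _ sampling_law_density)//; last 2 first.
- by move=> t; apply: prodr_ge0 => i _.
- by move=> t; apply: prode_ge0.
transitivity (\int[measure_pow leb n]_t \prod_(i < n) (f i (tnth t i) * (ball_density (radius i) (tnth t i))%:E))%E.
  by apply: eq_integral => t _; rewrite /sampling_density -prodEFin big_split.
rewrite (ge0_integral_prod_tuple leb (f := fun i x => f i x * (ball_density (radius i) x)%:E)%E); last 2 first.
- move=> i; apply: emeasurable_funM => //; apply/measurable_EFinP; exact: measurable_ball_density.
- by move=> i x; rewrite mule_ge0// lee_fin.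
apply: eq_bigr => i _.
by rewrite -(ge0_integral_density (measurable_ball_density (radius i)) (bd0 i)
  (fun A mA => uniform_ball_density (radius_gt0 i) mA)).
Qed.

End sampling_law.

(** * The limit array is an independent sample *)

Section limit_law.
Context {R : realType} {d : nat} (m : nat).
Local Notation E := 'rV[R]_d.
Local Notation RR := (measurableTypeR R * measurableTypeR R)%type.
Local Notation I := (bool * 'I_m)%type.
Local Notation n := #|{: I}|.
Variables (S : E -> R) (radius : bool -> R).
Hypothesis mS : measurable_fun setT S.
Hypothesis radius_gt0 : forall a, 0 < radius a.

(** The frequencies are listed in a single tuple, since the Fourier condition speaks of tuples. *)
Definition frequency_index (a : bool) (j : 'I_m) : 'I_n := enum_rank (a, j).
Definition frequency_radius (k : 'I_n) : R := radius (enum_val k).1.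

Lemma frequency_radius_gt0 k : 0 < frequency_radius k.
Proof. exact: radius_gt0. Qed.

Lemma prode_frequency (F : I -> \bar R) :
  (\prod_(k < n) F (enum_val k) = \prod_(j < m) (F (false, j) * F (true, j)))%E.
Proof.
transitivity (\prod_(i : I) F i)%E.
  rewrite [RHS](reindex (@enum_val {: I} (mem {: I})))//=.
  by exists (@enum_rank {: I}) => k _; rewrite ?enum_valK ?enum_rankK.
transitivity (\prod_(a : bool) \prod_(j < m) F (a, j))%E.
  by rewrite pair_bigA; apply: eq_bigr => -[].
by rewrite exchange_big; apply: eq_bigr => j _; rewrite big_bool muleC.
Qed.

Lemma measurable_scaled_modulus :
  measurable_fun setT (fun z : E * RR => scaled_modulus (S z.1) z.2).
Proof.
apply: measurable_funM; first exact: (measurableT_comp mS (@measurable_fst _ _ _ _)).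
exact: (measurableT_comp (@measurable_modulus R) (@measurable_snd _ _ _ _)).
Qed.

Definition limit_value : {mfun (E * RR)%type >-> measurableTypeR R} :=
  HB.pack (fun z : E * RR => scaled_modulus (S z.1) z.2)
  (isMeasurableFun.Build _ _ _ _ _ measurable_scaled_modulus).

(** The law of the limit of the periodogram at a frequency that is uniform on a ball. *)
Definition limit_marginal (a : bool) : probability (measurableTypeR R) R :=
  law (product_probability (uniform_ball (radius a)) gauss2) limit_value.

Section marginal.
Variables (B : set (measurableTypeR R)).
Hypothesis mB : measurable B.

Definition modulus_probability (x : E) : \bar R := gauss2 (scaled_modulus (S x) @^-1` B).

Let mvalB : measurable (limit_value @^-1` B).
Proof. by rewrite -[X in measurable X]setTI; exact: measurable_scaled_modulus. Qed.

Let sectionE (x : E) : xsection (limit_value @^-1` B) x = scaled_modulus (S x) @^-1` B.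
Proof. by apply/seteqP; split => g; rewrite /xsection /= inE. Qed.

Lemma measurable_scaled_modulus_preimage (x : E) : measurable (scaled_modulus (S x) @^-1` B).
Proof. by rewrite -sectionE; exact: measurable_xsection. Qed.

Lemma measurable_modulus_probability : measurable_fun setT modulus_probability.
Proof.
have h := measurable_fun_xsection gauss2 mvalB.
suff -> : modulus_probability = gauss2 \o xsection (limit_value @^-1` B) by exact: h.
by apply/funext => x; rewrite /modulus_probability -sectionE.
Qed.

Lemma limit_marginalE a :
  limit_marginal a B = (\int[uniform_ball (radius a)]_x modulus_probability x)%E.
Proof.
transitivity (\int[uniform_ball (radius a)]_x gauss2 (xsection (limit_value @^-1` B) x))%E.
  by [].
by apply: eq_integral => x _; rewrite sectionE.
Qed.

End marginal.

Definition limit_pair_law : probability RR R :=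
  product_probability (limit_marginal false) (limit_marginal true).

Definition limit_array (z : n.-tuple E * n.-tuple RR) (a : bool) (j : 'I_m) : R :=
  scaled_modulus (S (tnth z.1 (frequency_index a j))) (tnth z.2 (frequency_index a j)).

(** The limit array, regrouped into one pair of values for each [j]. *)
Definition limit_tuple (z : n.-tuple E * n.-tuple RR) : m.-tuple RR :=
  [tuple (limit_array z false j, limit_array z true j) | j < m].

Lemma measurable_limit_array a j : measurable_fun setT (fun z => limit_array z a j).
Proof.
have h : measurable_fun setT (fun z : n.-tuple E * n.-tuple RR =>
    ((tnth z.1 (frequency_index a j), tnth z.2 (frequency_index a j)) : E * RR)).
  apply/measurable_fun_pairP; split.
    exact: (measurableT_comp (measurable_tnth (frequency_index a j)) (@measurable_fst _ _ _ _)).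
  exact: (measurableT_comp (measurable_tnth (frequency_index a j)) (@measurable_snd _ _ _ _)).
exact: (measurableT_comp measurable_scaled_modulus h).
Qed.

Lemma measurable_limit_tuple : measurable_fun setT limit_tuple.
Proof.
apply/measurable_fun_tnthP => j.
rewrite (_ : _ \o _ = fun z => (limit_array z false j, limit_array z true j) : RR); last first.
  by apply/funext => z /=; rewrite tnth_mktuple.
by apply/measurable_fun_pairP; split; exact: measurable_limit_array.
Qed.

Definition array_coord (i : I) (t : m.-tuple RR) : measurableTypeR R :=
  pair_coord (~~ i.1) (tnth t i.2).

Lemma measurable_array_coord i : measurable_fun setT (array_coord i).
Proof. exact: (measurableT_comp (measurable_pair_coord (~~ i.1)) (measurable_tnth i.2)). Qed.

Lemma array_generation : @measurable _ (m.-tuple RR) `<=`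
  <<s [set A | exists (i : I) B, measurable B /\ A = array_coord i @^-1` B] >>.
Proof.
apply: generation_id; apply/measurable_fun_tnthP => j; apply/measurable_fun_pairP; split.
  exact: (measurable_generator (X := array_coord) (false, j)).
exact: (measurable_generator (X := array_coord) (true, j)).
Qed.

(** Integrating a rectangle over the Gaussian variables gives, at fixed frequencies, a
    product over the indices; so does then integrating over the frequencies, whose
    law is a product too. *)
Lemma limit_tuple_law (A : set (m.-tuple RR)) : measurable A ->
  (sampling_law frequency_radius \x measure_pow gauss2 n)%E (limit_tuple @^-1` A) =
  measure_pow limit_pair_law m A.
Proof.
move=> mA.
pose Lm : {mfun (n.-tuple E * n.-tuple RR)%type >-> m.-tuple RR} :=
  HB.pack limit_tuple (isMeasurableFun.Build _ _ _ _ _ measurable_limit_tuple).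
have := @probability_unique_rectangle _ _ (m.-tuple RR) _ R _ array_coord measurable_array_coord
  array_generation (mpushforward (sampling_law frequency_radius \x measure_pow gauss2 n)%E Lm)
  (measure_pow limit_pair_law m).
apply => //.
  have T1 : (sampling_law (d := d) frequency_radius \x measure_pow gauss2 n)%E setT = 1%E.
    by apply: product_measure_setT1; [exact: probability_setT|exact: measure_pow_setT].
  by rewrite [ltLHS]T1 ltry.
move=> B mB.
have rE : rectangle array_coord B =
    [set t : m.-tuple RR | forall j, (B (false, j) `*` B (true, j)) (tnth t j)].
  apply/seteqP; split => t /= Bt; last by move=> [[] j]; [exact: (Bt j).2|exact: (Bt j).1].
  by move=> j; split; [exact: (Bt (false, j))|exact: (Bt (true, j))].
have hR : measure_pow limit_pair_law m (rectangle array_coord B) =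
    (\prod_(k < n) limit_marginal (enum_val k).1 (B (enum_val k)))%E.
  rewrite rE (measure_powE limit_pair_law (A := fun j => B (false, j) `*` B (true, j))); last first.
    by move=> j; exact: measurableX.
  rewrite (prode_frequency (fun i => limit_marginal i.1 (B i))); apply: eq_bigr => j _.
  exact: (product_measure1E (limit_marginal false) (limit_marginal true)).
refine (etrans _ (esym hR)).
have mf (k : 'I_n) : measurable_fun setT (modulus_probability (B (enum_val k))).
  exact: measurable_modulus_probability.
transitivity (\int[sampling_law frequency_radius]_u
    \prod_(k < n) modulus_probability (B (enum_val k)) (tnth u k))%E.
  transitivity (\int[sampling_law frequency_radius]_u
     measure_pow gauss2 n (xsection (Lm @^-1` rectangle array_coord B) u))%E => //.
  apply: eq_integral => u _; rewrite /modulus_probability.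
  rewrite -(measure_powE gauss2 (A := fun k => scaled_modulus (S (tnth u k)) @^-1` B (enum_val k))); last first.
    by move=> k; exact: measurable_scaled_modulus_preimage.
  congr (measure_pow gauss2 n _).
  have cE g i : array_coord i (Lm (u, g)) =
      scaled_modulus (S (tnth u (enum_rank i))) (tnth g (enum_rank i)).
    by rewrite /array_coord /= tnth_mktuple; case: i => [[] j].
  rewrite /xsection; apply/seteqP; split => g /=.
    by rewrite inE => Bg k; have := Bg (enum_val k); rewrite cE enum_valK.
  by move=> Bg; rewrite inE => i; rewrite /= cE; have := Bg (enum_rank i); rewrite /= enum_rankK.
rewrite (ge0_integral_sampling_prod frequency_radius_gt0 mf); last by move=> k x; exact: measure_ge0.
by apply: eq_bigr => k _; rewrite limit_marginalE.
Qed.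

End limit_law.

Section gaussian_tuple.
Context {R : realType} {d : nat} (n : nat).
Local Notation E := 'rV[R]_d.
Local Notation RR := (measurableTypeR R * measurableTypeR R)%type.
Local Notation RT := (n.-tuple (measurableTypeR R)).
Variables (rho : R) (S : E -> R) (u : n.-tuple E).
Context (dG : measure_display) (TG : measurableType dG) (Q : probability TG R) (G : 'I_n -> TG -> R[i]).
Hypothesis rho_gt0 : 0 < rho.
Hypothesis G_gaussian : forall j, circular_gaussian Q (G j).
Hypothesis G_indep : independent Q (fun j => sigma_of (fun w => (complex.Re (G j w), complex.Im (G j w)))).
Hypothesis G_var : forall j, (\int[Q]_w (Normc.normc (G j w) ^+ 2)%:E)%E = (rho * S (tnth u j))%:E.

Definition gaussian_periodogram (w : TG) : RT := [tuple Normc.normc (G k w) ^+ 2 / rho | k < n].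

Definition modulus_tuple (g : n.-tuple RR) : RT := [tuple scaled_modulus (S (tnth u k)) (tnth g k) | k < n].

Let normc_sqr (z : R[i]) : Normc.normc z ^+ 2 = complex.Re z ^+ 2 + complex.Im z ^+ 2.
Proof. by case: z => a b /=; rewrite sqr_sqrtr// addr_ge0 ?sqr_ge0. Qed.

Lemma measurable_gaussian_periodogram : measurable_fun setT gaussian_periodogram.
Proof.
apply/measurable_fun_tnthP => k.
rewrite (_ : _ \o _ = fun w => Normc.normc (G k w) ^+ 2 / rho); last first.
  by apply/funext => w /=; rewrite tnth_mktuple.
under eq_fun do rewrite normc_sqr.
have [[m1 m2] _] := G_gaussian k.
by apply: measurable_funM => //; apply: measurable_funD; apply: measurable_funX.
Qed.

Lemma measurable_modulus_tuple : measurable_fun setT modulus_tuple.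
Proof.
apply/measurable_fun_tnthP => k.
rewrite (_ : _ \o _ = fun g : n.-tuple RR => scaled_modulus (S (tnth u k)) (tnth g k)); last first.
  by apply/funext => w /=; rewrite tnth_mktuple.
apply: measurable_funM => //.
exact: (measurableT_comp (@measurable_modulus R) (measurable_tnth k)).
Qed.

(** Both laws are products with the same marginals. *)
Lemma gaussian_periodogram_law (C : set RT) : measurable C ->
  Q (gaussian_periodogram @^-1` C) = measure_pow gauss2 n (modulus_tuple @^-1` C).
Proof.
move=> mC.
pose Gm : {mfun TG >-> RT} := HB.pack gaussian_periodogram
  (isMeasurableFun.Build _ _ _ _ _ measurable_gaussian_periodogram).
pose Mm : {mfun n.-tuple RR >-> RT} := HB.pack modulus_tuple
  (isMeasurableFun.Build _ _ _ _ _ measurable_modulus_tuple).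
have := @probability_unique_rectangle _ _ RT _ R _ (fun (i : 'I_n) (t : RT) => tnth t i)
  (fun i => measurable_tnth i) (@tuple_generation _ (measurableTypeR R) n)
  (mpushforward Q Gm) (mpushforward (measure_pow gauss2 n) Mm).
apply => //.
  have Q1 : (Q setT < +oo)%E by rewrite probability_setT ltry.
  exact: Q1.
move=> B mB.
suff : Q (Gm @^-1` rectangle (fun (i : 'I_n) (t : RT) => tnth t i) B) =
  measure_pow gauss2 n (Mm @^-1` rectangle (fun (i : 'I_n) (t : RT) => tnth t i) B) by [].
have -> : Gm @^-1` rectangle (fun (i : 'I_n) (t : RT) => tnth t i) B =
    \bigcap_(k in [set: 'I_n]) [set w | B k (Normc.normc (G k w) ^+ 2 / rho)].
  apply/seteqP; split => w /= Bw => [k _|k]; first by have := Bw k; rewrite /= tnth_mktuple.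
  by rewrite /= tnth_mktuple; exact: Bw.
rewrite G_indep; last first.
  move=> k; exists [set z : R * R | B k ((z.1 ^+ 2 + z.2 ^+ 2) / rho)].
    rewrite (_ : mkset _ = (fun z : R * R => (z.1 ^+ 2 + z.2 ^+ 2) / rho) @^-1` B k)//.
    have mf : measurable_fun setT (fun z : R * R => (z.1 ^+ 2 + z.2 ^+ 2) / rho : measurableTypeR R).
      apply: measurable_funM => //; apply: measurable_funD; apply: measurable_funX.
        exact: measurable_fst.
      exact: measurable_snd.
    rewrite -[X in measurable X]setTI; exact: mf.
  by rewrite setTI; apply/seteqP; split => w /=; rewrite normc_sqr.
have -> : Mm @^-1` rectangle (fun (i : 'I_n) (t : RT) => tnth t i) B =
    [set g | forall k, [set x | B k (scaled_modulus (S (tnth u k)) x)] (tnth g k)].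
  apply/seteqP; split => g /= Bg k; first by have := Bg k; rewrite /= tnth_mktuple.
  by rewrite /= tnth_mktuple; exact: Bg.
rewrite (measure_powE gauss2 (A := fun k => [set x | B k (scaled_modulus (S (tnth u k)) x)])); last first.
  move=> k; have mf : measurable_fun setT (scaled_modulus (S (tnth u k))).
    by apply: measurable_funM => //; exact: measurable_modulus.
  by rewrite -[X in measurable X]setTI; exact: mf.
apply: eq_big => [k|k _]; first by rewrite inE.
exact: (circular_gaussian_modulus rho_gt0 (G_gaussian k) (G_var k) (mB k)).
Qed.

End gaussian_tuple.

Section frequency_law.
Context {R : realType} {d : nat} (m : nat).
Local Notation E := 'rV[R]_d.
Local Notation I := (bool * 'I_m)%type.
Local Notation n := #|{: I}|.
Variables (radius : bool -> R).
Hypothesis radius_gt0 : forall a, 0 < radius a.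
Context (dO : measure_display) (Om : measurableType dO) (P : probability Om R).
Variable U : bool -> 'I_m -> Om -> E.
Hypothesis mU : forall a j, measurable_fun setT (U a j).
Hypothesis U_uniform : forall a j, uniform_on P (@lebesgue_rV R d) (eball (radius a)) (U a j).
Hypothesis U_indep : independent P (fun i : I => sigma_of (U i.1 i.2)).

Definition frequency_tuple (w : Om) : n.-tuple E :=
  [tuple U (enum_val k).1 (enum_val k).2 w | k < n].

Lemma tnth_frequency_tuple a j w : tnth (frequency_tuple w) (frequency_index a j) = U a j w.
Proof. by rewrite tnth_mktuple enum_rankK. Qed.

Lemma measurable_frequency_tuple : measurable_fun setT frequency_tuple.
Proof.
apply/measurable_fun_tnthP => k.
rewrite (_ : _ \o _ = U (enum_val k).1 (enum_val k).2)//.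
by apply/funext => w /=; rewrite tnth_mktuple.
Qed.

(** Both laws are products of uniform laws on balls. *)
Lemma frequency_tuple_law (A : set (n.-tuple E)) : measurable A ->
  P (frequency_tuple @^-1` A) = sampling_law (frequency_radius radius) A.
Proof.
move=> mA.
pose Um : {mfun Om >-> n.-tuple E} := HB.pack frequency_tuple
  (isMeasurableFun.Build _ _ _ _ _ measurable_frequency_tuple).
have := @probability_unique_rectangle _ _ (n.-tuple E) _ R _ (fun (i : 'I_n) (t : n.-tuple E) => tnth t i)
  (fun i => measurable_tnth i) (@tuple_generation _ E n)
  (mpushforward P Um) (sampling_law (frequency_radius radius)).
apply => //.
  have P1 : (P setT < +oo)%E by rewrite probability_setT ltry.
  exact: P1.
move=> B mB.
refine (etrans _ (esym (sampling_law_rectangle (frequency_radius_gt0 radius_gt0) mB))).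
suff : P (Um @^-1` rectangle (fun (i : 'I_n) (t : n.-tuple E) => tnth t i) B) =
  (\prod_(k < n) uniform_ball (frequency_radius radius k) (B k))%E by [].
have -> : Um @^-1` rectangle (fun (i : 'I_n) (t : n.-tuple E) => tnth t i) B =
    \bigcap_(i in [set: I]) (U i.1 i.2 @^-1` B (enum_rank i)).
  apply/seteqP; split => w /= Bw => [i _|k].
    by have := Bw (enum_rank i); rewrite /= tnth_mktuple enum_rankK.
  by have := Bw (enum_val k) Logic.I; rewrite /= tnth_mktuple enum_valK.
rewrite U_indep; last by move=> i; exists (B (enum_rank i)); [exact: mB|rewrite setTI].
rewrite [LHS](reindex (@enum_val {: I} (mem {: I})))//=; last first.
  by exists (@enum_rank {: I}) => k _; rewrite ?enum_valK ?enum_rankK.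
apply: eq_big => [k|k _]; first by rewrite inE.
rewrite enum_valK U_uniform// uniform_ballE//; last exact: radius_gt0.
rewrite mulrC EFinM fineK//.
rewrite ge0_fin_numE//; apply: (@le_lt_trans _ _ (@lebesgue_rV R d (eball (radius (enum_val k).1)))).
  by apply: le_measure; rewrite ?inE//; [apply: measurableI => //|]; exact: measurable_eball.
exact: lebesgue_eball_fin.
Qed.

End frequency_law.

(** * Averaging over frequencies independent of the process *)

Section mixture_limit.
Context d (T : measurableType d) (R : realType) (mu : probability T R).
Variables (p : R -> T -> R) (q : T -> R) (N : set T).
Hypothesis mp : forall rad, 0 < rad -> measurable_fun setT (p rad).
Hypothesis p01 : forall rad t, 0 < rad -> 0 <= p rad t <= 1.
Hypothesis mq : measurable_fun setT q.
Hypothesis q01 : forall t, 0 <= q t <= 1.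
Hypotheses (mN : measurable N) (N0 : mu N = 0%E).
Hypothesis limit : forall t, ~ N t -> forall e : R, 0 < e ->
  \forall rad \near (+oo : set_system R), q t - e <= p rad t.

Let mu1 := probability_setT mu.

(** The negative parts of [p rad - q] are bounded and tend to 0 almost everywhere;
    dominated convergence applies along sequences, which is enough. *)
Lemma mixture_lower_limit (e : R) : 0 < e ->
  \forall rad \near (+oo : set_system R), \int[mu]_t q t - e <= \int[mu]_t p rad t.
Proof.
move=> e0; apply: contrapT => hn.
have /choice[r hr] : forall k : nat, exists x : R, k%:R < x /\ \int[mu]_t p x t < \int[mu]_t q t - e.
  move=> k; apply: contrapT => /forallNP hk; apply: hn.
  exists k%:R; split; first exact: num_real.
  move=> x kx; rewrite leNgt; apply/negP => hx; exact: (hk x (conj kx hx)).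
have r0 k : 0 < r k by apply: le_lt_trans (hr k).1.
have rcvg : r k @[k --> \oo] --> +oo.
  apply/cvgryPge => A; near=> k.
  apply/ltW/(le_lt_trans _ (hr k).1); near: k; exact: nbhs_infty_ger.
pose f (k : nat) (t : T) : R := Num.max (q t - p (r k) t) 0.
have mf k : measurable_fun setT (f k).
  by apply: measurable_maxr => //; apply: measurable_funB => //; exact: mp.
have f0 k t : 0 <= f k t by rewrite /f le_max lexx orbT.
have f1 k t : f k t <= 1.
  have := p01 t (r0 k); have := q01 t; rewrite /f ge_max ler01 andbT; lra.
have fcvg t : ~ N t -> (f k t)%:E @[k --> \oo] --> 0%E.
  move=> Nt; apply: cvg_EFin; first exact: nearW.
  apply/cvgrPdist_le => /= d' d'0.
  have hq : \forall k \near \oo, q t - d' <= p (r k) t by exact: rcvg (limit Nt d'0).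
  near=> k; rewrite sub0r normrN ger0_norm// /f ge_max (ltW d'0) andbT.
  have : q t - d' <= p (r k) t by near: k; exact: hq.
  lra.
have i1 : mu.-integrable setT (cst 1%E).
  by apply: (bounded_integrable mu1 (f := cst 1) (K := 1)) => // t; rewrite normr1.
have [] := @dominated_convergence _ _ _ mu setT measurableT (fun k t => (f k t)%:E) (cst 0%E) (cst 1%E).
- by move=> k; apply/measurable_EFinP.
- exact: measurable_cst.
- exists N; split => // t /= ht; apply: contrapT => Nt; apply: ht => _; exact: fcvg.
- exact: i1.
- by apply: aeW => t k _ /=; rewrite lee_fin ger0_norm.
move=> _ _; rewrite integral0 => /fine_cvgP[_] /cvgrPdist_lt/(_ _ e0) hc.
have /filter_ex[k] := hc; rewrite /= sub0r normrN => fe.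
have iq : mu.-integrable setT (EFin \o q).
  by apply: (bounded_integrable mu1 (K := 1)) => // t; have /andP[h1 h2] := q01 t; rewrite ger0_norm.
have ip : mu.-integrable setT (EFin \o p (r k)).
  apply: (bounded_integrable mu1 (K := 1)) => [|t]; first exact: mp.
  by have /andP[h1 h2] := p01 t (r0 k); rewrite ger0_norm.
have if' : mu.-integrable setT (EFin \o f k).
  by apply: (bounded_integrable mu1 (K := 1)) => // t; rewrite ger0_norm.
have hle : \int[mu]_t (q t - p (r k) t) <= \int[mu]_t f k t.
  apply: le_Rintegral => //; first exact: (integrableB measurableT iq ip).
  by move=> t _; rewrite /f le_max lexx.
move: hle; rewrite RintegralB//.
have := (hr k).2; have := ler_norm (\int[mu]_t f k t); rewrite /Rintegral in fe *.
lra.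
Unshelve. all: end_near. Qed.

End mixture_limit.

Section process_space.
Context {R : realType} {d : nat}.
Local Notation E := 'rV[R]_d.
Context (dO : measure_display) (Om : measurableType dO) (eta : R.-ker Om ~> E).

(** The sample space with the sigma-algebra generated by the process: the periodograms
    must be jointly measurable with respect to that sigma-algebra, because it is the one
    that is independent of the frequencies. *)
Definition process_space := g_sigma_algebraType (sigma_of_process eta).

Lemma sigma_algebra_process : sigma_algebra setT (sigma_of_process eta).
Proof. by apply: sigma_algebra_preimage; exact: smallest_sigma_algebra. Qed.

Lemma measurable_process_space (A : set Om) :
  measurable (A : set process_space) = sigma_of_process eta A.
Proof.
by rewrite -[in RHS](sigma_algebra_id sigma_algebra_process).
Qed.

Lemma sigma_of_process_measurable (A : set Om) : sigma_of_process eta A -> measurable A.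
Proof.
move=> [B cB <-]; rewrite setTI.
pose F := [set B : set (set E -> \bar R) | measurable ((fun w => eta w : set E -> \bar R) @^-1` B)].
suff : F B by [].
apply: cB; split.
  split => [|C mC|G mG]; rewrite /F /=.
  - by rewrite preimage_set0; exact: measurable0.
  - by rewrite setTD -preimage_setC; exact: measurableC.
  - by rewrite preimage_bigcup; exact: bigcupT_measurable.
move=> _ [D [C [mD mC ->]]]; rewrite /F /=.
have := measurable_kernel eta D mD measurableT C mC; rewrite setTI.
exact.
Qed.

Definition process_kernel (w : process_space) : {measure set E -> \bar R} := eta w.

Lemma measurable_process_kernel (D : set E) : measurable D ->
  measurable_fun setT (fun w : process_space => process_kernel w D).
Proof.
move=> mD _ C mC; rewrite setTI measurable_process_space.
exists ((fun phi : set E -> \bar R => phi D) @^-1` C); last by rewrite setTI.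
by apply: sub_sigma_algebra; exists D, C.
Qed.

HB.instance Definition _ := isKernel.Build _ _ process_space E R process_kernel
  measurable_process_kernel.

Lemma measurable_to_process : measurable_fun setT (id : Om -> process_space).
Proof.
move=> _ A; rewrite measurable_process_space => sA; rewrite setTI.
exact: sigma_of_process_measurable.
Qed.

Definition to_process : {mfun Om >-> process_space} :=
  HB.pack (id : Om -> process_space) (isMeasurableFun.Build _ _ _ _ _ measurable_to_process).

End process_space.

Section sampled_coverage.
Context {R : realType} {d : nat} (m : nat).
Local Notation E := 'rV[R]_d.
Local Notation I := (bool * 'I_m)%type.
Local Notation n := #|{: I}|.
Local Notation leb := (@lebesgue_rV R d).
Variables (radius : bool -> R).
Hypothesis radius_gt0 : forall a, 0 < radius a.
Context (dO : measure_display) (Om : measurableType dO) (P : probability Om R).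
Variables (eta : R.-ker Om ~> E) (h : E -> R[i]).
Hypothesis eta_pp : point_process eta.
Hypothesis h_test : test_function (eball 1) h.
Variable U : bool -> 'I_m -> Om -> E.
Hypothesis mU : forall a j, measurable_fun setT (U a j).
Hypothesis U_uniform : forall a j, uniform_on P leb (eball (radius a)) (U a j).
Hypothesis U_indep : independent P (fun i : I => sigma_of (U i.1 i.2)).
Hypothesis U_eta_indep : independent P (fun b : bool =>
  if b then sigma_of_process eta
  else <<s \bigcup_(i in [set: I]) sigma_of (U i.1 i.2) >>).

Local Notation law_U := (sampling_law (d := d) (@frequency_radius R m radius)).
Local Notation U_tuple := (frequency_tuple U).

Lemma frequency_tuple_generated (A : set (n.-tuple E)) : measurable A ->
  <<s \bigcup_(i in [set: I]) sigma_of (U i.1 i.2) >> (U_tuple @^-1` A).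
Proof.
move=> mA; pose T' := g_sigma_algebraType (\bigcup_(i in [set: I]) sigma_of (U i.1 i.2)).
have mt : measurable_fun setT (U_tuple : T' -> n.-tuple E).
  apply/measurable_fun_tnthP => k.
  rewrite (_ : _ \o _ = U (enum_val k).1 (enum_val k).2); last first.
    by apply/funext => w /=; rewrite tnth_mktuple.
  move=> _ B mB; rewrite setTI; apply: sub_sigma_algebra.
  by exists (enum_val k) => //; exists B; rewrite ?setTI.
by have := mt measurableT A mA; rewrite setTI.
Qed.

(** Independence makes the joint law a product measure, provided that the sample space
    carries the sigma-algebra of the process. *)
Lemma joint_law (A : set (n.-tuple E * process_space eta)) : measurable A ->
  P [set w | A (U_tuple w, w)] = (law_U \x law P (to_process eta))%E A.
Proof.
move=> mA.
have mj : measurable_fun setT (fun w : Om => ((U_tuple w, to_process eta w) : n.-tuple E * process_space eta)).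
  apply/measurable_fun_pairP; split; first exact: measurable_frequency_tuple.
  exact: measurable_to_process.
pose J : {mfun Om >-> (n.-tuple E * process_space eta)%type} :=
  HB.pack (fun w : Om => ((U_tuple w, to_process eta w) : n.-tuple E * process_space eta))
  (isMeasurableFun.Build _ _ _ _ _ mj).
rewrite (@product_measure_unique _ _ _ _ R law_U (law P (to_process eta)) (mpushforward P J) _ A mA)//.
move=> B C mB mC.
suff : P (U_tuple @^-1` B `&` C) = (law_U B * P C)%E by [].
have := U_eta_indep (A := fun b : bool => if b then (C : set Om) else U_tuple @^-1` B).
rewrite (_ : \bigcap_(i in _) _ = U_tuple @^-1` B `&` C); last first.
  apply/seteqP; split => w /=.
    by move=> hw; split; [exact: (hw false)|exact: (hw true)].
  by move=> [h1 h2] [].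
move=> ->.
  by rewrite big_bool /= muleC (frequency_tuple_law radius_gt0 mU U_uniform U_indep mB).
case; last exact: frequency_tuple_generated.
by rewrite -measurable_process_space.
Qed.

Variables (alpha kappa s b z : R).
Local Notation idx := (@frequency_index m).

Definition joint_coverage (rad : R) : set (n.-tuple E * process_space eta) :=
  [set t | coverage_event (process_kernel (eta := eta)) h alpha kappa s b z idx t.1 rad t.2].

(** The periodogram is measurable in the process and continuous in the frequency. *)
Lemma measurable_joint_coverage rad : 0 < rad -> measurable (joint_coverage rad).
Proof.
move=> r0; pose pk : R.-ker process_space eta ~> E := process_kernel (eta := eta).
have mi : measurable_fun setT (fun t : n.-tuple E * process_space eta => intensity_estimator pk rad t.2).
  exact: (measurableT_comp (measurable_intensity_estimator pk rad) (@measurable_snd _ _ _ _)).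
pose Y (t : n.-tuple E * process_space eta) (a : bool) (j : 'I_m) : R :=
  periodogram pk h rad (tnth t.1 (idx a j)) t.2.
have mY a j : measurable_fun setT (fun t => Y t a j).
  apply: (@caratheodory_measurable _ _ R 1 d
    (fun t : n.-tuple E * process_space eta => tnth t.1 (idx a j)) _
    (fun t x => periodogram pk h rad x t.2)).
  - move=> i k; rewrite (_ : (fun _ => _) =
      (fun x : E => x ord0 k) \o (fun t : n.-tuple E => tnth t (idx a j)) \o
      (@fst (n.-tuple E) (process_space eta))); last first.
      by apply/funext => t /=; rewrite (ord1 i).
    apply: measurableT_comp; last exact: measurable_fst.
    by apply: measurableT_comp; [exact: measurable_rV_coord|exact: measurable_tnth].
  - move=> x; apply: (measurableT_comp (f := periodogram pk h rad x)); last exact: measurable_snd.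
    exact: measurable_periodogram.
  - by move=> t; exact: (@periodogram_continuous R d _ _ pk h eta_pp h_test rad t.2 r0).
rewrite (_ : joint_coverage rad =
    (fun t : n.-tuple E * process_space eta => intensity_estimator pk rad t.2) @^-1` `]0, +oo[ `&`
    [set t | `|s_hat alpha kappa (Y t) - s| < b + z * std_error alpha kappa (Y t)]); last first.
  apply/seteqP; split => t /=; rewrite /joint_coverage /= /coverage_event in_itv /= andbT; exact.
apply: measurableI; last exact: measurable_coverage.
by rewrite -[X in measurable X]setTI; apply: mi => //; exact: measurable_itv.
Qed.

Lemma joint_coverage_section rad u : xsection (joint_coverage rad) u =
  [set w : Om | coverage_event eta h alpha kappa s b z idx u rad w].
Proof. by apply/seteqP; split => w; rewrite /xsection /= inE. Qed.

Lemma measurable_coverage_event rad u : 0 < rad ->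
  measurable [set w | coverage_event eta h alpha kappa s b z idx u rad w].
Proof.
move=> r0; have mx := measurable_xsection u (measurable_joint_coverage r0).
by have := measurable_to_process measurableT mx; rewrite setTI joint_coverage_section.
Qed.

(** Conditioning on the frequencies, which are independent of the process. *)
Lemma sampled_coverage_probability rad : 0 < rad ->
  P [set w | coverage_event eta h alpha kappa s b z idx (U_tuple w) rad w] =
  (\int[law_U]_u P [set w | coverage_event eta h alpha kappa s b z idx u rad w])%E.
Proof.
move=> r0; apply: (etrans (joint_law (measurable_joint_coverage r0))).
transitivity (\int[law_U]_u law P (to_process eta) (xsection (joint_coverage rad) u))%E => //.
by apply: eq_integral => u _; rewrite joint_coverage_section.
Qed.

Lemma measurable_coverage_probability rad : 0 < rad -> measurable_fun setT
  (fun u => P [set w | coverage_event eta h alpha kappa s b z idx u rad w]).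
Proof.
move=> r0; have := measurable_fun_xsection (law P (to_process eta)) (measurable_joint_coverage r0).
suff -> : (fun u => P [set w | coverage_event eta h alpha kappa s b z idx u rad w]) =
  law P (to_process eta) \o xsection (joint_coverage rad) by [].
by apply/funext => u /=; rewrite joint_coverage_section.
Qed.

End sampled_coverage.

Section coverage_transfer.
Context {R : realType} {d : nat} (m : nat).
Local Notation E := 'rV[R]_d.
Local Notation I := (bool * 'I_m)%type.
Local Notation n := #|{: I}|.
Local Notation leb := (@lebesgue_rV R d).
Local Notation RR := (measurableTypeR R * measurableTypeR R)%type.
Local Notation RT := (n.-tuple (measurableTypeR R)).
Variables (radius : bool -> R).
Hypothesis radius_gt0 : forall a, 0 < radius a.
Context {dO : measure_display} {Om : measurableType dO}.
Variables (P : probability Om R) (eta : R.-ker Om ~> E) (rho : R).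
Variables (sigma : {measure set E -> \bar R}) (S : E -> R) (h : E -> R[i]).
Hypothesis d_gt0 : (0 < d)%N.
Hypothesis m_gt0 : (0 < m)%N.
Hypothesis eta_pp : point_process eta.
Hypothesis eta_moments : local_second_moments P eta.
Hypothesis sigma_bartlett : bartlett_measure P eta rho sigma.
Hypothesis sigma_ac : sigma `<< leb.
Hypothesis h_test : test_function (eball 1) h.
Hypothesis h_norm : (\int[leb]_x (Normc.normc (h x) ^+ 2)%:E = 1)%E.
Hypothesis rho_gt0 : 0 < rho.
Hypothesis mS : measurable_fun setT S.
Hypothesis F_cond : fourier_condition P eta rho S h.
Variable U : bool -> 'I_m -> Om -> E.
Hypothesis mU : forall a j, measurable_fun setT (U a j).
Hypothesis U_uniform : forall a j, uniform_on P leb (eball (radius a)) (U a j).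
Hypothesis U_indep : independent P (fun i : I => sigma_of (U i.1 i.2)).
Hypothesis U_eta_indep : independent P (fun b : bool =>
  if b then sigma_of_process eta
  else <<s \bigcup_(i in [set: I]) sigma_of (U i.1 i.2) >>).
Variables (alpha kappa s b z : R).
Local Notation law_U := (sampling_law (d := d) (@frequency_radius R m radius)).
Local Notation idx := (@frequency_index m).

Definition limit_coverage : set (m.-tuple RR) :=
  [set t | covers alpha kappa s b z (fun a j => array_coord (a, j) t)].

Lemma measurable_limit_coverage : measurable limit_coverage.
Proof.
apply: (@measurable_coverage _ (m.-tuple RR) R m alpha kappa (fun t a j => array_coord (a, j) t)).
by move=> a j; exact: measurable_array_coord.
Qed.

Let tuple_coverage : set RT :=
  [set t | covers alpha kappa s b z (fun a j => tnth t (idx a j))].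

Let measurable_tuple_coverage : measurable tuple_coverage.
Proof.
apply: (@measurable_coverage _ RT R m alpha kappa (fun t a j => tnth t (idx a j))).
by move=> a j; exact: measurable_tnth.
Qed.

Let limit_section (u : n.-tuple E) :
  xsection (limit_tuple S @^-1` limit_coverage) u = modulus_tuple S u @^-1` tuple_coverage.
Proof.
have aE g : (fun a j => array_coord (a, j) (limit_tuple S (u, g))) =
    (fun a j => tnth (modulus_tuple S u g) (idx a j)) :> (bool -> 'I_m -> R).
  apply/funext => a; apply/funext => j.
  by rewrite /array_coord /= !tnth_mktuple; case: a.
apply/seteqP; split => g; rewrite /xsection /= inE.
  by rewrite /limit_coverage /tuple_coverage /= aE.
by rewrite /limit_coverage /tuple_coverage /= aE.
Qed.

Let mlimit : measurable (limit_tuple S @^-1` limit_coverage : set (n.-tuple E * n.-tuple RR)).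
Proof.
rewrite -[X in measurable X]setTI; apply: (measurable_limit_tuple mS) => //.
exact: measurable_limit_coverage.
Qed.

(** For almost all frequencies the probability of coverage is asymptotically at least its
    value for independent exponential variables; averaging over the frequencies turns
    the latter into the coverage of an array of i.i.d. pairs. *)
Lemma coverage_transfer (e : R) : 0 < e -> \forall rad \near (+oo : set_system R),
  fine (measure_pow (limit_pair_law radius mS) m limit_coverage) - e <=
  fine (P [set w | coverage_event eta h alpha kappa s b z idx (frequency_tuple U w) rad w]).
Proof.
move=> e0.
have n0 : (0 < n)%N by rewrite card_prod card_bool card_ord muln_gt0.
have [V [mV V0 Vn hV]] := F_cond n0.
pose g2 := measure_pow (@gauss2 R) n.
have g21 : g2 setT = 1%E := measure_pow_setT gauss2 n.
pose q (u : n.-tuple E) : R := fine (g2 (modulus_tuple S u @^-1` tuple_coverage)).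
pose p (rad : R) (u : n.-tuple E) : R :=
  fine (P [set w | coverage_event eta h alpha kappa s b z idx u rad w]).
have mcov (u : n.-tuple E) : measurable (modulus_tuple S u @^-1` tuple_coverage).
  by rewrite -[X in measurable X]setTI; exact: (measurable_modulus_tuple S u).
have g2le (A : set (n.-tuple RR)) : measurable A -> (g2 A <= 1)%E.
  by move=> mA; rewrite -g21; apply: le_measure; rewrite ?inE.
have g2fin (A : set (n.-tuple RR)) : measurable A -> g2 A \is a fin_num.
  by move=> mA; rewrite ge0_fin_numE// (le_lt_trans (g2le _ mA))// ltry.
have mev rad u : 0 < rad -> measurable [set w | coverage_event eta h alpha kappa s b z idx u rad w].
  exact: (measurable_coverage_event eta_pp h_test alpha kappa s b z u).
have p01 rad u : 0 < rad -> 0 <= p rad u <= 1.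
  move=> r0; rewrite /p fine_ge0//= -lee_fin fineK; last by apply: fin_num_measure; exact: mev.
  by apply: probability_le1; exact: mev.
have q01 u : 0 <= q u <= 1.
  by rewrite /q fine_ge0//= -lee_fin fineK ?g2fin// g2le.
have mp rad : 0 < rad -> measurable_fun setT (p rad).
  move=> r0; apply: measurableT_comp => //.
  exact: (measurable_coverage_probability P eta_pp h_test alpha kappa s b z r0).
have mq : measurable_fun setT q.
  apply: measurableT_comp => //; have := measurable_fun_xsection g2 mlimit.
  suff -> : g2 \o xsection (limit_tuple S @^-1` limit_coverage) =
    (fun u => g2 (modulus_tuple S u @^-1` tuple_coverage)) by [].
  by apply/funext => u /=; rewrite limit_section.
have N0 : law_U (~` V) = 0%E.
  rewrite sampling_lawE; last exact: measurableC; last first.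
    by move=> k; exact: radius_gt0.
  rewrite (_ : measure_pow leb n _ = 0%E) ?mule0//.
  apply/eqP; rewrite eq_le measure_ge0 andbT -V0.
  apply: le_measure; rewrite ?inE.
  - apply: measurableI; [exact: measurableC|exact: measurable_sampling_box].
  - exact: measurableC.
  - by move=> t [].
have lim u : ~ (~` V) u -> forall e' : R, 0 < e' ->
    \forall rad \near (+oo : set_system R), q u - e' <= p rad u.
  move=> /contrapT Vu e' e'0.
  have [dG [TG [Q [G [hG iG vG _ cG]]]]] := hV u Vu.
  have u0 i : tnth u i != 0 by have [] := Vn u Vu.
  have mG i : Cmeasurable (G i) by have [] := hG i.
  have := coverage_limit d_gt0 eta_pp eta_moments sigma_bartlett sigma_ac h_test h_norm
    rho_gt0 alpha kappa s b z idx u0 mG cG e'0.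
  suff -> : Q [set w | covers alpha kappa s b z (fun a j => Normc.normc (G (idx a j) w) ^+ 2 / rho)] =
    g2 (modulus_tuple S u @^-1` tuple_coverage) by [].
  rewrite -(gaussian_periodogram_law rho_gt0 hG iG vG measurable_tuple_coverage).
  have gE w : (fun a j => tnth (gaussian_periodogram rho G w) (idx a j)) =
      (fun a j => Normc.normc (G (idx a j) w) ^+ 2 / rho) :> (bool -> 'I_m -> R).
    by apply/funext => a; apply/funext => j; rewrite tnth_mktuple.
  by congr (Q _); apply/seteqP; split => w; rewrite /tuple_coverage /= gE.
have := mixture_lower_limit mp p01 mq q01 (measurableC mV) N0 lim e0.
have qE : \int[law_U]_u q u = fine (measure_pow (limit_pair_law radius mS) m limit_coverage).
  rewrite -(limit_tuple_law mS radius_gt0 measurable_limit_coverage) /Rintegral; congr fine.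
  transitivity (\int[law_U]_u g2 (xsection (limit_tuple S @^-1` limit_coverage) u))%E => //.
  by apply: eq_integral => u _; rewrite limit_section /q fineK// g2fin.
rewrite qE => H; near=> rad.
have r0 : 0 < rad by near: rad; exact: nbhs_pinfty_gt.
rewrite (sampled_coverage_probability radius_gt0 eta_pp h_test mU U_uniform U_indep U_eta_indep alpha kappa s b z r0).
have -> : fine (\int[law_U]_u P [set w | coverage_event eta h alpha kappa s b z idx u rad w])%E =
    \int[law_U]_u p rad u.
  rewrite /Rintegral; congr fine; apply: eq_integral => u _; rewrite /p fineK//.
  by apply: fin_num_measure; exact: mev.
near: rad; exact H.
Unshelve. all: end_near. Qed.

End coverage_transfer.

(** * Moments of the limit law and coverage for the limit array *)

Section gaussian_moments.
Context {R : realType}.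
Local Notation RR := (measurableTypeR R * measurableTypeR R)%type.
Local Notation N := (@normal_prob R 0 1).

Let quartic (M : R) : (\int[N]_x (x ^+ 4)%:E = M%:E)%E -> forall a b c : R, 0 <= a -> 0 <= b -> 0 <= c ->
  (\int[N]_x (a * x ^+ 4 + b * x ^+ 2 + c)%:E = (a * M + b + c)%:E)%E.
Proof.
move=> hM a b c a0 b0 c0.
have x4 (x : R) : 0 <= x ^+ 4 by rewrite exprn_even_ge0.
have mX k : measurable_fun [set: measurableTypeR R] (fun x : R => (x ^+ k)%:E).
  by apply/measurable_EFinP; exact: measurable_funX.
have mZ (k : R) j : measurable_fun [set: measurableTypeR R] (fun x : R => (k * x ^+ j)%:E).
  by apply/measurable_EFinP; apply: measurable_funM => //; exact: measurable_funX.
transitivity (\int[N]_x ((a * x ^+ 4)%:E + (b * x ^+ 2)%:E + c%:E))%E.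
  by apply: eq_integral => x _; rewrite !EFinD.
have a4 (x : R) : 0 <= a * x ^+ 4 by exact: mulr_ge0.
have b2 (x : R) : 0 <= b * x ^+ 2 by rewrite mulr_ge0// sqr_ge0.
rewrite ge0_integralD//; last 2 first.
- by move=> x _; rewrite -EFinD lee_fin addr_ge0.
- exact: emeasurable_funD.
rewrite ge0_integralD//; last 2 first.
- by move=> x _; rewrite lee_fin.
- by move=> x _; rewrite lee_fin.
under eq_integral do rewrite EFinM.
under [X in (_ + X + _)%E]eq_integral do rewrite EFinM.
rewrite ge0_integralZl//; last by move=> x _; rewrite lee_fin.
rewrite ge0_integralZl//; last by move=> x _; rewrite lee_fin sqr_ge0.
have -> : (\int[N]_x c%:E = c%:E)%E.
  by rewrite integral_cst// [X in (_ * X)%E](probability_setT N) mule1.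
by rewrite hM normal_second_moment mule1 !EFinD EFinM.
Qed.

(** The fourth moment is determined by rotation invariance: averaging the fourth powers of
    [x + y] and [y - x] over independent [x] and [y] gives an affine equation for it. *)
Lemma normal_kurtosis : (\int[N]_x (x ^+ 4)%:E = 3%:E)%E.
Proof.
have x4 (x : R) : 0 <= x ^+ 4 by rewrite exprn_even_ge0.
have mX : measurable_fun [set: measurableTypeR R] (fun x : R => (x ^+ 4)%:E).
  by apply/measurable_EFinP; exact: measurable_funX.
have fin4 : (\int[N]_x (x ^+ 4)%:E)%E \is a fin_num.
  rewrite ge0_fin_numE ?normal_fourth_moment//.
  by apply: integral_ge0 => x _; rewrite lee_fin.
pose M := fine (\int[N]_x (x ^+ 4)%:E)%E.
have hM : (\int[N]_x (x ^+ 4)%:E = M%:E)%E by rewrite fineK.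
have M0 : 0 <= M by rewrite fine_ge0//; apply: integral_ge0 => x _; rewrite lee_fin.
have mf (k y : R) : measurable_fun [set: measurableTypeR R] (fun x : R => ((k * x + y) ^+ 4)%:E).
  by apply/measurable_EFinP; apply: measurable_funX; apply: measurable_funD => //; exact: measurable_funM.
have rot := @ge0_integral_normal2 R (fun x => (x ^+ 4)%:E) 1 1 ltr01 ler01 mX.
have rhs : (\int[N]_x ((Num.sqrt (1 ^+ 2 + 1 ^+ 2) * x) ^+ 4)%:E = (4 * M)%:E)%E.
  rewrite -(_ : (4 * M + 0 + 0) = 4 * M); last by ring.
  rewrite -(quartic hM) //; apply: eq_integral => x _; congr EFin.
  rewrite exprMn -[4%N]/(2 * 2)%N exprM sqr_sqrtr ?addr_ge0// !expr1n mul0r !addr0; ring.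
have lhs : (\int[N]_y \int[N]_x ((1 * x + 1 * y) ^+ 4)%:E +
            \int[N]_y \int[N]_x ((1 * x + 1 * y) ^+ 4)%:E = (4 * M + 12)%:E)%E.
  have F0 y : (0 <= \int[N]_x ((1 * x + 1 * y) ^+ 4)%:E)%E.
    by apply: integral_ge0 => x _; rewrite lee_fin.
  have inner y : (\int[N]_x ((1 * x + 1 * y) ^+ 4)%:E + \int[N]_x ((1 * x + 1 * y) ^+ 4)%:E =
      (2 * y ^+ 4 + 12 * y ^+ 2 + 2 * M)%:E)%E.
    rewrite -{1}(@ge0_integral_normalN R (fun x => ((1 * x + 1 * y) ^+ 4)%:E) (mf 1 _)); last first.
      by move=> x; rewrite lee_fin.
    rewrite -ge0_integralD//.
    - rewrite (_ : 2 * y ^+ 4 + 12 * y ^+ 2 + 2 * M = 2 * M + 12 * y ^+ 2 + 2 * y ^+ 4); last by ring.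
      have y2 : 0 <= 12 * y ^+ 2 by rewrite mulr_ge0// sqr_ge0.
      have y4 : 0 <= 2 * y ^+ 4 by rewrite mulr_ge0.
      rewrite -(quartic hM _ y2 y4)//.
      apply: eq_integral => x _; rewrite -EFinD; congr EFin; ring.
    - by move=> x _; rewrite lee_fin.
    - rewrite (_ : (fun x : R => _) = (fun x : R => ((-1 * x + 1 * y) ^+ 4)%:E)); first exact: mf.
      by apply/funext => x; congr ((_ + _) ^+ 4)%:E; ring.
    - by move=> x _; rewrite lee_fin.
  have mF : measurable_fun [set: measurableTypeR R] (fun y => (\int[N]_x ((1 * x + 1 * y) ^+ 4)%:E)%E).
    have mg : measurable_fun setT (fun z : RR => ((1 * z.2 + 1 * z.1) ^+ 4)%:E).
      apply/measurable_EFinP; apply: measurable_funX; apply: measurable_funD; apply: measurable_funM => //.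
    have g0 (z : RR) : (0 <= ((1 * z.2 + 1 * z.1) ^+ 4)%:E)%E by rewrite lee_fin.
    exact: (measurable_fun_fubini_tonelli_F (m2 := N) _ mg g0).
  rewrite -ge0_integralD//.
  under eq_integral do rewrite inner.
  by rewrite (quartic hM) ?mulr_ge0//; congr EFin; ring.
move: lhs; rewrite rot; last by move=> x; rewrite lee_fin.
by rewrite rhs -EFinD => -[e1]; rewrite hM; congr EFin; lra.
Qed.

Let gauss2_quartic (f : RR -> R) (a b1 b2 c1 c2 c3 : R) :
  (forall x y, f (x, y) = a * y ^+ 4 + (b1 * x ^+ 2 + b2) * y ^+ 2 + (c1 * x ^+ 4 + c2 * x ^+ 2 + c3)) ->
  0 <= a -> 0 <= b1 -> 0 <= b2 -> 0 <= c1 -> 0 <= c2 -> 0 <= c3 ->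
  measurable_fun setT f ->
  (\int[gauss2]_z (f z)%:E = (3 * a + b1 + b2 + 3 * c1 + c2 + c3)%:E)%E.
Proof.
move=> fE a0 b10 b20 c10 c20 c30 mf.
have x4 (x : R) : 0 <= x ^+ 4 by rewrite exprn_even_ge0.
have h3 := normal_kurtosis.
have h1 (x : R) : 0 <= b1 * x ^+ 2 + b2 by rewrite addr_ge0// mulr_ge0// sqr_ge0.
have h2 (x : R) : 0 <= c1 * x ^+ 4 + c2 * x ^+ 2 + c3.
  by rewrite !addr_ge0 ?(mulr_ge0 c20) ?sqr_ge0// mulr_ge0.
have f0 x y : 0 <= f (x, y).
  by rewrite fE !addr_ge0// mulr_ge0// sqr_ge0.
transitivity (\int[(N \x N)%E]_z (f z)%:E)%E => //.
rewrite fubini_tonelli1//; last 2 first.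
- exact/measurable_EFinP.
- by move=> [x y]; rewrite lee_fin.
transitivity (\int[N]_x (c1 * x ^+ 4 + (b1 + c2) * x ^+ 2 + (3 * a + b2 + c3))%:E)%E.
  apply: eq_integral => x _; rewrite /fubini_F.
  under eq_integral do rewrite fE.
  rewrite (quartic h3)//.
  by congr EFin; ring.
rewrite (quartic h3) ?addr_ge0 ?mulr_ge0//; congr EFin; ring.
Qed.

Lemma modulus_mean : (\int[@gauss2 R]_g ((g.1 ^+ 2 + g.2 ^+ 2) / 2)%:E = 1)%E.
Proof.
rewrite (@gauss2_quartic _ 0 0 (1 / 2) 0 (1 / 2) 0)//; last exact: measurable_modulus.
- by congr EFin; field.
- by move=> x y /=; field.
Qed.

Lemma modulus_second_moment : (\int[@gauss2 R]_g (((g.1 ^+ 2 + g.2 ^+ 2) / 2) ^+ 2)%:E = 2%:E)%E.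
Proof.
rewrite (@gauss2_quartic _ (1 / 4) (1 / 2) 0 (1 / 4) 0 0)//.
- by congr EFin; field.
- by move=> x y /=; field.
- by apply: measurable_funX; exact: measurable_modulus.
Qed.

End gaussian_moments.

Section product_integrals.
Context d1 d2 (T1 : measurableType d1) (T2 : measurableType d2) (R : realType).
Variables (m1 : probability T1 R) (m2 : probability T2 R).
Local Notation m12 := (product_probability m1 m2).

Lemma product_probability_fst (A : set T1) : measurable A -> m12 (fst @^-1` A) = m1 A.
Proof.
move=> mA; rewrite (_ : _ @^-1` _ = A `*` setT); last by apply/seteqP; split => z //= -[].
apply: (etrans (product_measure1E m1 m2 mA measurableT)).
by rewrite [X in (_ * X)%E](probability_setT m2) mule1.
Qed.

Lemma product_probability_snd (A : set T2) : measurable A -> m12 (snd @^-1` A) = m2 A.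
Proof.
move=> mA; rewrite (_ : _ @^-1` _ = setT `*` A); last by apply/seteqP; split => z //= -[].
apply: (etrans (product_measure1E m1 m2 measurableT mA)).
by rewrite [X in (X * _)%E](probability_setT m1) mul1e.
Qed.

Lemma Rintegral_product_centered (f : T1 -> R) (g : T2 -> R) :
  m2.-integrable setT (EFin \o g) -> \int[m2]_y g y = 0 ->
  m12.-integrable setT (EFin \o (fun z => f z.1 * g z.2)) ->
  \int[m12]_z (f z.1 * g z.2) = 0.
Proof.
move=> ig g0 ifg.
have g0' : (\int[m2]_y (g y)%:E = 0)%E.
  by rewrite -(fineK (integrable_fin_num measurableT ig)); congr EFin.
have <- : fine (\int[m1]_x fubini_F m2 (EFin \o (fun z : T1 * T2 => (f z.1 * g z.2)%R)) x)%E = 0.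
  rewrite integral0_eq// => x _; rewrite /fubini_F /=.
  under eq_integral do rewrite EFinM.
  by rewrite integralZl// g0' mule0.
by rewrite /Rintegral (integral12_prod_meas1 ifg).
Qed.

End product_integrals.

Section coordinate_laws.
Context {R : realType} (M : bool -> probability (measurableTypeR R) R).
Local Notation T := (measurableTypeR R).
Local Notation nu := (product_probability (M false) (M true)).

Let coordinate_mfun a : {mfun (T * T)%type >-> T} :=
  HB.pack (pair_coord (~~ a)) (isMeasurableFun.Build _ _ _ _ _ (measurable_pair_coord (~~ a))).

Lemma ge0_integral_coordinate a (f : T -> \bar R) : measurable_fun setT f -> (forall x, 0 <= f x)%E ->
  (\int[nu]_z f (pair_coord (~~ a) z) = \int[M a]_x f x)%E.
Proof.
move=> mf f0; rewrite -(ge0_integral_mpushforward nu (coordinate_mfun a))//.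
apply: eq_measure_integral => A mA _; case: a => /=.
  exact: (product_probability_snd (M false) (M true)).
exact: (product_probability_fst (M false) (M true)).
Qed.

Lemma Rintegral_coordinate a (f : T -> R) : measurable_fun setT f ->
  \int[nu]_z f (pair_coord (~~ a) z) = \int[M a]_x f x.
Proof.
move=> mf; rewrite -(Rintegral_mpushforward nu (coordinate_mfun a))// /Rintegral.
congr fine; apply: eq_measure_integral => A mA _; case: a => /=.
  exact: (product_probability_snd (M false) (M true)).
exact: (product_probability_fst (M false) (M true)).
Qed.

End coordinate_laws.

Section uniform_ball_moments.
Context {R : realType} {d : nat}.
Local Notation E := 'rV[R]_d.
Local Notation leb := (@lebesgue_rV R d).
Local Notation vol := (ball_volume (n := d)).

Lemma ge0_integral_uniform_ball (r : R) (f : E -> \bar R) : 0 < r ->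
  measurable_fun setT f -> (forall x, 0 <= f x)%E ->
  (\int[uniform_ball r]_x f x = (vol r)^-1%:E * \int[leb]_(x in eball r) f x)%E.
Proof.
move=> r0 mf f0; have v0 := @ball_volume_gt0 R d r r0.
rewrite (ge0_integral_density (measurable_ball_density r) (fun x => ball_density_ge0 x r0)
  (fun A mA => uniform_ball_density r0 mA))//.
rewrite [in RHS]integral_mkcond -ge0_integralZl//.
- apply: eq_integral => x _; rewrite patchE /ball_density indicE.
  by case: ifPn => _; rewrite ?mulr1 ?mulr0 ?mule0// muleC.
- by apply/(measurable_restrictT _ (measurable_eball r)); exact: measurable_funTS.
- by move=> x _; rewrite patchE; case: ifP.
- by rewrite lee_fin invr_ge0 ltW.
Qed.

Variables (sigma : {measure set E -> \bar R}) (rho : R) (S : E -> R).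
Hypothesis rho_gt0 : 0 < rho.
Hypothesis S_factor : structure_factor sigma rho S.

Let mS : measurable_fun setT S. Proof. by have [] := S_factor. Qed.
Let S0 x : 0 <= S x. Proof. by have [] := S_factor. Qed.

Lemma ball_average_uniform (r : R) : 0 < r -> ball_average sigma rho r =
  fine (\int[uniform_ball r]_x (S x)%:E)%E.
Proof.
move=> r0; have v0 := @ball_volume_gt0 R d r r0.
rewrite ge0_integral_uniform_ball//; last exact/measurable_EFinP.
have [_ _ sE] := S_factor.
rewrite /ball_average sE; last exact: measurable_eball.
under eq_integral do rewrite EFinM.
rewrite ge0_integralZl//.
- rewrite -/(ball_volume r); set J := (\int[leb]_(x in _) _)%E.
  have J0 : (0 <= J)%E by apply: integral_ge0 => x _; rewrite lee_fin.
  case: J J0 => [j| |] _ //=.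
    by field; rewrite !gt_eqF.
  by rewrite gt0_muley ?gt0_muley ?lte_fin ?invr_gt0//= mul0r.
- by exact: measurable_eball.
- by apply: measurable_funTS; exact/measurable_EFinP.
- by move=> x _; rewrite lee_fin.
- by rewrite lee_fin ltW.
Qed.

Lemma uniform_ball_sqr_fin (r r0 : R) : 0 < r <= r0 ->
  (\int[leb]_(x in eball r0) ((S x) ^+ 2)%:E < +oo)%E ->
  (\int[uniform_ball r]_x ((S x) ^+ 2)%:E < +oo)%E.
Proof.
move=> /andP[r_gt0 rr0] fin2; have v0 := @ball_volume_gt0 R d r r_gt0.
have mS2 : measurable_fun setT (fun x => ((S x) ^+ 2)%:E).
  by apply/measurable_EFinP; exact: measurable_funX.
rewrite ge0_integral_uniform_ball//; last by move=> x; rewrite lee_fin sqr_ge0.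
apply: lte_mul_pinfty => //; first by rewrite lee_fin invr_ge0 ltW.
apply: le_lt_trans fin2; apply: ge0_subset_integral => //; try exact: measurable_eball.
- exact: measurable_funTS.
- by move=> x _; rewrite lee_fin sqr_ge0.
- by move=> x; rewrite /eball /= => /lt_le_trans; exact.
Qed.

End uniform_ball_moments.

Section marginal_moments.
Context {R : realType} {d : nat}.
Local Notation E := 'rV[R]_d.
Variables (S : E -> R) (radius : bool -> R).
Hypothesis mS : measurable_fun setT S.
Hypothesis S0 : forall x, 0 <= S x.
Local Notation M := (limit_marginal radius mS).
Local Notation ub a := (uniform_ball (n := d) (radius a)).

Let modulus_ge0 (g : measurableTypeR R * measurableTypeR R) : 0 <= (g.1 ^+ 2 + g.2 ^+ 2) / 2 :> R.
Proof. by rewrite divr_ge0// addr_ge0// sqr_ge0. Qed.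

Let marginal_power a k (c : R) :
  (\int[@gauss2 R]_g (((g.1 ^+ 2 + g.2 ^+ 2) / 2) ^+ k)%:E = c%:E)%E ->
  (\int[M a]_y (`|y| ^+ k)%:E = \int[ub a]_x ((S x) ^+ k)%:E * c%:E)%E.
Proof.
move=> hk; rewrite ge0_integral_mpushforward; last 2 first.
- by apply/measurable_EFinP; apply: measurable_funX; exact: (@normr_measurable R setT).
- by move=> y; rewrite lee_fin exprn_ge0.
rewrite -hk; refine (etrans _ (@ge0_integral_product _ _ _ _ R (ub a) gauss2
  (fun x => (S x ^+ k)%:E) (fun g => (((g.1 ^+ 2 + g.2 ^+ 2) / 2) ^+ k)%:E) _ _ _ _)).
- apply: eq_integral => -[x g] _ /=.
  by rewrite -EFinM /scaled_modulus normrM exprMn !ger0_norm.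
- by apply/measurable_EFinP; exact: measurable_funX.
- by apply/measurable_EFinP; apply: measurable_funX; exact: measurable_modulus.
- by move=> x; rewrite lee_fin exprn_ge0.
- by move=> y; rewrite lee_fin exprn_ge0.
Qed.

Lemma limit_marginal_mean_abs a : (\int[M a]_y (`|y|)%:E = \int[ub a]_x (S x)%:E)%E.
Proof.
by have := @marginal_power a 1 1; rewrite /= => -> ; rewrite ?mule1//; exact: modulus_mean.
Qed.

Lemma limit_marginal_mean a : \int[M a]_y y = fine (\int[ub a]_x (S x)%:E)%E.
Proof.
rewrite -limit_marginal_mean_abs Rintegral_mpushforward//.
rewrite [in RHS]ge0_integral_mpushforward.
- congr fine; apply: eq_integral => -[x g] _ /=.
  by rewrite /scaled_modulus ger0_norm// mulr_ge0.
- by apply/measurable_EFinP; exact: (@normr_measurable R setT).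
- by move=> y; rewrite lee_fin.
Qed.

(** The square of an exponential variable of mean 1 has mean 2. *)
Lemma limit_marginal_second_moment a :
  (\int[M a]_y (y ^+ 2)%:E = \int[ub a]_x ((S x) ^+ 2)%:E * 2%:E)%E.
Proof.
rewrite -(marginal_power a modulus_second_moment).
by apply: eq_integral => y _; rewrite real_normK// num_real.
Qed.

End marginal_moments.

Section second_moments.
Context d (T : measurableType d) (R : realType) (mu : probability T R).
Variable X : T -> R.
Hypothesis mX : measurable_fun setT X.
Hypothesis X2_fin : (\int[mu]_t (X t ^+ 2)%:E < +oo)%E.

Lemma integrable_sqr : mu.-integrable setT (EFin \o (fun t => X t ^+ 2)).
Proof.
apply/integrableP; split; first by apply/measurable_EFinP; exact: measurable_funX.
rewrite (eq_integral (fun t => (X t ^+ 2)%:E))// => t _ /=.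
by rewrite ger0_norm// sqr_ge0.
Qed.

Let integrable_cst (k : R) : mu.-integrable setT (EFin \o (fun=> k)).
Proof. by apply: (bounded_integrable (probability_setT mu) (K := `|k|)) => // t. Qed.

Lemma integrable_of_sqr : mu.-integrable setT (EFin \o X).
Proof.
have i1 := integrableD measurableT (integrable_cst 1) integrable_sqr.
apply: (le_integrable measurableT _ _ i1); first exact/measurable_EFinP.
move=> t _ /=; rewrite lee_fin [leRHS]ger0_norm ?addr_ge0 ?sqr_ge0// ler_norml.
by have h1 := sqr_ge0 (X t - 1); have h2 := sqr_ge0 (X t + 1); apply/andP; split; nra.
Qed.

Lemma integrable_shift (k : R) : mu.-integrable setT (EFin \o (fun t => X t - k)).
Proof.
by have := integrableB measurableT integrable_of_sqr (integrable_cst k); apply: eq_integrable.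
Qed.

Lemma integrable_shift_sqr (k : R) : mu.-integrable setT (EFin \o (fun t => (X t - k) ^+ 2)).
Proof.
have i1 := integrableZl measurableT (2 * k) integrable_of_sqr.
have i3 := integrableD measurableT (integrableB measurableT integrable_sqr i1) (integrable_cst (k ^+ 2)).
by apply: eq_integrable i3 => // w _ /=; congr EFin; ring.
Qed.

Lemma Rintegral_variance :
  \int[mu]_t ((X t - \int[mu]_t X t) ^+ 2) = \int[mu]_t (X t ^+ 2) - (\int[mu]_t X t) ^+ 2.
Proof.
set a := \int[mu]_t X t.
have iX := integrable_of_sqr; have iX2 := integrable_sqr.
have iaX : mu.-integrable setT (EFin \o (fun t => 2 * a * X t)).
  exact: (integrableZl measurableT (2 * a) iX).
have i2 : mu.-integrable setT (EFin \o (fun t => X t ^+ 2 - 2 * a * X t)).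
  exact: (integrableB measurableT iX2 iaX).
transitivity (\int[mu]_t (X t ^+ 2 - 2 * a * X t + a ^+ 2)).
  by apply: eq_Rintegral => t _; ring.
rewrite RintegralD// RintegralB// RintegralZl// -/a.
by rewrite (Rintegral_cst1 (probability_setT mu)); ring.
Qed.

Lemma sqr_Rintegral_le : (\int[mu]_t X t) ^+ 2 <= \int[mu]_t (X t ^+ 2).
Proof.
rewrite -subr_ge0 -Rintegral_variance; apply: Rintegral_ge0 => t _; exact: sqr_ge0.
Qed.

End second_moments.

(** Both powers tend to 0 with [t]; if [s] were positive, they would be too small to cancel it. *)
Lemma vanishing_expansion (R : realType) (alpha beta L c s t0 : R) (eps : R -> R) :
  0 < alpha -> alpha < beta -> 0 < L -> 0 <= s -> 0 < t0 ->
  (forall t, 0 < t <= t0 -> s + c * t `^ alpha + eps t = 0) ->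
  (forall t, 0 < t <= t0 -> `|eps t| <= L * t `^ beta) -> s = 0.
Proof.
move=> a0 ab L0 s0 t00 hs he; apply/eqP; rewrite eq_le s0 andbT leNgt; apply/negP => sp.
pose K := `|c| + L.
have K0 : 0 < K by rewrite ltr_wpDl.
pose y := s / (2 * K); have y0 : 0 < y by rewrite divr_gt0// mulr_gt0.
pose t := Num.min (Num.min t0 1) (y `^ alpha^-1).
have t_gt0 : 0 < t by rewrite !lt_min t00 ltr01 powR_gt0.
have tt0 : t <= t0 by rewrite !ge_min lexx.
have t1 : t <= 1 by rewrite !ge_min lexx orbT.
have ty : t `^ alpha <= y.
  rewrite -[leRHS](powRr1 (ltW y0)) -(mulVf (lt0r_neq0 a0)) powRrM.
  by apply: ge0_ler_powR; rewrite ?nnegrE ?powR_ge0 ?(ltW t_gt0) ?(ltW a0)// /t ge_min lexx orbT.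
(* below 1 the larger exponent gives the smaller power *)
have tab : t `^ beta <= t `^ alpha.
  rewrite /powR (gt_eqF t_gt0) ler_expR ler_wnM2r// ?ln_le0//; exact: ltW.
have tt : 0 < t <= t0 by rewrite t_gt0.
have := hs t tt; have := he t tt; rewrite ler_norml => /andP[h1 _] h2.
have h3 : L * t `^ beta <= L * y by rewrite ler_pM2l// (le_trans tab).
have h4 : - (c * t `^ alpha) <= `|c| * y.
  by rewrite (le_trans (ler_norm _))// normrN normrM ler_wpM2l// ger0_norm// powR_ge0.
have h5 : K * y = s / 2 by rewrite /y; field; rewrite gt_eqF.
by have := erefl K; rewrite {1}/K => h6; nra.
Qed.

Section asymptotic_coverage.
Context {R : realType} {d : nat}.
Local Notation E := 'rV[R]_d.
Local Notation leb := (@lebesgue_rV R d).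
Local Notation RR := (measurableTypeR R * measurableTypeR R)%type.
Variables (sigma : {measure set E -> \bar R}) (rho : R) (S : E -> R).
Hypothesis rho_gt0 : 0 < rho.
Hypothesis S_factor : structure_factor sigma rho S.
Variables (alpha beta L r0 s c : R) (eps : R -> R).
Hypothesis alpha_gt0 : 0 < alpha.
Hypothesis alpha_lt_beta : alpha < beta.
Hypothesis L_gt0 : 0 < L.
Hypothesis A_expansion : forall r : R, 0 < r <= r0 ->
  ball_average sigma rho r = s + c * r `^ alpha + eps r.
Hypothesis eps_bound : forall r : R, 0 < r <= r0 -> `|eps r| <= L * r `^ beta.
Hypothesis S_square : (\int[leb]_(x in eball r0) ((S x) ^+ 2)%:E < +oo)%E.
Variables (gamma kappa r : R).
Hypothesis gamma_bounds : 0 < gamma < 1.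
Hypothesis kappa_gt1 : 1 < kappa.
Hypothesis r_bounds : 0 < r <= r0 / kappa.
Hypothesis mS : measurable_fun setT S.

Local Notation radius := (sampling_radius kappa r).
Local Notation M := (limit_marginal radius mS).
Local Notation nu := (limit_pair_law radius mS).
Local Notation A a := (ball_average sigma rho (radius a)).
Let Y (a : bool) (w : RR) : R := pair_coord (~~ a) w.
Local Notation ub a := (uniform_ball (n := d) (radius a)).
Let k := kappa `^ alpha.

Let r_gt0 : 0 < r. Proof. by have /andP[] := r_bounds. Qed.
Let kappa_gt0 : 0 < kappa. Proof. exact: lt_trans kappa_gt1. Qed.

Lemma sampling_radius_bounds a : 0 < radius a <= r0.
Proof.
have /andP[h1 h2] := r_bounds; have k0 := kappa_gt0; have k1 := kappa_gt1.
have h3 : kappa * r <= r0 by move: h2; rewrite ler_pdivlMr// mulrC.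
case: a; rewrite /sampling_radius ?mulr_gt0//= h1 /=.
by rewrite (le_trans _ h3)// ler_peMl// ltW.
Qed.

Let radius_gt0 a : 0 < radius a. Proof. by have /andP[] := sampling_radius_bounds a. Qed.

Let S0 x : 0 <= S x. Proof. by have [] := S_factor. Qed.

Let k_gt1 : 1 < k.
Proof.
rewrite /k /powR (gt_eqF kappa_gt0) -expR0 ltr_expR mulr_gt0// ln_gt0//.
Qed.

Let mY a : measurable_fun setT (Y a). Proof. exact: measurable_pair_coord. Qed.

Let S2_fin a : (\int[ub a]_x ((S x) ^+ 2)%:E < +oo)%E.
Proof. exact: (uniform_ball_sqr_fin S_factor (sampling_radius_bounds a) S_square). Qed.

Let marginal_sqr_fin a : (\int[M a]_y (y ^+ 2)%:E < +oo)%E.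
Proof.
by rewrite limit_marginal_second_moment// muleC; apply: lte_mul_pinfty.
Qed.

Let mid : measurable_fun setT (fun y : measurableTypeR R => y : R). Proof. exact: measurable_id. Qed.

Let Y2_fin a : (\int[nu]_w (Y a w ^+ 2)%:E < +oo)%E.
Proof.
rewrite (ge0_integral_coordinate M a (f := fun y : R => (y ^+ 2)%:E)); first exact: marginal_sqr_fin.
- by apply/measurable_EFinP; exact: measurable_funX.
- by move=> y; rewrite lee_fin sqr_ge0.
Qed.

Let iY2 a : nu.-integrable setT (EFin \o (fun w => Y a w ^+ 2)).
Proof. exact: integrable_sqr (mY a) (Y2_fin a). Qed.

Let iY a : nu.-integrable setT (EFin \o Y a).
Proof. exact: integrable_of_sqr (mY a) (Y2_fin a). Qed.

Lemma limit_mean a : \int[nu]_w Y a w = A a.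
Proof.
rewrite (Rintegral_coordinate M a (f := fun y : R => y))// limit_marginal_mean//.
by rewrite (ball_average_uniform rho_gt0 S_factor).
Qed.

Lemma limit_second_moment a : \int[nu]_w (Y a w ^+ 2) = 2 * \int[ub a]_x (S x ^+ 2).
Proof.
rewrite /Rintegral (ge0_integral_coordinate M a (f := fun y : R => (y ^+ 2)%:E)); last 2 first.
- by apply/measurable_EFinP; exact: measurable_funX.
- by move=> y; rewrite lee_fin sqr_ge0.
rewrite limit_marginal_second_moment// fineM//; first by rewrite mulrC.
rewrite ge0_fin_numE//; apply: integral_ge0 => x _; rewrite lee_fin sqr_ge0//.
Qed.

Let zeta a w := Y a w - \int[nu]_w Y a w.
Let D w := k ^+ 2 * zeta false w ^+ 2 + zeta true w ^+ 2.

Let izeta a : nu.-integrable setT (EFin \o zeta a).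
Proof. exact: integrable_shift (mY a) (Y2_fin a) _. Qed.

Let izeta2 a : nu.-integrable setT (EFin \o (fun w => zeta a w ^+ 2)).
Proof. exact: integrable_shift_sqr (mY a) (Y2_fin a) _. Qed.

Let iD : nu.-integrable setT (EFin \o D).
Proof. exact: (integrableD measurableT (integrableZl measurableT (k ^+ 2) (izeta2 false)) (izeta2 true)). Qed.

Let icross : nu.-integrable setT (EFin \o (fun w => zeta false w * zeta true w)).
Proof.
apply: (le_integrable measurableT _ _ (integrableD measurableT (izeta2 false) (izeta2 true))).
  by apply/measurable_EFinP; apply: measurable_funM; apply: measurable_funB.
move=> w _ /=; rewrite lee_fin [leRHS]ger0_norm ?addr_ge0 ?sqr_ge0// ler_norml.
have h1 := sqr_ge0 (zeta false w + zeta true w); have h2 := sqr_ge0 (zeta false w - zeta true w).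
by apply/andP; split; nra.
Qed.

Let cross0 : \int[nu]_w (zeta false w * zeta true w) = 0.
Proof.
apply: (Rintegral_product_centered (m1 := M false) (m2 := M true)
  (f := fun y : R => y - \int[nu]_w Y false w) (g := fun y : R => y - \int[nu]_w Y true w) _ _ icross).
- exact: integrable_shift mid (marginal_sqr_fin true) _.
- have iy := integrable_of_sqr mid (marginal_sqr_fin true).
  have ic : (M true).-integrable setT (EFin \o (fun=> \int[nu]_w Y true w)).
    by apply: (bounded_integrable (probability_setT (M true)) (K := `|\int[nu]_w Y true w|)) => // t.
  rewrite (RintegralB measurableT iy ic) (Rintegral_cst1 (probability_setT (M true))).
  by rewrite (Rintegral_coordinate M true (f := fun y : R => y))// subrr.
Qed.

Let uncorrelated :
  \int[nu]_w ((k * zeta false w - zeta true w) ^+ 2) = \int[nu]_w D w.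
Proof.
have i1 := integrableZl measurableT (2 * k) icross.
transitivity (\int[nu]_w (D w - 2 * k * (zeta false w * zeta true w))).
  by apply: eq_Rintegral => w _; rewrite /D; ring.
by rewrite RintegralB// RintegralZl// cross0 mulr0 subr0.
Qed.

(** The limit [S q] of a periodogram, with [q] exponential of mean 1, has variance at
    least the square of its mean. *)
Lemma limit_variance_gt0 : A true != 0 -> 0 < \int[nu]_w D w.
Proof.
move=> A0.
have z2 : \int[nu]_w (zeta true w ^+ 2) <= \int[nu]_w D w.
  apply: le_Rintegral => // w _; rewrite /D lerDr mulr_ge0 ?sqr_ge0//.
apply: lt_le_trans z2.
rewrite (Rintegral_variance (mY true) (Y2_fin true)) limit_mean limit_second_moment.
have := sqr_Rintegral_le mS (S2_fin true).
have -> : \int[ub true]_x S x = A true by rewrite (ball_average_uniform rho_gt0 S_factor).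
have : 0 < A true ^+ 2 by rewrite lt_def sqr_ge0 andbT expf_neq0.
lra.
Qed.

(** The extrapolation cancels the power [alpha] exactly; the two remainders add up to the bias
    bound. *)
Lemma extrapolation_bias : `|(k * A false - A true) / (k - 1) - s| <= bias_bound alpha beta L kappa r.
Proof.
have k1 : 0 < k - 1 by rewrite subr_gt0.
have hf := A_expansion (sampling_radius_bounds false).
have ht := A_expansion (sampling_radius_bounds true).
have ef := eps_bound (sampling_radius_bounds false).
have et := eps_bound (sampling_radius_bounds true).
rewrite /sampling_radius in hf ht ef et *.
rewrite hf ht powRM ?(ltW kappa_gt0)// ?(ltW r_gt0)// -/k.
rewrite [X in `|X|](_ : _ = (k * eps r - eps (kappa * r)) / (k - 1)); last first.
  by field; rewrite gt_eqF.
rewrite normrM [`|_^-1|]ger0_norm ?invr_ge0 ?(ltW k1)//.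
rewrite /bias_bound -/k ler_pdivrMr//.
rewrite (_ : L * _ * _ * _ = k * (L * r `^ beta) + L * (kappa `^ beta * r `^ beta)); last first.
  by field; rewrite gt_eqF.
rewrite (le_trans (ler_normB _ _))// lerD//.
  by rewrite normrM ger0_norm ?ler_wpM2l// (le_trans ler01)// ltW.
by rewrite -powRM ?(ltW kappa_gt0)// (ltW r_gt0).
Qed.

Let S_mean a : (\int[ub a]_x (S x)%:E = (A a)%:E)%E.
Proof.
rewrite (ball_average_uniform rho_gt0 S_factor)// fineK//.
by apply: integrable_fin_num => //; exact: integrable_of_sqr mS (S2_fin a).
Qed.

(** A nonnegative function with integral 0 on a ball has integral 0 on smaller balls. *)
Lemma degenerate_average (t : R) : A true = 0 -> 0 < t <= kappa * r ->
  (\int[uniform_ball (n := d) t]_x (S x)%:E = 0)%E.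
Proof.
move=> A0 /andP[t0 tr].
have mSE : measurable_fun setT (fun x => (S x)%:E) by exact/measurable_EFinP.
have kr0 : 0 < kappa * r by rewrite mulr_gt0.
have v0 := @ball_volume_gt0 R d _ kr0.
have := S_mean true; rewrite A0 /sampling_radius ge0_integral_uniform_ball//.
move=> /eqP; rewrite mule_eq0 eqe invr_eq0 (gt_eqF v0) /= => /eqP h0.
rewrite ge0_integral_uniform_ball// (_ : integral _ _ _ = 0%E) ?mule0//.
apply/eqP; rewrite eq_le integral_ge0 ?andbT; last by move=> x _; rewrite lee_fin.
rewrite -h0; apply: ge0_subset_integral => //; try exact: measurable_eball.
- exact: measurable_funTS.
- by move=> x _; rewrite lee_fin.
- by move=> x; rewrite /eball /= => /lt_le_trans; exact.
Qed.

Hypothesis s_ge0 : 0 <= s.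

(** All the averages up to the radius [kappa * r] vanish, in particular those of small radii. *)
Lemma degenerate_s : A true = 0 -> s = 0.
Proof.
move=> A0; have kr0 : 0 < kappa * r by rewrite mulr_gt0.
have krr : kappa * r <= r0 by have /andP[] := sampling_radius_bounds true.
apply: (@vanishing_expansion _ alpha beta L c s (kappa * r) eps) => // t /andP[t0 tr].
  rewrite -A_expansion ?t0 ?(le_trans tr)// (ball_average_uniform rho_gt0 S_factor)//.
  by rewrite degenerate_average// t0.
by apply: eps_bound; rewrite t0 (le_trans tr).
Qed.

Let degenerate_marginal a : A true = 0 -> M a [set 0] = 1%E.
Proof.
move=> A0.
have h0 : (\int[M a]_y (`|y|)%:E = 0)%E.
  rewrite limit_marginal_mean_abs// degenerate_average// radius_gt0 /=.
  by case: a; rewrite /sampling_radius// ler_peMl// ltW.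
have mE : measurable_fun setT (fun y : measurableTypeR R => (y : R)%:E) by exact/measurable_EFinP.
have [N [mN N0 hN]] := (ae_eq_integral_abs (M a) measurableT mE).1 h0.
have m0 : measurable ([set 0] : set (measurableTypeR R)) by exact: measurable_set1.
have : M a (~` [set 0]) = 0%E.
  apply/eqP; rewrite eq_le measure_ge0 andbT -N0; apply: le_measure; rewrite ?inE//.
    exact: measurableC.
  by move=> y /= y0; apply: hN => /= hy; apply: y0; have [] := hy Logic.I.
rewrite (probability_setC (M a) m0).
have := fin_num_measure (M a) _ m0; case: (M a [set 0]) => // x _.
by rewrite -EFinB => -[x1]; congr EFin; lra.
Qed.

Let z := normal_quantile (1 - gamma / 2).
Let b := bias_bound alpha beta L kappa r.

Let b_gt0 : 0 < b.
Proof.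
by rewrite /b /bias_bound !mulr_gt0 ?invr_gt0 ?subr_gt0// ?addr_gt0 ?powR_gt0.
Qed.

(** The limit values are 0 almost surely, the estimate is exact and its standard error is 0;
    the strict inequality holds because the bias bound is positive. *)
Lemma degenerate_coverage m : A true = 0 ->
  measure_pow nu m (limit_coverage (m := m) alpha kappa s b z) = 1%E.
Proof.
move=> A0; have s0 := degenerate_s A0.
have m0 : measurable ([set 0] : set (measurableTypeR R)) by exact: measurable_set1.
pose Z : set RR := [set 0] `*` [set 0].
have mZ : measurable Z by exact: measurableX.
have Z1 : nu Z = 1%E.
  apply: (etrans (product_measure1E (M false) (M true) m0 m0)).
  by rewrite [X in (X * _)%E]degenerate_marginal// [X in (_ * X)%E]degenerate_marginal// mule1.
have ZE : measure_pow nu m [set t | forall j, Z (tnth t j)] = 1%E.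
  rewrite (measure_powE nu (A := fun=> Z))//.
  by rewrite big1// => j _; exact: Z1.
apply/eqP; rewrite eq_le; apply/andP; split.
  rewrite -(measure_pow_setT nu m); apply: le_measure; rewrite ?inE//.
  exact: measurable_limit_coverage.
rewrite -[leLHS]ZE; apply: le_measure; rewrite ?inE.
- rewrite (_ : mkset _ = rectangle (fun (j : 'I_m) (t : m.-tuple RR) => tnth t j) (fun=> Z))//.
  apply: (@measurable_rectangle _ _ (m.-tuple RR) RR 'I_m (fun j t => tnth t j) _ (fun=> Z)) => //.
  by move=> j; exact: measurable_tnth.
- exact: measurable_limit_coverage.
move=> t tZ; rewrite /limit_coverage /=.
have t0 a j : array_coord (a, j) t = 0 by have [h1 h2] := tZ j; case: a.
have -> : (fun a j => array_coord (a, j) t) = (fun _ _ => 0) :> (bool -> 'I_m -> R).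
  by apply/funext => a; apply/funext => j; exact: t0.
rewrite /covers /s_hat /std_error /sample_variance /sample_mean !big1//; last first.
  by move=> j _; rewrite mulr0 subrr expr0n.
by rewrite s0 !mulr0 subrr mul0r subrr normr0 addr0 mul0r sqrtr0 mulr0 addr0.
Qed.

(** The variance vanishes only if the structure factor does on the larger ball, and the two
    cases require different reasons. *)
Lemma limit_coverage_lower (e : R) : 0 < e -> \forall m \near \oo,
  1 - gamma - e <= fine (measure_pow nu m (limit_coverage (m := m) alpha kappa s b z)).
Proof.
move=> e0; have [A0|A0] := eqVneq (A true) 0.
  near=> m; rewrite degenerate_coverage//=.
  by have /andP[g0 _] := gamma_bounds; lra.
apply: (coverage_nondegenerate mY iY iY2 k_gt1 uncorrelated (limit_variance_gt0 A0) gamma_bounds e0).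
by rewrite !limit_mean; exact: extrapolation_bias.
Unshelve. all: end_near. Qed.

End asymptotic_coverage.

(** * The confidence interval *)

Section interval_measurability.
Context {R : realType} {d : nat} (m : nat).
Local Notation E := 'rV[R]_d.
Context (dO : measure_display) (Om : measurableType dO).
Variables (eta : R.-ker Om ~> E) (h : E -> R[i]).
Hypothesis eta_pp : point_process eta.
Hypothesis h_test : test_function (eball 1) h.
Variable U : bool -> 'I_m -> Om -> E.
Hypothesis mU : forall a j, measurable_fun setT (U a j).
Variables (alpha beta L kappa s r gamma : R).
Hypothesis s_ge0 : 0 <= s.
Local Notation Y rad := (fun w a j => periodogram eta h rad (U a j w) w).
Local Notation b := (bias_bound alpha beta L kappa r).
Local Notation z := (normal_quantile (1 - gamma / 2)).

Lemma measurable_sampled_periodogram rad a j : 0 < rad ->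
  measurable_fun setT (fun w => Y rad w a j).
Proof.
move=> r0.
apply: (@caratheodory_measurable _ _ R 1 d (U a j) _ (fun w x => periodogram eta h rad x w)).
- move=> i k; rewrite (_ : (fun _ => _) = (fun x : E => x ord0 k) \o U a j); last first.
    by apply/funext => w /=; rewrite (ord1 i).
  by apply: measurableT_comp => //; exact: measurable_rV_coord.
- by move=> x; exact: measurable_periodogram.
- by move=> w; exact: (@periodogram_continuous R d _ _ eta h eta_pp h_test rad w r0).
Qed.

Lemma confidence_intervalE (y : bool -> 'I_m -> R) :
  confidence_interval alpha beta L kappa y r gamma s <->
  s_hat alpha kappa y - b - z * std_error alpha kappa y <= s /\
  s <= s_hat alpha kappa y + b + z * std_error alpha kappa y.
Proof.
rewrite /confidence_interval /=; split.
  by rewrite !in_itv /= => -[/andP[h1 h2] _].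
by rewrite !in_itv /= s_ge0 => -[-> ->].
Qed.

Lemma measurable_confidence_interval rad : 0 < rad ->
  measurable [set w | confidence_interval alpha beta L kappa (Y rad w) r gamma s].
Proof.
move=> r0; have mY a j := measurable_sampled_periodogram a j r0.
have ms := measurable_s_hat alpha kappa mY; have me := measurable_std_error alpha kappa mY.
pose lo w := s_hat alpha kappa (Y rad w) - b - z * std_error alpha kappa (Y rad w).
pose hi w := s_hat alpha kappa (Y rad w) + b + z * std_error alpha kappa (Y rad w).
rewrite (_ : mkset _ = lo @^-1` `]-oo, s] `&` hi @^-1` `[s, +oo[); last first.
  by apply/seteqP; split => w /=; rewrite confidence_intervalE !in_itv /= andbT.
have mlo : measurable_fun setT lo.
  by apply: measurable_funB; [exact: measurable_funB|exact: measurable_funM].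
have mhi : measurable_fun setT hi.
  by apply: measurable_funD; [exact: measurable_funD|exact: measurable_funM].
by apply: measurableI; rewrite -[X in measurable X]setTI; [apply: mlo|apply: mhi] => //;
  exact: measurable_itv.
Qed.

Lemma coverage_event_subset rad :
  [set w | coverage_event eta h alpha kappa s b z (@frequency_index m) (frequency_tuple U w) rad w] `<=`
  [set w | confidence_interval alpha beta L kappa (Y rad w) r gamma s].
Proof.
move=> w [_] /=.
have -> : (fun a j => periodogram eta h rad (tnth (frequency_tuple U w) (frequency_index a j)) w) =
    Y rad w :> (bool -> 'I_m -> R).
  by apply/funext => a; apply/funext => j; rewrite tnth_frequency_tuple.
by rewrite /covers confidence_intervalE ltr_norml => /andP[h1 h2]; split; lra.
Qed.

Lemma measurable_sampled_coverage rad : 0 < rad -> measurable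
  [set w | coverage_event eta h alpha kappa s b z (@frequency_index m) (frequency_tuple U w) rad w].
Proof.
move=> r0; have mY a j := measurable_sampled_periodogram a j r0.
have mi := measurable_intensity_estimator eta rad.
rewrite (_ : mkset _ = intensity_estimator eta rad @^-1` `]0, +oo[ `&`
    [set w | `|s_hat alpha kappa (Y rad w) - s| < b + z * std_error alpha kappa (Y rad w)]); last first.
  have YE w : (fun a j => periodogram eta h rad (tnth (frequency_tuple U w) (frequency_index a j)) w) =
      Y rad w :> (bool -> 'I_m -> R).
    by apply/funext => a; apply/funext => j; rewrite tnth_frequency_tuple.
  apply/seteqP; split => w /=; rewrite /coverage_event /covers in_itv /= andbT YE; exact.
apply: measurableI; last exact: measurable_coverage.
by rewrite -[X in measurable X]setTI; apply: mi => //; exact: measurable_itv.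
Qed.

End interval_measurability.

Lemma limf_einf_ge (R : realType) (X : choiceType) (T : filteredType X) (f : T -> \bar R) (F : set (set T)) (a : \bar R) :
  F [set x | a <= f x]%E -> (a <= limf_einf f F)%E.
Proof.
move=> Fa; rewrite limf_einfE; apply: ereal_sup_ge.
exists (ereal_inf (f @` [set x | a <= f x]%E)); first by exists [set x | a <= f x]%E.
by apply: le_ereal_inf_tmp => _ [x ax <-].
Qed.

Theorem corollary3p9 (R : realType) (d : nat) (d_gt0 : (0 < d)%N)
  (dO : measure_display) (Om : measurableType dO) (P : probability Om R)
  (eta : R.-ker Om ~> 'rV[R]_d) (rho : R)
  (sigma : {measure set 'rV[R]_d -> \bar R})
  (S : 'rV[R]_d -> R) (h : 'rV[R]_d -> R[i])
  (eta_pp : point_process eta)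
  (eta_stationary : stationary P eta) (eta_ergodic : ergodic P eta)
  (eta_intensity : has_intensity P eta rho) (rho_gt0 : 0 < rho)
  (eta_moments : local_second_moments P eta)
  (sigma_bartlett : bartlett_measure P eta rho sigma)
  (sigma_ac : sigma `<< (@lebesgue_rV R d))
  (S_factor : structure_factor sigma rho S)
  (h_test : test_function (eball 1) h)
  (h_norm : (\int[@lebesgue_rV R d]_x (Normc.normc (h x) ^+ 2)%:E = 1)%E)
  (F_cond : fourier_condition P eta rho S h)
  (alpha beta L r0 s c : R) (eps : R -> R)
  (alpha_gt0 : 0 < alpha) (alpha_lt_beta : alpha < beta)
  (L_gt0 : 0 < L) (r0_gt0 : 0 < r0) (s_ge0 : 0 <= s)
  (A_expansion : forall r : R, 0 < r <= r0 ->
     ball_average sigma rho r = s + c * r `^ alpha + eps r)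
  (eps_bound : forall r : R, 0 < r <= r0 -> `|eps r| <= L * r `^ beta)
  (S_square : (\int[@lebesgue_rV R d]_(x in eball r0) ((S x) ^+ 2)%:E < +oo)%E)
  (gamma kappa : R) (gamma_bounds : 0 < gamma < 1) (kappa_gt1 : 1 < kappa)
  (r : R) (r_bounds : 0 < r <= r0 / kappa)
  (U : forall m : nat, bool -> 'I_m -> Om -> 'rV[R]_d)
  (U_sampled : forall m : nat, (2 <= m)%N ->
     sampled_frequencies P eta kappa r (U m)) :
  ((1 - gamma)%:E <=
   limn_einf (fun m : nat =>
     limf_einf (fun rad : R =>
       P [set w | confidence_interval alpha beta L kappa
                    (fun (a : bool) (j : 'I_m) =>
                       periodogram eta h rad (U m a j w) w)
                    r gamma s])
       (pinfty_nbhs R)))%E.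
Proof.
have [mS S0 _] := S_factor.
have radius_gt0 a : 0 < sampling_radius kappa r a.
  by have /andP[] := sampling_radius_bounds kappa_gt1 r_bounds a.
apply/lee_addgt0Pr => e e0; rewrite -leeBlDr// -EFinB.
have e20 : 0 < e / 2 by rewrite divr_gt0.
have hm := limit_coverage_lower rho_gt0 S_factor alpha_gt0 alpha_lt_beta L_gt0 A_expansion
  eps_bound S_square gamma_bounds kappa_gt1 r_bounds mS s_ge0 e20.
apply: limf_einf_ge; near=> m.
have m2 : (2 <= m)%N by near: m; exact: nbhs_infty_ge.
have [mU U_uniform U_indep U_eta_indep] := U_sampled m m2.
have h1 : 1 - gamma - e / 2 <= fine (measure_pow (limit_pair_law (sampling_radius kappa r) mS) m
    (limit_coverage alpha kappa s (bias_bound alpha beta L kappa r) (normal_quantile (1 - gamma / 2)))).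
  by near: m.
have hr := coverage_transfer radius_gt0 d_gt0 (ltnW m2) eta_pp eta_moments sigma_bartlett sigma_ac
  h_test h_norm rho_gt0 mS F_cond mU U_uniform U_indep U_eta_indep alpha kappa s
  (bias_bound alpha beta L kappa r) (normal_quantile (1 - gamma / 2)) e20.
apply: limf_einf_ge; near=> rad.
have rad0 : 0 < rad by near: rad; exact: nbhs_pinfty_gt.
have mcov := measurable_sampled_coverage eta_pp h_test mU alpha beta L kappa s r gamma rad0.
have mci := measurable_confidence_interval eta_pp h_test mU alpha beta L kappa r gamma s_ge0 rad0.
apply: (@le_trans _ _ (P [set w | coverage_event eta h alpha kappa s (bias_bound alpha beta L kappa r)
    (normal_quantile (1 - gamma / 2)) (@frequency_index m) (frequency_tuple (U m) w) rad w])); last first.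
  by apply: le_measure; rewrite ?inE//; exact: coverage_event_subset.
rewrite -[leRHS]fineK; last exact: fin_num_measure.
rewrite lee_fin.
have h2 : fine (measure_pow (limit_pair_law (sampling_radius kappa r) mS) m
    (limit_coverage alpha kappa s (bias_bound alpha beta L kappa r) (normal_quantile (1 - gamma / 2)))) - e / 2 <=
  fine (P [set w | coverage_event eta h alpha kappa s (bias_bound alpha beta L kappa r)
    (normal_quantile (1 - gamma / 2)) (@frequency_index m) (frequency_tuple (U m) w) rad w]).
  near: rad; exact hr.
move: h1 h2; lra.
Unshelve. all: end_near. Qed.
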